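(* Let $n\ge 2$ and $(f,\lambda)\in\Lambda_n$. (1) The cell module $C(f,\lambda)$ of $\mathcal B_n$ has $\Bbbk$-basis $\{\mathrm m_{\mathbf t}+\mathcal B_n^{\rhd\lambda}\mid \mathbf t\in\mathscr T_n^{ud}(\lambda)\}$. (2) For any $1\le j\le m$, the $\Bbbk$-module $M_j$ spanned by $\{\mathrm m_{\mathbf t}+\mathcal B_n^{\rhd\lambda}\mid \mathbf t\in\mathscr T_n^{ud}(\lambda),\ \mathbf t_{n-1}\unrhd\mu^{(j)}\}$ is a $\mathcal B_{n-1}$-submodule of $C(f,\lambda)$. (3) For any $1\le j\le m$, $M_j=N_j$. (4) Put $M_0=0$. As $\mathcal B_{n-1}$-modules, $M_j/M_{j-1}\cong C(\ell,\mu^{(j)})$, where $\ell=f$ if $1\le j\le a$ and $\ell=f-1$ if $a+1\le j\le m$. The isomorphism sends $\mathrm m_{\mathbf t}+M_{j-1}$ (for $\mathbf t$ with $\mathbf t_{n-1}=\mu^{(j)}$) to $\mathrm m_{\mathbf t\downarrow_{n-1}}+\mathcal B_{n-1}^{\rhd\mu^{(j)}}$, where $\mathbf t\!\downarrow_{n-1}=(\mathbf t_0,\dots,\mathbf t_{n-1})\in\mathscr T_{n-1}^{ud}(\mu^{(j)})$. (5) The $\Bbbk$-algebra $\mathcal B_n$ has cellular basis (in the sense of Graham–Lehrer) $\{\mathrm m_{\mathbf s\mathbf t}\mid \mathbf s,\mathbf t\in\mathscr T_n^{ud}(\lambda),\ (f,\lambda)\in\Lambda_n\}$, where $\mathrm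 m_{\mathbf s\mathbf t}=\sigma(b_{\mathbf s})E^fx_\lambda b_{\mathbf t}$, with respect to the anti-involution $\sigma$.
   Context: Algebra. Let $\Bbbk=\mathbb Z[q,q^{-1},z,z^{-1},(q-q^{-1})^{-1},(z-z^{-1})^{-1}]$ with $q,z$ indeterminates and $\delta=(z-z^{-1})/(q-q^{-1})$. For $n\ge2$ the $q$-Brauer algebra $\mathcal B_n=\mathcal B_n(q,z)$ is the unital associative $\Bbbk$-algebra with generators $T_1,\dots,T_{n-1},E_1$ and relations (whenever the generators exist): $(T_i-q)(T_i+q^{-1})=0$; $T_iT_j=T_jT_i$ for $|i-j|>1$; $T_kT_{k+1}T_k=T_{k+1}T_kT_{k+1}$; $E_1^2=\delta E_1$; $T_1E_1=qE_1=E_1T_1$; $E_1T_2E_1=zE_1$; $T_iE_1=E_1T_i$ for $i>2$; $T_2T_3T_1^{-1}T_2^{-1}E_{(2)}=E_{(2)}=E_{(2)}T_2T_3T_1^{-1}T_2^{-1}$ with $E_{(2)}=E_1T_2T_3T_1^{-1}T_2^{-1}E_1$. $\mathcal B_0=\mathcal B_1=\Bbbk$, and $\mathcal B_{n-1}\subset\mathcal B_n$ is the subalgebra generated by the generators of $\mathcal B_{n-1}$. $\sigma$ is the $\Bbbk$-linear anti-involution of $\mathcal B_n$ fixing $E_1,T_1,\dots,T_{n-1}$. The $T_i$ generate a Hecke algebra $\mathcal H_n$ of $\mathfrak S_n$ (generated by $s_1,\dots,s_{n-1}$, acting on the right); $T_w=T_{i_1}\cdots T_{i_k}$ for a reduced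 expression $w=s_{i_1}\cdots s_{i_k}$. Special elements. $s_{i,j}=s_is_{i+1}\cdots s_{j-1}$ if $i<j$, $s_{i,i}=1$, $s_{i,j}=s_{i-1}s_{i-2}\cdots s_j$ if $i>j$; $T_{i,j}=T_{s_{i,j}}$, $T_{i,j}^{-1}=(T_{i,j})^{-1}$. $E^0=1$, $E^{k+1}=E_1T_{2,2k+2}T_{2k+1,1}^{-1}E^k$; $E_\ell=T_{\ell,1}T_{2,\ell+1}^{-1}E_1T_{2,\ell+1}T_{\ell,1}^{-1}$. Combinatorics. $\Lambda_n$ is the set of pairs $(f,\lambda)$ with $0\le f\le\lfloor n/2\rfloor$ and $\lambda$ a partition of $n-2f$. Order: $(\ell,\mu)\unlhd(f,\lambda)$ if $\ell<f$, or $\ell=f$ and $\mu\unlhd\lambda$ in dominance order; identify $(f,\lambda)$ with $\lambda$, so $\mu\unlhd\lambda$ means $|\mu|>|\lambda|$, or $|\mu|=|\lambda|$ and $\lambda$ dominates $\mu$. For $\lambda\vdash n-2f$, $\lambda$-tableaux have entries $2f+1,\dots,n$; $\mathscr T^{std}(\lambda)$ is the set of standard ones; $\mathfrak t^\lambda$ is the one filled successively along rows; $\mathfrak S_\lambda$ is its row stabilizer; $d(\mathfrak t)$ is defined by $\mathfrak t=\mathfrak t^\lambda d(\mathfrak t)$; $x_\lambda=\sum_{w\in\mathfrak S_\lambda}q^{\ell(w)}T_w$; $x_{\mathfrak s\mathfrak t}=\sigma(T_{d(\mathfrak s)})x_\lambda T_{d(\mathfrak t)}$. $\mathcal D_{f,n}=\{s_{2f,i_f}s_{2f-1,j_f}\cdots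 s_{2,i_1}s_{1,j_1}\mid i_1<\cdots<i_f,\ 2k-1\le j_k<i_k\le n \text{ for } 1\le k\le f\}$ ($\mathcal D_{0,n}=\{1\}$). Cell modules. $\mathcal B_n$ has the known cellular basis $C^{\lambda}_{(w,\mathfrak s),(v,\mathfrak t)}=\sigma(T_w)E^fx_{\mathfrak s\mathfrak t}T_v$, $(w,\mathfrak s),(v,\mathfrak t)\in\mathcal D_{f,n}\times\mathscr T^{std}(\lambda)$, $(f,\lambda)\in\Lambda_n$. $\mathcal B_n^{\rhd\lambda}$ is the $\Bbbk$-span of all $C^\mu_{\cdot,\cdot}$ with $(\ell,\mu)\in\Lambda_n$, $\mu\rhd\lambda$. The right cell module $C(f,\lambda)$ is the free $\Bbbk$-module with basis $E^fx_\lambda T_{d(\mathfrak t)}T_v+\mathcal B_n^{\rhd\lambda}$, $(v,\mathfrak t)\in\mathcal D_{f,n}\times\mathscr T^{std}(\lambda)$. Branching data. $\mathcal{RA}(\lambda)$ is the set of partitions $\mu$ obtained from $\lambda$ by removing or adding one node with $(l,\mu)\in\Lambda_{n-1}$ for some $l\ge0$. Write $\mathcal{RA}(\lambda)=\{\mu^{(1)},\dots,\mu^{(m)}\}$ with $\mu^{(1)}\rhd\cdots\rhd\mu^{(m)}$, where $\mu^{(1)},\dots,\mu^{(a)}$ are obtained by removing a node ($(f,\mu^{(i)})\in\Lambda_{n-1}$) and $\mu^{(a+1)},\dots,\mu^{(m)}$ by adding a node ($(f-1,\mu^{(i)})\in\Lambda_{n-1}$; only if $f>0$). Put $a_k=2f+\sum_{i\le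 k}\lambda_i$, $b_k=2f-1+\sum_{i\le k}\lambda_i$. Let $y_\mu^\lambda=E^fx_\lambda T_{a_k,n}$ if $\mu=\lambda\setminus(k,\lambda_k)$ and $y_\mu^\lambda=E_{2f-1}T_{n,2f}^{-1}T_{b_k,2f-1}^{-1}E^{f-1}x_\mu$ if $\mu=\lambda\cup(k,\lambda_k+1)$ (here $x_\mu$ is formed with tableau entries $2f-1,\dots,n-1$). $N_j=\sum_{i=1}^jy^\lambda_{\mu^{(i)}}\mathcal B_{n-1}+\mathcal B_n^{\rhd\lambda}$, regarded as a $\mathcal B_{n-1}$-submodule of $C(f,\lambda)$. Up-down tableaux. $\mathscr T_n^{ud}(\lambda)$ is the set of sequences $\mathbf t=(\mathbf t_0,\dots,\mathbf t_n)$ of partitions with $\mathbf t_0=\emptyset$, $\mathbf t_n=\lambda$, each $\mathbf t_{i+1}$ obtained from $\mathbf t_i$ by adding or removing one node. Define $b_{\mathbf t}$ inductively: $b_{\mathbf t}=1$ for $n=0$; for $n\ge1$ let $\mu=\mathbf t_{n-1}$, $\mathbf t'=(\mathbf t_0,\dots,\mathbf t_{n-1})$, and $b_{\mathbf t}=T_{a_k,n}b_{\mathbf t'}$ if $\lambda=\mu\cup(k,\mu_k+1)$; $b_{\mathbf t}=T_{n,2f}^{-1}\sum_{j=b_{k-1}}^{b_k}q^{b_k-j}T_{j,2f-1}^{-1}b_{\mathbf t'}$ if $\lambda=\mu\setminus(k,\mu_k)$, where $f=(n-|\lambda|)/2$, $a_k=2f+\sum_{i=1}^{k}\lambda_i$,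 $b_{k-1}=2f-1+\sum_{i=1}^{k-1}\lambda_i$ and $b_k=2f-1+\sum_{i=1}^{k}\lambda_i$. Put $\mathrm m_{\mathbf t}=E^fx_\lambda b_{\mathbf t}$. *)

(* Defs.v *)
From HB Require Import structures.
From mathcomp Require Import all_boot all_order all_algebra all_fingroup.
From mathcomp Require Import boolp classical_sets functions cardinality fsbigop.
From mathcomp Require Import generic_quotient ring_quotient.

Set Implicit Arguments.
Unset Strict Implicit.
Unset Printing Implicit Defensive.

Import GRing.Theory.
Local Open Scope ring_scope.
Local Open Scope classical_set_scope.
Local Open Scope quotient_scope.

Section ClassicalUnits.
Variable R : nzRingType.

Definition cunit : pred R := fun x => `[< exists y, y * x = 1 /\ x * y = 1 >].
Definition cinv (x : R) : R := xget x [set y | y * x = 1 /\ x * y = 1].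

Lemma cmulVr : {in cunit, left_inverse 1 cinv *%R}.
Proof. by move=> x /asboolP /(@xgetPex _ x) []. Qed.

Lemma cmulrV : {in cunit, right_inverse 1 cinv *%R}.
Proof. by move=> x /asboolP /(@xgetPex _ x) []. Qed.

Lemma cunitP (x y : R) : y * x = 1 /\ x * y = 1 -> cunit x.
Proof. by move=> h; apply/asboolP; exists y. Qed.

Lemma cinv_out : {in [predC cunit], cinv =1 id}.
Proof.
move=> x; rewrite inE => /asboolPn h; rewrite /cinv; case: xgetP => // y _ [h1 h2].
by case: h; exists y.
Qed.

End ClassicalUnits.

(* q is the outer variable and z the inner one. *)
Notation Kfrac := {fraction {poly {poly int}}}.
Definition fq : Kfrac := FracField.tofrac 'X.
Definition fz : Kfrac := FracField.tofrac ('X%:P).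

Inductive in_kk : Kfrac -> Prop :=
| ground_1 : in_kk 1
| ground_B x y : in_kk x -> in_kk y -> in_kk (x - y)
| ground_M x y : in_kk x -> in_kk y -> in_kk (x * y)
| ground_q : in_kk fq
| ground_qV : in_kk fq^-1
| ground_z : in_kk fz
| ground_zV : in_kk fz^-1
| ground_dq : in_kk (fq - fq^-1)^-1
| ground_dz : in_kk (fz - fz^-1)^-1.

Definition ground_pred : pred Kfrac := fun x => `[< in_kk x >].

Lemma ground_subring : subring_closed ground_pred.
Proof.
split; first by apply/asboolP; exact: ground_1.
- by move=> x y /asboolP hx /asboolP hy; apply/asboolP; exact: ground_B.
- by move=> x y /asboolP hx /asboolP hy; apply/asboolP; exact: ground_M.
Qed.
HB.instance Definition _ :=
  GRing.isSubringClosed.Build Kfrac ground_pred ground_subring.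

Record kk := KK { kkval :> Kfrac; _ : kkval \in ground_pred }.
HB.instance Definition _ := [isSub for kkval].
HB.instance Definition _ := [Choice of kk by <:].
HB.instance Definition _ := [SubChoice_isSubComNzRing of kk by <:].
HB.instance Definition _ := GRing.NzRing_hasMulInverse.Build kk
  (@cmulVr kk) (@cmulrV kk) (@cunitP kk) (@cinv_out kk).

Lemma ground_in x : in_kk x -> x \in ground_pred.
Proof. by move=> h; apply/asboolP. Qed.

Definition kq : kk := KK (ground_in ground_q).
Definition kz : kk := KK (ground_in ground_z).

Lemma ground_inv (x : kk) : val x != 0 -> in_kk (val x)^-1 ->
  x \is a GRing.unit /\ val x^-1 = (val x)^-1.
Proof.
move=> x0 hx; pose y := KK (ground_in hx).
have h1 : y * x = 1 by apply: val_inj; rewrite /= mulVf.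
have h2 : x * y = 1 by rewrite mulrC.
have ux : x \is a GRing.unit by apply/unitrP; exists y.
by split=> //; rewrite -[x^-1]mulr1 -h2 mulKr.
Qed.

Lemma fq_neq0 : fq != 0.
Proof. by rewrite /fq tofrac_eq0 polyX_eq0. Qed.

Lemma fz_neq0 : fz != 0.
Proof. by rewrite /fz tofrac_eq0 polyC_eq0 polyX_eq0. Qed.

Lemma subV_neq0 (x : Kfrac) : x != 0 -> x ^+ 2 != 1 -> x - x^-1 != 0.
Proof.
move=> x0; apply: contraNneq => h.
have: x * (x - x^-1) = 0 by rewrite h mulr0.
by rewrite mulrBr mulfV // => /eqP; rewrite subr_eq0 expr2.
Qed.

Lemma fdq_neq0 : fq - fq^-1 != 0.
Proof.
apply: (subV_neq0 fq_neq0); rewrite /fq -tofracXn -tofrac1 tofrac_eq.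
by apply/eqP => /(congr1 (fun p : {poly {poly int}} => size p)); rewrite size_polyXn size_poly1.
Qed.

Lemma fdz_neq0 : fz - fz^-1 != 0.
Proof.
apply: (subV_neq0 fz_neq0); rewrite /fz -tofracXn -tofrac1 tofrac_eq -polyC_exp.
rewrite -polyC1 (inj_eq (@polyC_inj _)).
by apply/eqP => /(congr1 (fun p : {poly int} => size p)); rewrite size_polyXn size_poly1.
Qed.

Lemma kq_unit : kq \is a GRing.unit.
Proof. by case: (@ground_inv kq fq_neq0 ground_qV). Qed.

Lemma kz_unit : kz \is a GRing.unit.
Proof. by case: (@ground_inv kz fz_neq0 ground_zV). Qed.

Lemma kdq_unit : kq - kq^-1 \is a GRing.unit.
Proof.
have [_ h] := @ground_inv kq fq_neq0 ground_qV.
have hv : val (kq - kq^-1) = fq - fq^-1 by rewrite /= h.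
apply: (proj1 (ground_inv _ _)); rewrite hv; [exact: fdq_neq0 | exact: ground_dq].
Qed.

Lemma kdz_unit : kz - kz^-1 \is a GRing.unit.
Proof.
have [_ h] := @ground_inv kz fz_neq0 ground_zV.
have hv : val (kz - kz^-1) = fz - fz^-1 by rewrite /= h.
apply: (proj1 (ground_inv _ _)); rewrite hv; [exact: fdz_neq0 | exact: ground_dz].
Qed.

Definition kdelta : kk := (kz - kz^-1) / (kq - kq^-1).

(* The algebra is the quotient of the term algebra on the symbols T_i, E_1 and
   the scalars by the congruence generated by the axioms of associative unital
   algebras and the defining relations.  The symbols that are not generators of
   B_n are sent to 0, so that B_0 = B_1 = k. *)
Inductive bterm :=
| TermT of nat
| TermE
| TermC of kk
| TermAdd of bterm & bterm
| TermMul of bterm & bterm.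

Declare Scope bterm_scope.
Delimit Scope bterm_scope with bt.
Bind Scope bterm_scope with bterm.
Local Notation "x + y" := (TermAdd x y) : bterm_scope.
Local Notation "x * y" := (TermMul x y) : bterm_scope.
Local Notation "'T_ i" := (TermT i) (at level 8, i at level 2, format "''T_' i") : bterm_scope.
Local Notation "'E1" := TermE : bterm_scope.
Local Notation "c %:S" := (TermC c) (at level 2, left associativity, format "c %:S") : bterm_scope.

(* (T - q)(T + q^-1) = 0 gives T^-1 = T - (q - q^-1). *)
Definition termTV (i : nat) : bterm := ('T_i + (- (kq - kq^-1))%:S)%bt.
Definition termE2 : bterm :=
  ('E1 * ('T_2 * ('T_3 * (termTV 1 * (termTV 2 * 'E1)))))%bt.

Inductive brel (n : nat) : bterm -> bterm -> Prop :=
| rel_noT i : ~~ (0 < i < n)%N -> brel n ('T_i) (0%:S)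
| rel_noE : (n < 2)%N -> brel n 'E1 (0%:S)
| rel_quad i : (0 < i < n)%N ->
    brel n (('T_i + (- kq)%:S) * ('T_i + (kq^-1)%:S)) (0%:S)
| rel_comm i j : (0 < i < n)%N -> (0 < j < n)%N ->
    ((i.+1 < j) || (j.+1 < i))%N -> brel n ('T_i * 'T_j) ('T_j * 'T_i)
| rel_braid k : (0 < k)%N -> (k.+1 < n)%N ->
    brel n ('T_k * ('T_k.+1 * 'T_k)) ('T_k.+1 * ('T_k * 'T_k.+1))
| rel_EE : (1 < n)%N -> brel n ('E1 * 'E1) (kdelta%:S * 'E1)
| rel_TE : (1 < n)%N -> brel n ('T_1 * 'E1) (kq%:S * 'E1)
| rel_ET : (1 < n)%N -> brel n ('E1 * 'T_1) (kq%:S * 'E1)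
| rel_ETE : (2 < n)%N -> brel n ('E1 * ('T_2 * 'E1)) (kz%:S * 'E1)
| rel_TEcomm i : (2 < i < n)%N -> brel n ('T_i * 'E1) ('E1 * 'T_i)
| rel_E2l : (3 < n)%N ->
    brel n ('T_2 * ('T_3 * (termTV 1 * (termTV 2 * termE2)))) termE2
| rel_E2r : (3 < n)%N ->
    brel n (termE2 * ('T_2 * ('T_3 * (termTV 1 * termTV 2)))) termE2.

Inductive beq (n : nat) : bterm -> bterm -> Prop :=
| beq_rel x y : brel n x y -> beq n x y
| beq_refl x : beq n x x
| beq_sym x y : beq n x y -> beq n y x
| beq_trans x y z : beq n x y -> beq n y z -> beq n x z
| beq_add x x' y y' : beq n x x' -> beq n y y' -> beq n (x + y) (x' + y')
| beq_mul x x' y y' : beq n x x' -> beq n y y' -> beq n (x * y) (x' * y')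
| beq_addA x y z : beq n (x + (y + z)) ((x + y) + z)
| beq_addC x y : beq n (x + y) (y + x)
| beq_add0 x : beq n (0%:S + x) x
| beq_addN x : beq n ((-1)%:S * x + x) (0%:S)
| beq_mulA x y z : beq n (x * (y * z)) ((x * y) * z)
| beq_mul1l x : beq n (1%:S * x) x
| beq_mulDl x y z : beq n ((x + y) * z) (x * z + y * z)
| beq_mulDr x y z : beq n (x * (y + z)) (x * y + x * z)
| beq_constD a b : beq n ((a + b)%R%:S) (a%:S + b%:S)
| beq_constM a b : beq n ((a * b)%R%:S) (a%:S * b%:S)
| beq_constC a x : beq n (a%:S * x) (x * a%:S).

HB.instance Definition _ := gen_eqMixin bterm.
HB.instance Definition _ := gen_choiceMixin bterm.

Section QBrauer.
Variable n : nat.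

Definition beqb : rel bterm := fun x y => `[< beq n x y >].

Lemma beqb_equiv : equiv_class_of beqb.
Proof.
split=> [x|x y|y x w]; first by apply/asboolP; exact: beq_refl.
  by apply/asboolP/asboolP => h; exact: beq_sym.
by move=> /asboolP h1 /asboolP h2; apply/asboolP; exact: beq_trans h1 h2.
Qed.

Canonical beqb_equiv_rel := EquivRelPack beqb_equiv.
Canonical beqb_encModRel := defaultEncModRel beqb.

Definition qBrauer : Type := {eq_quot beqb}.
HB.instance Definition _ : EqQuotient bterm beqb qBrauer :=
  EqQuotient.on qBrauer.
HB.instance Definition _ := Choice.on qBrauer.

Definition bpi (x : bterm) : qBrauer := \pi_qBrauer x.

Lemma bpi_eq x y : beq n x y -> bpi x = bpi y.
Proof. by move=> h; apply/eqmodP/asboolP. Qed.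

Lemma bpi_repr x : beq n (repr (bpi x)) x.
Proof.
have /eqmodP /asboolP // : repr (bpi x) = x %[mod qBrauer].
by rewrite reprK.
Qed.

Definition badd (x y : qBrauer) := bpi (repr x + repr y)%bt.
Definition bmul (x y : qBrauer) := bpi (repr x * repr y)%bt.
Definition bopp (x : qBrauer) := bpi ((-1)%:S * repr x)%bt.
Definition bscale (a : kk) (x : qBrauer) := bpi (a%:S * repr x)%bt.

Lemma bpiD x y : bpi (x + y)%bt = badd (bpi x) (bpi y).
Proof. by apply: bpi_eq; apply: beq_add; apply: beq_sym; exact: bpi_repr. Qed.

Lemma bpiM x y : bpi (x * y)%bt = bmul (bpi x) (bpi y).
Proof. by apply: bpi_eq; apply: beq_mul; apply: beq_sym; exact: bpi_repr. Qed.

Lemma bpiN x : bpi ((-1)%:S * x)%bt = bopp (bpi x).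
Proof.
by apply: bpi_eq; apply: beq_mul; [exact: beq_refl | apply: beq_sym; exact: bpi_repr].
Qed.

Lemma bpiZ a x : bpi (a%:S * x)%bt = bscale a (bpi x).
Proof.
by apply: bpi_eq; apply: beq_mul; [exact: beq_refl | apply: beq_sym; exact: bpi_repr].
Qed.

Lemma bpiK (x : qBrauer) : bpi (repr x) = x.
Proof. exact: reprK. Qed.

Lemma baddA : associative badd.
Proof.
move=> x y w; rewrite -(bpiK x) -(bpiK y) -(bpiK w) -!bpiD.
exact/bpi_eq/beq_addA.
Qed.

Lemma baddC : commutative badd.
Proof. by move=> x y; rewrite -(bpiK x) -(bpiK y) -!bpiD; exact/bpi_eq/beq_addC. Qed.

Lemma badd0 : left_id (bpi 0%:S) badd.
Proof. by move=> x; rewrite -(bpiK x) -!bpiD; exact/bpi_eq/beq_add0. Qed.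

Lemma baddN : left_inverse (bpi 0%:S) bopp badd.
Proof. by move=> x; rewrite -(bpiK x) -bpiN -!bpiD; exact/bpi_eq/beq_addN. Qed.

HB.instance Definition _ :=
  GRing.isZmodule.Build qBrauer baddA baddC badd0 baddN.

Lemma bmulA : associative bmul.
Proof.
move=> x y w; rewrite -(bpiK x) -(bpiK y) -(bpiK w) -!bpiM.
exact/bpi_eq/beq_mulA.
Qed.

Lemma bmul1 : left_id (bpi 1%:S) bmul.
Proof. by move=> x; rewrite -(bpiK x) -!bpiM; exact/bpi_eq/beq_mul1l. Qed.

Lemma bmulr1 : right_id (bpi 1%:S) bmul.
Proof.
move=> x; rewrite -(bpiK x) -!bpiM; apply/bpi_eq.
by apply: beq_trans (beq_mul1l _ _); apply: beq_sym; exact: beq_constC.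
Qed.

Lemma bmulDl : left_distributive bmul badd.
Proof.
move=> x y w; rewrite -(bpiK x) -(bpiK y) -(bpiK w) -!(bpiM, bpiD).
exact/bpi_eq/beq_mulDl.
Qed.

Lemma bmulDr : right_distributive bmul badd.
Proof.
move=> x y w; rewrite -(bpiK x) -(bpiK y) -(bpiK w) -!(bpiM, bpiD).
exact/bpi_eq/beq_mulDr.
Qed.

Fixpoint beval (x : bterm) : kk :=
  match x with
  | TermT i => if (0 < i < n)%N then kq else 0
  | TermE => 0
  | TermC c => c
  | TermAdd x y => beval x + beval y
  | TermMul x y => beval x * beval y
  end.

Lemma beval_eq x y : beq n x y -> beval x = beval y.
Proof.
elim=> {x y} //=; try by [move=> *; congruence];
  try by [move=> *; rewrite ?(addrA, mulrA, add0r, mulN1r, addNr, mul1r, mulrDl, mulrDr)];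
  try by [move=> *; exact: addrC]; try by [move=> *; exact: mulrC].
move=> x y []; rewrite /= ?(mulr0, mul0r) //.
- by move=> i /negbTE ->.
- by move=> i ->; rewrite subrr mul0r.
- by move=> i j _ _ _; rewrite mulrC.
- by move=> k k0 kn; rewrite k0 kn (ltn_trans _ kn).
- by move=> i _; rewrite mulr0 mul0r.
Qed.

Lemma bone_neq0 : bpi 1%:S != bpi 0%:S.
Proof.
apply/eqP => /eqmodP /asboolP /beval_eq /eqP; exact/negP/oner_neq0.
Qed.

HB.instance Definition _ := GRing.Zmodule_isNzRing.Build qBrauer
  bmulA bmul1 bmulr1 bmulDl bmulDr bone_neq0.

Lemma bpi_add x y : bpi (x + y)%bt = bpi x + bpi y.
Proof. exact: bpiD. Qed.

Lemma bpi_mul x y : bpi (x * y)%bt = bpi x * bpi y.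
Proof. exact: bpiM. Qed.

Lemma bscaleE a x : bscale a x = bpi a%:S * x.
Proof. by rewrite -(bpiK x) -bpiZ bpi_mul. Qed.

Lemma bscaleA a b x : bscale a (bscale b x) = bscale (a * b) x.
Proof.
rewrite !bscaleE mulrA; congr (_ * _).
by rewrite -bpi_mul; apply/bpi_eq/beq_sym/beq_constM.
Qed.

Lemma bscale1 : left_id 1 bscale.
Proof. by move=> x; rewrite bscaleE; exact: mul1r. Qed.

Lemma bscaleDr : right_distributive bscale +%R.
Proof. by move=> a x y; rewrite !bscaleE mulrDr. Qed.

Lemma bscaleDl x : {morph bscale^~ x : a b / a + b}.
Proof.
move=> a b; rewrite !bscaleE -mulrDl -bpi_add; congr (_ * _).
exact/bpi_eq/beq_constD.
Qed.

HB.instance Definition _ := GRing.Zmodule_isLmodule.Build kk qBrauer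
  bscaleA bscale1 bscaleDr bscaleDl.

Lemma bpi_scale (a : kk) (x : qBrauer) : a *: x = bpi a%:S * x.
Proof. exact: bscaleE. Qed.

Lemma bscaleAl (a : kk) (x y : qBrauer) : a *: (x * y) = (a *: x) * y.
Proof. by rewrite !bpi_scale mulrA. Qed.

HB.instance Definition _ := GRing.Lmodule_isLalgebra.Build kk qBrauer bscaleAl.

Lemma bscaleAr (a : kk) (x y : qBrauer) : a *: (x * y) = x * (a *: y).
Proof.
rewrite !bpi_scale !mulrA; congr (_ * _).
by rewrite -(bpiK x) -!bpi_mul; exact/bpi_eq/beq_constC.
Qed.

HB.instance Definition _ := GRing.Lalgebra_isAlgebra.Build kk qBrauer bscaleAr.

HB.instance Definition _ := GRing.NzRing_hasMulInverse.Build qBrauer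
  (@cmulVr qBrauer) (@cmulrV qBrauer) (@cunitP qBrauer) (@cinv_out qBrauer).

Lemma bpiC c : bpi c%:S = c%:A.
Proof. by rewrite bpi_scale mulr1. Qed.

Definition bT (i : nat) : qBrauer := bpi 'T_i.
Definition bE : qBrauer := bpi 'E1.

End QBrauer.
Section E2Reversal.
Variables (A : algType kk) (T1 T2 T3 U1 U2 U3 E : A) (a ai d b : kk).
Hypotheses (TU1 : T1 * U1 = 1) (UT1 : U1 * T1 = 1).
Hypotheses (TU2 : T2 * U2 = 1) (UT2 : U2 * T2 = 1) (TU3 : T3 * U3 = 1).
Hypotheses (T2E : T2 = U2 + d%:A) (aK : ai * a = 1).
Hypotheses (T13 : T1 * T3 = T3 * T1).
Hypotheses (br12 : T1 * (T2 * T1) = T2 * (T1 * T2)).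
Hypotheses (br23 : T2 * (T3 * T2) = T3 * (T2 * T3)).
Hypotheses (T1E : T1 * E = a *: E) (ET1 : E * T1 = a *: E).
Hypotheses (ETE : E * (T2 * E) = b *: E) (T3E : T3 * E = E * T3).
Let g := T2 * (T3 * (U1 * U2)).
Let g' := U2 * (U1 * (T3 * T2)).
Let e2 := E * (T2 * (T3 * (U1 * (U2 * E)))).
Hypotheses (gl : T2 * (T3 * (U1 * (U2 * e2))) = e2) (gr : e2 * g = e2).

Let U1E : U1 * E = ai *: E.
Proof. by rewrite -[E in LHS]scale1r -aK -scalerA -T1E scalerAr -!scalerAr mulrA UT1 mul1r. Qed.

Let EU1 : E * U1 = ai *: E.
Proof. by rewrite -[E in LHS]scale1r -aK -scalerA -ET1 -!scalerAl -mulrA TU1 mulr1. Qed.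

Let U13 : U1 * T3 = T3 * U1.
Proof. by rewrite -[LHS]mulr1 -TU1 mulrA -(mulrA U1) -T13 mulrA UT1 mul1r. Qed.

Let U2E : U2 = T2 - d%:A. Proof. by rewrite T2E addrK. Qed.

Let e2rev : E * (U2 * (U1 * (T3 * (T2 * E)))) = e2.
Proof.
have h1 : e2 = E * (T2 * (T3 * (U1 * (T2 * E)))) - (d * ai * b) *: (E * T3).
  rewrite /e2 {1}U2E mulrBl mulrBr mulrBr mulrBr mulrBr; congr (_ - _).
  rewrite -scalerAl mul1r -!scalerAr U1E -!scalerAr !scalerA T3E mulrA mulrA -[E * T2 * E]mulrA.
  by rewrite ETE -scalerAl scalerA.
have h2 : E * (U2 * (U1 * (T3 * (T2 * E)))) =
    E * (T2 * (T3 * (U1 * (T2 * E)))) - (d * ai * b) *: (E * T3).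
  rewrite U2E mulrBl mulrBr (mulrA U1) U13 -(mulrA T3); congr (_ - _).
  rewrite -scalerAl mul1r -!scalerAr (mulrA T3) -U13 -(mulrA U1) (mulrA E) EU1 -scalerAl scalerA.
  by rewrite (mulrA E T3) -T3E -(mulrA T3) ETE -scalerAr scalerA T3E.
by rewrite h1 h2.
Qed.

Let T1e2 : T1 * e2 = a *: e2.
Proof. by rewrite /e2 mulrA T1E scalerAl. Qed.
Let e2T1 : e2 * T1 = a *: e2.
Proof. by rewrite /e2 -!mulrA ET1 -!scalerAr. Qed.
Let U1e2 : U1 * e2 = ai *: e2.
Proof. by rewrite /e2 mulrA U1E scalerAl. Qed.
Let e2U1 : e2 * U1 = ai *: e2.
Proof. by rewrite /e2 -!mulrA EU1 -!scalerAr. Qed.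

Let ge2 : g * e2 = e2.
Proof. by rewrite /g -!mulrA. Qed.

Let T3g : T3 * g = g * T1.
Proof.
have h : T2 * (U1 * U2) = U1 * (U2 * T1).
  have : T1 * (T2 * (U1 * U2)) = U2 * T1.
    rewrite -[LHS]mul1r -UT2 -mulrA; congr (_ * _).
    rewrite (mulrA T2) (mulrA (T2 * T1)) -(mulrA T2 T1 T2) -br12.
    by rewrite -!mulrA (mulrA T1 U1) TU1 mul1r TU2 mulr1.
  by move=> <-; rewrite (mulrA U1 T1) UT1 mul1r.
rewrite /g (mulrA T3) (mulrA (T3 * T2)) -(mulrA T3 T2 T3) -br23 -!mulrA.
by rewrite h.
Qed.

Let T3e2 : T3 * e2 = a *: e2.
Proof. by rewrite -{1}ge2 mulrA T3g -mulrA T1e2 -scalerAr ge2. Qed.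

Let aC : a * ai = 1. Proof. by rewrite mulrC. Qed.

Let gi := T2 * (T1 * (U3 * U2)).

Let gK : g * gi = 1.
Proof.
rewrite /g /gi -!mulrA (mulrA U2) UT2 mul1r (mulrA U1) UT1 mul1r (mulrA T3) TU3.
by rewrite mul1r TU2.
Qed.

Let e2T3 : e2 * T3 = a *: e2.
Proof.
have e1 : e2 * T3 * g = a *: e2 by rewrite -mulrA T3g mulrA gr e2T1.
rewrite -[LHS]mulr1 -gK mulrA e1 -scalerAl -{1}gr -mulrA gK mulr1 //.
Qed.

Let h := T3 * U1.

Let he2 : h * e2 = e2.
Proof. by rewrite /h -mulrA U1e2 -scalerAr T3e2 scalerA aK scale1r. Qed.

Let e2h : e2 * h = e2.
Proof. by rewrite /h mulrA e2T3 -scalerAl e2U1 scalerA aC scale1r. Qed.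

Let g'E : g' = U2 * (h * T2).
Proof. by rewrite /g' /h (mulrA U1) U13. Qed.

Let gE : g = T2 * (h * U2).
Proof. by rewrite /g /h !mulrA. Qed.

Lemma e2_rev : E * (U2 * (U1 * (T3 * (T2 * E)))) = e2.
Proof. exact: e2rev. Qed.

Lemma e2_revl : g' * e2 = e2.
Proof.
have h1 : h * (U2 * e2) = U2 * e2.
  by rewrite -[LHS]mul1r -UT2 -mulrA; congr (_ * _); rewrite -[RHS]ge2 gE -!mulrA.
have h2 : h * (T2 * e2) = T2 * e2.
  rewrite T2E !mulrDl mulrDr h1; congr (_ + _).
  by rewrite -scalerAl mul1r -scalerAr he2.
by rewrite g'E -(mulrA U2) -(mulrA h) h2 mulrA UT2 mul1r.
Qed.

Lemma e2_revr : e2 * g' = e2.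
Proof.
have h1 : e2 * T2 * h = e2 * T2.
  by rewrite -[LHS]mulr1 -UT2 mulrA; congr (_ * _); rewrite -[RHS]gr gE -!mulrA.
have h2 : e2 * U2 * h = e2 * U2.
  rewrite U2E mulrBr mulrBl h1; congr (_ - _).
  by rewrite -scalerAr mulr1 -scalerAl e2h.
by rewrite g'E (mulrA e2) (mulrA (e2 * U2)) h2 -mulrA UT2 mulr1.
Qed.
End E2Reversal.

Fixpoint brev (x : bterm) : bterm :=
  match x with
  | TermAdd x y => TermAdd (brev x) (brev y)
  | TermMul x y => TermMul (brev y) (brev x)
  | _ => x
  end.

Section Reversal.
Variable n : nat.
Local Notation bpi := (bpi n).
Local Notation T := (bT n).
Local Notation E := (bE n).
Local Notation TV i := (bpi (termTV i)).

Lemma bpiTV i : TV i = T i - (kq - kq^-1)%:A.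
Proof. by rewrite bpi_add bpiC scaleNr. Qed.

Lemma bT_quad i : (0 < i < n)%N -> (T i - kq%:A) * (T i + (kq^-1)%:A) = 0.
Proof.
move=> hi; have := bpi_eq (beq_rel (rel_quad hi)).
by rewrite bpi_mul !bpi_add !bpiC scaleNr scale0r.
Qed.

Lemma bT_sqr i : (0 < i < n)%N -> T i * T i = 1 + (kq - kq^-1) *: T i.
Proof.
move/bT_quad; rewrite mulrBl !mulrDr -!scalerAl -!scalerAr !mul1r mulr1 scalerA.
rewrite mulrV ?kq_unit // scale1r => /subr0_eq h.
by rewrite scalerBl addrA [1 + _]addrC -h addrK.
Qed.

Lemma bT_TV i : (0 < i < n)%N -> T i * TV i = 1.
Proof. by move=> hi; rewrite bpiTV mulrBr bT_sqr // -scalerAr mulr1 addrK. Qed.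

Lemma bTV_T i : (0 < i < n)%N -> TV i * T i = 1.
Proof. by move=> hi; rewrite bpiTV mulrBl bT_sqr // -scalerAl mul1r addrK. Qed.

Lemma bT_unit i : (0 < i < n)%N -> T i \is a GRing.unit.
Proof. by move=> hi; apply/unitrP; exists (TV i); rewrite bT_TV ?bTV_T. Qed.

Lemma bTVE i : (0 < i < n)%N -> (T i)^-1 = TV i.
Proof. by move=> hi; apply: (mulrI (bT_unit hi)); rewrite bT_TV // mulrV ?bT_unit. Qed.

Lemma beq_bpi x y : bpi x = bpi y -> beq n x y.
Proof. by move/eqmodP/asboolP. Qed.

Section E2.
Hypothesis hn : (3 < n)%N.

Let h1 : (0 < 1 < n)%N. Proof. by rewrite (ltn_trans _ hn). Qed.
Let h2 : (0 < 2 < n)%N. Proof. by rewrite (ltn_trans _ hn). Qed.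
Let h3 : (0 < 3 < n)%N. Proof. by rewrite hn. Qed.

Let rel u v : brel n u v -> bpi u = bpi v.
Proof. by move=> h; exact/bpi_eq/beq_rel. Qed.

Let T2E : T 2 = TV 2 + (kq - kq^-1)%:A. Proof. by rewrite bpiTV addrNK. Qed.
Let aK : kq^-1 * kq = 1. Proof. by rewrite mulVr ?kq_unit. Qed.
Let T13 : T 1 * T 3 = T 3 * T 1.
Proof. by rewrite /bT /bE -!bpi_mul; apply/rel/rel_comm. Qed.
Let br12 : T 1 * (T 2 * T 1) = T 2 * (T 1 * T 2).
Proof. by rewrite /bT /bE -!bpi_mul; apply: rel; apply: (@rel_braid n 1) => //; exact: ltn_trans hn. Qed.
Let br23 : T 2 * (T 3 * T 2) = T 3 * (T 2 * T 3).
Proof. by rewrite /bT /bE -!bpi_mul; apply: rel; apply: (@rel_braid n 2). Qed.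
Let T1E : T 1 * E = kq *: E.
Proof. by rewrite /bT /bE -bpi_mul (rel (rel_TE _)) ?(ltn_trans _ hn) // bpi_mul -bpi_scale. Qed.
Let ET1 : E * T 1 = kq *: E.
Proof. by rewrite /bT /bE -bpi_mul (rel (rel_ET _)) ?(ltn_trans _ hn) // bpi_mul -bpi_scale. Qed.
Let ETE : E * (T 2 * E) = kz *: E.
Proof. by rewrite /bT /bE -!bpi_mul (rel (rel_ETE _)) ?(ltn_trans _ hn) // bpi_mul -bpi_scale. Qed.
Let T3E : T 3 * E = E * T 3.
Proof. by rewrite /bT /bE -!bpi_mul; apply/rel/rel_TEcomm. Qed.
Let gl : T 2 * (T 3 * (TV 1 * (TV 2 *
  (E * (T 2 * (T 3 * (TV 1 * (TV 2 * E)))))))) = E * (T 2 * (T 3 * (TV 1 * (TV 2 * E)))).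
Proof. by rewrite /bT /bE -!bpi_mul (rel (rel_E2l hn)). Qed.
Let gr : (E * (T 2 * (T 3 * (TV 1 * (TV 2 * E))))) * (T 2 * (T 3 * (TV 1 * TV 2))) =
  E * (T 2 * (T 3 * (TV 1 * (TV 2 * E)))).
Proof. by rewrite /bT /bE -!bpi_mul (rel (rel_E2r hn)). Qed.

Let bpi_E2 : bpi termE2 = E * (T 2 * (T 3 * (TV 1 * (TV 2 * E)))).
Proof. by rewrite !bpi_mul. Qed.

Lemma brev_E2 : bpi (brev termE2) = bpi termE2.
Proof.
rewrite /= !bpi_mul -!mulrA.
exact: (e2_rev (bT_TV h1) (bTV_T h1) T2E aK T13 T1E ET1 ETE T3E).
Qed.

Let brevM x y : bpi (brev (TermMul x y)) = bpi (brev y) * bpi (brev x).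
Proof. by rewrite -bpi_mul. Qed.

Lemma brev_E2l :
  bpi (brev (TermMul (TermT 2) (TermMul (TermT 3) (TermMul (termTV 1)
    (TermMul (termTV 2) termE2))))) = bpi (brev termE2).
Proof.
rewrite (brevM (TermT 2)) (brevM (TermT 3)) (brevM (termTV 1)) (brevM (termTV 2)) brev_E2 -!mulrA.
have h := e2_revr (bT_TV h1) (bTV_T h1) (bT_TV h2) (bTV_T h2) (bT_TV h3) T2E aK
  T13 br12 br23 ET1 gr.
by rewrite bpi_E2; exact: h.
Qed.

Lemma brev_E2r :
  bpi (brev (TermMul termE2 (TermMul (TermT 2) (TermMul (TermT 3)
    (TermMul (termTV 1) (termTV 2)))))) = bpi (brev termE2).
Proof.
rewrite (brevM termE2) (brevM (TermT 2)) (brevM (TermT 3)) (brevM (termTV 1)) brev_E2 -!mulrA.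
have h := e2_revl (bT_TV h1) (bTV_T h1) (bT_TV h2) (bTV_T h2) T2E aK T13 br12 br23
  T1E gl.
by rewrite bpi_E2 -[RHS]h -!mulrA.
Qed.
End E2.

Lemma brev_rel x y : brel n x y -> bpi (brev x) = bpi (brev y).
Proof.
have rel u v : brel n u v -> bpi u = bpi v by move=> h; exact/bpi_eq/beq_rel.
case=> {x y} /=.
- by move=> i hi; exact/rel/rel_noT.
- by move=> hn; exact/rel/rel_noE.
- move=> i hi; have := bT_quad hi; rewrite bpi_mul !bpi_add !bpiC scaleNr scale0r => <-.
  by rewrite mulrBr mulrDl mulrBl mulrDr -!scalerAl -!scalerAr !mul1r !mulr1.
- by move=> i j hi hj hij; exact/esym/rel/rel_comm.
- move=> k k0 kn; rewrite !bpi_mul -!mulrA -!bpi_mul; exact/rel/rel_braid.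
- move=> hn; rewrite (rel _ _ (rel_EE hn)); exact/bpi_eq/beq_constC.
- move=> hn; rewrite (rel _ _ (rel_ET hn)); exact/bpi_eq/beq_constC.
- move=> hn; rewrite (rel _ _ (rel_TE hn)); exact/bpi_eq/beq_constC.
- move=> hn; rewrite !bpi_mul -mulrA -!bpi_mul (rel _ _ (rel_ETE hn)).
  exact/bpi_eq/beq_constC.
- by move=> i hi; exact/esym/rel/rel_TEcomm.
- exact: brev_E2l.
- exact: brev_E2r.
Qed.

Lemma brev_eq x y : beq n x y -> beq n (brev x) (brev y).
Proof.
elim=> {x y} /=.
- by move=> x y /brev_rel h; exact: beq_bpi.
- by move=> x; exact: beq_refl.
- by move=> x y _; exact: beq_sym.
- by move=> x y w _ h1 _ h2; exact: beq_trans h1 h2.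
- by move=> x x' y y' _ h1 _ h2; exact: beq_add.
- by move=> x x' y y' _ h1 _ h2; exact: beq_mul.
- by move=> x y w; exact: beq_addA.
- by move=> x y; exact: beq_addC.
- by move=> x; exact: beq_add0.
- move=> x; apply: beq_trans (beq_addN n _).
  by apply: beq_add; [apply: beq_sym; exact: beq_constC | exact: beq_refl].
- by move=> x y w; apply: beq_sym; exact: beq_mulA.
- by move=> x; apply: beq_trans (beq_mul1l n _); apply: beq_sym; exact: beq_constC.
- by move=> x y w; exact: beq_mulDr.
- by move=> x y w; exact: beq_mulDl.
- by move=> a b; exact: beq_constD.
- by move=> a b; apply: beq_trans (beq_constM n _ _) _; exact: beq_constC.
- by move=> a x; apply: beq_sym; exact: beq_constC.
Qed.

Definition bsigma (x : qBrauer n) : qBrauer n := bpi (brev (repr x)).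

Lemma bsigma_bpi x : bsigma (bpi x) = bpi (brev x).
Proof. by apply/bpi_eq/brev_eq; exact: bpi_repr. Qed.

Lemma bsigmaT i : bsigma (T i) = T i. Proof. exact: bsigma_bpi. Qed.

Lemma bsigmaE : bsigma E = E. Proof. exact: bsigma_bpi. Qed.

Lemma bsigmaM x y : bsigma (x * y) = bsigma y * bsigma x.
Proof. by rewrite -(bpiK x) -(bpiK y) -bpi_mul !bsigma_bpi -bpi_mul. Qed.

Lemma bsigmaK : involutive bsigma.
Proof.
have brevK y : brev (brev y) = y by elim: y => //= y -> w ->.
by move=> x; rewrite -(bpiK x) !bsigma_bpi brevK.
Qed.

Lemma bsigma_linear : linear bsigma.
Proof.
move=> a x y; rewrite -(bpiK x) -(bpiK y) !bpi_scale -bpi_mul -bpi_add !bsigma_bpi /=.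
by rewrite bpi_add bpi_mul bpiC -scalerAr mulr1 mulr_algl.
Qed.

End Reversal.

Section Modules.
Variables (k : comNzRingType) (V : lmodType k).

Definition kspan (S : set V) : {pred V} := fun x =>
  `[< exists s : seq (k * V),
        (forall c, c \in s -> S c.2) /\ x = \sum_(c <- s) c.1 *: c.2 >].

Lemma kspan_closed S : subsemimod_closed (kspan S).
Proof.
split; [split|].
- by apply/asboolP; exists [::]; rewrite big_nil.
- move=> x y /asboolP[s [hs ->]] /asboolP[t [ht ->]]; apply/asboolP.
  exists (s ++ t); split; last by rewrite big_cat.
  by move=> c; rewrite mem_cat => /orP[/hs|/ht].
- move=> a x /asboolP[s [hs ->]]; apply/asboolP.
  exists [seq (a * c.1, c.2) | c <- s]; split; first by move=> _ /mapP[c /hs hc ->].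
  by rewrite big_map scaler_sumr; apply: eq_bigr => c _; rewrite scalerA.
Qed.
HB.instance Definition _ S :=
  GRing.isSubmodClosed.Build k V (kspan S) (kspan_closed S).

Definition kquot (S : set V) : Type :=
  Quotient.quot [the zmodClosed V of kspan S].
HB.instance Definition _ S := EqQuotient.on (kquot S).
HB.instance Definition _ S := GRing.Zmodule.on (kquot S).

Definition kproj (S : set V) (x : V) : kquot S := \pi_(kquot S) x.

Lemma kproj_eq S (x y : V) : (kproj S x = kproj S y) <-> (x - y \in kspan S).
Proof. by rewrite Quotient.idealrBE; split=> [/eqP|/eqP]. Qed.

Lemma kprojK S (x : kquot S) : kproj S (repr x) = x.
Proof. exact: reprK. Qed.

Lemma kprojD S (x y : V) : kproj S (x + y) = kproj S x + kproj S y.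
Proof. exact: (Quotient.pi_add [the zmodClosed V of kspan S]). Qed.

Definition kquot_scale S (a : k) (x : kquot S) : kquot S := kproj S (a *: repr x).

Lemma kprojZ S a (x : V) : kquot_scale a (kproj S x) = kproj S (a *: x).
Proof. by apply/kproj_eq; rewrite -scalerBr rpredZ //; apply/kproj_eq/kprojK. Qed.

Lemma kquot_scaleA S a b (x : kquot S) :
  kquot_scale a (kquot_scale b x) = kquot_scale (a * b) x.
Proof. by rewrite -(kprojK x) !kprojZ scalerA. Qed.

Lemma kquot_scale1 S : left_id 1 (@kquot_scale S).
Proof. by move=> x; rewrite -(kprojK x) kprojZ scale1r. Qed.

Lemma kquot_scaleDr S : right_distributive (@kquot_scale S) +%R.
Proof. by move=> a x y; rewrite -(kprojK x) -(kprojK y) !(kprojZ, =^~ kprojD) scalerDr. Qed.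

Lemma kquot_scaleDl S (x : kquot S) : {morph (@kquot_scale S)^~ x : a b / a + b}.
Proof. by move=> a b; rewrite -(kprojK x) !(kprojZ, =^~ kprojD) scalerDl. Qed.

HB.instance Definition _ S := GRing.Zmodule_isLmodule.Build k (kquot S)
  (@kquot_scaleA S) (@kquot_scale1 S) (@kquot_scaleDr S) (@kquot_scaleDl S).

Definition kimage (S : set V) (X : {pred V}) : {pred kquot S} := fun y =>
  `[< exists2 x, x \in X & y = kproj S x >].

Definition lin_indep (I : eqType) (P : set I) (v : I -> V) : Prop :=
  forall (s : seq I) (c : I -> k), uniq s -> (forall i, i \in s -> P i) ->
    \sum_(i <- s) c i *: v i = 0 -> forall i, i \in s -> c i = 0.

Definition is_basis (I : eqType) (P : set I) (v : I -> V) (M : {pred V}) : Prop :=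
  lin_indep P v /\ M =i kspan (v @` P).

End Modules.
Arguments kimage {k V} S X.

Section AlgebraModules.
Variables (k : comNzRingType) (A : algType k).

Inductive gen_subalg (S : set A) : A -> Prop :=
| gen_subalg_gen x of S x : gen_subalg S x
| gen_subalg_1 : gen_subalg S 1
| gen_subalg_D x y of gen_subalg S x & gen_subalg S y : gen_subalg S (x + y)
| gen_subalg_M x y of gen_subalg S x & gen_subalg S y : gen_subalg S (x * y)
| gen_subalg_Z a x of gen_subalg S x : gen_subalg S (a *: x).

(* All right modules below are k-submodules X of iterated quotients U of the
   right regular module, p : A -> U being the projection; the action is
   (p a) b = p (a b).  The following two notions quantify over all
   representatives, so that they include the fact that the action of S is well
   defined on the modules involved. *)
Definition right_submodule (S : set A) (U : lmodType k) (p : A -> U)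
    (X : {pred U}) : Prop :=
  forall a b, S b -> p a \in X -> p (a * b) \in X.

Definition right_isomorphism (S : set A) (U U' : lmodType k)
    (p : A -> U) (X : {pred U}) (p' : A -> U') (X' : {pred U'})
    (phi : U -> U') : Prop :=
  [/\ forall c u v, u \in X -> v \in X -> phi (c *: u + v) = c *: phi u + phi v,
      set_bij [set` X] [set` X'] phi
    & forall a a' b, S b -> p a \in X -> phi (p a) = p' a' ->
        p (a * b) \in X /\ phi (p (a * b)) = p' (a' * b)].

(* Left multiplication as in Graham and Lehrer, with le y x, y <> x for the
   lower cells. *)
Record cellular_basis (L I : choiceType) (Lam : set L) (le : L -> L -> Prop)
    (M : L -> set I) (C : L -> I -> I -> A) (inv : A -> A) : Prop := {
  cell_refl : forall x, Lam x -> le x x;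
  cell_anti : forall x y, Lam x -> Lam y -> le x y -> le y x -> x = y;
  cell_trans : forall x y z, Lam x -> Lam y -> Lam z -> le x y -> le y z -> le x z;
  cell_fin : forall x, Lam x -> finite_set (M x);
  cell_free : is_basis [set u : L * I * I |
      [/\ Lam u.1.1, M u.1.1 u.1.2 & M u.1.1 u.2]]
    (fun u => C u.1.1 u.1.2 u.2) predT;
  cell_linear : linear inv;
  cell_invM : forall a b, inv (a * b) = inv b * inv a;
  cell_invK : involutive inv;
  cell_invC : forall x s t, Lam x -> M x s -> M x t -> inv (C x s t) = C x t s;
  cell_mul : forall a x s, Lam x -> M x s -> exists r : I -> k,
    forall t, M x t ->
      a * C x s t - \sum_(s' \in M x) r s' *: C x s' t \in
        kspan [set b | exists y u v,
                 [/\ Lam y, le y x /\ y <> x, M y u, M y v & b = C y u v]]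
}.

End AlgebraModules.

Section Combinatorics.
Local Open Scope nat_scope.

Definition is_part (la : seq nat) : bool := sorted geq la && (0 \notin la).

Definition Lambda (m : nat) : set (nat * seq nat) :=
  [set p | [/\ p.1 <= m./2, is_part p.2 & sumn p.2 = m - p.1.*2]].

Definition psum (la : seq nat) (k : nat) : nat := sumn (take k la).

Definition dominates (la mu : seq nat) : Prop := forall k, psum mu k <= psum la k.

(* The order of Lambda_m, expressed on the partitions: f decreases as |la|
   increases. *)
Definition ple (mu la : seq nat) : Prop :=
  sumn la < sumn mu \/ (sumn mu = sumn la /\ dominates la mu).
Definition plt (mu la : seq nat) : Prop := ple mu la /\ mu <> la.

(* la = mu with one node added in row k, rows being numbered from 1. *)
Definition add_node (mu la : seq nat) (k : nat) : Prop :=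
  [/\ 0 < k, is_part mu, is_part la & la = incr_nth mu k.-1].
Definition added_row (mu la : seq nat) : nat :=
  (find (fun k => la == incr_nth mu k) (iota 0 (size la))).+1.

Definition updown (m : nat) (la : seq nat) : set (seq (seq nat)) :=
  [set t | [/\ size t = m.+1, nth [::] t 0 = [::], nth [::] t m = la
    & forall i, i < m -> exists k,
        add_node (nth [::] t i) (nth [::] t i.+1) k \/
        add_node (nth [::] t i.+1) (nth [::] t i) k]].

Definition RA (n : nat) (la : seq nat) : set (seq nat) :=
  [set mu | (exists k, add_node mu la k \/ add_node la mu k) /\
            (exists l, Lambda n.-1 (l, mu))].

Definition RA_enum (n f : nat) (la : seq nat) (mus : seq (seq nat)) (a : nat) : Prop :=
  [/\ (forall mu, mu \in mus <-> RA n la mu),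
      (forall i j, i < j < size mus -> plt (nth [::] mus j) (nth [::] mus i)),
      a <= size mus,
      (forall i, i < a -> (exists k, add_node (nth [::] mus i) la k) /\
         Lambda n.-1 (f, nth [::] mus i))
    & (forall i, a <= i < size mus -> (exists k, add_node la (nth [::] mus i) k) /\
         0 < f /\ Lambda n.-1 (f.-1, nth [::] mus i))].

(* The tableaux of shape la used with (f, la) have entries 2f+1, 2f+2, etc *)
Definition tab_entries (f : nat) (la : seq nat) : seq nat := iota f.*2.+1 (sumn la).
Definition row_tab (f : nat) (la : seq nat) : seq (seq nat) :=
  reshape la (tab_entries f la).

Definition std_tab (f : nat) (la : seq nat) : set (seq (seq nat)) :=
  [set t | [/\ shape t = la, perm_eq (flatten t) (tab_entries f la),
      all (sorted ltn) t
    & forall i j, j < nth 0 la i.+1 ->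
        nth 0 (nth [::] t i) j < nth 0 (nth [::] t i.+1) j]].

Definition s_word (i j : nat) : seq nat :=
  if i <= j then iota i (j - i) else rev (iota j (i - j)).

End Combinatorics.

Section Permutations.
Variable n : nat.

(* 'S_n acts on 'I_n = {0, ..., n-1}, so the point x of {1, ..., n} is the
   ordinal x - 1; in mathcomp (u * v) x = v (u x), i.e. 'S_n acts on the right. *)
Definition sref (i : nat) : 'S_n :=
  match insub i.-1, insub i with
  | Some a, Some b => tperm a b
  | _, _ => 1%g
  end.

Definition pact (w : 'S_n) (x : nat) : nat :=
  if insub x.-1 is Some i then (w i).+1 else x.

Definition word_perm (s : seq nat) : 'S_n := (\prod_(i <- s) sref i)%g.

Definition expression (w : 'S_n) (s : seq nat) : Prop :=
  all (fun i => 0 < i < n)%N s /\ word_perm s = w.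

Definition reduced (w : 'S_n) (s : seq nat) : Prop :=
  expression w s /\ forall s', expression w s' -> (size s <= size s')%N.

(* Any reduced expression will do: T_w does not depend on it (Matsumoto). *)
Definition redexp (w : 'S_n) : seq nat := xget [::] (reduced w).
Definition slen (w : 'S_n) : nat := size (redexp w).

Definition fixes_off (w : 'S_n) (s : seq nat) : bool :=
  [forall i : 'I_n, (i.+1 \notin s) ==> (w i == i)].

Definition row_stab (f : nat) (la : seq nat) : {set 'S_n} :=
  [set w : 'S_n | fixes_off w (tab_entries f la) &&
     all (fun r => perm_eq (map (pact w) r) r) (row_tab f la)]%SET.

Definition dperm (f : nat) (t : seq (seq nat)) : 'S_n :=
  odflt 1%g [pick w : 'S_n | fixes_off w (tab_entries f (shape t)) &&
    (t == map (map (pact w)) (row_tab f (shape t)))].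

(* D_{f,m}; the sequences i_1, ..., i_f and j_1, ..., j_f are functions here. *)
Definition D_word (f : nat) (i j : nat -> nat) : seq nat :=
  flatten [seq s_word k.*2 (i k) ++ s_word k.*2.-1 (j k) | k <- rev (iota 1 f)].

Definition Dset (f m : nat) : set 'S_n :=
  [set v | exists i j : nat -> nat,
     [/\ (forall k l, 0 < k -> k < l -> l <= f -> i k < i l)%N,
         (forall k, 0 < k <= f -> k.*2.-1 <= j k /\ j k < i k <= m)%N
       & v = word_perm (D_word f i j)]].

End Permutations.
Arguments Dset : clear implicits.

(* Everything about B_m, m <= n, is expressed inside B_n, where B_m is the
   subalgebra generated by E_1 (if m >= 2) and T_1, ..., T_{m-1}. *)
Section Elements.
Variable n : nat.
Local Notation B := (qBrauer n).

Definition subB (m : nat) : set B :=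
  gen_subalg [set x | (exists2 i, (0 < i < m)%N & x = bT n i) \/
                      ((1 < m)%N /\ x = bE n)].

Definition Tw (w : 'S_n) : B := \prod_(i <- redexp w) bT n i.
Definition Tij (i j : nat) : B := Tw (word_perm n (s_word i j)).

Fixpoint Epow (k : nat) : B :=
  if k is k'.+1 then
    bE n * Tij 2 (k'.*2.+2) * (Tij k'.*2.+1 1)^-1 * Epow k'
  else 1.

Definition El (l : nat) : B :=
  Tij l 1 * (Tij 2 l.+1)^-1 * bE n * Tij 2 l.+1 * (Tij l 1)^-1.

Definition xla (f : nat) (la : seq nat) : B :=
  \sum_(w in row_stab n f la) kq ^+ slen w *: Tw w.

Definition xst (f : nat) (la : seq nat) (s t : seq (seq nat)) : B :=
  bsigma (Tw (dperm n f s)) * xla f la * Tw (dperm n f t).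

Definition cellC (f : nat) (la : seq nat) (w : 'S_n) (s : seq (seq nat))
    (v : 'S_n) (t : seq (seq nat)) : B :=
  bsigma (Tw w) * Epow f * xst f la s t * Tw v.

Definition cells_above (m : nat) (la : seq nat) : set B :=
  [set x | exists l mu w s v t,
     [/\ Lambda m (l, mu), plt la mu, Dset n l m w /\ std_tab l mu s,
         Dset n l m v /\ std_tab l mu t & x = cellC l mu w s v t]].

Definition cell_quot (m : nat) (la : seq nat) : lmodType kk := kquot (cells_above m la).
Definition cell_proj (m : nat) (la : seq nat) : B -> cell_quot m la :=
  @kproj _ _ (cells_above m la).

Definition cell_module (m f : nat) (la : seq nat) : {pred cell_quot m la} :=
  kspan [set X | exists v t, [/\ Dset n f m v, std_tab f la t
    & X = cell_proj m la (Epow f * xla f la * Tw (dperm n f t) * Tw v)]].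

Fixpoint bud (m : nat) (t : seq (seq nat)) : B :=
  if m is m'.+1 then
    let la := nth [::] t m in
    let mu := nth [::] t m' in
    let f := ((m - sumn la)./2)%N in
    if (sumn mu < sumn la)%N then
      let k := added_row mu la in
      Tij (f.*2 + psum la k)%N m * bud m' t
    else
      let k := added_row la mu in
      let bk := (f.*2.-1 + psum la k)%N in
      let bk1 := (f.*2.-1 + psum la k.-1)%N in
      (Tij m f.*2)^-1 *
      (\sum_(bk1 <= j < bk.+1) kq ^+ (bk - j) *: (Tij j f.*2.-1)^-1) * bud m' t
  else 1.

Definition mt (m f : nat) (la : seq nat) (t : seq (seq nat)) : B :=
  Epow f * xla f la * bud m t.

Definition mst (m f : nat) (la : seq nat) (s t : seq (seq nat)) : B :=
  bsigma (bud m s) * Epow f * xla f la * bud m t.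

Definition yla (f : nat) (la mu : seq nat) : B :=
  if (sumn mu < sumn la)%N then
    Epow f * xla f la * Tij (f.*2 + psum la (added_row mu la))%N n
  else
    El f.*2.-1 * (Tij n f.*2)^-1 *
    (Tij (f.*2.-1 + psum la (added_row la mu))%N f.*2.-1)^-1 * Epow f.-1 * xla f.-1 mu.

(* mus lists mu^(1), mu^(2), etc; it is indexed from 0. *)
Definition Mset (f : nat) (la : seq nat) (mus : seq (seq nat)) (j : nat) :
    set (cell_quot n la) :=
  [set X | exists t, [/\ (0 < j)%N, updown n la t,
      ple (nth [::] mus j.-1) (nth [::] t n.-1) & X = cell_proj n la (mt n f la t)]].

Definition Nset (f : nat) (la : seq nat) (mus : seq (seq nat)) (j : nat) :
    set (cell_quot n la) :=
  [set X | exists i b, [/\ (i < j)%N, subB n.-1 b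
    & X = cell_proj n la (yla f la (nth [::] mus i) * b)]].

End Elements.
Arguments subB : clear implicits.
Arguments cell_quot : clear implicits.
Arguments cell_proj : clear implicits.
Arguments cell_module : clear implicits.
Arguments cells_above : clear implicits.
Arguments bud : clear implicits.
Arguments mt : clear implicits.
Arguments mst : clear implicits.
Arguments yla : clear implicits.
Arguments Mset : clear implicits.
Arguments Nset : clear implicits.

(* Main.v *)
Require Import Defs.
From HB Require Import structures.
From mathcomp Require Import all_boot all_order all_algebra all_fingroup.
From mathcomp Require Import boolp classical_sets functions cardinality fsbigop.
From mathcomp Require Import zify ring.

Set Implicit Arguments.
Unset Strict Implicit.
Unset Printing Implicit Defensive.

Import GRing.Theory.
Local Open Scope ring_scope.

(** Why the theorem is true.

    All subalgebras [B_m] with [m <= n] are studied inside [B_n]; [SQ T E m] is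
    [B_m], [el f la] is the generator [E^f x_la], and products of consecutive
    Hecke generators or of their inverses are called strings.

    Spanning.  Up to the ideal generated by [E^{f+1}], restricting [E^f B_m] to
    [B_{m-1}] leaves two kinds of generators: [E^f H], and [E^f H] times the
    inverse string that joins the last strand to an arc ([Ep_SQ_restrict]).  This
    is proved by induction on [f], because [T_3, T_4, ...] and a multiple of
    [E_(2)] satisfy the defining relations again on two strands less
    ([qbs_shift]).  After multiplication by [x_la], Hecke cosets turn the first
    kind into the branching elements of the removals and the second kind into
    those of the additions of nodes; removals and additions that do not lead to
    a partition are pushed along rows of equal length by Garnir relations
    ([low_chain], [up_chain]).  The branching element [y_mu] is a left multiple of
    the generator attached to [mu], and the same left factor sends what
    straightening produces for [mu] to branching elements of larger neighbours
    ([yv_step]).  Induction on [m] shows that the [E^f x_la b_t] span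
    [E^f x_la B_m] modulo larger shapes ([straighten]), and the [m_st] span [B_m]
    ([cell_span]).

    Independence.  The [m_st] of [B_m] correspond to closed walks of length [2m]
    at the empty partition in the Young graph, of which there are at most
    [(2m-1)!!] ([cnt_closed]).  On the other hand [B_m] contains [(2m-1)!!]
    products of generators, one for each Brauer diagram, that are independent:
    they act on tensor space after specialising [z] to a power of [q], and at
    [q = 1] they act as the Brauer diagrams, which are told apart by colourings
    of their end points ([diag_indep]).  A spanning family with no more members
    than an independent one is independent ([mst_indep]).  Multiplying a relation
    in the cell module by [sigma (b_s)] then shows that the [m_t] form a basis
    ([indep_mod], [mt_basis]).

    Conclusion.  The known cellular basis satisfies the same spanning property,
    by [Ep_SQ_D] and [xP_HT_std], so that it and the [m_st] define the same ideals
    of larger shapes ([cells_AboveP]).  The layers of the filtration are compared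
    with the cell modules of [B_{n-1}] through [y_mu c |-> E^l x_mu c]: straightening
    expands both sides with the same coefficients, and independence of the two
    bases makes the map well defined and injective ([layer_kernel], [layer_iso]).
    Cellularity follows from straightening and [sigma] ([mst_cellular]). *)

(** * Strings of Hecke generators *)

(** The inverse of [T i] when the quadratic relation holds. *)
HB.lock Definition Uof (A : algType kk) (T : nat -> A) (i : nat) : A := T i - (kq - kq^-1)%:A.

Lemma UofE (A : algType kk) (T : nat -> A) i : Uof T i = T i - (kq - kq^-1)%:A.
Proof. by rewrite Uof.unlock. Qed.

Section Strings.
Variable A : algType kk.
Implicit Types (T F : nat -> A) (x y g : A).

Definition pr F (s : seq nat) : A := \prod_(i <- s) F i.
Definition Sup F (a b : nat) : A := pr F (iota a (b - a)).
Definition Sdn F (b a : nat) : A := pr F (rev (iota a (b - a))).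

Lemma pr_cat F s t : pr F (s ++ t) = pr F s * pr F t.
Proof. exact: big_cat. Qed.

Lemma pr_cons F i s : pr F (i :: s) = F i * pr F s.
Proof. exact: big_cons. Qed.

Lemma pr_nil F : pr F [::] = 1.
Proof. exact: big_nil. Qed.

Lemma pr1 F i : pr F [:: i] = F i.
Proof. exact: big_seq1. Qed.

Lemma pr_rcons F s i : pr F (rcons s i) = pr F s * F i.
Proof. by rewrite -cats1 pr_cat pr1. Qed.

Lemma pr_comm F s x : (forall i, i \in s -> GRing.comm x (F i)) -> GRing.comm x (pr F s).
Proof.
elim: s => [|i s IH] h; first by rewrite pr_nil; exact: commr1.
rewrite pr_cons; apply: commrM; first by apply: h; rewrite inE eqxx.
by apply: IH => j hj; apply: h; rewrite inE hj orbT.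
Qed.

Lemma Sup_geq F a b : (b <= a)%N -> Sup F a b = 1.
Proof. by rewrite /Sup -subn_eq0 => /eqP ->; rewrite pr_nil. Qed.

Lemma Sdn_geq F a b : (b <= a)%N -> Sdn F b a = 1.
Proof. by rewrite /Sdn -subn_eq0 => /eqP ->; rewrite pr_nil. Qed.

Lemma iota_split a b c : (a <= b <= c)%N -> iota a (c - a) = iota a (b - a) ++ iota b (c - b).
Proof.
move=> /andP[h1 h2].
have -> : (c - a = (b - a) + (c - b))%N by lia.
by rewrite iotaD subnKC.
Qed.

Lemma Sup_cat F a b c : (a <= b <= c)%N -> Sup F a b * Sup F b c = Sup F a c.
Proof. by move=> h; rewrite /Sup -pr_cat -iota_split. Qed.

Lemma Sdn_cat F a b c : (a <= b <= c)%N -> Sdn F c b * Sdn F b a = Sdn F c a.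
Proof. by move=> h; rewrite /Sdn -pr_cat -rev_cat -iota_split. Qed.

Lemma Sup1 F a : Sup F a a.+1 = F a.
Proof. by rewrite /Sup subSnn pr1. Qed.

Lemma Sdn1 F a : Sdn F a.+1 a = F a.
Proof. by rewrite /Sdn subSnn pr1. Qed.

Lemma Sup_recr F a b : (a <= b)%N -> Sup F a b.+1 = Sup F a b * F b.
Proof. by move=> h; rewrite -(@Sup_cat F a b b.+1) ?Sup1 ?h ?leqnSn. Qed.

Lemma Sup_recl F a b : (a < b)%N -> Sup F a b = F a * Sup F a.+1 b.
Proof. by move=> h; rewrite -(@Sup_cat F a a.+1 b) ?Sup1 ?h ?leqnSn. Qed.

Lemma Sdn_recl F a b : (a <= b)%N -> Sdn F b.+1 a = F b * Sdn F b a.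
Proof. by move=> h; rewrite -(@Sdn_cat F a b b.+1) ?Sdn1 ?h ?leqnSn. Qed.

Lemma Sdn_recr F a b : (a < b)%N -> Sdn F b a = Sdn F b a.+1 * F a.
Proof. by move=> h; rewrite -(@Sdn_cat F a a.+1 b) ?Sdn1 ?h ?leqnSn. Qed.

Lemma Sup_comm F a b x : (forall i, (a <= i < b)%N -> GRing.comm x (F i)) ->
  GRing.comm x (Sup F a b).
Proof. by move=> h; apply: pr_comm => i; rewrite mem_iota => hi; apply: h; lia. Qed.

Lemma Sdn_comm F a b x : (forall i, (a <= i < b)%N -> GRing.comm x (F i)) ->
  GRing.comm x (Sdn F b a).
Proof. by move=> h; apply: pr_comm => i; rewrite mem_rev mem_iota => hi; apply: h; lia. Qed.

(** The braid and commutation relations.  They are asked for all indices: the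
    symbols of [B_n] that are not generators vanish, and satisfy them. *)
Record braids T : Prop := Braids {
  braidE : forall i, T i * (T i.+1 * T i) = T i.+1 * (T i * T i.+1);
  braidC : forall i j, (i.+1 < j)%N -> T i * T j = T j * T i }.

Section Braids.
Variable T : nat -> A.
Hypothesis bT : braids T.

Lemma T_comm i j : (i.+1 < j)%N || (j.+1 < i)%N -> GRing.comm (T i) (T j).
Proof.
by move=> /orP[h|h]; [exact: (braidC bT) | apply: esym; exact: (braidC bT)].
Qed.

Lemma Sup_shift a b i : (a <= i)%N -> (i.+1 < b)%N ->
  Sup T a b * T i = T i.+1 * Sup T a b.
Proof.
move=> h1 h2.
rewrite -(@Sup_cat T a i b); last by lia.
rewrite (@Sup_recl T i b); last by lia.
rewrite (@Sup_recl T i.+1 b); last by lia.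
have c1 : GRing.comm (T i) (Sup T i.+2 b).
  by apply: Sup_comm => j hj; apply: T_comm; lia.
have c2 : GRing.comm (T i.+1) (Sup T a i).
  by apply: Sup_comm => j hj; apply: T_comm; lia.
rewrite -!mulrA -c1 (mulrA (T i.+1) (T i)) (mulrA (T i)) (braidE bT).
by rewrite -!mulrA (mulrA (Sup T a i)) -c2 -!mulrA.
Qed.

Lemma Sdn_shift a b i : (a <= i)%N -> (i.+1 < b)%N ->
  Sdn T b a * T i.+1 = T i * Sdn T b a.
Proof.
move=> h1 h2.
rewrite -(@Sdn_cat T a i b); last by lia.
rewrite (@Sdn_recr T i b); last by lia.
rewrite (@Sdn_recr T i.+1 b); last by lia.
have c1 : GRing.comm (T i.+1) (Sdn T i a).
  by apply: Sdn_comm => j hj; apply: T_comm; lia.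
have c2 : GRing.comm (T i) (Sdn T b i.+2).
  by apply: Sdn_comm => j hj; apply: T_comm; lia.
rewrite -!mulrA -c1 [RHS]mulrA c2 -!mulrA; congr (_ * _).
rewrite (mulrA (T i)) (mulrA (T i.+1)) -(braidE bT).
by rewrite -!mulrA.
Qed.

Local Notation d := (kq - kq^-1).

Definition quadratic T m := forall i, (0 < i < m)%N -> T i * T i = 1 + d *: T i.

Variable m : nat.
Hypothesis qT : quadratic T m.
Local Notation U := (Uof T).

Lemma TU i : (0 < i < m)%N -> T i * U i = 1.
Proof. by move=> hi; rewrite UofE mulrBr qT // mulr_algr addrK. Qed.

Lemma UT i : (0 < i < m)%N -> U i * T i = 1.
Proof. by move=> hi; rewrite UofE mulrBl qT // mulr_algl addrK. Qed.

Lemma comm_U x i : GRing.comm x (T i) -> GRing.comm x (U i).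
Proof.
by move=> h; rewrite UofE; apply: commrB => //; rewrite /GRing.comm mulr_algl mulr_algr.
Qed.

Lemma SdnT_SupU a b : (0 < a)%N -> (b <= m)%N -> Sdn T b a * Sup U a b = 1.
Proof.
move=> ha hb; have [h|h] := leqP b a; first by rewrite Sdn_geq ?Sup_geq ?mulr1.
have [k ek] : exists k, k = (b - a)%N by exists (b - a)%N.
elim: k a ha h ek => [|k IH] a ha h ek; first by lia.
rewrite (@Sup_recl U a) // (@Sdn_recr T a) // mulrA -(mulrA _ (T a)) TU ?mulr1; last by lia.
have [h1|h1] := leqP b a.+1; first by rewrite Sdn_geq ?Sup_geq ?mulr1.
by apply: IH => //; lia.
Qed.

Lemma SupU_SdnT a b : (0 < a)%N -> (b <= m)%N -> Sup U a b * Sdn T b a = 1.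
Proof.
move=> ha hb; have [h|h] := leqP b a; first by rewrite Sdn_geq ?Sup_geq ?mulr1.
have [k ek] : exists k, k = (b - a)%N by exists (b - a)%N.
elim: k b hb h ek => [|k IH] b hb h ek; first by lia.
case: b hb h ek => // b hb h ek.
rewrite (@Sup_recr U a) // (@Sdn_recl T a) // mulrA -(mulrA _ (U b)) UT ?mulr1; last by lia.
have [h1|h1] := leqP b a; first by rewrite Sdn_geq ?Sup_geq ?mulr1.
by apply: IH => //; lia.
Qed.

Lemma SupU_shift a b i : (0 < a)%N -> (b <= m)%N -> (a <= i)%N -> (i.+1 < b)%N ->
  Sup U a b * T i = T i.+1 * Sup U a b.
Proof.
move=> ha hb h1 h2.
rewrite -[RHS]mul1r -(SupU_SdnT ha hb) -!mulrA (mulrA (Sdn T b a)) (Sdn_shift h1 h2).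
by rewrite -!mulrA SdnT_SupU // mulr1.
Qed.

Lemma U_braid i : (0 < i)%N -> (i.+1 < m)%N ->
  U i * (U i.+1 * U i) = U i.+1 * (U i * U i.+1).
Proof.
move=> h1 h2; have h3 : (0 < i.+1 < m)%N by lia.
have := @SupU_shift i i.+2 i h1 h2 (leqnn _) (leqnn _).
have eT k : T k = U k + d%:A by rewrite UofE subrK.
by rewrite Sup_recr // Sup1 !eT mulrDl mulrDr mulr_algl mulr_algr -!mulrA => /addIr.
Qed.

Lemma U_sqr i : (0 < i < m)%N -> U i * U i = 1 - d *: U i.
Proof. by move=> hi; rewrite {2}UofE mulrBr UT // mulr_algr. Qed.

Lemma SupU_comm a b x : (forall i, (a <= i < b)%N -> GRing.comm x (T i)) ->
  GRing.comm x (Sup U a b).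
Proof. by move=> h; apply: Sup_comm => i hi; apply: comm_U; exact: h. Qed.

End Braids.
End Strings.

(** * Reduced expressions *)

Ltac iflia :=
  repeat match goal with
  | |- context [if ?b then _ else _] =>
      lazymatch b with
      | context [if _ then _ else _] => fail
      | _ => case: (boolP b) => ?
      end
  end; lia.

Definition sw (i y : nat) : nat :=
  if y == i then i.+1 else if y == i.+1 then i else y.
Definition wact (s : seq nat) (x : nat) : nat := foldl (fun y i => sw i y) x s.

(** The code [j_m, ..., j_1] stands for the word
    [s_{1,j_1} s_{2,j_2} ... s_{m,j_m}], a normal form for the elements of the
    symmetric group on [m] letters. *)
Fixpoint nfw (c : seq nat) : seq nat :=
  if c is j :: c' then nfw c' ++ rev (iota j (size c - j)) else [::].
Fixpoint okc (c : seq nat) : bool :=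
  if c is j :: c' then (0 < j <= size c)%N && okc c' else true.

Fixpoint cstep (c : seq nat) (i : nat) : seq nat :=
  if c is j :: c' then
    if (i.+1 < j)%N then j :: cstep c' i else
    if i.+1 == j then i :: c' else
    if i == j then j.+1 :: c' else j :: cstep c' i.-1
  else [::].

Fixpoint cup (c : seq nat) (i : nat) : bool :=
  if c is j :: c' then
    if (i.+1 < j)%N then cup c' i else
    if i.+1 == j then true else
    if i == j then false else cup c' i.-1
  else false.

Lemma size_cstep c i : size (cstep c i) = size c.
Proof. by elim: c i => //= j c IH i; do 3?[case: ifP => _ //=]; rewrite IH. Qed.

Lemma okc_cstep c i : okc c -> (0 < i < size c)%N -> okc (cstep c i).
Proof.
elim: c i => //= j c IH i /andP[hj hc] hi.
case: (ltnP i.+1 j) => h1 /=.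
  by rewrite size_cstep hj IH //; lia.
case: (i.+1 =P j) => h2 /=; first by rewrite hc andbT; lia.
case: (i =P j) => h3 /=; first by rewrite hc andbT; lia.
by rewrite size_cstep hj IH //; lia.
Qed.

Lemma size_nfw_cstep c i : okc c -> (0 < i < size c)%N ->
  if cup c i then size (nfw (cstep c i)) = (size (nfw c)).+1
  else size (nfw c) = (size (nfw (cstep c i))).+1.
Proof.
elim: c i => [|j c IH] i /=; first by lia.
move=> /andP[hj hc] hi.
case: (ltnP i.+1 j) => h1 /=.
  have hi' : (0 < i < size c)%N by lia.
  have := IH i hc.
  by move/(_ hi'); case: ifP => _ h; rewrite !size_cat !size_rev !size_iota size_cstep; lia.
case: (i.+1 =P j) => h2 /=; first by rewrite !size_cat !size_rev !size_iota; lia.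
case: (i =P j) => h3 /=; first by rewrite !size_cat !size_rev !size_iota; lia.
have := IH i.-1 hc; have hi' : (0 < i.-1 < size c)%N by lia.
by move/(_ hi'); case: ifP => _ h; rewrite !size_cat !size_rev !size_iota size_cstep; lia.
Qed.

Lemma wact_cat s t x : wact (s ++ t) x = wact t (wact s x).
Proof. by rewrite /wact foldl_cat. Qed.

Lemma wact_dn m j x : (j <= m)%N ->
  wact (rev (iota j (m - j))) x =
    if x == m then j else if (j <= x < m)%N then x.+1 else x.
Proof.
elim: m x => [|m IH] x hj; first by rewrite sub0n /=; iflia.
have [e|hj'] : j = m.+1 \/ (j <= m)%N by lia.
  by rewrite e subnn /=; iflia.
rewrite subSn // -addn1 iotaD rev_cat /= subnKC // /sw IH //.
by iflia.
Qed.

Lemma wact_up m j x : (j <= m)%N ->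
  wact (iota j (m - j)) x =
    if x == j then m else if (j < x <= m)%N then x.-1 else x.
Proof.
elim: m x => [|m IH] x hj; first by rewrite sub0n /=; iflia.
have [e|hj'] : j = m.+1 \/ (j <= m)%N by lia.
  by rewrite e subnn /=; iflia.
rewrite subSn // -addn1 iotaD wact_cat /= subnKC // IH // /sw.
by iflia.
Qed.

Lemma wact_nfw_fix c x : okc c -> (size c < x)%N -> wact (nfw c) x = x.
Proof.
elim: c x => [|j c IH] x /=; first by []. move=> /andP[hj hc] hx.
by rewrite wact_cat IH ?(ltnW hx) // wact_dn; iflia.
Qed.

Lemma wact_nfw_le c x : okc c -> (0 < x <= size c)%N -> (0 < wact (nfw c) x <= size c)%N.
Proof.
elim: c x => [|j c IH] x /=; first by lia.
move=> /andP[hj hc] hx.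
rewrite wact_cat wact_dn; last by lia.
have [e|hx'] : x = (size c).+1 \/ (0 < x <= size c)%N by lia.
  by rewrite wact_nfw_fix ?e //=; iflia.
by have := IH x hc hx'; iflia.
Qed.

Lemma sw_cross j m i y : (j < i < m)%N ->
  sw i (if y == m then j else if (j <= y < m)%N then y.+1 else y) =
  let y' := sw i.-1 y in
  if y' == m then j else if (j <= y' < m)%N then y'.+1 else y'.
Proof. by move=> h; rewrite /sw /=; iflia. Qed.

Lemma wact_cstep c i x : okc c -> (0 < i < size c)%N -> (0 < x)%N ->
  wact (nfw (cstep c i)) x = sw i (wact (nfw c) x).
Proof.
elim: c i => [|j c IH] i /=; first by lia.
move=> /andP[hj hc] hi hx.
case: (ltnP i.+1 j) => h1 /=.
  rewrite !wact_cat size_cstep IH //; last by lia.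
  by rewrite !wact_dn; [rewrite /sw; iflia | lia | lia].
case: (i.+1 =P j) => h2 /=.
  by rewrite !wact_cat !wact_dn; [rewrite /sw; iflia | lia | lia].
case: (i =P j) => h3 /=.
  by rewrite !wact_cat !wact_dn; [rewrite /sw; iflia | lia | lia].
rewrite !wact_cat size_cstep IH //; last by lia.
by rewrite !wact_dn ?sw_cross //; lia.
Qed.

Lemma nfw_inj c c' : okc c -> okc c' -> size c = size c' ->
  (forall x, (0 < x <= size c)%N -> wact (nfw c) x = wact (nfw c') x) -> c = c'.
Proof.
elim: c c' => [|j c IH] [|j' c'] //= /andP[hj hc] /andP[hj' hc'] [hs] h.
rewrite -hs in hj' *.
have e : j = j'.
  have := h (size c).+1 (leqnn _); rewrite !wact_cat !wact_nfw_fix -?hs //.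
  by rewrite !wact_dn ?eqxx; lia.
rewrite e; congr (_ :: _); apply: IH => // x hx.
have := h x; rewrite !wact_cat !wact_dn; try lia.
have := wact_nfw_le hc hx; have := @wact_nfw_le c' x hc'; rewrite -hs => /(_ hx).
by move: (wact _ _) (wact _ _) => u v; rewrite e; iflia.
Qed.

Lemma cup_wact c i x y : okc c -> (0 < i < size c)%N -> (0 < x)%N -> (x < y)%N ->
  (y <= size c)%N -> wact (nfw c) x = i -> wact (nfw c) y = i.+1 -> cup c i.
Proof.
elim: c i y => [|j c IH] i y /=; first by lia.
move=> /andP[hj hc] hi hx hxy hy.
rewrite !wact_cat.
have hx' : (0 < x <= size c)%N by lia.
have := wact_nfw_le hc hx'.
rewrite !wact_dn; [|lia|lia].
have [ey|hy'] : y = (size c).+1 \/ (0 < y <= size c)%N by lia.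
  by rewrite ey (@wact_nfw_fix c (size c).+1) //; iflia.
have := wact_nfw_le hc hy'.
move=> b1 b2 e1 e2.
case: (ltnP i.+1 j) => h1.
  apply: (IH i y) => //; try lia.
    by move: e1; iflia.
  by move: e2; iflia.
case: (i.+1 =P j) => h2 //.
case: (i =P j) => h3; first by move: e1; iflia.
apply: (IH i.-1 y) => //; try lia.
  by move: e1; iflia.
by move: e2; iflia.
Qed.

Lemma pr_cstep (A : algType kk) (T : nat -> A) c i : braids T -> okc c ->
  (0 < i < size c)%N -> cup c i -> pr T (nfw (cstep c i)) = pr T (nfw c) * T i.
Proof.
move=> hT; elim: c i => //= j c IH i /andP[hj hc] hi.
have dn k : pr T (rev (iota k ((size c).+1 - k))) = Sdn T (size c).+1 k by [].
case: (ltnP i.+1 j) => h1 /=.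
  move=> hu; rewrite !pr_cat size_cstep !dn IH //; last by lia.
  rewrite -!mulrA; congr (_ * _); apply: Sdn_comm => k hk; apply: T_comm => //; lia.
case: (i.+1 =P j) => h2 /=.
  by move=> _; rewrite !pr_cat !dn -mulrA -h2 -Sdn_recr //; lia.
case: (i =P j) => h3 //= hu.
rewrite !pr_cat size_cstep !dn IH //; last by lia.
have e : i = i.-1.+1 by lia.
by rewrite -!mulrA [in RHS]e (Sdn_shift hT) //; lia.
Qed.

(** The code reached by reading a word letter by letter: a word is at least as
    long as its normal form, and when the lengths agree every step has been
    upward, so that the products of generators agree. *)
Lemma word_code (A : algType kk) (T : nat -> A) m s : braids T ->
  all (fun i => 0 < i < m)%N s ->
  exists c, [/\ okc c, size c = m,
    forall x, (0 < x)%N -> wact (nfw c) x = wact s x,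
    (size (nfw c) <= size s)%N &
    size (nfw c) = size s -> pr T (nfw c) = pr T s].
Proof.
move=> hT; elim/last_ind: s => [|s i IH] hs.
  have h k : okc (rev (iota 1 k)) /\ nfw (rev (iota 1 k)) = [::].
    elim: k => [|k [h1 h2]] //.
    have -> : iota 1 k.+1 = rcons (iota 1 k) k.+1 by rewrite -[k.+1]addn1 iotaD cats1 add1n addn1.
    by rewrite rev_rcons /= size_rev size_iota subnn cats0 h1 h2 ltnSn.
  by exists (rev (iota 1 m)); have [-> ->] := h m; rewrite size_rev size_iota.
move: hs; rewrite all_rcons => /andP[hi hs].
have [c [h1 h2 h3 h4 h5]] := IH hs.
have hi' : (0 < i < size c)%N by rewrite h2.
exists (cstep c i); have hz := size_nfw_cstep h1 hi'; rewrite size_rcons; split.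
- exact: okc_cstep.
- by rewrite size_cstep.
- by move=> x hx; rewrite wact_cstep // h3 // -cats1 wact_cat.
- by move: hz; case: ifP => _; lia.
- move: hz; case: ifP => hu; last by lia.
  by move=> -> [e]; rewrite pr_cstep // h5 // pr_rcons.
Qed.

Section PermActions.
Variable n : nat.
Implicit Types (u v w : 'S_n) (x y i j m : nat).

Lemma pactE w (i : 'I_n) : pact w i.+1 = (w i).+1.
Proof. by rewrite /pact /= valK. Qed.

Lemma pact_ord x : (0 < x <= n)%N -> exists i : 'I_n, x = i.+1.
Proof.
move=> /andP[h1 h2]; have h : (x.-1 < n)%N by lia.
by exists (Ordinal h) => /=; lia.
Qed.

Lemma pact_range w x : (0 < x <= n)%N -> (0 < pact w x <= n)%N.
Proof. by move=> /pact_ord[i ->]; rewrite pactE /=. Qed.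

Lemma pactM u v x : (0 < x <= n)%N -> pact (u * v)%g x = pact v (pact u x).
Proof. by move=> /pact_ord[i ->]; rewrite !pactE permM. Qed.

Lemma pact1 x : (0 < x <= n)%N -> pact (1%g : 'S_n) x = x.
Proof. by move=> /pact_ord[i ->]; rewrite pactE perm1. Qed.

Lemma pactK w x : (0 < x <= n)%N -> pact w^-1%g (pact w x) = x.
Proof. by move=> hx; rewrite -pactM // mulgV pact1. Qed.

Lemma pactKV w x : (0 < x <= n)%N -> pact w (pact w^-1%g x) = x.
Proof. by move=> hx; rewrite -pactM // mulVg pact1. Qed.

Lemma pact_inj w x y : (0 < x <= n)%N -> (0 < y <= n)%N -> pact w x = pact w y -> x = y.
Proof. by move=> hx hy h; rewrite -(pactK w hx) h pactK. Qed.

Lemma perm_pact u v : (forall x, (0 < x <= n)%N -> pact u x = pact v x) -> u = v.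
Proof.
by move=> h; apply/permP => i; apply/val_inj/succn_inj; rewrite -!pactE h //=.
Qed.

Lemma pact_sref i x : (0 < i < n)%N -> (0 < x <= n)%N -> pact (sref n i) x = sw i x.
Proof.
move=> hi /pact_ord[k ->]; rewrite pactE /sref.
have h1 : (i.-1 < n)%N by lia.
have h2 : (i < n)%N by lia.
rewrite (insubT (fun j => j < n)%N h1) (insubT (fun j => j < n)%N h2) /=.
rewrite permE /= /sw -!val_eqE /=.
have -> : (k.+1 == i) = (val k == i.-1) by apply/eqP/eqP => /=; lia.
have -> : (k.+1 == i.+1) = (val k == i) by [].
by case: ifP => _ /=; [lia|]; case: ifP => _ /=; lia.
Qed.

Lemma word_perm_cat s t : word_perm n (s ++ t) = (word_perm n s * word_perm n t)%g.
Proof. exact: big_cat. Qed.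

Lemma word_perm1 i : word_perm n [:: i] = sref n i.
Proof. exact: big_seq1. Qed.

Lemma pact_word s x : all (fun i => 0 < i < n)%N s -> (0 < x <= n)%N ->
  pact (word_perm n s) x = wact s x.
Proof.
elim: s x => [|i s IH] x /=; first by move=> _ hx; rewrite /word_perm big_nil pact1.
move=> /andP[hi hs] hx.
rewrite -cat1s word_perm_cat word_perm1 pactM // pact_sref // IH //.
by rewrite -pact_sref //; exact: pact_range.
Qed.

Definition fixes_above m w := forall x, (m < x <= n)%N -> pact w x = x.
Definition fixes_upto a w := forall x, (0 < x <= a)%N -> pact w x = x.

Lemma all_dn j m : (0 < j)%N -> (m <= n)%N ->
  all (fun i => 0 < i < n)%N (rev (iota j (m - j))).
Proof. by move=> h1 h2; rewrite all_rev; apply/allP => i; rewrite mem_iota; lia. Qed.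

Lemma all_up j m : (0 < j)%N -> (m <= n)%N ->
  all (fun i => 0 < i < n)%N (iota j (m - j)).
Proof. by rewrite -all_rev; exact: all_dn. Qed.

Definition wdn m j : 'S_n := word_perm n (rev (iota j (m - j))).
Definition wup j m : 'S_n := word_perm n (iota j (m - j)).

Lemma pact_wdn m j x : (0 < j <= m)%N -> (m <= n)%N -> (0 < x <= n)%N ->
  pact (wdn m j) x = if x == m then j else if (j <= x < m)%N then x.+1 else x.
Proof. by move=> h1 h2 h3; rewrite pact_word ?wact_dn ?all_dn //; lia. Qed.

Lemma pact_wup m j x : (0 < j <= m)%N -> (m <= n)%N -> (0 < x <= n)%N ->
  pact (wup j m) x = if x == j then m else if (j < x <= m)%N then x.-1 else x.
Proof. by move=> h1 h2 h3; rewrite pact_word ?wact_up ?all_up //; lia. Qed.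

Lemma wdnV m j : (0 < j <= m)%N -> (m <= n)%N -> (wdn m j)^-1%g = wup j m.
Proof.
move=> h1 h2; apply: perm_pact => x hx.
have hy := pact_range (wup j m) hx.
rewrite -[X in pact _ X = _](@pactK (wup j m)^-1%g) //.
have e y : (0 < y <= n)%N -> pact (wdn m j) (pact (wup j m) y) = y.
  move=> hy'; rewrite pact_wdn ?pact_wup //; first by iflia.
  by rewrite -pact_wup //; exact: pact_range.
by rewrite invgK pactKV // -{1}(e x hx) pactK.
Qed.

Lemma split_top w m : (0 < m <= n)%N -> fixes_above m w ->
  exists w' j, [/\ (0 < j <= m)%N, j = pact w m, w = (w' * wdn m j)%g,
    fixes_above m.-1 w' & forall a, fixes_upto a w -> (a < m)%N ->
      (a < j)%N /\ fixes_upto a w'].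
Proof.
move=> hm hw; set j := pact w m.
have hj : (0 < j <= m)%N.
  have hr := @pact_range w m; have : ~ (m < j)%N; last by move: hr; rewrite -/j; lia.
  move=> h; have hj : (m < j <= n)%N by move: (hr hm); rewrite -/j; lia.
  have := hw j hj => e; have : j = m by apply: (@pact_inj w) => //; lia.
  by lia.
exists (w * (wdn m j)^-1)%g, j; split => //; first by rewrite mulgKV.
- move=> x hx; rewrite pactM; last by lia.
  have [->|hx'] : x = m \/ (m < x <= n)%N by lia.
    by rewrite -/j wdnV ?pact_wup ?eqxx //; lia.
  by rewrite hw // wdnV ?pact_wup //; try lia; iflia.
- move=> a ha ham; have haj : (a < j)%N.
    have : ~ (j <= a)%N; last by lia.
    move=> h; have e := ha j; have : j = m by apply: (@pact_inj w); [lia|lia|rewrite e //; lia].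
    by lia.
  split=> // x hx; rewrite pactM; last by lia.
  by rewrite ha // wdnV ?pact_wup //; try lia; iflia.
Qed.

Lemma fixes_all w m : fixes_above m w -> (m <= 1)%N || (n <= 1)%N -> w = 1%g.
Proof.
move=> hw hm; apply: perm_pact => x hx; rewrite pact1 //.
have [h|h] : (m < x)%N \/ (x <= m)%N by lia.
  by apply: hw; lia.
have hr := pact_range w hx.
have [h1|h1] : (n <= 1)%N \/ (1 < n)%N by lia.
  by lia.
have e : x = 1%N by lia.
have := hw (pact w x).
have [e2|h2] : pact w x = 1%N \/ (1 < pact w x)%N by lia.
  by lia.
have hm1 : m = 1%N by lia.
move=> h3; have := h3 _ => h4; have : pact w x = x; last by lia.
by apply: (@pact_inj w) => //; apply: h4; lia.
Qed.

Lemma fixes_word w a m : fixes_above m w -> fixes_upto a w -> (m <= n)%N ->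
  exists2 s, all (fun i => a < i < m)%N s & word_perm n s = w.
Proof.
elim: m w => [|m IH] w hw ha hm.
  by exists [::] => //; rewrite /word_perm big_nil (fixes_all hw).
have [h|h] : (m.+1 <= a)%N \/ (a < m.+1)%N by lia.
  exists [::] => //; apply: perm_pact => x hx.
  rewrite /word_perm big_nil pact1 //.
  have [h1|h1] : (x <= a)%N \/ (m.+1 < x)%N by lia.
    by rewrite ha //; lia.
  by rewrite hw //; lia.
have [|w' [j [hj _ ew hw' ha']]] := @split_top w m.+1 _ hw; first by lia.
have [haj ha''] := ha' a ha h.
have [|s hs es] := IH w' hw' ha''; first by lia.
exists (s ++ rev (iota j (m.+1 - j))); last by rewrite word_perm_cat es ew.
rewrite all_cat all_rev; apply/andP; split.
  by apply/allP => i /(allP hs); lia.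
by apply/allP => i; rewrite mem_iota; lia.
Qed.

Lemma perm_word w : exists2 s, all (fun i => 0 < i < n)%N s & word_perm n s = w.
Proof.
by apply: (@fixes_word w 0 n) => // x; lia.
Qed.

Lemma redexpP w : reduced w (redexp w).
Proof.
apply: xgetPex.
have [s hs es] := perm_word w.
pose P k := `[< exists s, expression w s /\ size s = k >].
have exP : exists k, P k by exists (size s); apply/asboolP; exists s.
case: (ex_minnP exP) => k /asboolP[s' [h1 h2]] hk.
exists s'; split=> // s'' h''; rewrite h2; apply: hk.
by apply/asboolP; exists s''.
Qed.

End PermActions.

(** * The basis [T_w] of the Hecke algebra *)

Definition HT (A : algType kk) (T : nat -> A) (a m : nat) : set A :=
  gen_subalg [set x | exists2 i, (a < i < m)%N & x = T i]%classic.

Section GenSubalg.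
Variable A : algType kk.
Implicit Types (S : set A) (x y : A).

Lemma gen_sub S S' x : (forall y, S y -> gen_subalg S' y) -> gen_subalg S x -> gen_subalg S' x.
Proof.
move=> h; elim=> {x} [x /h //||x y _ h1 _ h2|x y _ h1 _ h2|c x _ h1].
- exact: gen_subalg_1.
- exact: gen_subalg_D.
- exact: gen_subalg_M.
- exact: gen_subalg_Z.
Qed.

Lemma gen_pr S F s : (forall i, i \in s -> gen_subalg S (F i)) -> gen_subalg S (pr F s).
Proof.
elim: s => [|i s IH] h; first by rewrite pr_nil; exact: gen_subalg_1.
rewrite pr_cons; apply: gen_subalg_M; first by apply: h; rewrite inE eqxx.
by apply: IH => j hj; apply: h; rewrite inE hj orbT.
Qed.

Lemma gen_0 S : gen_subalg S 0.
Proof. by rewrite -(scale0r 1); apply/gen_subalg_Z/gen_subalg_1. Qed.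

Lemma gen_C S c : gen_subalg S c%:A.
Proof. by apply/gen_subalg_Z/gen_subalg_1. Qed.

Lemma gen_comm S x y : (forall z, S z -> GRing.comm y z) -> gen_subalg S x -> GRing.comm y x.
Proof.
move=> h; elim=> {x} [x /h //||u v _ h1 _ h2|u v _ h1 _ h2|c u _ h1].
- exact: commr1.
- exact: commrD.
- exact: commrM.
- by rewrite /GRing.comm -scalerAr -scalerAl h1.
Qed.

Variable T : nat -> A.

Lemma HT_gen a m i : (a < i < m)%N -> HT T a m (T i).
Proof. by move=> h; apply: gen_subalg_gen; exists i. Qed.

Lemma HT_sub a m a' m' x : (a' <= a)%N -> (m <= m')%N -> HT T a m x -> HT T a' m' x.
Proof. by move=> h1 h2; apply: gen_sub => _ [i hi ->]; apply: HT_gen; lia. Qed.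

Lemma HT_Sup a m i j : (a < i)%N -> (j <= m)%N -> HT T a m (Sup T i j).
Proof. by move=> h1 h2; apply: gen_pr => k; rewrite mem_iota => hk; apply: HT_gen; lia. Qed.

Lemma HT_Sdn a m i j : (a < i)%N -> (j <= m)%N -> HT T a m (Sdn T j i).
Proof.
by move=> h1 h2; apply: gen_pr => k; rewrite mem_rev mem_iota => hk; apply: HT_gen; lia.
Qed.

Lemma HT_comm a m x y : (forall i, (a < i < m)%N -> GRing.comm y (T i)) ->
  HT T a m x -> GRing.comm y x.
Proof. by move=> h; apply: gen_comm => _ [i hi ->]; exact: h. Qed.

Lemma HT_U a m i : (a < i < m)%N -> HT T a m (Uof T i).
Proof.
move=> hi; rewrite UofE; apply: gen_subalg_D; first exact: HT_gen.
by rewrite -scaleNr; exact: gen_C.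
Qed.

Lemma HT_SupU a m i j : (a < i)%N -> (j <= m)%N -> HT T a m (Sup (Uof T) i j).
Proof. by move=> h1 h2; apply: gen_pr => k; rewrite mem_iota => hk; apply: HT_U; lia. Qed.

Lemma HT_triv a m x : (m <= a.+1)%N -> HT T a m x -> exists c, x = c%:A.
Proof.
move=> h; elim=> {x} [x [i hi]||x y _ [c ->] _ [d ->]|x y _ [c ->] _ [d ->]|c x _ [d ->]].
- by lia.
- by exists 1; rewrite scale1r.
- by exists (c + d); rewrite scalerDl.
- by exists (c * d); rewrite -scalerAl mul1r scalerA.
- by exists (c * d); rewrite scalerA.
Qed.

End GenSubalg.

Section TwBasis.
Variable n : nat.
Local Notation B := (qBrauer n).
Local Notation T := (bT n).
Implicit Types (u v w : 'S_n).

Lemma bT_out i : ~~ (0 < i < n)%N -> T i = 0.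
Proof.
move=> h; rewrite /bT (bpi_eq (beq_rel (rel_noT h))) bpiC scale0r //.
Qed.

Lemma bT_braids : braids T.
Proof.
split=> [i|i j hij].
  have [hi|hi] := boolP ((0 < i)%N && (i.+1 < n)%N); last first.
    have [h|h] : ~~ (0 < i < n)%N \/ ~~ (0 < i.+1 < n)%N by lia.
      by rewrite (bT_out h) !(mul0r, mulr0).
    by rewrite (bT_out h) !(mul0r, mulr0).
  have [h1 h2] := andP hi.
  by have := bpi_eq (beq_rel (rel_braid h1 h2)); rewrite !bpi_mul.
have [hi|hi] := boolP ((0 < i < n)%N && (0 < j < n)%N); last first.
  have [h|h] : ~~ (0 < i < n)%N \/ ~~ (0 < j < n)%N by lia.
    by rewrite (bT_out h) !(mul0r, mulr0).
  by rewrite (bT_out h) !(mul0r, mulr0).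
have [h1 h2] := andP hi.
by have := bpi_eq (beq_rel (@rel_comm n i j h1 h2 _)); rewrite !bpi_mul; apply; rewrite hij.
Qed.

Lemma Tw_pr w s : expression w s -> (slen w <= size s)%N /\
  (size s = slen w -> pr T s = Tw w).
Proof.
move=> hs; have [hr hmin] := redexpP w; split; first exact: hmin.
move=> es.
have [c [c1 c2 c3 c4 c5]] := word_code bT_braids hs.1.
have [d [d1 d2 d3 d4 d5]] := word_code bT_braids hr.1.
have ecd : c = d.
  apply: nfw_inj => //; rewrite ?c2 ?d2 // => x hx.
  rewrite c3 ?d3; try lia.
  by rewrite -!(@pact_word n) ?hs.2 ?hr.2 // ?hs.1 ?hr.1.
have ok : all (fun i => 0 < i < n)%N (nfw c).
  have {c2 d2} : (size c <= n)%N by rewrite c2.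
  elim: (c) c1 {c3 c4 c5 ecd} => //= j c' IH /andP[hj hc'] hz.
  by rewrite all_cat IH ?all_dn //=; lia.
have hc : expression w (nfw c).
  split=> //; apply: perm_pact => x hx; rewrite pact_word // c3; last by lia.
  by rewrite -(@pact_word n) ?hs.2 // hs.1.
have h1 : (slen w <= size (nfw c))%N := hmin _ hc.
have e1 : size (nfw c) = slen w by lia.
by rewrite -c5 ?e1 // ecd d5 // -ecd.
Qed.

(** Right multiplication by a simple reflection that increases the length is read off the normal forms. *)
Lemma Tw_step w i x y : (0 < i < n)%N -> (0 < x)%N -> (x < y)%N -> (y <= n)%N ->
  pact w x = i -> pact w y = i.+1 ->
  Tw (w * sref n i)%g = Tw w * T i /\ slen (w * sref n i)%g = (slen w).+1.
Proof.
move=> hi hx hxy hy ex ey.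
have [hr hmin] := redexpP w.
have [c [c1 c2 c3 c4 c5]] := word_code bT_braids hr.1.
have ok d : okc d -> size d = n -> all (fun i => 0 < i < n)%N (nfw d).
  move=> h1 h2; have : (size d <= n)%N by rewrite h2.
  elim: (d) h1 => //= j c' IH /andP[hj hc'] hz.
  by rewrite all_cat IH ?all_dn //=; lia.
have hc : expression w (nfw c).
  split; first exact: ok.
  apply: perm_pact => z hz; rewrite pact_word ?ok // c3; last by lia.
  by rewrite -(@pact_word n) ?hr.2 // hr.1.
have ec : size (nfw c) = slen w by apply/eqP; rewrite eqn_leq c4 (Tw_pr hc).1.
have hi' : (0 < i < size c)%N by rewrite c2.
have up : cup c i.
  apply: (@cup_wact c i x y) => //; rewrite ?c2 //.
    by rewrite -(@pact_word n) ?ok ?hc.2 //; lia.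
  by rewrite -(@pact_word n) ?ok ?hc.2 //; lia.
have okd : okc (cstep c i) by exact: okc_cstep.
have sd : size (cstep c i) = n by rewrite size_cstep.
have hd : expression (w * sref n i)%g (nfw (cstep c i)).
  split; first exact: ok.
  apply: perm_pact => z hz; rewrite pact_word ?ok // wact_cstep //; last by lia.
  rewrite pactM // pact_sref //; last exact: pact_range.
  by rewrite -(@pact_word n) ?ok ?hc.2.
have := size_nfw_cstep c1 hi'; rewrite up ec => sz.
have [[o1 o2] _] := redexpP (w * sref n i)%g.
have el : slen (w * sref n i)%g = (slen w).+1.
  apply/eqP; rewrite eqn_leq -{1}sz (Tw_pr hd).1 /=.
  have [e [e1 e2 e3 e4 e5]] := word_code bT_braids o1.
  have -> : (slen w).+1 = size (nfw e); last exact: e4.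
  rewrite -sz; congr (size (nfw _)); apply: nfw_inj => //; rewrite ?sd ?e2 // => z hz.
  rewrite e3; last by lia.
  by rewrite -(@pact_word n) ?ok // -(@pact_word n) // o2 hd.2.
split=> //; rewrite -(Tw_pr hd).2 ?sz ?el // pr_cstep //; last exact: bT_braids.
by rewrite (Tw_pr hc).2.
Qed.

Lemma bsigmaD (x y : B) : bsigma (x + y) = bsigma x + bsigma y.
Proof. by have := @bsigma_linear n 1 x y; rewrite !scale1r. Qed.

Lemma bsigma0 : bsigma (0 : B) = 0.
Proof. by apply: (addrI (bsigma 0)); rewrite -bsigmaD !addr0. Qed.

Lemma bsigmaZ c (x : B) : bsigma (c *: x) = c *: bsigma x.
Proof. by have := @bsigma_linear n c x 0; rewrite addr0 bsigma0 addr0. Qed.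

Lemma bsigma1 : bsigma (1 : B) = 1.
Proof. exact: bsigma_bpi. Qed.

Lemma bsigma_pr s : bsigma (pr T s) = pr T (rev s).
Proof.
elim: s => [|i s IH]; first by rewrite !pr_nil bsigma1.
by rewrite pr_cons bsigmaM IH rev_cons pr_rcons bsigmaT.
Qed.

Lemma word_permV s : all (fun i => 0 < i < n)%N s -> word_perm n (rev s) = (word_perm n s)^-1%g.
Proof.
elim: s => [|i s IH]; first by rewrite /word_perm !big_nil invg1.
move=> /andP[hi hs]; rewrite rev_cons -cats1 word_perm_cat IH // -[i :: s]cat1s word_perm_cat.
rewrite invMg word_perm1; congr (_ * _)%g; apply: perm_pact => x hx.
have hy := pact_range (sref n i)^-1%g hx.
have e : x = sw i (pact (sref n i)^-1%g x) by rewrite -(@pact_sref n) // pactKV.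
by rewrite pact_sref // {1}e; move: (pact _ x) => y; rewrite /sw; iflia.
Qed.

Lemma slenV w : slen w^-1%g = slen w.
Proof.
have h v : (slen v^-1%g <= slen v)%N.
  have [[h1 h2] _] := redexpP v.
  have e : expression v^-1%g (rev (redexp v)) by split; rewrite ?all_rev // word_permV ?h2.
  by have := (Tw_pr e).1; rewrite size_rev.
by apply/eqP; rewrite eqn_leq h /= -{1}(invgK w) h.
Qed.

Lemma bsigma_Tw w : bsigma (Tw w) = Tw w^-1%g.
Proof.
have [[h1 h2] _] := redexpP w.
have e : expression w^-1%g (rev (redexp w)) by split; rewrite ?all_rev // word_permV ?h2.
by rewrite -(Tw_pr e).2 ?size_rev ?slenV // -bsigma_pr.
Qed.

Lemma sref_inv i : (0 < i < n)%N -> (sref n i)^-1%g = sref n i.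
Proof.
by move=> hi; rewrite -!word_perm1 -word_permV //= hi.
Qed.

(** The mirror image of [Tw_step], by the anti-involution. *)
Lemma Tw_stepl w i : (0 < i < n)%N -> (pact w i < pact w i.+1)%N ->
  Tw (sref n i * w)%g = T i * Tw w /\ slen (sref n i * w)%g = (slen w).+1.
Proof.
move=> hi hw.
have r1 := @pact_range n w i; have r2 := @pact_range n w i.+1.
have [||||||h1 h2] := @Tw_step w^-1%g i (pact w i) (pact w i.+1) => //; rewrite ?pactK //; try lia.
split; last by rewrite -slenV invMg sref_inv // h2 slenV.
by rewrite -[LHS]bsigmaK bsigma_Tw invMg sref_inv // h1 bsigmaM bsigma_Tw invgK bsigmaT.
Qed.

Lemma Tw_dn w m j : (0 < j <= m)%N -> (m <= n)%N -> fixes_above m.-1 w ->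
  Tw (w * wdn n m j)%g = Tw w * Sdn T m j /\ slen (w * wdn n m j)%g = (slen w + (m - j))%N.
Proof.
move=> /andP[hj hjm] hm hw.
have [k ek] : exists k, k = (m - j)%N by exists (m - j)%N.
elim: k j hj hjm ek => [|k IH] j hj hjm ek.
  have -> : j = m by lia.
  by rewrite /wdn subnn /= /word_perm big_nil mulg1 Sdn_geq // mulr1 addn0.
have [|||h1 h2] := IH j.+1; try lia.
have -> : wdn n m j = (wdn n m j.+1 * sref n j)%g.
  rewrite -word_perm1 -word_perm_cat; congr word_perm.
  have -> : (m - j = (m - j.+1).+1)%N by lia.
  by rewrite /= rev_cons cats1.
rewrite mulgA (@Sdn_recr _ T j m); last by lia.
rewrite mulrA -h1.
have e y : (0 < y < m)%N -> exists2 x, (0 < x < m)%N & pact w x = y.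
  move=> hy; exists (pact w^-1%g y); last by rewrite pactKV //; lia.
  have r := @pact_range n w^-1%g y; have : ~ (m <= pact w^-1%g y)%N; last by lia.
  move=> h3; have := hw (pact w^-1%g y); rewrite pactKV; lia.
have [|x hx ex] := e j; first by lia.
have [||||||-> ->] := @Tw_step (w * wdn n m j.+1)%g j x m => //; try lia.
- rewrite pactM; last by lia.
  by rewrite ex pact_wdn //; try lia; iflia.
- rewrite pactM; last by lia.
  by rewrite hw ?pact_wdn ?eqxx //; lia.
by rewrite h2; split=> //; lia.
Qed.

Lemma Tw_up w m j : (0 < j <= m)%N -> (m <= n)%N -> fixes_above m.-1 w ->
  Tw (wup n j m * w)%g = Sup T j m * Tw w /\ slen (wup n j m * w)%g = (slen w + (m - j))%N.
Proof.
move=> hj hm hw.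
have hw' : fixes_above m.-1 w^-1%g.
  by move=> x hx; rewrite -{1}(hw x hx) pactK //; lia.
have [h1 h2] := Tw_dn hj hm hw'.
have e : (wup n j m * w = (w^-1 * wdn n m j)^-1)%g by rewrite invMg wdnV // invgK.
rewrite e slenV h2 slenV; split=> //.
by rewrite -bsigma_Tw h1 bsigmaM bsigma_Tw invgK bsigma_pr revK.
Qed.

Lemma Tw1 : Tw (1%g : 'S_n) = 1 /\ slen (1%g : 'S_n) = 0%N.
Proof.
have e : expression (1%g : 'S_n) [::] by split; rewrite // /word_perm big_nil.
have [h1 h2] := Tw_pr e.
have e2 : slen (1%g : 'S_n) = 0%N by move: h1; case: (slen _).
by rewrite -h2 ?e2 // pr_nil.
Qed.

Lemma Tij_up i j : (0 < i <= j)%N -> (j <= n)%N -> Tij n i j = Sup T i j.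
Proof.
move=> h1 h2; rewrite /Tij /s_word; have -> : (i <= j)%N by lia.
have [|h _] := @Tw_up 1%g j i h1 h2; first by move=> x hx; rewrite pact1 //; lia.
by move: h; rewrite mulg1 Tw1.1 mulr1.
Qed.

Lemma Tij_dn i j : (0 < j <= i)%N -> (i <= n)%N -> Tij n i j = Sdn T i j.
Proof.
move=> h1 h2; rewrite /Tij /s_word; case: leqP => h.
  have -> : i = j by lia.
  by rewrite subnn /= /word_perm big_nil Tw1.1 Sdn_geq.
have [|h' _] := @Tw_dn 1%g i j h1 h2; first by move=> x hx; rewrite pact1 //; lia.
by move: h'; rewrite mul1g Tw1.1 mul1r.
Qed.

Lemma Tw_HT w a m : fixes_above m w -> fixes_upto a w -> (m <= n)%N -> HT T a m (Tw w).
Proof.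
elim: m w => [|m IH] w hw ha hm.
  by rewrite (fixes_all hw) // Tw1.1; exact: gen_subalg_1.
have [h|h] : (m.+1 <= a)%N \/ (a < m.+1)%N by lia.
  have -> : w = 1%g.
    apply: perm_pact => x hx; rewrite pact1 //.
    have [h1|h1] : (x <= a)%N \/ (m.+1 < x)%N by lia.
      by rewrite ha //; lia.
    by rewrite hw //; lia.
  by rewrite Tw1.1; exact: gen_subalg_1.
have [|w' [j [hj _ ew hw' ha']]] := @split_top n w m.+1 _ hw; first by lia.
have [haj ha''] := ha' a ha h.
have [ew' _] := Tw_dn hj hm hw'; rewrite ew ew'.
apply: gen_subalg_M; last by apply: HT_Sdn; lia.
by apply: (HT_sub (leqnn _) (leqnSn _)); apply: IH => //; lia.
Qed.
End TwBasis.

(** * Spans *)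

Section Spans.
Variables (k : comNzRingType) (V : lmodType k).
Implicit Types (S : set V) (x y : V).

Lemma kspan_in S x : S x -> x \in kspan S.
Proof.
move=> h; apply/asboolP; exists [:: (1, x)]; rewrite big_seq1 scale1r.
by split=> // c; rewrite inE => /eqP ->.
Qed.

Lemma kspan_ind S (P : V -> Prop) : P 0 -> (forall a x y, P x -> P y -> P (a *: x + y)) ->
  (forall x, S x -> P x) -> forall x, x \in kspan S -> P x.
Proof.
move=> P0 PD PS x /asboolP[s [hs ->]].
elim: s hs => [|c s IH] hs; first by rewrite big_nil.
rewrite big_cons; apply: PD; first by apply: PS; apply: hs; rewrite inE eqxx.
by apply: IH => d hd; apply: hs; rewrite inE hd orbT.
Qed.

Lemma kspan_min S S' x : (forall y, S y -> y \in kspan S') -> x \in kspan S -> x \in kspan S'.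
Proof.
move=> h; apply: (@kspan_ind S (fun x => x \in kspan S')) => [|a y z hy hz|//]; first exact: rpred0.
by rewrite rpredD ?rpredZ.
Qed.

Lemma kspan_sub S S' x : (forall y, S y -> S' y) -> x \in kspan S -> x \in kspan S'.
Proof. by move=> h; apply: kspan_min => y /h; exact: kspan_in. Qed.
End Spans.

Section AlgSpans.
Variables (k : comNzRingType) (A : algType k).
Implicit Types (S : set A) (x y : A).

Lemma kspan_mulr S S' y x : (forall u, S u -> u * y \in kspan S') ->
  x \in kspan S -> x * y \in kspan S'.
Proof.
move=> h; apply: (@kspan_ind _ _ S (fun x => x * y \in kspan S')) => [|a u v hu hv|//].
  by rewrite mul0r rpred0.
by rewrite mulrDl -scalerAl rpredD ?rpredZ.
Qed.

Lemma kspan_mull S S' y x : (forall u, S u -> y * u \in kspan S') ->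
  x \in kspan S -> y * x \in kspan S'.
Proof.
move=> h; apply: (@kspan_ind _ _ S (fun x => y * x \in kspan S')) => [|a u v hu hv|//].
  by rewrite mulr0 rpred0.
by rewrite mulrDr -scalerAr rpredD ?rpredZ.
Qed.

Lemma kspan_gen S (G : set A) x y : (forall u g, S u -> G g -> u * g \in kspan S) ->
  x \in kspan S -> gen_subalg G y -> x * y \in kspan S.
Proof.
move=> h hx hy; elim: hy x hx => {y} [y hy||y z _ h1 _ h2|y z _ h1 _ h2|c y _ h1] x hx.
- by apply: kspan_mulr hx => u hu; exact: h.
- by rewrite mulr1.
- by rewrite mulrDr rpredD ?h1 ?h2.
- by rewrite mulrA h2 ?h1.
- by rewrite -scalerAr rpredZ ?h1.
Qed.
End AlgSpans.

(** * Row symmetrizers *)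

Section SymmetrizersRec.
Variables (A : algType kk) (F : nat -> A).
Local Notation q := kq.

Fixpoint Lx_rec (s m : nat) : A :=
  if m is m'.+1 then 1 + q *: (Lx_rec s m' * F (s + m')%N) else 0.
Fixpoint Rx_rec (s m : nat) : A :=
  if m is m'.+1 then 1 + q *: (F (s + m')%N * Rx_rec s m') else 0.
Fixpoint Xs_rec (s m : nat) : A := if m is m'.+1 then Xs_rec s m' * Rx_rec s m else 1.
Fixpoint xP_rec (s : nat) (rho : seq nat) : A :=
  if rho is c :: rho' then Xs_rec s c * xP_rec (s + c) rho' else 1.
Fixpoint gam_rec (s a : nat) : nat -> A := fix g (v : nat) : A :=
  match a, v with
  | a'.+1, v'.+1 =>
      g v' + q ^+ v *: (Sup F (s + a) (s + a + v) * gam_rec s a' v)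
  | _, _ => 1
  end.
End SymmetrizersRec.

(** Locked, lest unification unfold them on numerals. *)
HB.lock Definition Lx (A : algType kk) (F : nat -> A) := Lx_rec F.
HB.lock Definition Rx (A : algType kk) (F : nat -> A) := Rx_rec F.

(** The symmetrizer of the entries [s+1, ..., s+m]. *)
HB.lock Definition Xs (A : algType kk) (F : nat -> A) := Xs_rec F.

(** The symmetrizer of consecutive rows of lengths [rho] starting after [s]. *)
HB.lock Definition xP (A : algType kk) (F : nat -> A) := xP_rec F.

(** The sum of [q^l(d) T_d] over the minimal coset representatives of
    [S_a x S_v] in the symmetric group of the entries [s+1, ..., s+a+v],
    computed by the [q]-Pascal rule. *)
HB.lock Definition gam (A : algType kk) (F : nat -> A) := gam_rec F.

Section Symmetrizers.
Variables (A : algType kk) (F : nat -> A).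
Local Notation q := kq.
Local Notation Lx := (Lx F).
Local Notation Rx := (Rx F).
Local Notation Xs := (Xs F).
Local Notation xP := (xP F).
Local Notation gam := (gam F).

Lemma Lx0 s : Lx s 0 = 0. Proof. by rewrite Lx.unlock. Qed.
Lemma LxS s m : Lx s m.+1 = 1 + q *: (Lx s m * F (s + m)%N).
Proof. by rewrite Lx.unlock. Qed.
Lemma Rx0 s : Rx s 0 = 0. Proof. by rewrite Rx.unlock. Qed.
Lemma RxS s m : Rx s m.+1 = 1 + q *: (F (s + m)%N * Rx s m).
Proof. by rewrite Rx.unlock. Qed.
Lemma Xs0 s : Xs s 0 = 1. Proof. by rewrite Xs.unlock. Qed.
Lemma XsS s m : Xs s m.+1 = Xs s m * Rx s m.+1.
Proof. by rewrite Xs.unlock Rx.unlock. Qed.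
Lemma xP_nil s : xP s [::] = 1. Proof. by rewrite xP.unlock. Qed.
Lemma xP_cons s c rho : xP s (c :: rho) = Xs s c * xP (s + c) rho.
Proof. by rewrite xP.unlock Xs.unlock. Qed.

Lemma gam_a0 s a : gam s a 0 = 1. Proof. by rewrite gam.unlock; case: a. Qed.
Lemma gam_0v s v : gam s 0 v = 1. Proof. by rewrite gam.unlock; case: v. Qed.
Lemma gamS s a v : gam s a.+1 v.+1 =
  gam s a.+1 v + q ^+ v.+1 *: (Sup F (s + a.+1) (s + a.+1 + v.+1) * gam s a v.+1).
Proof. by rewrite gam.unlock. Qed.

Lemma xP_cat s rho tau : xP s (rho ++ tau) = xP s rho * xP (s + sumn rho) tau.
Proof.
elim: rho s => [|c rho IH] s /=; first by rewrite xP_nil mul1r addn0.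
by rewrite !xP_cons IH -mulrA addnA.
Qed.

Lemma Lx1 s : Lx s 1 = 1. Proof. by rewrite LxS Lx0 mul0r scaler0 addr0. Qed.
Lemma Rx1 s : Rx s 1 = 1. Proof. by rewrite RxS Rx0 mulr0 scaler0 addr0. Qed.

Lemma Lx_HT s m : HT F s (s + m) (Lx s m).
Proof.
elim: m => [|[|m] IH]; [by rewrite Lx0; exact: gen_0 | by rewrite Lx1; exact: gen_subalg_1 |].
rewrite LxS; apply: gen_subalg_D; first exact: gen_subalg_1.
apply: gen_subalg_Z; apply: gen_subalg_M; first by apply: HT_sub IH => //; lia.
by apply: HT_gen; lia.
Qed.

Lemma Rx_HT s m : HT F s (s + m) (Rx s m).
Proof.
elim: m => [|[|m] IH]; [by rewrite Rx0; exact: gen_0 | by rewrite Rx1; exact: gen_subalg_1 |].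
rewrite RxS; apply: gen_subalg_D; first exact: gen_subalg_1.
apply: gen_subalg_Z; apply: gen_subalg_M; first by apply: HT_gen; lia.
by apply: HT_sub IH => //; lia.
Qed.

Lemma Xs_HT s m : HT F s (s + m) (Xs s m).
Proof.
elim: m => [|m IH]; first by rewrite Xs0; exact: gen_subalg_1.
by rewrite XsS; apply: gen_subalg_M; [apply: HT_sub IH => //; lia | exact: Rx_HT].
Qed.

Lemma xP_HT s rho : HT F s (s + sumn rho) (xP s rho).
Proof.
elim: rho s => [|c rho IH] s /=; first by rewrite xP_nil; exact: gen_subalg_1.
rewrite xP_cons; apply: gen_subalg_M; first by apply: HT_sub (Xs_HT s c) => //; lia.
by rewrite addnA; apply: HT_sub (IH _) => //; lia.
Qed.

Lemma gam_HT s a v : HT F s (s + a + v) (gam s a v).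
Proof.
elim: a v => [|a IHa] v; first by rewrite gam_0v; exact: gen_subalg_1.
elim: v => [|v IHv]; first by rewrite gam_a0; exact: gen_subalg_1.
rewrite gamS; apply: gen_subalg_D; first by apply: HT_sub IHv => //; lia.
apply: gen_subalg_Z; apply: gen_subalg_M; first by apply: HT_Sup; lia.
by apply: HT_sub (IHa _) => //; lia.
Qed.

Section Shift.
Variables (g : A).

Lemma Sup_shift_gen a b : (forall i, (a <= i < b)%N -> g * F i = F i.+1 * g) ->
  g * Sup F a b = Sup F a.+1 b.+1 * g.
Proof.
move=> h; have [hab|hab] := leqP b a; first by rewrite !Sup_geq // mulr1 mul1r.
have [m em] : exists m, b = (a + m)%N by exists (b - a)%N; lia.
rewrite em {hab b em} in h *; elim: m h => [|m IH] h.
  by rewrite addn0 !Sup_geq // mulr1 mul1r.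
rewrite addnS (@Sup_recr _ F a (a + m)) ?(@Sup_recr _ F a.+1 (a + m).+1); try lia.
rewrite mulrA IH; last by move=> i hi; apply: h; lia.
by rewrite -!mulrA h //; lia.
Qed.

Lemma Rx_shift s m : (forall i, (s < i < s + m)%N -> g * F i = F i.+1 * g) ->
  g * Rx s m = Rx s.+1 m * g.
Proof.
elim: m => [|[|m] IH] h; first by rewrite !Rx0 mulr0 mul0r.
  by rewrite !Rx1 mulr1 mul1r.
rewrite (RxS s m.+1) (RxS s.+1 m.+1) addSn.
rewrite mulrDr mulrDl mulr1 mul1r -scalerAl -scalerAr mulrA h; last by apply/andP; split; lia.
by rewrite -!mulrA IH // => i hi; apply: h; lia.
Qed.

Lemma Xs_shift s m : (forall i, (s < i < s + m)%N -> g * F i = F i.+1 * g) ->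
  g * Xs s m = Xs s.+1 m * g.
Proof.
elim: m => [|m IH] h; first by rewrite !Xs0 mulr1 mul1r.
rewrite !XsS mulrA IH -?mulrA ?Rx_shift // => i hi; apply: h; lia.
Qed.

Lemma xP_shift s rho : (forall i, (s < i < s + sumn rho)%N -> g * F i = F i.+1 * g) ->
  g * xP s rho = xP s.+1 rho * g.
Proof.
elim: rho s => [|c rho IH] s h; first by rewrite !xP_nil mulr1 mul1r.
rewrite !xP_cons mulrA Xs_shift -?mulrA; last by move=> i hi; apply: h => /=; lia.
by rewrite IH // => i hi; apply: h => /=; lia.
Qed.

Lemma gam_shift s a v : (forall i, (s < i < s + a + v)%N -> g * F i = F i.+1 * g) ->
  g * gam s a v = gam s.+1 a v * g.
Proof.
elim: a v => [|a IHa] v h; first by rewrite !gam_0v mulr1 mul1r.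
elim: v h => [|v IHv] h; first by rewrite !gam_a0 mulr1 mul1r.
rewrite !gamS mulrDr mulrDl -scalerAl -scalerAr; congr (_ + _ *: _).
  by apply: IHv => i hi; apply: h; lia.
rewrite mulrA Sup_shift_gen; last by move=> i hi; apply: h; lia.
by rewrite -!mulrA IHa // => i hi; apply: h; lia.
Qed.
End Shift.
End Symmetrizers.

(** * The symmetrizers in the Hecke algebra *)

Section HeckeSym.
Variable n : nat.
Local Notation B := (qBrauer n).
Local Notation T := (bT n).
Local Notation q := kq.
Local Notation d := (kq - kq^-1).
Local Notation X := (Xs T).
Local Notation L := (Lx T).

Local Notation U := (Uof T).

Lemma bT_quadratic : quadratic T n.
Proof. by move=> i hi; exact: bT_sqr. Qed.

Lemma qV : kq * kq^-1 = 1. Proof. by rewrite mulrV ?kq_unit. Qed.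
Lemma Vq : kq^-1 * kq = 1. Proof. by rewrite mulVr ?kq_unit. Qed.

Lemma Xs_commT s m i : (i < s)%N || (s + m < i)%N -> GRing.comm (T i) (X s m).
Proof.
by move=> hi; apply: (HT_comm _ (Xs_HT T s m)) => j hj; apply: (T_comm (bT_braids n)); lia.
Qed.

Lemma Lx_commT s m i : (i < s)%N || (s + m < i)%N -> GRing.comm (T i) (L s m).
Proof.
by move=> hi; apply: (HT_comm _ (Lx_HT T s m)) => j hj; apply: (T_comm (bT_braids n)); lia.
Qed.

Lemma Xs_L s m : X s m.+1 = L s m.+1 * X s m.
Proof.
elim: m => [|m IH]; first by rewrite XsS Xs0 Lx1 Rx1.
rewrite (XsS T s m.+1) (RxS T s m.+1) (LxS T s m.+1).
rewrite mulrDr mulr1 mulrDl mul1r; congr (_ + _).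
rewrite -scalerAr -scalerAl; congr (_ *: _).
rewrite {1}IH -!mulrA; congr (_ * _).
by rewrite XsS mulrA -Xs_commT -?mulrA //; lia.
Qed.

Lemma bsigma_Lx s m : bsigma (L s m) = Rx T s m.
Proof.
elim: m => [|m IH]; first by rewrite Lx0 Rx0 bsigma0.
by rewrite LxS RxS bsigmaD bsigmaZ bsigmaM IH bsigmaT bsigma1.
Qed.

Lemma bsigma_Xs s m : bsigma (X s m) = X s m.
Proof.
elim: m => [|m IH]; first by rewrite Xs0 bsigma1.
by rewrite {1}Xs_L bsigmaM IH bsigma_Lx XsS.
Qed.

Lemma TXs s m i : (s < i < s + m)%N -> (s + m <= n)%N -> T i * X s m = q *: X s m.
Proof.
elim: m i => [|m IH] i hi hm; first by lia.
have [hi'|e] : (s < i < s + m)%N \/ i = (s + m)%N by lia.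
  by rewrite XsS mulrA IH -?scalerAl //; lia.
case: m IH e hi hm => [|m] IH e hi hm; first by lia.
have eL : L s m.+2 = 1 + q *: (L s m.+1 * T i) by rewrite LxS e.
have eL' : L s m.+1 = 1 + q *: (L s m * T i.-1).
  by rewrite LxS; have -> : i.-1 = (s + m)%N by lia.
have sq : T i * T i = 1 + d *: T i by apply: bT_sqr; lia.
have cP : GRing.comm (T i) (L s m) by apply: Lx_commT; lia.
have br : T i * (T i.-1 * T i) = T i.-1 * (T i * T i.-1).
  by have := braidE (bT_braids n) i.-1; rewrite prednK //; lia.
have hP z : L s m * (z * (T i.-1 * X s m.+1)) = q *: (L s m * (z * X s m.+1)).
  case: (m) IH hi e hm => [|m'] IH hi e hm; first by rewrite Lx0 !mul0r scaler0.
  by rewrite IH -?scalerAr //; lia.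
rewrite Xs_L; set Y := X s m.+1 in hP *.
have h1 : T i * (L s m.+1 * (T i * Y)) =
    Y + d *: (T i * Y) + q *: (q *: (L s m * (T i.-1 * (T i * Y)))).
  rewrite {1}eL' mulrDl mul1r mulrDr mulrA sq mulrDl mul1r -scalerAl; congr (_ + _).
  rewrite -scalerAl -scalerAr; congr (_ *: _).
  have br' z : T i * (T i.-1 * (T i * z)) = T i.-1 * (T i * (T i.-1 * z)).
    by have := congr1 (fun x => x * z) br; rewrite -!mulrA.
  rewrite -!mulrA [LHS]mulrA cP -!mulrA br'.
  by rewrite (mulrA (T i.-1)) hP -!mulrA.
have h2 : L s m.+1 * (T i * Y) = T i * Y + q *: (L s m * (T i.-1 * (T i * Y))).
  by rewrite eL' mulrDl mul1r -scalerAl !mulrA.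
rewrite eL mulrDl mul1r -scalerAl -mulrA mulrDr -scalerAr h1 h2.
move: (T i * Y) (L s m * _) => a b.
rewrite !scalerDr !scalerA addrA [a + _]addrC -!addrA; congr (_ + _).
rewrite addrA -{2}[a]scale1r -scalerDl; congr (_ *: _ + _).
by rewrite mulrBr qV subrK.
Qed.

Lemma XsT s m i : (s < i < s + m)%N -> (s + m <= n)%N -> X s m * T i = q *: X s m.
Proof.
move=> h1 h2; rewrite -[LHS]bsigmaK bsigmaM bsigmaT bsigma_Xs TXs // bsigmaZ.
by rewrite bsigma_Xs.
Qed.

Lemma UXs s m i : (s < i < s + m)%N -> (s + m <= n)%N -> U i * X s m = q^-1 *: X s m.
Proof. by move=> h1 h2; rewrite UofE mulrBl TXs // mulr_algl -scalerBl opprB addrC subrK. Qed.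

Lemma Lx_add s a w : L s (a.+1 + w) =
  L (s + a.+1) w + q ^+ w *: (L s a.+1 * Sup T (s + a.+1) (s + a.+1 + w)).
Proof.
elim: w => [|w IH]; first by rewrite !addn0 Lx0 add0r scale1r Sup_geq ?mulr1.
rewrite addnS.
rewrite (LxS T s (a.+1 + w)) (LxS T (s + a.+1) w) IH addnA -addrA; congr (_ + _).
rewrite mulrDl scalerDr; congr (_ + _).
rewrite -scalerAl scalerA -exprS (addnS (s + a.+1)%N w) Sup_recr ?mulrA //.
exact: leq_addr.
Qed.

(** The coset sum turns the symmetrizer of two adjacent rows into that of the
    row obtained by joining them. *)
Lemma Xs_gam s a v : X s a * X (s + a) v * gam T s a v = X s (a + v).
Proof.
elim: a v => [|a IHa] v; first by rewrite gam_0v Xs0 mulr1 mul1r addn0.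
elim: v => [|v IHv]; first by rewrite gam_a0 Xs0 !mulr1 addn0.
rewrite gamS mulrDr.
have -> : X s a.+1 * X (s + a.+1) v.+1 * gam T s a.+1 v = L (s + a.+1) v.+1 * X s (a.+1 + v).
  rewrite (Xs_L (s + a.+1)) mulrA; have -> : X s a.+1 * L (s + a.+1) v.+1 = L (s + a.+1) v.+1 * X s a.+1.
    apply: esym; apply: (HT_comm _ (Xs_HT T s a.+1)) => j hj; apply: esym.
    by apply: Lx_commT; lia.
  by rewrite -IHv -!mulrA.
have -> : X s a.+1 * X (s + a.+1) v.+1 *
    (q ^+ v.+1 *: (Sup T (s + a.+1) (s + a.+1 + v.+1) * gam T s a v.+1)) =
    q ^+ v.+1 *: (L s a.+1 * Sup T (s + a.+1) (s + a.+1 + v.+1) * X s (a.+1 + v)).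
  rewrite -scalerAr; congr (_ *: _); set g := Sup T _ _.
  have cg : GRing.comm g (X s a).
    by apply/esym/Sup_comm => j hj; apply/esym/Xs_commT; lia.
  have sg : X (s + a.+1) v.+1 * g = g * X (s + a) v.+1.
    rewrite addnS -Xs_shift // => j hj; apply: (Sup_shift (bT_braids n)); lia.
  have -> : (a.+1 + v = a + v.+1)%N by lia.
  by rewrite -IHa [LHS]mulrA -(mulrA (X s a.+1)) sg Xs_L -!mulrA (mulrA (X s a) g) -cg -!mulrA.
have -> : X s (a.+1 + v.+1) = L s (a.+1 + v.+1) * X s (a.+1 + v) by rewrite addnS Xs_L.
by rewrite scalerAl -mulrDl Lx_add.
Qed.
End HeckeSym.

(** * Garnir elements *)

Section Garnir.
Variable n : nat.
Local Notation B := (qBrauer n).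
Local Notation T := (bT n).
Local Notation U := (Uof T).
Local Notation q := kq.
Local Notation X := (Xs T).
Local Notation L := (Lx T).
Local Notation gm := (gam T).
Local Notation H := (HT T).
Implicit Types (pi tau la mu rho : seq nat) (s a b c v e : nat) (x y g h : B).

Lemma HT_HT_comm a b c e x y : (b <= c)%N -> H a b x -> H c e y -> GRing.comm x y.
Proof.
move=> hbc hx hy; apply: (HT_comm _ hy) => j hj; apply: esym.
apply: (HT_comm _ hx) => i hi; apply: (T_comm (bT_braids n)); lia.
Qed.

Lemma HT_bsigma a b x : H a b x -> H a b (bsigma x).
Proof.
elim=> {x} [_ [i hi ->]||x y _ h1 _ h2|x y _ h1 _ h2|c x _ h1].
- by rewrite bsigmaT; exact: HT_gen.
- by rewrite bsigma1; exact: gen_subalg_1.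
- by rewrite bsigmaD; exact: gen_subalg_D.
- by rewrite bsigmaM; exact: gen_subalg_M.
- by rewrite bsigmaZ; exact: gen_subalg_Z.
Qed.

Lemma xP_T s pi b tau i : (s + sumn (pi ++ b :: tau) <= n)%N ->
  (s + sumn pi < i < s + sumn pi + b)%N ->
  xP T s (pi ++ b :: tau) * T i = q *: xP T s (pi ++ b :: tau).
Proof.
rewrite sumn_cat /= => hn hi; rewrite xP_cat xP_cons -!mulrA.
have -> : xP T (s + sumn pi + b) tau * T i = T i * xP T (s + sumn pi + b) tau.
  by apply: esym; apply: (HT_comm _ (xP_HT T _ _)) => j hj; apply: (T_comm (bT_braids n)); lia.
by rewrite (mulrA (X _ _) (T i)) XsT -?scalerAl -?scalerAr ?mulrA //; lia.
Qed.

Lemma xP_Sup s pi b tau i j : (s + sumn (pi ++ b :: tau) <= n)%N ->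
  (s + sumn pi < i)%N -> (i <= j)%N -> (j <= s + sumn pi + b)%N ->
  xP T s (pi ++ b :: tau) * Sup T i j = q ^+ (j - i) *: xP T s (pi ++ b :: tau).
Proof.
move=> hn h1 h2; elim: j h2 => [|j IH] h2 h3; first by lia.
have [e|h4] : i = j.+1 \/ (i <= j)%N by lia.
  by rewrite e Sup_geq // mulr1 subnn scale1r.
rewrite Sup_recr // mulrA IH; try lia.
by rewrite -scalerAl xP_T ?scalerA -?exprSr -?subSn //; lia.
Qed.

(** The element [x_la T_{a_k,n}] for the removal of a node from the row of
    length [a] between the rows [pi] and [tau]. *)
Definition Yr s pi a tau : B :=
  xP T s (pi ++ a :: tau) * Sup T (s + sumn pi + a) (s + sumn pi + a + sumn tau).

Lemma Yr_left s pi a tau : exists2 h, H s (s + sumn (pi ++ a.+1 :: tau)) h &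
  [/\ Yr s pi a.+1 tau = h * xP T s (pi ++ a :: tau) &
    H (s + sumn pi) (s + sumn (pi ++ a.+1 :: tau)) h].
Proof.
rewrite sumn_cat /=; set S := (s + sumn pi)%N.
have h0 : H S (s + (sumn pi + (a.+1 + sumn tau))%N)
    (L S a.+1 * Sup T (S + a.+1) (S + a.+1 + sumn tau)).
  apply: gen_subalg_M; first by apply: HT_sub (Lx_HT T S a.+1); rewrite /S; lia.
  by apply: HT_Sup; rewrite /S; lia.
exists (L S a.+1 * Sup T (S + a.+1) (S + a.+1 + sumn tau)).
  by apply: HT_sub h0; rewrite /S; lia.
split=> //; rewrite /Yr !xP_cat !xP_cons -/S -!mulrA.
set g := Sup T _ _.
have e1 : g * xP T (S + a) tau = xP T (S + a.+1) tau * g.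
  rewrite addnS; apply: xP_shift => i hi; apply: (Sup_shift (bT_braids n)); lia.
have c1 : GRing.comm g (X S a).
  by apply/esym/Sup_comm => j hj; apply/esym/Xs_commT; lia.
have c2 : GRing.comm (xP T s pi) (L S a.+1 * g).
  by apply: HT_HT_comm (xP_HT T s pi) h0; rewrite /S; lia.
rewrite -e1 Xs_L -!mulrA (mulrA (X S a)) -c1 -!mulrA.
by rewrite (mulrA (L _ _)) (mulrA (xP T s pi)) c2 -!mulrA.
Qed.

(** The q-Pascal rule on a pair of adjacent rows: the Garnir element of [la]
    for the pair splits into a multiple of that of [la] less a node of the upper
    row and a multiple of the generator attached to the lower row. *)
Lemma Yr_pascal s pi a b tau v : (s + sumn (pi ++ a.+1 :: b :: tau) <= n)%N ->
  (0 < v <= b)%N ->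
  q ^+ v *: (Yr s pi a.+1 (b :: tau) * gm (s + sumn pi) a v) =
  xP T s (pi ++ a.+1 :: b :: tau) * gm (s + sumn pi) a.+1 v *
    Sup T (s + sumn pi + a.+1 + v) (s + sumn pi + a.+1 + (b + sumn tau)) -
  q ^+ (b - v) *: (Yr s (pi ++ [:: a.+1]) b tau * gm (s + sumn pi) a.+1 v.-1).
Proof.
move=> hn hv; rewrite /Yr; set S := (s + sumn pi)%N.
have [w ew] : exists w, v = w.+1 by exists v.-1; lia.
rewrite ew in hv *; rewrite gamS /=.
set x := xP T s _; set e := (S + a.+1 + (b + sumn tau))%N.
rewrite -catA /= -/x sumn_cat /= addn0.
have -> : (s + (sumn pi + a.+1) + b = S + a.+1 + b)%N by rewrite /S; lia.
have -> : (S + a.+1 + b + sumn tau = e)%N by rewrite /e; lia.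
rewrite -/S.
have c1 : GRing.comm (gm S a w.+1) (Sup T (S + a.+1 + w.+1) e).
  apply: Sup_comm => j hj; apply: esym; apply: (HT_comm _ (gam_HT T S a w.+1)) => i hi.
  by apply: (T_comm (bT_braids n)); lia.
have c2 : GRing.comm (gm S a.+1 w) (Sup T (S + a.+1 + w.+1) e).
  apply: Sup_comm => j hj; apply: esym; apply: (HT_comm _ (gam_HT T S a.+1 w)) => i hi.
  by apply: (T_comm (bT_braids n)); lia.
have hx : x * Sup T (S + a.+1 + w.+1) (S + a.+1 + b) = q ^+ (b - w.+1) *: x.
  have := @xP_Sup s (pi ++ [:: a.+1]) b tau (S + a.+1 + w.+1) (S + a.+1 + b).
  rewrite -catA /= -/x => ->.
  - by congr (_ ^+ _ *: _); lia.
  - by [].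
  - by rewrite sumn_cat /= /S; lia.
  - by lia.
  - by rewrite sumn_cat /= /S; lia.
have e1 : Sup T (S + a.+1 + w.+1) e = Sup T (S + a.+1 + w.+1) (S + a.+1 + b) * Sup T (S + a.+1 + b) e.
  by rewrite Sup_cat // /e; lia.
have e2 : Sup T (S + a.+1) e = Sup T (S + a.+1) (S + a.+1 + w.+1) * Sup T (S + a.+1 + w.+1) e.
  by rewrite Sup_cat // /e; lia.
rewrite mulrDr mulrDl -[x * gm S a.+1 w * _]mulrA c2 {1}e1 !mulrA hx -!scalerAl addrAC subrr add0r.
by rewrite -!scalerAr -!scalerAl e2 -!mulrA c1.
Qed.

Definition Lc s v w : B := bsigma (gm s v w).

Lemma Xs_split s v w : X s (v + w) = Lc s v w * (X s v * X (s + v) w).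
Proof.
rewrite -bsigma_Xs -Xs_gam !bsigmaM !bsigma_Xs; congr (_ * _).
by apply: esym; apply: HT_HT_comm (Xs_HT T s v) (Xs_HT T _ w).
Qed.

Lemma Lc_HT s v w : H s (s + v + w) (Lc s v w).
Proof. by apply: HT_bsigma; exact: gam_HT. Qed.

Lemma xP_split s pi v w tau : xP T s (pi ++ (v + w)%N :: tau) =
  Lc (s + sumn pi) v w * xP T s (pi ++ v :: w :: tau).
Proof.
rewrite !xP_cat !xP_cons Xs_split !mulrA addnA.
rewrite (HT_HT_comm (leqnn _) (xP_HT T s pi) (_ : H _ (s + sumn pi + v + w) _)) //.
exact: Lc_HT.
Qed.

Lemma xP_gam s pi a b tau v : (v <= b)%N ->
  xP T s (pi ++ a :: b :: tau) * gm (s + sumn pi) a v =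
  Lc (s + sumn pi + a) v (b - v) * xP T s (pi ++ (a + v)%N :: (b - v)%N :: tau).
Proof.
move=> hv.
have := xP_split s (pi ++ [:: a]) v (b - v) tau.
rewrite -!catA /= subnKC // => ->; rewrite sumn_cat /= addn0 addnA.
have e : (s + sumn pi + (a + v) = s + sumn pi + a + v)%N by rewrite addnA.
have c : GRing.comm (gm (s + sumn pi) a v) (xP T (s + sumn pi + a + v) ((b - v)%N :: tau)).
  exact: HT_HT_comm (leqnn _) (gam_HT T _ a v) (xP_HT T _ _).
rewrite -mulrA; congr (_ * _); rewrite !xP_cat !(xP_cons _ _ a) !(xP_cons _ _ v) (xP_cons _ _ (a + v)%N).
by rewrite -!mulrA; congr (_ * _); rewrite -(Xs_gam n (s + sumn pi) a v) e -c !mulrA.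
Qed.

(** For two adjacent rows, the coset sum that moves [v] nodes of the lower row to the
    upper one. *)
Definition Garn s la : set B := [set x | exists pi a b tau v,
  [/\ la = pi ++ a :: b :: tau, (0 < v <= b)%N & x = xP T s la * gm (s + sumn pi) a v]]%classic.
Definition RG s la a e : set B := [set x | exists g h,
  [/\ Garn s la g, H a e h & x = g * h]]%classic.

Lemma Garn_in s pi a b tau v a' e h : (0 < v <= b)%N -> H a' e h ->
  xP T s (pi ++ a :: b :: tau) * gm (s + sumn pi) a v * h \in
    kspan (RG s (pi ++ a :: b :: tau) a' e).
Proof.
move=> hv hh; apply: kspan_in.
by exists (xP T s (pi ++ a :: b :: tau) * gm (s + sumn pi) a v), h; split=> //; exists pi, a, b, tau, v.
Qed.

(** When the lower row is the longer one, induction on the lengths with the q-Pascal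
    rule ends in Garnir elements that move at least [b - c] nodes upwards, after which
    the two rows are in decreasing order. *)
Lemma Zlem s c b : (c < b)%N -> (s + (c + b) <= n)%N ->
  X s c * X (s + c) b \in kspan [set x | exists v h,
    [/\ (b - c <= v <= b)%N, H s (s + (c + b)) h & x = X s c * X (s + c) b * gm s c v * h]]%classic.
Proof.
have [k ek] : exists k, k = (c + b)%N by exists (c + b)%N.
elim: k c b ek => [|k IH] c b ek hcb hn; first by lia.
set Q := kspan _; set x := X s c * X (s + c) b.
case: c IH ek hcb hn @x @Q => [|c] IH ek hcb hn x Q.
  have -> : x = x * gm s 0 b * 1 by rewrite gam_0v !mulr1.
  apply: kspan_in.
  by exists b, 1; split; [lia | exact: gen_subalg_1 | ].
have Qg v h : (b - c.+1 <= v <= b)%N -> H s (s + (c.+1 + b)) h -> x * gm s c.+1 v * h \in Q.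
  by move=> hv hh; apply: kspan_in; exists v, h.
have Qg1 v : (b - c.+1 <= v <= b)%N -> x * gm s c.+1 v \in Q.
  by move=> hv; rewrite -[x * _]mulr1; apply: Qg => //; exact: gen_subalg_1.
have ex : x = xP T s [:: c.+1; b] by rewrite !xP_cons xP_nil mulr1.
pose be := Yr s [::] c.+1 [:: b].
have pas v : (0 < v <= b)%N -> q ^+ v *: (be * gm s c v) =
    x * gm s c.+1 v * Sup T (s + c.+1 + v) (s + c.+1 + b) - q ^+ (b - v) *: (x * gm s c.+1 v.-1).
  move=> hv; have := @Yr_pascal s [::] c b [::] v; rewrite /= !addn0 -/be => -> //.
  by rewrite -ex /Yr /= !addn0 -ex (Sup_geq T (leqnn (s + c.+1 + b)%N)) mulr1.
have uq v : q ^- v * q ^+ v = 1 by rewrite mulVr // unitrX // kq_unit.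
have unit v y : q ^+ v *: y \in Q -> y \in Q.
  by move=> hy; rewrite -[y]scale1r -(uq v) -scalerA; apply: rpredZ.
have Qh y h : y \in Q -> H s (s + (c.+1 + b)) h -> y * h \in Q.
  move=> hy hh; apply: kspan_gen hy hh => _ g [v [h' [hv hh' ->]]] hg.
  rewrite -(mulrA (x * gm s c.+1 v)); apply: Qg => //; apply: gen_subalg_M => //; exact: gen_subalg_gen.
have hS v : H s (s + (c.+1 + b)) (Sup T (s + c.+1 + v) (s + c.+1 + b)).
  by apply: HT_Sup; lia.
have bQ v : (b - c <= v <= b)%N -> be * gm s c v \in Q.
  move=> hv; apply: (unit v); rewrite pas; last by lia.
  apply: rpredB; first by apply: Qg => //; lia.
  by apply: rpredZ; apply: Qg1; lia.
have beQ : be \in Q.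
  have [h hh [eb _]] := Yr_left s [::] c [:: b]; rewrite /= !xP_cons xP_nil mulr1 addn0 in eb hh.
  rewrite /be eb; apply: kspan_mull (IH c b _ _ _); try lia.
  move=> _ [v [h' [hv hh' ->]]]; rewrite !mulrA -(mulrA h) -eb -/be.
  apply: Qh; first by apply: bQ; lia.
  by apply: HT_sub hh'; lia.
have h0 : x * gm s c.+1 (b - c.+1).-1 \in Q.
  apply: (unit (b - (b - c.+1))%N).
  have hv : (0 < b - c.+1 <= b)%N by lia.
  have -> : q ^+ (b - (b - c.+1)) *: (x * gm s c.+1 (b - c.+1).-1) =
      x * gm s c.+1 (b - c.+1) * Sup T (s + c.+1 + (b - c.+1)) (s + c.+1 + b) -
      q ^+ (b - c.+1) *: (be * gm s c (b - c.+1)) by rewrite pas // subKr.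
  apply: rpredB; first by apply: Qg => //; lia.
  by apply: rpredZ; apply: Qh => //; apply: HT_sub (gam_HT T s c _); lia.
have [e|hcb'] : b = c.+2 \/ (c.+1 < b.-1)%N by lia.
  by move: h0; rewrite e (_ : _.-1 = 0%N) ?gam_a0 ?mulr1 //; lia.
have [b' eb] : exists b', b = b'.+1 by exists b.-1; lia.
rewrite eb in hcb' *.
have xL : x = L (s + c.+1) b'.+1 * (X s c.+1 * X (s + c.+1) b').
  rewrite /x eb (Xs_L n (s + c.+1)) !mulrA; congr (_ * _).
  exact: (HT_HT_comm (leqnn _) (Xs_HT T s c.+1) (Lx_HT T (s + c.+1) b'.+1)).
rewrite xL; apply: kspan_mull (IH c.+1 b' _ _ _); try lia.
move=> _ [v [h' [hv hh' ->]]]; rewrite !mulrA -(mulrA (L _ _)) -xL.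
apply: Qh; last by apply: HT_sub hh'; lia.
have [ev|hv'] : v = (b - c.+1).-1 \/ (b - c.+1 <= v <= b)%N by lia.
  by rewrite ev.
exact: Qg1.
Qed.
End Garnir.
Arguments Yr {n} s pi a tau.
Arguments Lc {n} s v w.
Arguments Garn {n} s la.
Arguments RG {n} s la a e.

Lemma rows_cases (pi tau pi1 tau1 : seq nat) (a c d : nat) :
  pi ++ a :: tau = pi1 ++ c :: d :: tau1 ->
  [\/ exists p2, pi = pi1 ++ c :: d :: p2 /\ tau1 = p2 ++ a :: tau,
      [/\ pi = pi1 ++ [:: c], d = a & tau1 = tau],
      [/\ pi1 = pi, c = a & tau = d :: tau1]
    | exists p2, pi1 = pi ++ a :: p2 /\ tau = p2 ++ c :: d :: tau1].
Proof.
elim: pi pi1 => [|x pi IH] [|y pi1] //=.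
- by case=> -> ->; apply: Or43.
- by case=> -> e; apply: Or44; exists pi1.
- case=> ex; case: pi {IH} => [|x2 pi] /=; first by case=> -> ->; rewrite ex; apply: Or42.
  by case=> ex2 e; apply: Or41; exists pi; rewrite ex ex2.
- case=> -> /IH [[p2 [-> ->]]|[-> -> ->]|[-> -> ->]|[p2 [-> ->]]].
  + by apply: Or41; exists p2.
  + exact: Or42.
  + exact: Or43.
  + by apply: Or44; exists p2.
Qed.

Lemma commrZ (k : comNzRingType) (A : algType k) (c : k) (x y : A) :
  GRing.comm x y -> GRing.comm x (c *: y).
Proof. by move=> h; rewrite /GRing.comm -scalerAr -scalerAl h. Qed.

Lemma comm_sum_nat (R : pzRingType) (a b : nat) (F : nat -> R) (x : R) :
  (forall j, (a <= j < b)%N -> GRing.comm x (F j)) -> GRing.comm x (\sum_(a <= j < b) F j).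
Proof.
move=> h; rewrite /GRing.comm big_nat_cond; apply: commr_sum => j.
by rewrite andbT; exact: h.
Qed.

Section Branching.
Variable n : nat.
Local Notation B := (qBrauer n).
Local Notation T := (bT n).
Local Notation U := (Uof T).
Local Notation q := kq.
Local Notation X := (Xs T).
Local Notation gm := (gam T).
Local Notation H := (HT T).
Implicit Types (pi tau la mu rho : seq nat) (s a b c v e : nat) (x y g h : B).

Lemma xP_Z s pi c b tau : (c < b)%N -> (s + sumn (pi ++ c :: b :: tau) <= n)%N ->
  xP T s (pi ++ c :: b :: tau) \in kspan [set x | exists v h,
    [/\ (b - c <= v <= b)%N, H (s + sumn pi) (s + sumn pi + (c + b)) h &
     x = xP T s (pi ++ c :: b :: tau) * gm (s + sumn pi) c v * h]]%classic.
Proof.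
rewrite sumn_cat /= => hcb hn.
set S := (s + sumn pi)%N.
have -> : xP T s (pi ++ c :: b :: tau) = xP T s pi * (X S c * X (S + c) b) * xP T (S + (c + b)) tau.
  by rewrite xP_cat !xP_cons !mulrA addnA.
set y := X S c * _.
apply: (kspan_mulr (S := [set x | exists v h, [/\ (b - c <= v <= b)%N, H S (S + (c + b)) h &
   x = xP T s pi * (y * gm S c v * h)]]%classic)).
  move=> _ [v [h [hv hh ->]]]; apply: kspan_in; exists v, h; split=> //.
  have c1 : GRing.comm (gm S c v * h) (xP T (S + (c + b)) tau).
    apply: (HT_HT_comm (a := S) (leqnn _) _ (xP_HT T _ _)); apply: gen_subalg_M => //.
    by apply: HT_sub (gam_HT T S c v); lia.
  by rewrite -(mulrA y) -!(mulrA (xP T s pi)) -(mulrA y) c1 !mulrA.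
apply: kspan_mull (Zlem (n := n) (s := S) hcb _); last by rewrite /S; lia.
by move=> _ [v [h [hv hh ->]]]; apply: kspan_in; exists v, h.
Qed.

(** The straightening of a removal moves it to the row just below. *)
Definition RLow s pi a tau : set B := [set x |
  RG s (pi ++ a :: tau) s (s + sumn (pi ++ a :: tau)) x \/
  exists b tau' h, [/\ tau = b :: tau', (0 < b)%N,
    H s (s + sumn (pi ++ a :: tau)).-1 h & x = Yr s (pi ++ [:: a]) b tau' * h]]%classic.

Lemma RLow_mulr s pi a tau y h : y \in kspan (RLow s pi a tau) ->
  H s (s + sumn (pi ++ a :: tau)).-1 h -> y * h \in kspan (RLow s pi a tau).
Proof.
move=> hy hh; apply: kspan_mulr hy => x [[g [h' [hg hh' ->]]]|[b [tau' [h' [et hb hh' ->]]]]].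
  apply: kspan_in; left; exists g, (h' * h); split; rewrite ?mulrA //.
  by apply: gen_subalg_M => //; apply: HT_sub hh => //; lia.
apply: kspan_in; right; exists b, tau', (h' * h); split; rewrite ?mulrA //.
exact: gen_subalg_M.
Qed.

(** A Garnir element of the smaller shape that involves the shortened row is rewritten
    by the q-Pascal rule; the others pass through the string. *)
Lemma Yr_garnir s pi a tau pi1 c d tau1 v : (s + sumn (pi ++ a.+1 :: tau) <= n)%N ->
  pi ++ a :: tau = pi1 ++ c :: d :: tau1 -> (0 < v <= d)%N ->
  Yr s pi a.+1 tau * gm (s + sumn pi1) c v \in kspan (RLow s pi a.+1 tau).
Proof.
move=> hn /rows_cases hc hv.
have cm s1 : (s1 + c + v <= s + sumn pi + a)%N ->
    Yr s pi a.+1 tau * gm s1 c v = xP T s (pi ++ a.+1 :: tau) * gm s1 c v *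
      Sup T (s + sumn pi + a.+1) (s + sumn pi + a.+1 + sumn tau).
  move=> hs; rewrite /Yr -!mulrA; congr (_ * _).
  apply: esym; apply: (HT_HT_comm hs (gam_HT T _ _ _)).
  by apply: HT_Sup; [lia | exact: leqnn].
have hS : H s (s + sumn (pi ++ a.+1 :: tau)) (Sup T (s + sumn pi + a.+1) (s + sumn pi + a.+1 + sumn tau)).
  by rewrite sumn_cat /=; apply: HT_Sup; lia.
case: hc => [[p2 [ep et]]|[ep ed et]|[ep ec et]|[p2 [ep et]]].
- rewrite cm; last by rewrite ep sumn_cat /=; lia.
  rewrite {1}ep -catA /=; apply: kspan_sub (Garn_in _ _ _ _ hv hS) => x hx.
  by left; rewrite {1}ep -catA.
- rewrite cm; last by rewrite ep sumn_cat /=; lia.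
  have hv' : (0 < v <= a.+1)%N by lia.
  rewrite {1}ep -catA /=; apply: kspan_sub (Garn_in _ _ _ _ hv' hS).
  by move=> x hx; left; rewrite {1}ep -catA.
- rewrite ep ec et in hn hS *.
  have uq : q ^- v * q ^+ v = 1 by rewrite mulVr // unitrX // kq_unit.
  rewrite -[_ * gm _ _ _]scale1r -uq -scalerA Yr_pascal //; apply: rpredZ; apply: rpredB.
    apply: kspan_sub (Garn_in s pi a.+1 tau1 hv (_ : H s (s + sumn (pi ++ a.+1 :: d :: tau1)) _)).
      by move=> x hx; left.
    by rewrite sumn_cat /=; apply: HT_Sup; lia.
  apply: rpredZ; apply: kspan_in; right; exists d, tau1, (gm (s + sumn pi) a.+1 v.-1); split=> //.
    by lia.
  by rewrite sumn_cat /=; apply: HT_sub (gam_HT T _ _ _); lia.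
- have e1 : (s + sumn pi1 = s + sumn pi + a + sumn p2)%N by rewrite ep sumn_cat /=; lia.
  have -> : Yr s pi a.+1 tau * gm (s + sumn pi1) c v =
      xP T s ((pi ++ a.+1 :: p2) ++ c :: d :: tau1) * gm (s + sumn (pi ++ a.+1 :: p2)) c v *
      Sup T (s + sumn pi + a.+1) (s + sumn pi + a.+1 + sumn tau).
    have e2 : (s + sumn (pi ++ a.+1 :: p2) = (s + sumn pi1).+1)%N by rewrite e1 sumn_cat /=; lia.
    rewrite e2 /Yr -!mulrA gam_shift; first by rewrite {1}et -catA.
    move=> i hi; apply: (Sup_shift (bT_braids n)).
      by rewrite e1 in hi; lia.
    by rewrite et sumn_cat /=; rewrite e1 in hi; lia.
  apply: kspan_sub (Garn_in _ _ _ _ hv hS) => x hx.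
  by left; rewrite et -catA in hx *.
Qed.

(** If the next row has the same length, the removal leaves two rows in the wrong
    order, to which [xP_Z] applies. *)
Lemma Yr_stuck s pi a tau : (s + sumn (pi ++ a.+1 :: a.+1 :: tau) <= n)%N ->
  Yr s pi a.+1 (a.+1 :: tau) \in kspan (RLow s pi a.+1 (a.+1 :: tau)).
Proof.
move=> hn; have [h hh [eh _]] := Yr_left n s pi a (a.+1 :: tau).
have hn' : (s + sumn (pi ++ a :: a.+1 :: tau) <= n)%N by move: hn; rewrite !sumn_cat /=; lia.
rewrite {1}eh; apply: kspan_mull (xP_Z (ltnSn a) hn') => _ [v [h' [hv hh' ->]]].
rewrite !mulrA -eh; apply: RLow_mulr.
  by apply: (Yr_garnir hn (erefl _)); lia.
by rewrite sumn_cat /=; apply: HT_sub hh'; lia.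
Qed.

(** * Symmetrizers of arbitrary compositions *)

Fixpoint tailsum rho : nat := if rho is c :: rho' then (sumn rho' + tailsum rho')%N else 0%N.

Lemma tailsum_cat rho tau : tailsum (rho ++ tau) = (tailsum rho + size rho * sumn tau + tailsum tau)%N.
Proof. by elim: rho => //= c rho ->; rewrite sumn_cat mulSn; lia. Qed.

Lemma not_sorted_desc rho : ~~ sorted geq rho ->
  exists pi c b tau, rho = pi ++ c :: b :: tau /\ (c < b)%N.
Proof.
elim: rho => // c [|b tau] IH //=.
case: (leqP b c) => h /=; last by exists [::], c, b, tau.
by move/IH => [pi [c' [b' [tau' [e hb]]]]]; exists (c :: pi), c', b', tau'; rewrite e.
Qed.

Lemma psum_cat (rho tau : seq nat) k :
  psum (rho ++ tau) k = if (k < size rho)%N then psum rho k else (sumn rho + psum tau (k - size rho))%N.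
Proof. by rewrite /psum take_cat; case: ifP => // _; rewrite sumn_cat. Qed.

Lemma dominates_join pi c b tau v : (v <= b)%N ->
  dominates (pi ++ (c + v)%N :: (b - v)%N :: tau) (pi ++ c :: b :: tau).
Proof.
move=> hv k; rewrite !psum_cat; case: ifP => // _; rewrite leq_add2l /psum.
by case: (k - size pi)%N => [|[|j]] //=; lia.
Qed.

Lemma dominates_trans : forall la mu nu, dominates la mu -> dominates mu nu -> dominates la nu.
Proof. by move=> la mu nu h1 h2 k; apply: leq_trans (h2 k) (h1 k). Qed.

Lemma filter_xP s rho : xP T s [seq c <- rho | c != 0%N] = xP T s rho.
Proof.
elim: rho s => [|c rho IH] s //=; case: eqP => [->|_] /=; rewrite !xP_cons ?IH //.
by rewrite Xs0 mul1r addn0.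
Qed.

Lemma filter_sumn rho : sumn [seq c <- rho | c != 0%N] = sumn rho.
Proof. by elim: rho => //= c rho IH; case: eqP => [->|_] /=; rewrite IH. Qed.

Lemma filter_dominates rho : dominates [seq c <- rho | c != 0%N] rho.
Proof.
elim: rho => //= c rho IH [|k]; first by rewrite /psum !take0.
case: eqP => [->|_] /=; last by rewrite /psum /= leq_add2l; exact: IH.
apply: leq_trans (IH k) _; rewrite /psum.
move: (filter _ _) => l; elim: l k => [|x l IHl] [|k] //=.
by rewrite leq_add2l; exact: IHl.
Qed.

(** Joining adjacent rows in increasing order by [Zlem] ends with a partition. *)
Lemma xP_straighten s rho : (s + sumn rho <= n)%N ->
  xP T s rho \in kspan [set x | exists nu h h', [/\ is_part nu, sumn nu = sumn rho,
     dominates nu rho, H s (s + sumn rho) h /\ H s (s + sumn rho) h' &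
     x = h * xP T s nu * h']]%classic.
Proof.
have [k hk] := ubnP (tailsum rho); elim: k rho hk => // k IH rho hk hn.
case: (boolP (sorted geq rho)) => [srt|/not_sorted_desc[pi [c [b [tau [er hcb]]]]]].
  apply: kspan_in; exists [seq c <- rho | c != 0%N], 1, 1; split.
  - rewrite /is_part sorted_filter //=; last by move=> x y z /= h1 h2; apply: leq_trans h2 h1.
    by rewrite mem_filter.
  - exact: filter_sumn.
  - exact: filter_dominates.
  - by split; exact: gen_subalg_1.
  - by rewrite mul1r mulr1 filter_xP.
rewrite er; apply: kspan_min (xP_Z hcb _); last by rewrite -er.
move=> _ [v [h [hv hh ->]]]; rewrite xP_gam; last by lia.
set nu := pi ++ (c + v)%N :: _.
have es : sumn nu = sumn rho by rewrite er /nu !sumn_cat /=; lia.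
have hnu : xP T s nu \in kspan [set x | exists nu' h h', [/\ is_part nu', sumn nu' = sumn nu,
     dominates nu' nu, H s (s + sumn nu) h /\ H s (s + sumn nu) h' &
     x = h * xP T s nu' * h']]%classic.
  apply: IH; last by rewrite es.
  move: hk; rewrite er /nu !tailsum_cat /=.
  have -> : (c + v + (b - v + sumn tau) = c + (b + sumn tau))%N by lia.
  by lia.
set Q := kspan _; have hQ h1 h2 nu' : is_part nu' -> sumn nu' = sumn nu -> dominates nu' nu ->
    H s (s + sumn rho) h1 -> H s (s + sumn rho) h2 -> h1 * xP T s nu' * h2 \in Q.
  move=> p1 p2 p3 p4 p5; apply: kspan_in; exists nu', h1, h2; rewrite -er -es; split; rewrite -?es //.
    by apply: (dominates_trans p3); rewrite er /nu; apply: dominates_join; lia.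
  by rewrite es.
have hh' : H s (s + sumn rho) h by rewrite er sumn_cat /=; apply: HT_sub hh; lia.
have hL : H s (s + sumn rho) (Lc (s + sumn pi + c) v (b - v) : B).
  by rewrite er sumn_cat /=; apply: HT_sub (Lc_HT _ _ _ _); lia.
move: hnu; apply: (@kspan_ind _ _ _ (fun y => Lc (s + sumn pi + c) v (b - v) * y * h \in Q)).
- by rewrite mulr0 mul0r rpred0.
- by move=> c' y z hy hz; rewrite mulrDr mulrDl -scalerAr -scalerAl rpredD ?rpredZ.
move=> _ [nu' [h1 [h2 [p1 p2 p3 [p4 p5] ->]]]]; rewrite es in p4 p5.
by rewrite !mulrA -mulrA; apply: hQ => //; exact: gen_subalg_M.
Qed.

(** * Adding a node *)

Lemma Rx_sum s m : Rx T s m = \sum_(s.+1 <= j < (s + m).+1) q ^+ (s + m - j) *: Sdn T (s + m) j.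
Proof.
elim: m => [|m IH]; first by rewrite Rx0 addn0 big_geq.
rewrite RxS IH addnS [in RHS]big_nat_recr /=; last by rewrite ltnS leq_addr.
rewrite subnn scale1r Sdn_geq // addrC; congr (_ + _).
rewrite mulr_sumr scaler_sumr; apply: eq_big_nat => j hj.
rewrite -scalerAr scalerA -exprS Sdn_recl; last by lia.
by congr (_ ^+ _ *: _); lia.
Qed.

(** The element [T^-1 ... x_mu] for the addition of a node to the row of length
    [a] between the rows [pi] and [tau].  The rows of [la] itself start one step
    later than those of [mu]. *)
Definition Ya s pi a tau : B :=
  Sup U s.+1 (s + sumn pi + a).+1 * xP T s (pi ++ a.+1 :: tau).

Definition Theta s pi a : B :=
  \sum_((s + sumn pi).+1 <= j < (s + sumn pi + a).+2)
    q ^+ ((s + sumn pi + a).+1 - j) *: Sup U s.+1 j.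

(** The symmetrizer of the lengthened row is that of the row times a coset sum, and the
    inverse string carries this sum to the one that occurs in [b_t]. *)
Lemma Ya_Theta s pi a tau : (s + sumn (pi ++ a :: tau) < n)%N ->
  Ya s pi a tau = xP T s.+1 (pi ++ a :: tau) * Theta s pi a.
Proof.
rewrite sumn_cat /= => hn; rewrite /Ya /Theta !xP_cat !xP_cons XsS Rx_sum addnS addSn.
set S := (s + sumn pi)%N.
set u := Sup U _ _.
have sh i : (s < i)%N -> (i < S + a)%N -> u * T i = T i.+1 * u.
  by move=> h1 h2; apply: (SupU_shift (bT_braids n) (@bT_quadratic n)); rewrite -/S; lia.
have e1 : u * xP T s pi = xP T s.+1 pi * u by apply: xP_shift => i hi; apply: sh; lia.
have e2 : u * X S a = X S.+1 a * u by apply: Xs_shift => i hi; apply: sh; lia.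
rewrite [LHS]mulrA e1 -!mulrA (mulrA u) e2 -!mulrA; congr (_ * (_ * _)).
rewrite mulrA mulr_sumr.
have -> : \sum_(S.+1 <= j < (S + a).+2) u * (q ^+ ((S + a).+1 - j) *: Sdn T (S + a).+1 j) =
    \sum_(S.+1 <= j < (S + a).+2) q ^+ ((S + a).+1 - j) *: Sup U s.+1 j.
  apply: eq_big_nat => j hj; rewrite -scalerAr; congr (_ *: _).
  rewrite /u -(@Sup_cat _ U s.+1 j); last by rewrite -/S; lia.
  rewrite -mulrA (SupU_SdnT (@bT_quadratic n)) ?mulr1 //; rewrite -/S; lia.
rewrite addSn; apply: (HT_comm _ (xP_HT T _ _)) => i hi; apply: esym.
apply: comm_sum_nat => j hj; apply: commrZ.
by apply: SupU_comm => k hk; apply: (T_comm (bT_braids n)); lia.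
Qed.

Lemma U_xP s pi b tau i : (s + sumn (pi ++ b :: tau) <= n)%N ->
  (s + sumn pi < i < s + sumn pi + b)%N ->
  U i * xP T s (pi ++ b :: tau) = q^-1 *: xP T s (pi ++ b :: tau).
Proof.
rewrite sumn_cat /= => hn hi; rewrite xP_cat xP_cons !mulrA.
have -> : U i * xP T s pi = xP T s pi * U i.
  apply: esym; apply: comm_U; apply: esym; apply: (HT_comm _ (xP_HT T _ _)) => j hj.
  by apply: (T_comm (bT_braids n)); lia.
by rewrite -(mulrA (xP T s pi)) UXs -?scalerAr -?scalerAl //; lia.
Qed.

Lemma SupU_xP s pi b tau i j : (s + sumn (pi ++ b :: tau) <= n)%N ->
  (s + sumn pi < i)%N -> (i <= j)%N -> (j <= s + sumn pi + b)%N ->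
  Sup U i j * xP T s (pi ++ b :: tau) = q ^- (j - i) *: xP T s (pi ++ b :: tau).
Proof.
move=> hn h1 h2; elim: j h2 => [|j IH] h2 h3; first by lia.
have [e|h4] : i = j.+1 \/ (i <= j)%N by lia.
  by rewrite e Sup_geq // mul1r subnn invr1 scale1r.
rewrite Sup_recr // -mulrA U_xP //; last by lia.
rewrite -scalerAr IH //; last by lia.
by rewrite scalerA -exprVn -exprS subSn // exprVn.
Qed.

Lemma xP_gam_join s pi c v tau :
  xP T s (pi ++ c :: v :: tau) * gm (s + sumn pi) c v = xP T s (pi ++ (c + v)%N :: tau).
Proof.
rewrite !xP_cat !xP_cons addnA -(Xs_gam n) -!mulrA; congr (_ * (_ * (_ * _))).
by apply: esym; apply: (HT_HT_comm (leqnn _) (gam_HT T _ _ _) (xP_HT T _ _)).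
Qed.

Lemma Ya_pair s pi a d tau v : (s + sumn (pi ++ a :: d :: tau) < n)%N -> (v <= d)%N ->
  Ya s pi a (d :: tau) * gm (s + sumn pi) a.+1 v =
  q ^+ v *: (Lc (s + sumn pi + a.+1) v (d - v) * Ya s pi (a + v) ((d - v)%N :: tau)).
Proof.
rewrite sumn_cat /= => hn hv; rewrite /Ya -mulrA xP_gam //.
set S := (s + sumn pi)%N; set y := xP T s _.
have hu : H s (S + a.+1)%N (Sup U s.+1 (S + a).+1) by apply: HT_SupU; rewrite /S; lia.
rewrite mulrA (HT_HT_comm (leqnn _) hu (Lc_HT n (S + a.+1) v (d - v))).
rewrite -mulrA scalerAr; congr (_ * _).
rewrite -(@Sup_cat _ U s.+1 (S + a).+1 (S + (a + v)).+1); last by rewrite /S; lia.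
have e : (a.+1 + v = (a + v).+1)%N by lia.
rewrite -mulrA /y e SupU_xP; try by rewrite ?sumn_cat /= /S; lia.
rewrite -scalerAr scalerA (_ : ((S + (a + v)).+1 - (S + a).+1 = v)%N); last by lia.
by rewrite mulrV ?scale1r // unitrX ?kq_unit.
Qed.

(** The straightening of an addition moves it to the row just above. *)
Definition RUp s pi a tau : set B := [set x |
  RG s.+1 (pi ++ a :: tau) s (s + sumn (pi ++ a :: tau)).+1 x \/
  exists pi1 c h, [/\ pi = pi1 ++ [:: c], H s (s + sumn (pi ++ a :: tau)).+1 h &
    x = Ya s pi1 c (a :: tau) * h]]%classic.

Lemma RUp_mulr s pi a tau y h : y \in kspan (RUp s pi a tau) ->
  H s (s + sumn (pi ++ a :: tau)).+1 h -> y * h \in kspan (RUp s pi a tau).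
Proof.
move=> hy hh; apply: kspan_mulr hy => x [[g [h' [hg hh' ->]]]|[pi1 [c [h' [ep hh' ->]]]]].
  apply: kspan_in; left; exists g, (h' * h); split; rewrite ?mulrA //.
  exact: gen_subalg_M.
apply: kspan_in; right; exists pi1, c, (h' * h); split; rewrite ?mulrA //.
exact: gen_subalg_M.
Qed.

Lemma Theta_HT s pi a e : (s + sumn pi + a < e)%N -> H s e (Theta s pi a).
Proof.
move=> he; rewrite /Theta big_nat_cond.
apply: big_ind; [exact: gen_0 | by move=> x y; exact: gen_subalg_D | ].
move=> j; rewrite andbT => hj; apply: gen_subalg_Z; apply: HT_SupU; lia.
Qed.

Lemma Ya_garnir s pi a tau pi1 c d tau1 v : (s + sumn (pi ++ a :: tau) < n)%N ->
  pi ++ a.+1 :: tau = pi1 ++ c :: d :: tau1 -> (0 < v <= d)%N ->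
  Ya s pi a tau * gm (s + sumn pi1) c v \in kspan (RUp s pi a tau).
Proof.
move=> hn /rows_cases hc hv.
have hTh : H s (s + sumn (pi ++ a :: tau)).+1 (Theta s pi a).
  by rewrite sumn_cat /=; apply: Theta_HT; lia.
case: hc => [[p2 [ep et]]|[ep ed et]|[ep ec et]|[p2 [ep et]]].
- rewrite Ya_Theta // -mulrA gam_shift; last first.
    move=> i hi; rewrite /Theta mulr_suml mulr_sumr; apply: eq_big_nat => j hj.
    rewrite -scalerAl -scalerAr; congr (_ *: _).
    move: hn; rewrite sumn_cat /= => hn; rewrite ep sumn_cat /= in hj hn.
    by apply: (SupU_shift (bT_braids n) (@bT_quadratic n)); lia.
  have e : pi ++ a :: tau = pi1 ++ c :: d :: (p2 ++ a :: tau) by rewrite ep -catA.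
  rewrite mulrA {1}e -addSn; apply: kspan_sub (Garn_in _ _ _ _ hv hTh) => x hx.
  by left; rewrite {1}e.
- have [w ew] : exists w, v = w.+1 by exists v.-1; lia.
  rewrite ed ew in hv *; set S1 := (s + sumn pi1)%N.
  have eS : (s + sumn pi = S1 + c)%N by rewrite ep sumn_cat /= /S1; lia.
  have hn1 : (S1 + c + a + sumn tau < n)%N by move: hn; rewrite sumn_cat /=; lia.
  (* The terms with [j > S + v] commute past the Garnir element. *)
  pose Th2 := \sum_((s + sumn pi + w).+2 <= j < (s + sumn pi + a).+2)
    q ^+ ((s + sumn pi + a).+1 - j) *: Sup U s.+1 j.
  have eT : Theta s pi a = q ^+ (a - w) *: Theta s pi w + Th2.
    rewrite /Theta (@big_cat_nat _ _ _ (s + sumn pi + w).+2) /=; try lia.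
    congr (_ + _); rewrite scaler_sumr; apply: eq_big_nat => j hj.
    by rewrite scalerA -exprD; congr (_ ^+ _ *: _); lia.
  have hT2 : Th2 * gm S1 c w.+1 = gm S1.+1 c w.+1 * Th2.
    apply: gam_shift => i hi; rewrite /Th2 mulr_suml mulr_sumr; apply: eq_big_nat => j hj.
    rewrite -scalerAl -scalerAr; congr (_ *: _).
    by apply: (SupU_shift (bT_braids n) (@bT_quadratic n)); rewrite /S1 in hi; lia.
  have hTh2 : H s (s + sumn (pi ++ a :: tau)).+1 Th2.
    rewrite /Th2 big_nat_cond; apply: big_ind; [exact: gen_0 | by move=> x y; exact: gen_subalg_D | ].
    move=> j; rewrite andbT sumn_cat /= => hj.
    by apply: gen_subalg_Z; apply: HT_SupU; lia.
  have e : pi ++ a :: tau = pi1 ++ c :: a :: tau by rewrite ep -catA.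
  rewrite Ya_Theta // eT mulrDr mulrDl; apply: rpredD; last first.
    rewrite -mulrA hT2.
    have [ewa|hwa] : w = a \/ (w < a)%N by lia.
      by rewrite /Th2 ewa big_geq // !mulr0 rpred0.
    rewrite mulrA {1}e -addSn.
    have hv' : (0 < w.+1 <= a)%N by lia.
    apply: kspan_sub (Garn_in _ _ _ _ hv' hTh2) => x hx.
    by left; rewrite {1}e.
  rewrite -scalerAr -scalerAl; apply: rpredZ.
  have -> : xP T s.+1 (pi ++ a :: tau) * Theta s pi w * gm S1 c w.+1 =
      q ^- w *: (Ya s pi1 c (a :: tau) * gm S1 c.+1 w).
    rewrite Ya_pair; [|by rewrite sumn_cat /= -/S1; lia|by lia].
    rewrite scalerA mulVr ?unitrX ?kq_unit // scale1r.
    have {1}-> : a = (w + (a - w))%N by lia.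
    rewrite xP_split -!mulrA.
    have eL : (s.+1 + sumn pi = S1 + c.+1)%N by lia.
    rewrite eL -[in RHS]/S1; congr (_ * _).
    rewrite mulrA -Ya_Theta; last by rewrite sumn_cat /=; lia.
    rewrite /Ya -mulrA {2}ep -catA /= xP_gam_join -/S1 addnS.
    by congr (Sup _ _ _.+1 * _); lia.
  apply: rpredZ; apply: kspan_in; right; exists pi1, c, (gm S1 c.+1 w); split=> //.
  by rewrite sumn_cat /=; apply: HT_sub (gam_HT T _ _ _); lia.
- rewrite ec et in hn hTh *; rewrite ep Ya_pair //; last by lia.
  apply: rpredZ; rewrite Ya_Theta; last by move: hn; rewrite !sumn_cat /=; lia.
  have := @xP_gam n s.+1 pi a d tau1 v; rewrite addSn addSnnS => e.
  rewrite mulrA -e; last by lia.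
  rewrite -addSn; apply: kspan_sub (Garn_in s.+1 pi a tau1 hv (_ : H s (s + sumn (pi ++ a :: d :: tau1)).+1 _)).
    by move=> x hx; left.
  by rewrite sumn_cat /=; apply: Theta_HT; lia.
- have e1 : (s + sumn pi1 = (s + sumn pi + a).+1 + sumn p2)%N by rewrite ep sumn_cat /=; lia.
  have c1 : GRing.comm (Theta s pi a) (gm (s + sumn pi1) c v).
    apply: (HT_HT_comm (a := s) (b := (s + sumn pi + a).+1) _ _ (gam_HT T _ _ _)); first by lia.
    by apply: Theta_HT; lia.
  rewrite Ya_Theta // -mulrA c1 mulrA.
  have e : pi ++ a :: tau = (pi ++ a :: p2) ++ c :: d :: tau1 by rewrite et -catA.
  have e2 : (s + sumn pi1 = s.+1 + sumn (pi ++ a :: p2))%N by rewrite e1 sumn_cat /=; lia.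
  rewrite {1}e e2; apply: kspan_sub (Garn_in _ _ _ _ hv hTh) => x hx.
  by left; rewrite {1}e.
Qed.

(** If the row above has the same length, the addition leaves two rows in the wrong order. *)
Lemma Ya_stuck s pi c tau : (s + sumn (pi ++ c :: c :: tau) < n)%N ->
  Ya s (pi ++ [:: c]) c tau \in kspan (RUp s (pi ++ [:: c]) c tau).
Proof.
move=> hn; have hn' : (s + sumn (pi ++ c :: c.+1 :: tau) <= n)%N.
  by move: hn; rewrite !sumn_cat /=; lia.
have hn2 : (s + sumn ((pi ++ [:: c]) ++ c :: tau) < n)%N by rewrite -catA.
rewrite {1}/Ya -catA /=; apply: kspan_mull (xP_Z (ltnSn c) hn') => _ [v [h [hv hh ->]]].
have -> : pi ++ c :: c.+1 :: tau = (pi ++ [:: c]) ++ c.+1 :: tau by rewrite -catA.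
rewrite !mulrA -/(Ya s (pi ++ [:: c]) c tau); apply: RUp_mulr.
  by apply: (Ya_garnir hn2 (tau1 := tau) (d := c.+1)); [rewrite -catA | lia].
by rewrite -catA sumn_cat /=; apply: HT_sub hh; lia.
Qed.

End Branching.
Arguments Ya {n} s pi a tau.
Arguments RLow {n} s pi a tau.
Arguments RUp {n} s pi a tau.
Arguments Theta {n} s pi a.

(** * Systems of generators of q-Brauer type *)

HB.lock Definition e2 (n : nat) (T : nat -> qBrauer n) (E : qBrauer n) : qBrauer n :=
  E * (T 2%N * (T 3%N * (Uof T 1 * (Uof T 2 * E)))).

Section Systems.
Variable n : nat.
Local Notation B := (qBrauer n).
Local Notation q := kq.
Local Notation z := kz.
Local Notation del := kdelta.
Local Notation d := (kq - kq^-1).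
Implicit Types (T : nat -> B) (E x y : B) (m i j k f : nat).

Lemma e2E T E : e2 T E = E * (T 2%N * (T 3%N * (Uof T 1 * (Uof T 2 * E)))).
Proof. by rewrite e2.unlock. Qed.

(** The defining relations of [B_m] for elements of the big algebra.  Besides
    the generators themselves they hold for [T_3, T_4, ...] and a multiple of
    [E_(2)], which lets one prove facts about [E^f] by induction on [f]. *)
Record qbs m T E : Prop := Qbs {
  qb_br : braids T;
  qb_qu : quadratic T m;
  qb_sT : forall i, bsigma (T i) = T i;
  qb_sE : bsigma E = E;
  qb_EE : E * E = del *: E;
  qb_TE : T 1%N * E = q *: E;
  qb_ETE : (2 < m)%N -> E * (T 2%N * E) = z *: E;
  qb_C : forall i, (2 < i)%N -> GRing.comm (T i) E;
  qb_gl : (3 < m)%N -> T 2%N * (T 3%N * (Uof T 1%N * (Uof T 2 * e2 T E))) = e2 T E;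
  qb_gr : (3 < m)%N -> e2 T E * (T 2%N * (T 3%N * (Uof T 1%N * Uof T 2))) = e2 T E }.

Lemma del_unit : del \is a GRing.unit.
Proof. by rewrite unitrMr ?kdz_unit // unitrV kdq_unit. Qed.

Lemma d_del : d * del = z - z^-1.
Proof. by rewrite /kdelta mulrC divrK // kdq_unit. Qed.

Lemma delV x : del^-1 *: (del *: x) = x.
Proof. by rewrite scalerA mulVr ?del_unit // scale1r. Qed.

Lemma Vdel x : del *: (del^-1 *: x) = x.
Proof. by rewrite scalerA mulrV ?del_unit // scale1r. Qed.

Section OneSystem.
Variables (m : nat) (T : nat -> B) (E : B).
Hypotheses (hq : qbs m T E) (hm : (1 < m)%N).
Local Notation U := (Uof T).
Local Notation F := (e2 T E).

Lemma qb_bU i : bsigma (U i) = U i.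
Proof. by rewrite UofE bsigmaD -scaleNr bsigmaZ bsigma1 (qb_sT hq) scaleNr. Qed.

Lemma qb_ET : E * T 1 = q *: E.
Proof. by rewrite -[LHS]bsigmaK bsigmaM (qb_sT hq) (qb_sE hq) (qb_TE hq) bsigmaZ (qb_sE hq). Qed.

Lemma qb_UE : U 1 * E = q^-1 *: E.
Proof. by rewrite UofE mulrBl (qb_TE hq) mulr_algl -scalerBl opprB addrC subrK. Qed.

Lemma qb_EU : E * U 1 = q^-1 *: E.
Proof. by rewrite UofE mulrBr qb_ET mulr_algr -scalerBl opprB addrC subrK. Qed.

Lemma qb_EUE : (2 < m)%N -> E * (U 2 * E) = z^-1 *: E.
Proof.
move=> h; rewrite UofE mulrBl mulrBr (qb_ETE hq) // mulr_algl -scalerAr (qb_EE hq) scalerA.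
by rewrite d_del -scalerBl opprB addrC subrK.
Qed.

Lemma qb_CU i : (2 < i)%N -> GRing.comm (U i) E.
Proof. by move=> h; apply: esym; apply: comm_U; apply: esym; exact: (qb_C hq). Qed.

Lemma qb_HT_E a b x : (2 <= a)%N -> HT T a b x -> GRing.comm E x.
Proof. by move=> ha; apply: HT_comm => i hi; apply: esym; apply: (qb_C hq); lia. Qed.

Let c_TT i j : (i.+1 < j)%N || (j.+1 < i)%N -> GRing.comm (T i) (T j).
Proof. exact: (T_comm (qb_br hq)). Qed.
Let c_TU i j : (i.+1 < j)%N || (j.+1 < i)%N -> GRing.comm (T i) (U j).
Proof. by move=> h; apply: comm_U; exact: c_TT. Qed.
Let c_UU i j : (i.+1 < j)%N || (j.+1 < i)%N -> GRing.comm (U i) (U j).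
Proof. by move=> h; apply: comm_U; apply: esym; apply: c_TU; lia. Qed.
Let TUx i y : (0 < i < m)%N -> T i * (U i * y) = y.
Proof. by move=> h; rewrite mulrA (TU (qb_qu hq)) // mul1r. Qed.
Let UTx i y : (0 < i < m)%N -> U i * (T i * y) = y.
Proof. by move=> h; rewrite mulrA (UT (qb_qu hq)) // mul1r. Qed.

Section Four.
Hypothesis h3 : (3 < m)%N.

Let h1' : (0 < 1 < m)%N. Proof. lia. Qed.
Let h2' : (0 < 2 < m)%N. Proof. lia. Qed.
Let h3' : (0 < 3 < m)%N. Proof. lia. Qed.
Let h2m : (2 < m)%N. Proof. lia. Qed.

Let T2E : T 2 = U 2 + d%:A. Proof. by rewrite UofE subrK. Qed.
Let T13 : T 1 * T 3 = T 3 * T 1. Proof. exact: c_TT. Qed.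
Let br12 := braidE (qb_br hq) 1.
Let br23 := braidE (qb_br hq) 2.

Lemma e2_sigma : bsigma F = F.
Proof.
rewrite e2E !bsigmaM !qb_bU !(qb_sT hq) (qb_sE hq) -!mulrA.
apply: (e2_rev (TU (qb_qu hq) h1') (UT (qb_qu hq) h1') T2E Vq T13 (qb_TE hq) qb_ET (qb_ETE hq h2m)).
by apply: (qb_C hq).
Qed.

Lemma e2_r : F * (U 2 * (U 1 * (T 3 * T 2))) = F.
Proof.
have := qb_gr hq h3; rewrite e2E => gr.
exact: (e2_revr (TU (qb_qu hq) h1') (UT (qb_qu hq) h1') (TU (qb_qu hq) h2') (UT (qb_qu hq) h2')
  (TU (qb_qu hq) h3') T2E Vq T13 br12 br23 qb_ET gr).
Qed.

Lemma e2_E : F * E = del *: F.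
Proof. by rewrite e2E -!mulrA (qb_EE hq) -!scalerAr. Qed.

Lemma E_e2 : E * F = del *: F.
Proof. by rewrite e2E mulrA (qb_EE hq) -scalerAl. Qed.

Lemma e2_EE y : F * (E * y) = del *: (F * y).
Proof. by rewrite mulrA e2_E -scalerAl. Qed.

Lemma e2_e2 : F * F = del ^+ 2 *: F.
Proof.
rewrite {2}e2E e2_EE expr2 -scalerA; congr (_ *: _).
have := congr1 (fun x => x * E) (qb_gr hq h3); rewrite -!mulrA => ->.
exact: e2_E.
Qed.

Lemma e2_comm x : GRing.comm x E -> GRing.comm x (T 2) -> GRing.comm x (T 3) ->
  GRing.comm x (T 1) -> GRing.comm x F.
Proof.
move=> hE a2 a3 a1; rewrite e2E.
by do ![apply: commrM => //]; apply: comm_U.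
Qed.

Lemma e2_U2U1 y : F * (U 2 * (U 1 * y)) = F * (U 2 * (U 3 * y)).
Proof.
have e : F * (U 2 * U 1) = F * (U 2 * U 3).
  rewrite -[in RHS]e2_r -!mulrA; congr (F * (U 2 * _)).
  by rewrite TUx // (TU (qb_qu hq)) ?mulr1.
by have := congr1 (fun x => x * y) e; rewrite -!mulrA.
Qed.

Lemma T3_e2 : T 3 * F = q *: F.
Proof.
have hs : T 3 * (T 2 * (T 3 * (U 1 * U 2))) = T 2 * (T 3 * (U 1 * U 2)) * T 1.
  have e1 : U 1 * (U 2 * T 1) = T 2 * (U 1 * U 2).
    have := SupU_shift (qb_br hq) (qb_qu hq) (a := 1) (b := 3) (i := 1) isT h2m isT isT.
    by rewrite Sup_recr // Sup1 -!mulrA.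
  by rewrite -!mulrA e1 (mulrA (T 3)) (mulrA (T 3 * T 2)) -(mulrA (T 3) (T 2)) -br23 -!mulrA.
rewrite -{1}(qb_gl hq h3).
have := congr1 (fun x => x * F) hs; rewrite -!mulrA => ->.
have -> : T 1 * F = q *: F by rewrite e2E mulrA (qb_TE hq) -scalerAl.
by rewrite -!scalerAr (qb_gl hq h3).
Qed.

Lemma e2_T3 : F * T 3 = q *: F.
Proof. by rewrite -[LHS]bsigmaK bsigmaM (qb_sT hq) e2_sigma T3_e2 bsigmaZ e2_sigma. Qed.

Lemma e2_U3 y : F * (U 3 * y) = q^-1 *: (F * y).
Proof.
by rewrite mulrA UofE mulrBr e2_T3 mulr_algr -scalerBl opprB addrC subrK -scalerAl.
Qed.

Lemma e2_U1 y : F * (U 1 * y) = q^-1 *: (F * y).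
Proof. by rewrite e2E -!mulrA (mulrA E (U 1)) qb_EU -!scalerAl -!scalerAr. Qed.

(** [E_(2) T_4 E_(2) = delta z E_(2)], the relation [E_1 T_2 E_1 = z E_1] of the
    shifted system. *)
Lemma e2_T4_e2 : (4 < m)%N -> F * (T 4 * F) = (del * z) *: F.
Proof.
move=> h4; have h4' : (0 < 4 < m)%N by lia.
have cE i : (2 < i)%N -> T i * E = E * T i by move=> hi; exact: (qb_C hq).
have cUE i : (2 < i)%N -> U i * E = E * U i by move=> hi; exact: qb_CU.
have cxE x y : GRing.comm x E -> x * (E * y) = E * (x * y) by move=> h; rewrite !mulrA h.
rewrite {2}e2E cxE; last exact: (qb_C hq).
rewrite e2_EE -scalerA; congr (_ *: _).
have x24 y : T 4 * (T 2 * y) = T 2 * (T 4 * y) by rewrite !mulrA c_TT.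
have xU2T4 y : U 2 * (T 4 * y) = T 4 * (U 2 * y) by rewrite !mulrA c_TU.
have xU1 i y : (2 < i)%N -> T i * (U 1 * y) = U 1 * (T i * y).
  by move=> hi; rewrite !mulrA c_TU //; lia.
have xU4U2 y : U 4 * (U 2 * y) = U 2 * (U 4 * y) by rewrite !mulrA c_UU.
have FE y : F * y = del^-1 *: (F * (E * y)) by rewrite e2_EE delV.
have FxE x y : GRing.comm x E -> F * (x * (E * y)) = del *: (F * (x * y)).
  by move=> h; rewrite cxE // e2_EE.
have FxUE x y : GRing.comm x E -> F * (x * (U 2 * (E * y))) = z^-1 *: (F * (x * y)).
  move=> h; rewrite FE -cxE // (mulrA (U 2)) (mulrA E) qb_EUE // -scalerAl -!scalerAr.
  rewrite FxE // !scalerA; congr (_ *: _).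
  by rewrite mulrC mulrA mulrV ?del_unit ?mul1r.
have cM x y : GRing.comm x E -> GRing.comm y E -> GRing.comm (x * y) E.
  by move=> hx hy; apply: esym; apply: commrM; apply: esym.
have cT3 : GRing.comm (T 3) E by exact: (qb_C hq).
have cT4 : GRing.comm (T 4) E by exact: (qb_C hq).
have cU3 : GRing.comm (U 3) E by exact: qb_CU.
rewrite x24 [T 2 * (_ * _)](_ : _ = U 2 * (T 4 * (T 3 * (U 1 * (U 2 * E)))) +
  d *: (T 4 * (T 3 * (U 1 * (U 2 * E))))); last by rewrite T2E mulrDl mulr_algl.
(* the contribution of [U_2] *)
have a1 : F * (U 2 * (T 4 * (T 3 * (U 1 * (U 2 * E))))) =
    z^-1 *: F - (z^-1 * d * q^-1) *: (F * (U 4 * T 3)) + (d * del) *: F - (d ^+ 2 * z^-1) *: F.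
  have y343 y : U 3 * (T 4 * (T 3 * y)) = T 4 * (T 3 * (U 4 * y)).
    have := Sdn_shift (qb_br hq) (a := 3) (b := 5) (i := 3) isT isT.
    rewrite Sdn_recl // Sdn1 => e.
    have := congr1 (fun x => U 3 * x * (U 4 * y)) e; by rewrite -!mulrA UTx // TUx // => ->.
  have u232 y : U 2 * (T 3 * (U 2 * y)) = U 3 * (U 2 * (U 3 * y)) + d *: y - d ^+ 2 *: (U 2 * y).
    have -> : T 3 * (U 2 * y) = U 3 * (U 2 * y) + d *: (U 2 * y).
      by rewrite [in RHS]UofE mulrBl mulr_algl subrK.
    rewrite mulrDr -scalerAr (mulrA (U 2) (U 2)) (U_sqr (qb_qu hq)) //.
    rewrite mulrBl mul1r -scalerAl scalerBr scalerA addrA; congr (_ + _ - _).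
    have := U_braid (qb_br hq) (qb_qu hq) (i := 2) isT h3.
    by move/(congr1 (fun x => x * y)); rewrite -!mulrA.
  have t343 : T 4 * (U 3 * U 4) = U 3 * (U 4 * T 3).
    have := SupU_shift (qb_br hq) (qb_qu hq) (a := 3) (b := 5) (i := 3) isT h4 isT isT.
    by rewrite Sup_recr // Sup1 -!mulrA.
  rewrite xU1 // xU1 // e2_U2U1 y343 xU2T4 xU4U2 cUE // u232.
  rewrite [T 4 * (_ - _)]mulrBr [T 4 * (_ + _)]mulrDr [F * (_ - _)]mulrBr [F * (_ + _)]mulrDr.
  rewrite -!scalerAr FxUE // FxE // (TU (qb_qu hq)) // mulr1.
  congr (_ + _ - _); rewrite ?scalerA //.
  rewrite (mulrA (U 3) E) cU3 -mulrA (mulrA (T 4)) FxUE; last exact: cM.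
  rewrite -mulrA (mulrA (U 3) (U 3)) (U_sqr (qb_qu hq)) // mulrBl mul1r -scalerAl.
  rewrite !mulrBr (TU (qb_qu hq)) // mulr1 -!scalerAr t343 e2_U3 scalerBr !scalerA.
  by rewrite !(mulrBr, mulrBl).
have a2 : F * (T 4 * (T 3 * (U 1 * (U 2 * E)))) = (q^-1 * z^-1) *: (F * (T 4 * T 3)).
  rewrite xU1 // xU1 // e2_U1 -[U 2 * E]mulr1 -(mulrA (U 2)) (mulrA (T 4)) FxUE; last exact: cM.
  by rewrite mulr1 scalerA.
have a3 : F * (T 4 * T 3) = F * (U 4 * T 3) + (d * q) *: F.
  rewrite [in RHS]UofE mulrBl mulrBr mulr_algl -scalerAr e2_T3 scalerA.
  by rewrite subrK.
  rewrite mulrDr -scalerAr a1 a2 a3 !scalerDr !scalerA.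
have -> : z *: F = z^-1 *: F + (d * del) *: F by rewrite -scalerDl d_del addrC subrK.
have -> : d * (q^-1 * z^-1) * (d * q) = d ^+ 2 * z^-1.
  by rewrite -[RHS]mulr1 -Vq; ring.
have -> : d * (q^-1 * z^-1) = z^-1 * d * q^-1 by ring.
move: (z^-1 *: F) (_ *: (F * (U 4 * T 3))) ((d * del) *: F) ((d ^+ 2 / z) *: F) => x1 x2 x3 x4.
by rewrite [x2 + x4]addrC addrA subrK addrAC subrK.
Qed.
End Four.
End OneSystem.
End Systems.

(** * Powers of E and the shifted system *)

HB.lock Definition Ep (n : nat) (T : nat -> qBrauer n) (E : qBrauer n) :=
  fix Ep (k : nat) : qBrauer n :=
    if k is k'.+1 then E * (Sup T 2 k'.*2.+2 * (Sup (Uof T) 1 k'.*2.+1 * Ep k')) else 1.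

Section Powers.
Variable n : nat.
Local Notation B := (qBrauer n).
Local Notation q := kq.
Local Notation z := kz.
Local Notation del := kdelta.
Local Notation d := (kq - kq^-1).
Implicit Types (T : nat -> B) (E x y : B) (m i j k f : nat).

Lemma Ep0 T E : Ep T E 0 = 1. Proof. by rewrite Ep.unlock. Qed.
Lemma EpS T E k :
  Ep T E k.+1 = E * (Sup T 2 k.*2.+2 * (Sup (Uof T) 1 k.*2.+1 * Ep T E k)).
Proof. by rewrite Ep.unlock. Qed.
Lemma Ep1 T E : Ep T E 1 = E.
Proof. by rewrite EpS Ep0 !Sup_geq // !mulr1. Qed.

Definition shT T : nat -> B := fun i => T i.+2.
Definition shE T E : B := del^-1 *: e2 T E.

Lemma U_shT T i : Uof (shT T) i = Uof T i.+2.
Proof. by rewrite !UofE. Qed.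

Lemma Sup_sh2 (F : nat -> B) a b : Sup (fun i => F i.+2) a b = Sup F a.+2 b.+2.
Proof.
have [h|h] := leqP b a; first by rewrite !Sup_geq //; lia.
elim: b h => // b IH h; case: (ltngtP a b) => hab; try lia.
- by rewrite (@Sup_recr _ _ a b) ?(@Sup_recr _ _ a.+2 b.+2) ?IH //; lia.
- by rewrite hab !Sup1.
Qed.

Lemma Sup_UshT T a b : Sup (Uof (shT T)) a b = Sup (Uof T) a.+2 b.+2.
Proof.
by rewrite -Sup_sh2 /Sup /pr; apply: eq_bigr => i _; rewrite U_shT.
Qed.

Lemma qbs_le T E m m' : (m' <= m)%N -> qbs m T E -> qbs m' T E.
Proof.
move=> h hq; split; try by case: hq.
- by move=> i hi; apply: (qb_qu hq); lia.
- by move=> h2; apply: (qb_ETE hq); lia.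
- by move=> h2; apply: (qb_gl hq); lia.
- by move=> h2; apply: (qb_gr hq); lia.
Qed.

Section Shifted.
Variables (m : nat) (T : nat -> B) (E : B).
Hypotheses (hq : qbs m T E) (h3 : (3 < m)%N).
Local Notation U := (Uof T).
Local Notation F := (e2 T E).

Let hm : (1 < m)%N. Proof. lia. Qed.

(** [T_i] is moved by two past [T_2T_3T_1^-1T_2^-1] followed by its shift, which
    gives the last two relations for the shifted system. *)
Lemma e2_shift : (5 < m)%N ->
  T 4 * (T 5 * (U 3 * (U 4 * (F * (T 4 * (T 5 * (U 3 * (U 4 * F)))))))) =
    F * (T 4 * (T 5 * (U 3 * (U 4 * F)))) /\
  F * (T 4 * (T 5 * (U 3 * (U 4 * (F * (T 4 * (T 5 * (U 3 * U 4)))))))) =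
    F * (T 4 * (T 5 * (U 3 * (U 4 * F)))).
Proof.
move=> h5.
have [g hg] : exists x, x = T 2%N * (T 3%N * (U 1%N * U 2%N)) by eexists.
have [g' hg'] : exists x, x = T 4%N * (T 5%N * (U 3%N * U 4%N)) by eexists.
have cE i : (2 < i)%N -> GRing.comm E (T i) by move=> hi; apply: esym; exact: (qb_C hq).
have cEU i : (2 < i)%N -> GRing.comm E (U i) by move=> hi; apply: comm_U; exact: cE.
have cEg' : E * g' = g' * E by rewrite hg'; do ![apply: commrM => //]; by [apply: cE | apply: cEU].
have eF : F = E * (g * E) by rewrite e2E hg -!mulrA.
have gg : g * g' = Sup T 2 6 * Sup U 1 5.
  have c2 i y : (3 < i)%N -> U 2 * (T i * y) = T i * (U 2 * y).
    by move=> hi; rewrite !mulrA; congr (_ * _); apply: esym; apply: comm_U; apply: (T_comm (qb_br hq)); lia.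
  have c1 i y : (3 < i)%N -> U 1 * (T i * y) = T i * (U 1 * y).
    by move=> hi; rewrite !mulrA; congr (_ * _); apply: esym; apply: comm_U; apply: (T_comm (qb_br hq)); lia.
  rewrite (@Sup_recl _ T 2) // (@Sup_recl _ T 3) // (@Sup_recl _ T 4) // Sup1.
  rewrite (@Sup_recl _ U 1) // (@Sup_recl _ U 2) // (@Sup_recl _ U 3) // Sup1 hg hg' -!mulrA.
  by rewrite c2 // c2 // c1 // c1.
have sh i : (0 < i < 4)%N -> T i.+2 * (g * g') = g * g' * T i.
  move=> hi; rewrite gg -mulrA (SupU_shift (qb_br hq) (qb_qu hq)) //; try lia.
  by rewrite !mulrA (Sup_shift (qb_br hq)) //; lia.
have shU i : (0 < i < 4)%N -> U i.+2 * (g * g') = g * g' * U i.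
  by move=> hi; rewrite !UofE mulrBl mulrBr sh // mulr_algl mulr_algr.
have ggg : g' * (g * g') = g * g' * g.
  rewrite {1}hg' {3}hg; move: (g * g') sh shU => G sh shU.
  rewrite -!mulrA shU // (mulrA (U 3)) shU // -mulrA (mulrA (T 5)) sh // -mulrA.
  by rewrite (mulrA (T 4)) sh // -mulrA.
have gF : g * F = F by rewrite hg -!mulrA (qb_gl hq).
have Fg : F * g = F by rewrite hg (qb_gr hq).
have fl y : g' * y = T 4 * (T 5 * (U 3 * (U 4 * y))) by rewrite hg' -!mulrA.
rewrite -!fl -hg'.
have e1 : F * (g' * F) = del *: (E * (g * (g' * F))).
  by rewrite {1}eF -!mulrA (mulrA E g') cEg' -(mulrA g') (E_e2 hq) // -!scalerAr.
have e2' : F * (g' * F) = del *: (F * (g' * (g * E))).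
  rewrite {2}eF (mulrA g') -cEg' -(mulrA E) (mulrA F) (e2_E hq) // -scalerAl.
  by [].
split.
- rewrite e1 -scalerAr (mulrA g') -cEg' -(mulrA E); congr (_ *: (_ * _)).
  by rewrite (mulrA g g' F) (mulrA g' (g * g') F) ggg -!mulrA gF.
- rewrite (mulrA g' F) (mulrA F (g' * F)) e2' -scalerAl; congr (_ *: _).
  rewrite -!(mulrA F) -!(mulrA g') -(mulrA g) cEg' (mulrA g g') (mulrA g' (g * g')) ggg.
  by rewrite -!mulrA (mulrA F g) Fg.
Qed.

(** Hence a statement about all systems can be used for the shifted one, which is how
    the inductions on [f] below proceed. *)
Lemma qbs_shift : qbs (m - 2) (shT T) (shE T E).
Proof.
have hF := e2_comm.
split.
- by split=> [i|i j h]; [exact: (braidE (qb_br hq)) | apply: (braidC (qb_br hq)); lia].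
- by move=> i hi; apply: (qb_qu hq); lia.
- by move=> i; exact: (qb_sT hq).
- by rewrite /shE bsigmaZ (e2_sigma hq).
- by rewrite /shE -scalerAl -scalerAr (e2_e2 hq) // expr2 -scalerA !delV Vdel.
- by rewrite /shE /shT -scalerAr (T3_e2 hq) // !scalerA mulrC.
- move=> h; rewrite /shE /shT -scalerAl -!scalerAr (e2_T4_e2 hq) //; last by lia.
  by rewrite -(scalerA del) delV !scalerA mulrC.
- move=> i hi; rewrite /shE /shT /GRing.comm -scalerAl -scalerAr; congr (_ *: _).
  apply: e2_comm; first by apply: (qb_C hq); lia.
  + by apply: (T_comm (qb_br hq)); lia.
  + by apply: (T_comm (qb_br hq)); lia.
  + by apply: (T_comm (qb_br hq)); lia.
- move=> h; have [e _] := e2_shift ltac:(lia).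
  rewrite e2E /shE !U_shT /shT -!scalerAl -!scalerAr; do 2![congr (_ *: _)]; exact: e.
- move=> h; have [_ e] := e2_shift ltac:(lia).
  rewrite e2E /shE !U_shT /shT -!scalerAl -!scalerAr -!scalerAl; do 2![congr (_ *: _)].
  by rewrite -!mulrA; exact: e.
Qed.

End Shifted.

Lemma Ep_comm T E x k : (forall i, (0 < i < k.*2)%N -> GRing.comm x (T i)) ->
  GRing.comm x E -> GRing.comm x (Ep T E k).
Proof.
elim: k => [|k IH] h hE; first by rewrite Ep0; exact: commr1.
rewrite EpS; do ![apply: commrM => //].
- by apply: Sup_comm => i hi; apply: h; lia.
- by apply: SupU_comm => i hi; apply: h; lia.
- by apply: IH => // i hi; apply: h; lia.
Qed.

Lemma comm_E_shT m T E i : qbs m T E -> (0 < i)%N -> GRing.comm E (shT T i).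
Proof. by move=> hq hi; apply: esym; apply: (qb_C hq); lia. Qed.

Lemma comm_E_shE m T E : qbs m T E -> (3 < m)%N -> GRing.comm E (shE T E).
Proof.
by move=> hq h3; apply: commrZ; rewrite /GRing.comm (E_e2 hq) // (e2_E hq).
Qed.

Lemma comm_E_Ep m T E k : qbs m T E -> (k.*2.+2 <= m)%N -> GRing.comm E (Ep (shT T) (shE T E) k).
Proof.
case: k => [|k] hq hk; first by rewrite Ep0; exact: commr1.
apply: Ep_comm; first by move=> i hi; apply: (comm_E_shT hq); lia.
by apply: (comm_E_shE hq); lia.
Qed.

(** This is what makes [E^f] accessible to induction through the shifted system. *)
Lemma Ep_shift m T E k : qbs m T E -> (k.*2.+2 <= m)%N ->
  Ep T E k.+1 = Ep (shT T) (shE T E) k * E.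
Proof.
elim: k => [|k IH] hq hk; first by rewrite Ep1 Ep0 mul1r.
have h3 : (3 < m)%N by lia.
rewrite EpS IH //; last by lia.
have hc : E * (Sup T 4 k.*2.+4 * (Sup (Uof T) 3 k.*2.+3 * Ep (shT T) (shE T E) k)) =
    Sup T 4 k.*2.+4 * (Sup (Uof T) 3 k.*2.+3 * Ep (shT T) (shE T E) k) * E.
  do ![apply: commrM => //].
  - by apply: Sup_comm => i hi; apply: esym; apply: (qb_C hq); lia.
  - by apply: SupU_comm => i hi; apply: esym; apply: (qb_C hq); lia.
  - by apply: (comm_E_Ep hq); lia.
have cT : Uof T 1 * (Uof T 2 * Sup T 4 k.*2.+4) = Sup T 4 k.*2.+4 * (Uof T 1 * Uof T 2).
  rewrite mulrA; apply: esym; apply: commrM; apply: comm_U; apply: esym; apply: Sup_comm => i hi;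
    by apply: (T_comm (qb_br hq)); lia.
rewrite [in RHS]EpS Sup_UshT [Sup (shT T) _ _]Sup_sh2.
move: (Ep _ _ _) hc => P hc; rewrite /shE e2E -!scalerAl -!mulrA.
have := congr1 (fun x => x * E) hc; rewrite -!mulrA => ->.
rewrite (qb_EE hq) -!scalerAr delV.
rewrite (@Sup_recl _ T 2) // (@Sup_recl _ T 3) // (@Sup_recl _ _ 1) // (@Sup_recl _ _ 2) // -!mulrA.
have := congr1 (fun x => x * (Sup (Uof T) 3 k.*2.+3 * (P * E))) cT.
by rewrite -!mulrA => ->.
Qed.

Lemma Ep_shiftl m T E k : qbs m T E -> (k.*2.+2 <= m)%N ->
  Ep T E k.+1 = E * Ep (shT T) (shE T E) k.
Proof. by move=> hq hk; rewrite (Ep_shift hq) // (comm_E_Ep hq hk). Qed.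

Lemma Ep_sigma m T E k : qbs m T E -> (k.*2 <= m)%N -> bsigma (Ep T E k) = Ep T E k.
Proof.
elim: k m T E => [|k IH] m T E hq hk; first by rewrite Ep0 bsigma1.
rewrite (Ep_shift hq) // bsigmaM (qb_sE hq); case: k IH hk => [|k] IH hk.
  by rewrite Ep0 bsigma1 mulr1 mul1r.
by rewrite (IH _ _ _ (qbs_shift hq ltac:(lia))) ?(comm_E_Ep hq) //; lia.
Qed.

Lemma Ep_Ep m T E f j : qbs m T E -> (f.*2 <= m)%N -> (j <= f)%N ->
  Ep T E f * Ep T E j = del ^+ j *: Ep T E f.
Proof.
elim: j m T E f => [|j IH] m T E f hq hf hj; first by rewrite Ep0 mulr1 scale1r.
case: f hf hj => // f hf hj.
rewrite (Ep_shift hq) // -mulrA (@Ep_shiftl m) //; last by lia.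
rewrite (mulrA E) (qb_EE hq) -scalerAl -scalerAr (comm_E_Ep hq); last by lia.
rewrite mulrA exprS -scalerA; congr (_ *: _).
case: f hf hj => [|f] hf hj; first by case: j IH hj => // IH _; rewrite !Ep0 mulr1 scale1r.
by rewrite (IH _ _ _ _ (qbs_shift hq ltac:(lia))) -?scalerAl //; lia.
Qed.

Lemma E_Ep m T E k : qbs m T E -> (k.*2.+2 <= m)%N -> E * Ep T E k.+1 = del *: Ep T E k.+1.
Proof. by move=> hq hk; rewrite (Ep_shiftl hq) // mulrA (qb_EE hq) -scalerAl. Qed.

Lemma Ep_C m T E k i : qbs m T E -> (k.*2 < i)%N -> GRing.comm (T i) (Ep T E k).
Proof.
case: k => [|k] hq hk; first by rewrite Ep0; exact: commr1.
apply: Ep_comm; first by move=> j hj; apply: (T_comm (qb_br hq)); lia.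
by apply: (qb_C hq); lia.
Qed.

Lemma Ep_T m T E k : qbs m T E -> (k.*2.+2 <= m)%N -> Ep T E k.+1 * T k.*2.+1 = q *: Ep T E k.+1.
Proof.
elim: k m T E => [|k IH] m T E hq hk; first by rewrite Ep1 (qb_ET hq).
have h3 : (3 < m)%N by lia.
rewrite (Ep_shiftl hq) // -mulrA.
have := IH _ _ _ (qbs_shift hq h3) ltac:(lia); rewrite /shT doubleS => ->.
by rewrite -scalerAr.
Qed.

Lemma Ep_U m T E k : qbs m T E -> (k.*2.+2 <= m)%N ->
  Ep T E k.+1 * Uof T k.*2.+1 = q^-1 *: Ep T E k.+1.
Proof.
by move=> hq hk; rewrite UofE mulrBr (Ep_T hq) // mulr_algr -scalerBl opprB addrC subrK.
Qed.

Lemma Ep_UU m T E k : qbs m T E -> (k.*2.+4 <= m)%N ->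
  Ep T E k.+2 * (Uof T k.*2.+2 * Uof T k.*2.+3) = Ep T E k.+2 * (Uof T k.*2.+2 * Uof T k.*2.+1).
Proof.
elim: k m T E => [|k IH] m T E hq hk.
  rewrite (Ep_shiftl hq) // Ep1 /shE -scalerAr (E_e2 hq) // -!scalerAl.
  have h1 : (1 < m)%N by lia.
  have := e2_U2U1 hq h1 hk 1; rewrite !mulr1 => e.
  by do 2![congr (_ *: _)]; rewrite e.
have h3 : (3 < m)%N by lia.
rewrite (Ep_shiftl hq) // -!mulrA.
have := IH _ _ _ (qbs_shift hq h3) ltac:(lia); rewrite !U_shT !doubleS => ->.
by [].
Qed.

(** [E^k+1] absorbs the string that occurs in its definition. *)
Lemma Ep_string m T E k : qbs m T E -> (k.*2.+2 <= m)%N ->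
  Sup T 2 k.*2.+2 * (Sup (Uof T) 1 k.*2.+1 * Ep T E k.+1) = Ep T E k.+1.
Proof.
elim: k m T E => [|k IH] m T E hq hk; first by rewrite !Sup_geq // !mul1r.
have h3 : (3 < m)%N by lia.
have hc : GRing.comm (Uof T 1 * Uof T 2) (Sup T 4 k.*2.+4).
  apply: Sup_comm => i hi; apply: esym; apply: commrM; apply: comm_U;
    by apply: (T_comm (qb_br hq)); lia.
rewrite doubleS (@Sup_recl _ T 2) // (@Sup_recl _ T 3) // (@Sup_recl _ _ 1) // (@Sup_recl _ _ 2) // -!mulrA.
rewrite (mulrA (Sup T 4 _)) (mulrA (Sup T 4 _ * _)) -(mulrA (Sup T 4 _)) -hc -!mulrA.
rewrite {1}(Ep_shift hq) //; have := IH _ _ _ (qbs_shift hq h3) ltac:(lia).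
rewrite Sup_UshT {1}/shT Sup_sh2 => e; have := congr1 (fun x => x * E) e; rewrite -!mulrA => ->.
rewrite -(Ep_shift hq) // [in LHS](Ep_shift hq) // (Ep_shiftl (qbs_shift hq h3)); last by lia.
rewrite -mulrA /shE -scalerAl -!scalerAr.
have := qb_gl hq h3 => /(congr1 (fun x => x * (Ep (shT (shT T)) (shE (shT T) (del^-1 *: e2 T E)) k * E))).
rewrite -!mulrA => ->.
by rewrite scalerAl -/(shE T E) mulrA -(Ep_shiftl (qbs_shift hq h3)) -?(Ep_shift hq) //; lia.
Qed.

End Powers.

(** * Reduction modulo the ideal generated by the next power of E *)

Section Ideals.
Variable n : nat.
Local Notation B := (qBrauer n).
Local Notation q := kq.
Local Notation z := kz.
Local Notation del := kdelta.
Local Notation d := (kq - kq^-1).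
Implicit Types (T : nat -> B) (E x y : B) (m i j k f : nat).

Lemma gen_in_span (S : set B) (X : set B) : X 1 ->
  (forall u g, X u -> S g -> u * g \in kspan X) -> forall x, gen_subalg S x -> x \in kspan X.
Proof. by move=> h1 hg x hx; rewrite -[x]mul1r; apply: (kspan_gen hg) => //; exact: kspan_in. Qed.

Lemma gen_pr_span (S : set B) x : gen_subalg S x ->
  x \in kspan [set y | exists s : seq B, (forall g, g \in s -> S g) /\ y = \prod_(g <- s) g].
Proof.
elim=> {x} [x hx||x y _ h1 _ h2|x y _ h1 _ h2|c x _ h1].
- by apply: kspan_in; exists [:: x]; split; rewrite ?big_seq1 // => g; rewrite inE => /eqP ->.
- by apply: kspan_in; exists [::]; rewrite big_nil.
- exact: rpredD.
- apply: kspan_mulr h1 => _ [s [hs ->]]; apply: kspan_mull h2 => _ [t [ht ->]].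
  apply: kspan_in; exists (s ++ t); split; last by rewrite big_cat.
  by move=> g; rewrite mem_cat => /orP[/hs|/ht].
- exact: rpredZ.
Qed.

Lemma kspan_genl (X : set B) (S : set B) x y : (forall u g, X u -> S g -> g * u \in kspan X) ->
  x \in kspan X -> gen_subalg S y -> y * x \in kspan X.
Proof.
move=> h hx /gen_pr_span; apply: kspan_mulr => _ [s [hs ->]].
elim: s hs => [|g s IH] hs; first by rewrite big_nil mul1r.
rewrite big_cons -mulrA.
have := IH (fun g' (hg' : g' \in s) => hs g' (mem_behead (s := g :: s) hg')).
by apply: kspan_mull => u hu; apply: h => //; apply: hs; rewrite inE eqxx.
Qed.

(** ** The algebra of a system and the ideals of its powers of E *)

Definition SQ T E m : set B :=
  gen_subalg [set x | (exists2 i, (0 < i < m)%N & x = T i) \/ ((1 < m)%N /\ x = E)]%classic.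

Lemma SQ_T T E m i : (0 < i < m)%N -> SQ T E m (T i).
Proof. by move=> h; apply: gen_subalg_gen; left; exists i. Qed.

Lemma SQ_E T E m : (1 < m)%N -> SQ T E m E.
Proof. by move=> h; apply: gen_subalg_gen; right. Qed.

Lemma SQ_1 T E m : SQ T E m 1. Proof. exact: gen_subalg_1. Qed.

Lemma SQ_U T E m i : (0 < i < m)%N -> SQ T E m (Uof T i).
Proof.
move=> h; rewrite UofE -scaleNr; apply: gen_subalg_D; [exact: SQ_T | exact: gen_C].
Qed.

Lemma SQ_HT T E a m x : HT T a m x -> SQ T E m x.
Proof. by apply: gen_sub => _ [i hi ->]; apply: SQ_T; lia. Qed.

Lemma SQ_le T E m m' x : (m <= m')%N -> SQ T E m x -> SQ T E m' x.
Proof.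
by move=> h; apply: gen_sub => _ [[i hi ->]|[hm ->]]; [apply: SQ_T | apply: SQ_E]; lia.
Qed.

Lemma SQ_Sup T E m a b : (0 < a)%N -> (b <= m)%N -> SQ T E m (Sup T a b).
Proof. by move=> h1 h2; apply: gen_pr => i; rewrite mem_iota => hi; apply: SQ_T; lia. Qed.

Lemma SQ_SupU T E m a b : (0 < a)%N -> (b <= m)%N -> SQ T E m (Sup (Uof T) a b).
Proof. by move=> h1 h2; apply: gen_pr => i; rewrite mem_iota => hi; apply: SQ_U; lia. Qed.

Lemma SQ_Ep T E m k : (k.*2 <= m)%N -> SQ T E m (Ep T E k).
Proof.
elim: k => [|k IH] hk; first by rewrite Ep0; exact: SQ_1.
rewrite EpS; do ![apply: gen_subalg_M].
- by apply: SQ_E; lia.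
- by apply: SQ_Sup; lia.
- by apply: SQ_SupU; lia.
- by apply: IH; lia.
Qed.

Lemma SQ_comm T E m x y : (forall i, (0 < i < m)%N -> GRing.comm y (T i)) ->
  ((1 < m)%N -> GRing.comm y E) -> SQ T E m x -> GRing.comm y x.
Proof. by move=> h1 h2; apply: gen_comm => _ [[i hi ->]|[hm ->]]; [exact: h1 | exact: h2]. Qed.

Lemma SQ_sigma m' T E m x : qbs m' T E -> SQ T E m x -> SQ T E m (bsigma x).
Proof.
move=> hq; elim=> {x} [x [[i hi ->]|[hm ->]]||x y _ h1 _ h2|x y _ h1 _ h2|c x _ h1].
- by rewrite (qb_sT hq); exact: SQ_T.
- by rewrite (qb_sE hq); exact: SQ_E.
- by rewrite bsigma1; exact: SQ_1.
- by rewrite bsigmaD; exact: gen_subalg_D.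
- by rewrite bsigmaM; exact: gen_subalg_M.
- by rewrite bsigmaZ; exact: gen_subalg_Z.
Qed.

Lemma HT_shT T a m x : (1 < m)%N -> HT (shT T) a (m - 2) x <-> HT T a.+2 m x.
Proof.
move=> hm; split; apply: gen_sub => _ [i hi ->]; first by apply: HT_gen; lia.
have -> : T i = shT T (i - 2) by rewrite /shT; congr T; lia.
by apply: HT_gen; lia.
Qed.

Definition IdG T E k m : set B :=
  [set x | exists a b, [/\ SQ T E m a, SQ T E m b, (k.*2 <= m)%N & x = a * Ep T E k * b]]%classic.

Lemma IdG_mull T E k m a x : SQ T E m a -> x \in kspan (IdG T E k m) -> a * x \in kspan (IdG T E k m).
Proof.
move=> ha; apply: kspan_mull => _ [u [v [hu hv hk ->]]]; apply: kspan_in.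
by exists (a * u), v; split; rewrite ?mulrA //; exact: gen_subalg_M.
Qed.

Lemma IdG_mulr T E k m a x : SQ T E m a -> x \in kspan (IdG T E k m) -> x * a \in kspan (IdG T E k m).
Proof.
move=> ha; apply: kspan_mulr => _ [u [v [hu hv hk ->]]]; apply: kspan_in.
by exists u, (v * a); split; rewrite ?mulrA //; exact: gen_subalg_M.
Qed.

Lemma IdG_le T E k m m' x : (m <= m')%N -> x \in kspan (IdG T E k m) -> x \in kspan (IdG T E k m').
Proof.
move=> hm; apply: kspan_sub => _ [u [v [hu hv hk ->]]].
by exists u, v; split; rewrite // ?(leq_trans hk hm) //; exact: SQ_le hm _.
Qed.

(** ** Hecke cosets *)

Lemma cosL T a m x : braids T -> quadratic T m ->
  HT T a m x ->
  x \in kspan [set y | exists h j, [/\ HT T a.+1 m h, (a < j <= maxn a.+1 m)%N & y = h * Sup T a.+1 j]].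
Proof.
move=> hb hqu; apply: gen_in_span.
  by exists 1, a.+1; rewrite Sup_geq // mulr1; split; [exact: gen_subalg_1 | lia |].
move=> _ _ [h [j [hh hj ->]]] [i hi ->].
have mem h' j' : HT T a.+1 m h' -> (a < j' <= maxn a.+1 m)%N ->
  h' * Sup T a.+1 j' \in kspan [set y | exists h j,
    [/\ HT T a.+1 m h, (a < j <= maxn a.+1 m)%N & y = h * Sup T a.+1 j]].
  by move=> h1 h2; apply: kspan_in; exists h', j'.
case: (ltngtP i j) => hij.
- have [e|hne] := eqVneq i.+1 j.
    rewrite -e (@Sup_recr _ T a.+1 i) ?(andP hi).1 // -!mulrA hqu; last by lia.
    rewrite mulrDr mulr1 -scalerAr mulrDr -scalerAr rpredD ?rpredZ ?mem //; try lia.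
    by rewrite -(@Sup_recr _ T a.+1 i) ?mem //; lia.
  rewrite -mulrA (Sup_shift hb); try lia.
  rewrite mulrA mem //; apply: gen_subalg_M => //; apply: HT_gen; lia.
- rewrite -mulrA [Sup _ _ _ * _](_ : _ = T i * Sup T a.+1 j).
    by rewrite mulrA mem //; apply: gen_subalg_M => //; apply: HT_gen; lia.
  by apply: esym; apply: Sup_comm => k hk; apply: (T_comm hb); lia.
- by rewrite hij -mulrA -Sup_recr ?mem //; lia.
Qed.

Lemma cosU T a m x : braids T -> quadratic T m -> (a < m)%N ->
  HT T a m x ->
  x \in kspan [set y | exists h j, [/\ HT T a m.-1 h, (a < j <= m)%N & y = Sup (Uof T) j m * h]].
Proof.
move=> hb hqu ham hx; rewrite -[x]mulr1.
have mem h' j' : HT T a m.-1 h' -> (a < j' <= m)%N ->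
  Sup (Uof T) j' m * h' \in kspan [set y | exists h j,
    [/\ HT T a m.-1 h, (a < j <= m)%N & y = Sup (Uof T) j m * h]].
  by move=> h1 h2; apply: kspan_in; exists h', j'.
apply: (@kspan_genl _ _ _ _ _ _ hx); last first.
  by rewrite -(@Sup_geq _ (Uof T) m m) // -[Sup _ _ _]mulr1; apply: mem; [exact: gen_subalg_1 | lia].
move=> _ _ [h [j [hh hj ->]]] [i hi ->].
case: (ltngtP i j) => hij.
- have [e|hne] := eqVneq i.+1 j.
    rewrite -[T i](subrK ((kq - kq^-1)%:A)) -UofE mulrDl mulr_algl rpredD ?rpredZ ?mem //.
    by rewrite mulrA -e -Sup_recl ?mem //; lia.
  rewrite mulrA (SupU_comm (b := m) (a := j) (T := T) (x := T i)).
    by rewrite -mulrA mem //; apply: gen_subalg_M => //; apply: HT_gen; lia.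
  by move=> k hk; apply: (T_comm hb); lia.
- have -> : i = i.-1.+1 by lia.
  rewrite mulrA -(SupU_shift hb hqu); try lia.
  by rewrite -mulrA mem //; apply: gen_subalg_M => //; apply: HT_gen; lia.
- rewrite hij Sup_recl; last by lia.
  by rewrite !mulrA (TU hqu) ?mul1r ?mem //; lia.
Qed.

Lemma kspan_bi (S X : set B) a b x : x \in kspan S -> (forall u, S u -> a * (u * b) \in kspan X) ->
  a * (x * b) \in kspan X.
Proof.
move=> hx h; apply: (kspan_ind _ _ h hx) => [|c u v hu hv]; first by rewrite mul0r mulr0 rpred0.
by rewrite mulrDl -scalerAl mulrDr -scalerAr rpredD ?rpredZ.
Qed.

Section Rank1.
Variables (m : nat) (T : nat -> B) (E : B).
Hypotheses (hq : qbs m T E) (hm : (1 < m)%N).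

Local Notation X1 := [set y | (exists2 h, HT T 2 m h & y = E * h) \/
  ((3 < m)%N /\ exists h1 h2, [/\ HT T 2 m h1, HT T 2 m h2 & y = h1 * (e2 T E * h2)])]%classic.

Let X1_l h x : HT T 2 m h -> x \in kspan X1 -> h * x \in kspan X1.
Proof.
move=> hh; apply: kspan_mull => _ [[h' hh' ->]|[h3 [h1 [h2 [hh1 hh2 ->]]]]]; apply: kspan_in.
- left; exists (h * h'); first exact: gen_subalg_M.
  by rewrite mulrA -(qb_HT_E hq hm (leqnn 2) hh) // -mulrA.
- by right; split => //; exists (h * h1), h2; split; rewrite -?mulrA //; exact: gen_subalg_M.
Qed.

Let X1_r h x : HT T 2 m h -> x \in kspan X1 -> x * h \in kspan X1.
Proof.
move=> hh; apply: kspan_mulr => _ [[h' hh' ->]|[h3 [h1 [h2 [hh1 hh2 ->]]]]]; apply: kspan_in.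
- by left; exists (h' * h); rewrite -?mulrA //; exact: gen_subalg_M.
- by right; split => //; exists h1, (h2 * h); split; rewrite -?mulrA //; exact: gen_subalg_M.
Qed.

Let X1_E : E \in kspan X1.
Proof. by apply: kspan_in; left; exists 1; rewrite ?mulr1 //; exact: gen_subalg_1. Qed.

Let ETE : (2 < m)%N -> E * (T 2 * E) \in kspan X1.
Proof. by move=> h; rewrite (qb_ETE hq h) rpredZ. Qed.

(** Hecke cosets on both sides reduce the middle factor to short strings, which give
    multiples of [E] and of [E_(2)]. *)
Lemma E_HT_E h : HT T 0 m h -> E * (h * E) \in kspan X1.
Proof.
move=> hh.
have HS i j : (2 < i)%N -> (j <= m)%N -> HT T 2 m (Sup T i j) by move=> h1 h2; exact: HT_Sup.
have cS i j : (2 < i)%N -> Sup T i j * E = E * Sup T i j.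
  by move=> h1; apply: esym; apply: Sup_comm => k hk; apply: esym; apply: (qb_C hq); lia.
have step1 i : (1 < i <= m)%N -> E * (Sup T 2 i * E) \in kspan X1.
  move=> hi; have [e|hne] := eqVneq i 2%N.
    by rewrite e Sup_geq // mul1r (qb_EE hq) rpredZ.
  rewrite (@Sup_recl _ T 2 i); last by lia.
  rewrite -mulrA cS // !mulrA; apply: X1_r; first by apply: HS; lia.
  by rewrite -mulrA ETE; lia.
have step2 : (3 < m)%N -> E * (T 2 * (T 3 * (T 1 * (T 2 * E)))) \in kspan X1.
  move=> h3; have TE i : T i = Uof T i + d%:A by rewrite UofE subrK.
  have hT3 : HT T 2 m (T 3) by apply: HT_gen; lia.
  have u232 : T 2 * (T 3 * (Uof T 2 * E)) = Uof T 3 * (T 2 * (E * T 3)).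
    have e3 : T 2 * (T 3 * T 2) = T 3 * (T 2 * T 3) := braidE (qb_br hq) 2.
    have -> : E * T 3 = T 3 * E by apply: esym; exact: (qb_C hq).
    rewrite -[LHS]mul1r -(UT (qb_qu hq) (i := 3)); last by lia.
    rewrite -!mulrA; congr (_ * _).
    have := congr1 (fun x => x * (Uof T 2 * E)) e3; rewrite -!mulrA => <-.
    by rewrite (mulrA (T 2) (Uof T 2)) (TU (qb_qu hq)) ?mul1r //; lia.
  have -> : T 1 * (T 2 * E) = Uof T 1 * (Uof T 2 * E) + d *: (Uof T 1 * E) + d *: (T 2 * E).
    rewrite {1}(TE 1%N) mulrDl mulr_algl; congr (_ + _).
    by rewrite {1}(TE 2%N) mulrDl mulr_algl mulrDr -scalerAr.
  rewrite (qb_UE hq) !mulrDr -!scalerAr.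
  do 2?[apply: rpredD]; rewrite ?rpredZ //.
  - apply: kspan_in; right; split => //; exists 1, 1.
    by split; rewrite ?mulr1 ?mul1r ?e2E //; exact: gen_subalg_1.
  - rewrite (qb_C hq) // (mulrA (T 2)) (mulrA E); apply: X1_r => //.
    by rewrite ETE //; lia.
  - have -> : T 2 * E = Uof T 2 * E + d *: E by rewrite {1}(TE 2%N) mulrDl mulr_algl.
    rewrite !mulrDr -!scalerAr u232.
    rewrite rpredD ?rpredZ //.
      rewrite (mulrA E) -(qb_CU hq) // -mulrA; apply: X1_l.
        by rewrite UofE -scaleNr; apply: gen_subalg_D => //; exact: gen_C.
      by rewrite !mulrA; apply: X1_r => //; rewrite -mulrA ETE //; lia.
    rewrite (qb_C hq) // (mulrA (T 2)) (mulrA E); apply: X1_r => //.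
    by rewrite ETE //; lia.
have step3 i j : (1 < i <= m)%N -> (0 < j <= m)%N ->
    E * (Sup T 2 i * (Sup T 1 j * E)) \in kspan X1.
  move=> hi hj; have [j1|[j2|j3]] : j = 1%N \/ j = 2%N \/ (2 < j)%N by lia.
  - by rewrite j1 [Sup T 1 1]Sup_geq // mul1r step1.
  - by rewrite j2 Sup1 (qb_TE hq) -!scalerAr rpredZ // step1.
  rewrite (@Sup_recl _ T 1 j) ?(@Sup_recl _ T 2 j); try lia.
  rewrite -!mulrA cS // 4!mulrA; apply: X1_r; first by apply: HS; lia.
  rewrite -!mulrA; have [i2|[i3|i4]] : i = 2%N \/ i = 3%N \/ (3 < i)%N by lia.
  - rewrite i2 Sup_geq // mul1r mulrA (qb_ET hq) -scalerAl rpredZ // ETE //; lia.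
  - have := braidE (qb_br hq) 1 => /(congr1 (fun x => E * (x * E))); rewrite -!mulrA i3 Sup1 => <-.
    by rewrite (qb_TE hq) mulrA (qb_ET hq) -!scalerAr -scalerAl !rpredZ // ETE //; lia.
  - rewrite (@Sup_recl _ T 2 i) ?(@Sup_recl _ T 3 i); try lia.
    have hc : Sup T 4 i * (T 1 * (T 2 * E)) = T 1 * (T 2 * E) * Sup T 4 i.
      apply: esym; apply: Sup_comm => k hk; apply: esym; do ![apply: commrM].
      - by apply: (T_comm (qb_br hq)); lia.
      - by apply: (T_comm (qb_br hq)); lia.
      - by apply: (qb_C hq); lia.
    rewrite -!mulrA hc !mulrA; apply: X1_r; first by apply: HS; lia.
    by rewrite -!mulrA step2; lia.
apply: (kspan_bi (cosL (qb_br hq) (qb_qu hq) hh)) => _ [h1 [j [hh1 hj ->]]].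
rewrite -mulrA; apply: (kspan_bi (cosL (qb_br hq) (qb_qu hq) hh1)) => _ [h2 [i [hh2 hi ->]]].
rewrite -mulrA mulrA (qb_HT_E hq hm (leqnn 2) hh2) // -mulrA; apply: X1_l => //.
by apply: step3; lia.
Qed.

End Rank1.

End Ideals.

Section Reduction.
Variable n : nat.
Local Notation B := (qBrauer n).
Local Notation q := kq.
Local Notation del := kdelta.
Local Notation d := (kq - kq^-1).
Implicit Types (T : nat -> B) (E x y : B) (m i j k f : nat).

Lemma SQ_triv T E m x : (m <= 1)%N -> SQ T E m x -> exists c, x = c%:A.
Proof.
move=> hm; elim=> {x} [x [[i hi]|[hi]]||x y _ [c ->] _ [d' ->]|x y _ [c ->] _ [d' ->]|c x _ [d' ->]].
- lia.
- lia.
- by exists 1; rewrite scale1r.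
- by exists (c + d'); rewrite scalerDl.
- by exists (c * d'); rewrite -scalerAl mul1r scalerA.
- by exists (c * d'); rewrite scalerA.
Qed.

Lemma SQ_shT T E m x : (1 < m)%N -> SQ (shT T) (shE T E) (m - 2) x -> SQ T E m x.
Proof.
move=> hm; apply: gen_sub => _ [[i hi ->]|[h3 ->]]; first by apply: SQ_T; lia.
apply: gen_subalg_Z; rewrite e2E; do ![apply: gen_subalg_M].
all: by [apply: SQ_E; lia | apply: SQ_T; lia | apply: SQ_U; lia].
Qed.

Lemma comm_E_SQ T E m x : qbs m T E -> SQ (shT T) (shE T E) (m - 2) x -> GRing.comm E x.
Proof.
move=> hq; apply: SQ_comm => [i hi|h3]; first by apply: (comm_E_shT hq); lia.
by apply: (comm_E_shE hq); lia.
Qed.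

Lemma IdG_shT T E f m x : qbs m T E -> (1 < m)%N ->
  x \in kspan (IdG (shT T) (shE T E) f (m - 2)) -> x * E \in kspan (IdG T E f.+1 m).
Proof.
move=> hq hm; apply: kspan_mulr => _ [a [b [ha hb hf ->]]].
apply: kspan_in; exists a, b; split; [exact: SQ_shT | exact: SQ_shT | lia |].
by rewrite (Ep_shift hq); [rewrite -!mulrA (comm_E_SQ hq hb) | lia].
Qed.

(** In the image of E^f the whole algebra acts from the left through its Hecke
    part, up to the ideal of the next power. *)
Lemma SQ_mul_Ep f m T E a : qbs m T E -> (f.*2 <= m)%N -> SQ T E m a ->
  a * Ep T E f \in kspan [set y | (exists2 h, HT T 0 m h & y = h * Ep T E f) \/
                                 IdG T E f.+1 m y].
Proof.
elim: f m T E a => [|f IH] m T E a hq hf.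
  apply: kspan_genl; last by apply: kspan_in; left; exists 1; rewrite ?mul1r //; exact: gen_subalg_1.
  move=> u g [[h hh ->]|hu] hg; last first.
    apply: (@kspan_sub _ _ (IdG T E 1 m)); first by right.
    by apply: IdG_mull; [exact: gen_subalg_gen | exact: kspan_in].
  apply: kspan_in; case: hg => [[i hi ->]|[hm ->]].
    by left; exists (T i * h); rewrite ?mulrA //; apply: gen_subalg_M => //; exact: HT_gen.
  by right; exists 1, h; rewrite Ep0 Ep1 mulr1 mul1r; split => //; [exact: SQ_1 | exact: SQ_HT hh].
have hm : (1 < m)%N by lia.
set X := kspan _.
have XI x : x \in kspan (IdG T E f.+2 m) -> x \in X by apply: kspan_sub => y hy; right.
have Xh h h' x : HT T 0 m h -> HT T 0 m h' -> x = h * (h' * Ep T E f.+1) -> x \in X.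
  move=> h1 h2 ->; rewrite mulrA; apply: kspan_in; left; exists (h * h') => //.
  exact: gen_subalg_M.
apply: kspan_genl; last by apply: kspan_in; left; exists 1; rewrite ?mul1r //; exact: gen_subalg_1.
move=> u g [[h hh ->]|hu] hg; last first.
  by apply: (XI); apply: IdG_mull; [exact: gen_subalg_gen | exact: kspan_in].
case: hg => [[i hi ->]|[_ ->]].
  by apply: (Xh (T i) h) => //; apply: HT_gen; lia.
have -> : E * (h * Ep T E f.+1) = del^-1 *: (E * (h * E) * Ep T E f.+1).
  by rewrite -!mulrA (E_Ep hq) // -!scalerAr delV.
apply: rpredZ; apply: kspan_mulr (E_HT_E hq hm hh) => _ [[h' hh' ->]|[h3 [h1 [h2 [hh1 hh2 ->]]]]].
  rewrite (qb_HT_E hq hm (leqnn 2) hh') -mulrA (E_Ep hq) // -scalerAr; apply: rpredZ.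
  apply: (Xh h' 1); rewrite ?mul1r //; last exact: gen_subalg_1.
  exact: HT_sub hh'.
have -> : h1 * (e2 T E * h2) * Ep T E f.+1 =
    del *: (h1 * ((shE T E * h2) * Ep (shT T) (shE T E) f * E)).
  rewrite (Ep_shift hq) //; move: (Ep _ _ _) => P.
  by rewrite /shE -!scalerAl -!scalerAr Vdel -!mulrA.
apply: rpredZ.
have hs2 : SQ (shT T) (shE T E) (m - 2) (shE T E * h2).
  apply: gen_subalg_M; first by apply: SQ_E; lia.
  by apply: (@SQ_HT _ _ _ 0); apply/HT_shT.
have := IH _ _ _ _ (qbs_shift hq h3) _ hs2 => /(_ ltac:(lia)) hI.
apply: (kspan_bi hI) => y0 [[h' hh' ->]|hI'].
  rewrite -mulrA -(Ep_shift hq) //; apply: (Xh h1 h') => //; first exact: HT_sub hh1.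
  by move/HT_shT: hh' => /(_ hm); exact: HT_sub.
apply: (XI); apply: IdG_mull; first exact: SQ_HT hh1.
by apply: (IdG_shT hq hm); exact: kspan_in.
Qed.

(** Sandwiching between two copies of E^f retracts the algebra onto the Hecke
    algebra of the entries beyond 2f. *)
Lemma Ep_SQ_Ep f m T E a : qbs m T E -> (f.*2 <= m)%N -> SQ T E m a ->
  Ep T E f * (a * Ep T E f) \in kspan [set y | (exists2 h, HT T f.*2 m h & y = Ep T E f * h) \/
                                 IdG T E f.+1 m y].
Proof.
elim: f m T E a => [|f IH] m T E a hq hf ha.
  rewrite Ep0 mul1r; have := SQ_mul_Ep hq hf ha; rewrite Ep0; apply: kspan_sub.
  by move=> y [[h hh ->]|hy]; [left; exists h; rewrite ?mul1r ?mulr1 | right].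
have hm : (1 < m)%N by lia.
set X := kspan _.
have XI x : x \in kspan (IdG T E f.+2 m) -> x \in X by apply: kspan_sub => y hy; right.
apply: kspan_mull (SQ_mul_Ep hq hf ha) => y0 [[h hh ->]|hI]; last first.
  by apply: (XI); apply: IdG_mull; [exact: SQ_Ep | exact: kspan_in].
pose P := Ep (shT T) (shE T E) f.
have -> : Ep T E f.+1 * (h * Ep T E f.+1) = P * (E * (h * E) * P).
  by rewrite {1}(Ep_shift hq) // (Ep_shiftl hq) // -!mulrA.
(* a sandwich by the shifted power, multiplied by E *)
have step b : (3 < m)%N || (f == 0)%N -> SQ (shT T) (shE T E) (m - 2) b -> P * (b * P) * E \in X.
  move=> hf3 hb.
  have [h3|h3] := ltnP 3 m; last first.
    have f0 : f = 0%N by move: hf3; lia.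
    rewrite /P f0 !Ep0 mul1r mulr1; move: hb; rewrite /SQ => hb.
    have [|c ->] := SQ_triv _ hb; first by lia.
    apply: kspan_in; left; exists c%:A; first exact: gen_C.
    by rewrite f0 Ep1 mulr_algl mulr_algr.
  have := IH _ _ _ _ (qbs_shift hq h3) _ hb => /(_ ltac:(lia)) hI.
  apply: kspan_mulr hI => y1 [[h' hh' ->]|hI']; last first.
    by apply: (XI); apply: (IdG_shT hq hm); exact: kspan_in.
  apply: kspan_in; left; exists h'; first by rewrite doubleS; apply/HT_shT.
  rewrite (Ep_shift hq) // -!mulrA; congr (_ * _); apply: esym.
  by apply: (qb_HT_E hq hm (a := f.*2.+2) (b := m)) => //; apply/HT_shT.
have hfm : (3 < m)%N || (f == 0)%N by lia.
have cE b : SQ (shT T) (shE T E) (m - 2) b -> P * (E * b * P) = P * (b * P) * E.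
  move=> hb; have cP : GRing.comm E (b * P).
    by apply: commrM; [exact: (comm_E_SQ hq hb) | apply: (comm_E_Ep hq); lia].
  by rewrite -mulrA cP mulrA.
have hs h' : HT T 2 m h' -> SQ (shT T) (shE T E) (m - 2) h'.
  by move=> hh'; apply: (@SQ_HT _ _ _ 0); apply/HT_shT.
apply: (kspan_bi (E_HT_E hq hm hh)) => _ [[h' hh' ->]|[h3 [h1 [h2 [hh1 hh2 ->]]]]].
  by rewrite cE ?step //; exact: hs.
have hb : SQ (shT T) (shE T E) (m - 2) (h1 * (shE T E * h2)).
  by do ![apply: gen_subalg_M]; [exact: hs | apply: SQ_E; lia | exact: hs].
have -> : h1 * (e2 T E * h2) = E * (h1 * (shE T E * h2)).
  rewrite [RHS]mulrA (qb_HT_E hq hm (leqnn 2) hh1) -mulrA (mulrA E) /shE -scalerAr -scalerAl (E_e2 hq) // -scalerAl.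
  by rewrite delV.
by rewrite cE ?step.
Qed.

Lemma Ep_U_low m T E k : qbs m T E -> (k.*2.+4 <= m)%N ->
  Ep T E k.+2 * Sup (Uof T) k.*2.+2 m =
  Ep T E k.+2 * (Sup (Uof T) k.*2.+4 m * (Uof T k.*2.+2 * Uof T k.*2.+1)).
Proof.
move=> hq hk; rewrite (@Sup_recl _ _ k.*2.+2) ?(@Sup_recl _ _ k.*2.+3); try lia.
have -> : Sup (Uof T) k.*2.+4 m * (Uof T k.*2.+2 * Uof T k.*2.+1) =
    Uof T k.*2.+2 * Uof T k.*2.+1 * Sup (Uof T) k.*2.+4 m.
  apply: esym; apply: SupU_comm => i hi; apply: esym; apply: commrM; apply: comm_U;
    by apply: (T_comm (qb_br hq)); lia.
by rewrite (mulrA (Uof T _)) [LHS]mulrA [RHS]mulrA (Ep_UU hq).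
Qed.

Lemma HT_mul_SupU T a m x : braids T -> quadratic T m -> (0 < a)%N -> HT T a m x ->
  exists2 y, HT T a.-1 m.-1 y & x * Sup (Uof T) a m = Sup (Uof T) a m * y.
Proof.
move=> hb hqu ha; elim=> {x} [x [i hi ->]||x y _ [x' hx ex] _ [y' hy ey]|x y _ [x' hx ex] _ [y' hy ey]|c x _ [x' hx ex]].
- exists (T i.-1); first by apply: HT_gen; lia.
  have -> : i = i.-1.+1 by lia.
  by rewrite (SupU_shift hb hqu) //; lia.
- by exists 1; rewrite ?mulr1 ?mul1r //; exact: gen_subalg_1.
- by exists (x' + y'); rewrite ?mulrDl ?mulrDr ?ex ?ey //; exact: gen_subalg_D.
- by exists (x' * y'); rewrite -?mulrA ?ey ?mulrA ?ex //; exact: gen_subalg_M.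
- by exists (c *: x'); rewrite -?scalerAl -?scalerAr ?ex //; exact: gen_subalg_Z.
Qed.

(** The right multiplication by [B_{m-1}] on E^f B_m has, modulo the next ideal,
    two kinds of generators over the Hecke part. *)
Lemma Ep_SQ_restrict f m N T E a : qbs N T E -> (m <= N)%N -> (f.*2 <= m)%N -> SQ T E m a ->
  Ep T E f * a \in kspan [set y |
    (exists h s, [/\ HT T f.*2 m h, SQ T E m.-1 s & y = Ep T E f * (h * s)]) \/
    (exists h s, [/\ (0 < f)%N, HT T f.*2 m h, SQ T E m.-1 s &
                   y = Ep T E f * (h * (Sup (Uof T) f.*2 m * s))]) \/
    IdG T E f.+1 m y].
Proof.
move=> hqN; have hb := qb_br hqN.
elim: m f a => [|m IH] f a hmN hf ha.
  apply: kspan_in; left; exists 1, a; rewrite mul1r; split => //; exact: gen_subalg_1.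
have hq := qbs_le hmN hqN; have hqm := qbs_le (ltnW hmN) hqN; have hqu := qb_qu hq.
set X := kspan _.
have XI x : x \in kspan (IdG T E f.+1 m.+1) -> x \in X by apply: kspan_sub => y hy; right; right.
have X1 h s x : HT T f.*2 m.+1 h -> SQ T E m s -> x = Ep T E f * (h * s) -> x \in X.
  by move=> h1 h2 ->; apply: kspan_in; left; exists h, s.
have X2 h s x : (0 < f)%N -> HT T f.*2 m.+1 h -> SQ T E m s ->
    x = Ep T E f * (h * (Sup (Uof T) f.*2 m.+1 * s)) -> x \in X.
  by move=> h0 h1 h2 ->; apply: kspan_in; right; left; exists h, s.
have Xr s x : SQ T E m s -> x \in X -> x * s \in X.
  move=> hs; apply: kspan_mulr => y0 [[h [s' [hh hs' ->]]]|[[h [s' [h0 hh hs' ->]]]|hI]].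
  - by apply: (X1 h (s' * s)) => //; [exact: gen_subalg_M | rewrite -!mulrA].
  - by apply: (X2 h (s' * s)) => //; [exact: gen_subalg_M | rewrite -!mulrA].
  - by apply: (XI); apply: IdG_mulr; [exact: SQ_le hs | exact: kspan_in].
have Xl h x : HT T f.*2 m.+1 h -> x \in X -> h * x \in X.
  move=> hh0; have cP : GRing.comm h (Ep T E f).
    apply: esym; apply: HT_comm hh0 => i hi; apply: esym; apply: (Ep_C hq); lia.
  apply: kspan_mull => y0 [[h' [s [hh hs ->]]]|[[h' [s [h0 hh hs ->]]]|hI]].
  - by apply: (X1 (h * h') s) => //; [exact: gen_subalg_M | rewrite mulrA cP -!mulrA].
  - by apply: (X2 (h * h') s) => //; [exact: gen_subalg_M | rewrite mulrA cP -!mulrA].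
  - by apply: (XI); apply: IdG_mull; [exact: SQ_HT hh0 | exact: kspan_in].
have TmE : T m = Uof T m + d%:A by rewrite UofE subrK.
have cTm s : (0 < m)%N -> SQ T E m.-1 s -> s * T m = T m * s.
  move=> hm; have [m1 /SQ_triv|m1] := leqP m 1.
    by case; [lia | move=> c ->; rewrite mulr_algl mulr_algr].
  move=> hs; apply: esym; apply: SQ_comm hs => [i hi|hi]; first by apply: (T_comm hb); lia.
  by apply: (qb_C hq); lia.
have Sm s : SQ T E m.-1 s -> SQ T E m s by apply: SQ_le; lia.
have SupTm j : (j <= m)%N -> Sup (Uof T) j m * T m = Sup (Uof T) j m.+1 + d *: Sup (Uof T) j m.
  by move=> hj; rewrite TmE mulrDr mulr_algr -Sup_recr.
(* the part of the image of E^f reached by the Hecke algebra *)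
have claimA w s : (0 < f)%N -> HT T f.*2.-2 m.+1 w -> SQ T E m s -> Ep T E f * (w * s) \in X.
  move=> h0 hw hs; rewrite mulrA; apply: (Xr _ _ hs).
  have ham : (f.*2.-2 < m.+1)%N by lia.
  apply: kspan_mull (cosU hb hqu ham hw) => _ [h [j [hh hj ->]]].
  rewrite mulrA; apply: (Xr); first exact: SQ_HT hh.
  have [j1|[j2|j3]] : j = f.*2.-1 \/ j = f.*2 \/ (f.*2 < j)%N by lia.
  - rewrite j1 Sup_recl; last by lia.
    have -> : f.*2.-1.+1 = f.*2 by lia.
    rewrite mulrA; have -> : Ep T E f * Uof T f.*2.-1 = q^-1 *: Ep T E f.
      have e1 : f.-1.+1 = f by lia.
      have e2 : f.-1.*2.+1 = f.*2.-1 by lia.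
      by have := @Ep_U _ m.+1 T E f.-1 hq ltac:(lia); rewrite e1 e2.
    rewrite -scalerAl rpredZ //; apply: (X2 1 1) => //; rewrite ?mul1r ?mulr1 //; exact: gen_subalg_1.
  - apply: (X2 1 1) => //; rewrite ?mul1r ?mulr1 ?j2 //; exact: gen_subalg_1.
  - apply: (X1 (Sup (Uof T) j m.+1) 1); rewrite ?mulr1 //; last exact: gen_subalg_1.
    by apply: HT_SupU.
(* a string starting below 2f is absorbed *)
have claimB w s : (1 < f)%N -> HT T f.*2.-2 m.+1 w -> SQ T E m s ->
    Ep T E f * (w * (Sup (Uof T) f.*2.-2 m.+1 * s)) \in X.
  move=> h1 hw hs; have h2 : (0 < f.*2.-2)%N by lia.
  have [w' hw' e] := HT_mul_SupU hb hqu h2 hw.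
  have -> : Ep T E f * (w * (Sup (Uof T) f.*2.-2 m.+1 * s)) =
      Ep T E f * Sup (Uof T) f.*2.-2 m.+1 * (w' * s) by rewrite (mulrA w) e -!mulrA.
  apply: (Xr).
    by apply: gen_subalg_M => //; apply: SQ_HT hw'.
  have -> : Ep T E f * Sup (Uof T) f.*2.-2 m.+1 = Ep T E f * (1 *
      (Sup (Uof T) f.*2 m.+1 * (Uof T f.*2.-2 * Uof T f.*2.-2.-1))).
    have e2 : f.-2.+2 = f by lia.
    have e3 : f.-2.*2.+4 = f.*2 by lia.
    have e4 : f.-2.*2.+2 = f.*2.-2 by lia.
    have e5 : f.-2.*2.+1 = f.*2.-2.-1 by lia.
    by have := @Ep_U_low m.+1 T E f.-2 hq ltac:(lia); rewrite e2 e3 e4 e5 mul1r.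
  apply: (X2); [lia | exact: gen_subalg_1 | | by []].
  by apply: gen_subalg_M; apply: SQ_U; lia.
have case1 h s : (0 < m)%N -> (f.*2 <= m)%N -> HT T f.*2 m.+1 h -> SQ T E m s ->
    Ep T E f * (h * s) * T m \in X.
  move=> hm hfm hh hs.
  have -> : Ep T E f * (h * s) * T m = h * (Ep T E f * s * T m).
    have cP : GRing.comm (Ep T E f) h.
      by apply: HT_comm hh => i hi; apply: esym; apply: (Ep_C hq); lia.
    by rewrite !mulrA cP.
  apply: (Xl) => //; apply: kspan_mulr (IH f s (ltnW hmN) hfm hs) => y0.
  case=> [[h' [s' [hh' hs' ->]]]|[[h' [s' [h0 hh' hs' ->]]]|hI]].
  - rewrite -!mulrA cTm //; have [hfm'|hfm'] := ltnP f.*2 m.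
      apply: (X1 (h' * T m) s'); [|exact: Sm|by rewrite -!mulrA].
      by apply: gen_subalg_M; [exact: HT_sub hh' | apply: HT_gen; lia].
    have em : f.*2 = m by lia.
    rewrite TmE mulrDl mulr_algl !mulrDr -!scalerAr rpredD ?rpredZ //.
    + apply: (X2 h' s'); [lia | exact: HT_sub hh' | exact: Sm | by rewrite em Sup1].
    + apply: (X1 h' s'); [exact: HT_sub hh' | exact: Sm | by []].
  - rewrite -!mulrA cTm // (mulrA (Sup _ _ _)) SupTm // mulrDl !mulrDr -!scalerAl -!scalerAr.
    rewrite rpredD ?rpredZ //.
    + by apply: (X2 h' s') => //; [exact: HT_sub hh' | exact: Sm].
    + apply: (X1 h' (Sup (Uof T) f.*2 m * s')) => //; first exact: HT_sub hh'.
      by apply: gen_subalg_M; [apply: SQ_SupU; lia | exact: Sm].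
  - apply: (XI); apply: IdG_mulr; first by apply: SQ_T; lia.
    by apply: (IdG_le (leqnSn m)); exact: kspan_in.
(* the power below E^f is inserted to the left of s *)
have claimC w s : (0 < m)%N -> (0 < f)%N -> HT T f.*2.-2 m.+1 w -> SQ T E m s ->
    Ep T E f * (w * s) * T m \in X.
  move=> hm h0 hw hs.
  have f1 : f.-1.*2 = f.*2.-2 by lia.
  have cw : GRing.comm (Ep T E f.-1) w.
    by apply: HT_comm hw => i hi; apply: esym; apply: (Ep_C hq); lia.
  have ee : Ep T E f * Ep T E f.-1 = del ^+ f.-1 *: Ep T E f by rewrite (Ep_Ep hq) //; lia.
  have ins x : Ep T E f * (w * (Ep T E f.-1 * x)) = del ^+ f.-1 *: (Ep T E f * (w * x)).
    by rewrite (mulrA w) -cw -(mulrA _ w) (mulrA (Ep T E f)) ee -scalerAl.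
  have -> : Ep T E f * (w * s) * T m =
      (del ^+ f.-1)^-1 *: (Ep T E f * w * ((Ep T E f.-1 * s) * T m)).
    rewrite -!mulrA ins scalerA mulVr ?scale1r //.
    by rewrite unitrX // del_unit.
  rewrite rpredZ //.
  apply: (kspan_bi (IH f.-1 s (ltnW hmN) ltac:(lia) hs)) => y0.
  rewrite -mulrA f1; case=> [[h' [s' [hh' hs' ->]]]|[[h' [s' [h1 hh' hs' ->]]]|hI]].
  - rewrite -!mulrA ins rpredZ // cTm // (mulrA h') (mulrA w).
    apply: (claimA) => //; last exact: Sm.
    apply: gen_subalg_M => //; apply: gen_subalg_M; first exact: HT_sub hh'.
    by apply: HT_gen; lia.
  - rewrite -!mulrA ins rpredZ // cTm // (mulrA (Sup _ _ _)) SupTm; last by lia.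
    rewrite (mulrA w) mulrDl !mulrDr -scalerAl -!scalerAr.
    have hwh : HT T f.*2.-2 m.+1 (w * h') by apply: gen_subalg_M => //; exact: HT_sub hh'.
    rewrite rpredD ?rpredZ //; first by apply: (claimB) => //; [lia | exact: Sm].
    by apply: (claimA) => //; apply: gen_subalg_M; [apply: SQ_SupU; lia | exact: Sm].
  - have e1 : f.-1.+1 = f by lia.
    case: hI => a0 [b0]; rewrite e1 => -[ha0 hb0 hfm ->].
    have hwa : SQ T E m.+1 (w * a0).
      by apply: gen_subalg_M; [exact: SQ_HT hw | exact: SQ_le ha0].
    have -> : Ep T E f * (w * (a0 * Ep T E f * b0 * T m)) =
      Ep T E f * (w * a0 * Ep T E f) * (b0 * T m) by rewrite !mulrA.
    apply: kspan_mulr (Ep_SQ_Ep hq hf hwa) => y1 [[h' hh' ->]|hI].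
      by rewrite mulrA -(mulrA _ h'); exact: case1.
    apply: (XI); apply: IdG_mulr; last exact: kspan_in.
    by apply: gen_subalg_M; [exact: SQ_le hb0 | apply: SQ_T; lia].
apply: (@kspan_gen _ _ _ _ (Ep T E f) a _ _ ha); last first.
  by apply: (X1 1 1); rewrite ?mulr1 //; exact: gen_subalg_1.
have Xin y : y \in X -> forall g, ((exists2 i, (0 < i < m)%N & g = T i) \/ ((1 < m)%N /\ g = E)) ->
    y * g \in X.
  by move=> hy g hg; apply: (Xr) => //; exact: gen_subalg_gen.
move=> u g hu hg.
have [hg'|] : ((exists2 i, (0 < i < m)%N & g = T i) \/ ((1 < m)%N /\ g = E)) \/
    (0 < m)%N /\ (g = T m \/ m = 1%N /\ g = E).
  case: hg => [[i hi ->]|[h1 ->]].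
    by have [e|e] := eqVneq i m; [right; rewrite e; split; [lia | left] | left; left; exists i => //; lia].
  by have [e|e] := eqVneq m 1%N; [right; split; [lia | right] | left; right; split => //; lia].
  by apply: Xin => //; exact: kspan_in.
case=> hm [->|[m1 ->]].
  case: hu => [[h [s [hh hs ->]]]|[[h [s [h0 hh hs ->]]]|hI]].
  - have [hfm|hfm] := leqP f.*2 m; first exact: case1.
    by apply: (claimC) => //; [lia | apply: HT_sub hh; lia].
  - rewrite (mulrA h); apply: (claimC) => //; apply: gen_subalg_M; first by apply: HT_sub hh; lia.
    by apply: HT_SupU => //; lia.
  - by apply: (XI); apply: IdG_mulr; [apply: SQ_T; lia | exact: kspan_in].
have [hI|[f0|f1]] : IdG T E f.+1 m.+1 u \/ f = 0%N \/ f = 1%N by (case: hu; auto; right; lia).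
- by apply: (XI); apply: IdG_mulr; [apply: SQ_E; lia | exact: kspan_in].
- apply: (XI); apply: kspan_in.
  have hSu : SQ T E m.+1 u.
    case: hu => [[h [s [hh hs ->]]]|[[h [s [h0 hh hs ->]]]|[x [y [hx hy hf2 ->]]]]]; last 1 first.
    + by do ![apply: gen_subalg_M] => //; exact: SQ_Ep.
    + apply: gen_subalg_M; first exact: SQ_Ep.
      by apply: gen_subalg_M; [exact: SQ_HT hh | exact: SQ_le hs].
    + by rewrite f0 in h0.
  exists u, 1; rewrite f0 Ep1 mulr1; split => //; exact: SQ_1.
- have [c ->] : exists c, u = c *: E.
    case: hu => [[h [s [/HT_triv hh hs ->]]]|[[h [s [h0 /HT_triv hh hs ->]]]|[x [y [hx hy hf2 ->]]]]].
    + have [|c ->] := hh _; first by lia.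
      have [|c' ->] := SQ_triv _ hs; first by lia.
      by exists (c * c'); rewrite f1 Ep1 mulr_algl scalerA mulr_algr.
    + have [|c ->] := hh _; first by lia.
      have [|c' ->] := SQ_triv _ hs; first by lia.
      exists (c * c'); rewrite f1 Ep1 Sup_geq; last by lia.
      by rewrite mul1r mulr_algl scalerA mulr_algr.
    + by move: hf2; lia.
  rewrite -scalerAl (qb_EE hq) scalerA rpredZ //.
  by apply: (X1 1 1); rewrite ?mulr1 ?f1 ?Ep1 //; exact: gen_subalg_1.
Qed.

End Reduction.

(** * Counting up-down tableaux *)

Section Walks.
Local Open Scope nat_scope.
Implicit Types (la mu nu ka : seq nat) (k i j m : nat).

Lemma part_nth la i : is_part la -> nth 0 la i.+1 <= nth 0 la i.
Proof.
move=> /andP[hs _]; have [hi|hi] := ltnP i.+1 (size la); last by rewrite (nth_default 0 hi).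
by have /(sortedP 0) := hs; apply.
Qed.

Lemma part_nth_gt0 la i : is_part la -> (0 < nth 0 la i) = (i < size la).
Proof.
move=> /andP[_ h0]; have [hi|hi] := ltnP i (size la); last by rewrite nth_default.
by rewrite lt0n; apply: contraNneq h0 => <-; rewrite mem_nth.
Qed.

Lemma part_ext la mu : is_part la -> is_part mu -> (forall i, nth 0 la i = nth 0 mu i) -> la = mu.
Proof.
move=> hl hm h; have hs : size la = size mu.
  have H i : (i < size la) = (i < size mu) by rewrite -!part_nth_gt0 // h.
  by have := H (size la); have := H (size mu); lia.
by apply: (eq_from_nth (x0 := 0)).
Qed.

Lemma part_of_fun (g : nat -> nat) M : (forall i, g i.+1 <= g i) -> g M = 0 ->
  exists ka, is_part ka /\ forall i, nth 0 ka i = g i.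
Proof.
move=> hg hM; have h0 : exists i, g i == 0 by exists M; rewrite hM.
case: (ex_minnP h0) => s /eqP hs hmin; exists (mkseq g s).
have gz i : s <= i -> g i = 0.
  move=> /subnK <-; elim: (i - s) => // k IH; apply/eqP; rewrite -leqn0 addSn -IH; exact: hg.
split.
  apply/andP; split.
    apply/(sortedP 0) => i; rewrite size_mkseq => hi.
    by rewrite !nth_mkseq //; [exact: hg | exact: ltnW].
  apply/negP => /mapP[i]; rewrite mem_iota add0n => /andP[_ hi] /esym/eqP/hmin.
  by rewrite leqNgt hi.
move=> i; have [hi|hi] := ltnP i s; first by rewrite nth_mkseq.
by rewrite nth_default ?size_mkseq // gz.
Qed.

Lemma incr_part la k : is_part la -> k = 0 \/ nth 0 la k < nth 0 la k.-1 ->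
  is_part (incr_nth la k).
Proof.
move=> hl hk; have [| |ka [hka e]] := @part_of_fun (nth 0 (incr_nth la k)) (maxn (size la) k.+1).
- move=> i; rewrite !nth_incr_nth; have := part_nth i hl.
  by case: eqP hk => [->|_] /=; case: eqP => // _; lia.
- rewrite nth_incr_nth nth_default; last by lia.
  by have -> : (k == maxn (size la) k.+1) = false by lia.
- suff -> : incr_nth la k = ka by [].
  have hk' : k <= size la.
    case: hk => [->//|h]; have : 0 < nth 0 la k.-1 by lia.
    rewrite (part_nth_gt0 _ hl); case: k {e} h => [|k] /=; lia.
  have hs : size (incr_nth la k) = maxn (size la) k.+1 by rewrite size_incr_nth; case: ltnP => ?; lia.
  have hs' : size ka = size (incr_nth la k).
    apply/eqP; rewrite eqn_leq; apply/andP; split; rewrite leqNgt; apply/negP.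
      by rewrite -(part_nth_gt0 _ hka) e nth_default.
    move=> h; have := part_nth_gt0 (size ka) hka; rewrite ltnn e nth_incr_nth => /negbT.
    rewrite -leqNgt leqn0 addn_eq0 => /andP[/eqP h1 /eqP h2].
    have h3 := part_nth_gt0 (size ka) hl; lia.
  by apply: (eq_from_nth (x0 := 0)) => // i _; rewrite e.
Qed.

Lemma decr_part la k : is_part la -> nth 0 la k.+1 < nth 0 la k ->
  exists ka, is_part ka /\ la = incr_nth ka k.
Proof.
move=> hl hk; pose g i := nth 0 la i - (i == k).
have [| |ka [hka e]] := @part_of_fun g (size la).
- move=> i; rewrite /g; have := part_nth i hl; case: eqP => h1; case: eqP => h2; try subst; lia.
- by rewrite /g nth_default.
exists ka; split=> //.
apply: part_ext => //; last first.
  by move=> i; rewrite nth_incr_nth e /g (eq_sym k i); case: eqP => [->|_] /=; lia.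
apply: incr_part => //; case: k hk @g e => [|k] hk g e; [by left | right].
rewrite !e /g /= eqxx; have := part_nth k hl; have -> : (k == k.+1) = false by lia.
lia.
Qed.

Lemma incr_inj la i j : incr_nth la i = incr_nth la j -> i = j.
Proof.
move=> /(congr1 (nth 0 ^~ i)); rewrite !nth_incr_nth eqxx.
by case: eqP => // _; lia.
Qed.

Lemma incr_addable la k : is_part la -> is_part (incr_nth la k) ->
  k = 0 \/ nth 0 la k < nth 0 la k.-1.
Proof.
case: k => [|k] hl hk; [by left | right].
have := part_nth k hk; rewrite !nth_incr_nth eqxx /=; have -> : (k.+1 == k) = false by lia.
lia.
Qed.

Lemma incr_le la k : is_part la -> is_part (incr_nth la k) -> k <= size la.
Proof.
move=> hl /(incr_addable hl) [->//|h]; have : 0 < nth 0 la k.-1 by lia.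
by rewrite (part_nth_gt0 _ hl); case: k {h} => //= k; lia.
Qed.

Lemma sumn_incr la k : sumn (incr_nth la k) = (sumn la).+1.
Proof. by rewrite sumn_incr_nth addn1 || (elim: la k => [|a la IH] [|k] //=; rewrite ?IH; [elim: k => //=|]; lia). Qed.

Definition adds la := [seq incr_nth la k | k <- iota 0 (size la).+1 & is_part (incr_nth la k)].
Fixpoint parts k : seq (seq nat) :=
  if k is k'.+1 then undup (flatten [seq adds la | la <- parts k']) else [:: [::]].
Definition rems la := [seq mu <- parts (sumn la).-1 | la \in adds mu].

Lemma addsP la mu : is_part la -> reflect (exists k, is_part mu /\ mu = incr_nth la k) (mu \in adds la).
Proof.
move=> hl; apply: (iffP mapP) => [[k]|[k [hm e]]].
  by rewrite mem_filter => /andP[h _] ->; exists k.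
exists k => //; rewrite mem_filter -e hm mem_iota /= add0n ltnS; apply: incr_le => //; by rewrite -e.
Qed.

Lemma adds_uniq la : uniq (adds la).
Proof. by rewrite map_inj_uniq ?filter_uniq ?iota_uniq // => i j; exact: incr_inj. Qed.

Lemma partsP k la : (la \in parts k) = is_part la && (sumn la == k).
Proof.
elim: k la => [|k IH] la.
  rewrite inE; apply/eqP/andP => [->//|[/andP[_ h0] /eqP hs]].
  by case: la h0 hs => // a la; rewrite inE /=; lia.
rewrite mem_undup; apply/flattenP/andP => [[s /mapP[mu]]|[hl /eqP hs]].
  rewrite IH => /andP[hm /eqP <-] -> /(addsP _ hm) [i [hl e]].
  by rewrite e in hl *; rewrite sumn_incr eqxx.
have hsz : 0 < size la by case: la hl hs.
have [|mu [hm e]] := @decr_part la (size la).-1 hl.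
  rewrite prednK // nth_default // part_nth_gt0 //; lia.
exists (adds mu); last by apply/(addsP _ hm); exists (size la).-1.
by apply: map_f; rewrite IH hm /=; move: hs; rewrite e sumn_incr; lia.
Qed.

Lemma parts_uniq k : uniq (parts k).
Proof. by case: k => // k; exact: undup_uniq. Qed.

Lemma remsP la mu : is_part la -> (mu \in rems la) = is_part mu && (la \in adds mu).
Proof.
move=> hl; rewrite mem_filter partsP andbC; case hm: (is_part mu) => //=.
apply: andb_idl => /(addsP _ hm) [k [_ e]]; by rewrite e sumn_incr.
Qed.

Lemma rems_uniq la : uniq (rems la).
Proof. by rewrite filter_uniq ?parts_uniq. Qed.

Lemma size_adds_rems la : is_part la -> size (adds la) <= (size (rems la)).+1.
Proof.
move=> hl; rewrite size_map size_filter /= (_ : is_part (incr_nth la 0)); last by apply: incr_part => //; left.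
rewrite add1n ltnS (iotaDl 1 0) count_map.
set a := preim _ _.
have hka k : exists ka, a k -> k < size la -> is_part ka /\ la = incr_nth ka k.
  have [/andP[ak hk]|hn] := boolP (a k && (k < size la)); last by exists [::] => h1 h2; rewrite h1 h2 in hn.
  have [|ka h] := @decr_part la k hl; last by exists ka.
  by case: (incr_addable hl ak).
pose f k := sval (cid (hka k)).
have fP k : a k -> k < size la -> is_part (f k) /\ la = incr_nth (f k) k by rewrite /f; case: (cid _).
rewrite -size_filter -(size_map f); apply: uniq_leq_size.
  rewrite map_inj_in_uniq ?filter_uniq ?iota_uniq // => i j.
  rewrite !mem_filter !mem_iota !add0n => /andP[ai /= hi] /andP[aj /= hj] e.
  have [hi' ei] := fP i ai hi; have [hj' ej] := fP j aj hj.
  by apply: (@incr_inj (f i)); rewrite -ei {1}ej -e.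
move=> y /mapP[k hk' ->]; move: hk'; rewrite mem_filter mem_iota add0n => /andP[ak /= hk].
have [h1 h2] := fP k ak hk; rewrite remsP // h1 /=; apply/(addsP _ h1).
by exists k; rewrite -h2.
Qed.

(** Two partitions with a common cover have a common lower neighbour. *)
Lemma diamond la mu nu : is_part la -> is_part nu -> la <> nu -> mu \in adds la -> mu \in adds nu ->
  exists ka, ka \in rems la /\ nu \in adds ka.
Proof.
move=> hl hn hne /(addsP _ hl) [i [hm ei]] /(addsP _ hn) [j [_ ej]].
have e k : nth 0 la k + (i == k) = nth 0 nu k + (j == k).
  by have := congr1 (nth 0 ^~ k) ej; rewrite {1}ei /= !nth_incr_nth; lia.
have hij : i <> j.
  by move=> eij; apply: hne; apply: part_ext => // k; have := e k; rewrite eij; lia.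
have [|ka [hka el]] := @decr_part la j hl.
  have h1 := part_nth j hn; have h2 := e j; have h3 := e j.+1; have h4 := part_nth j hm.
  rewrite ei !nth_incr_nth in h4; lia.
have en : nu = incr_nth ka i.
  have h0 k : nth 0 nu k = nth 0 (incr_nth ka i) k.
    by have := e k; rewrite el !nth_incr_nth; lia.
  have hs : is_part (incr_nth ka i).
    apply: incr_part => //; case: i {ei e} hij hm h0 => [|i] hij hm h0; [by left | right].
    have h1 := part_nth i hn; rewrite !h0 !nth_incr_nth in h1.
    have e0 : (i.+1 == i) = false by lia.
    by move: h1; rewrite eqxx e0 /=; lia.
  exact: part_ext.
exists ka; rewrite remsP // hka /=; split; apply/(addsP _ hka); [exists j | exists i]; by rewrite -?el -?en.
Qed.

Lemma adds_common la nu mu mu' : is_part la -> is_part nu -> la <> nu ->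
  mu \in adds la -> mu \in adds nu -> mu' \in adds la -> mu' \in adds nu -> mu = mu'.
Proof.
move=> hl hn hne /(addsP _ hl) [i [hm ei]] /(addsP _ hn) [j [_ ej]].
move=> /(addsP _ hl) [i' [hm' ei']] /(addsP _ hn) [j' [_ ej']].
have e k : nth 0 la k + (i == k) = nth 0 nu k + (j == k).
  by have := congr1 (nth 0 ^~ k) ej; rewrite {1}ei /= !nth_incr_nth; lia.
have e' k : nth 0 la k + (i' == k) = nth 0 nu k + (j' == k).
  by have := congr1 (nth 0 ^~ k) ej'; rewrite {1}ei' /= !nth_incr_nth; lia.
have hij : i <> j.
  by move=> eij; apply: hne; apply: part_ext => // k; have := e k; rewrite eij; lia.
suff -> : mu = incr_nth la i' by [].
rewrite ei; congr incr_nth.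
have := e i; have := e' i; rewrite eqxx; have -> : (j == i) = false by apply/eqP; lia.
by case: eqP => [->|_] //=; case: eqP => //=; lia.
Qed.

(** ** Walks to the empty partition *)

Fixpoint cnt k la : nat :=
  if k is k'.+1 then \sum_(mu <- adds la ++ rems la) cnt k' mu else (la == [::]).

Lemma sum_filter (s : seq (seq nat)) (P : pred (seq nat)) (F : seq nat -> nat) :
  \sum_(x <- [seq x <- s | P x]) F x = \sum_(x <- s) P x * F x.
Proof.
by rewrite big_filter big_mkcond; apply: eq_bigr => x _; case: (P x); rewrite ?mul1n ?mul0n.
Qed.

Lemma sum_adds (F : seq nat -> nat) la k : is_part la -> sumn la = k ->
  \sum_(mu <- adds la) F mu = \sum_(mu <- parts k.+1) (mu \in adds la) * F mu.
Proof.
move=> hl hs; rewrite -sum_filter; apply: perm_big; apply: uniq_perm.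
- exact: adds_uniq.
- by rewrite filter_uniq ?parts_uniq.
move=> mu; rewrite mem_filter partsP; case h: (mu \in adds la) => //=; apply: esym.
by move/(addsP _ hl): h => [i [hm e]]; rewrite hm e sumn_incr hs eqxx.
Qed.

(** The form in which [DU - UD = 1] holds for adding and removing nodes in the Young graph. *)
Lemma down_up_le (F : seq nat -> nat) la : is_part la ->
  \sum_(mu <- adds la) \sum_(nu <- rems mu) F nu <=
  F la + \sum_(ka <- rems la) \sum_(nu <- adds ka) F nu.
Proof.
move=> hl; set k := sumn la.
have -> : \sum_(mu <- adds la) \sum_(nu <- rems mu) F nu =
    \sum_(nu <- parts k) \sum_(mu <- adds la) (mu \in adds nu) * F nu.
  rewrite exchange_big; apply: eq_big_seq => mu /(addsP _ hl) [i [_ e]].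
  by rewrite /rems sum_filter e sumn_incr.
have -> : \sum_(ka <- rems la) \sum_(nu <- adds ka) F nu =
    \sum_(nu <- parts k) \sum_(ka <- rems la) (nu \in adds ka) * F nu.
  rewrite exchange_big; apply: eq_big_seq => ka; rewrite remsP // => /andP[hka /(addsP _ hka) [i [_ e]]].
  by rewrite (sum_adds F hka erefl) /k e sumn_incr.
have -> : F la = \sum_(nu <- parts k) (nu == la) * F nu.
  rewrite -sum_filter (eq_filter (a2 := pred1 la)) // filter_pred1_uniq ?parts_uniq ?big_seq1 //.
  by rewrite partsP hl eqxx.
rewrite -big_split /=; rewrite big_seq [X in _ <= X]big_seq; apply: leq_sum => nu.
rewrite partsP => /andP[hn /eqP hns]; rewrite -!big_distrl -mulnDl leq_mul2r; apply/orP; right.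
have cE (s : seq (seq nat)) (P : pred (seq nat)) : \sum_(x <- s) (P x : nat) = count P s.
  by rewrite -sum1_count [RHS]big_mkcond; apply: eq_bigr => x _; case: (P x).
rewrite !cE; case: eqP => [->|hne].
  rewrite add1n (eq_in_count (a2 := predT)) ?count_predT; last by move=> mu ->.
  apply: leq_trans (size_adds_rems hl) _; rewrite ltnS.
  rewrite [X in _ <= X](eq_in_count (a2 := predT)) ?count_predT // => ka.
  by rewrite remsP // => /andP[_ ->].
rewrite add0n; have [/hasP[mu h1 h2]|] := boolP (has (fun mu => mu \in adds nu) (adds la)); last first.
  by rewrite has_count -leqNgt leqn0 => /eqP ->.
have hne' : la <> nu by move=> e; apply: hne.
have [ka [hk1 hk2]] := diamond hl hn hne' h1 h2.
apply: (@leq_trans 1); last by rewrite -has_count; apply/hasP; exists ka.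
rewrite -size_filter -[1]/(size [:: mu]); apply: uniq_leq_size; first by rewrite filter_uniq ?adds_uniq.
move=> mu'; rewrite mem_filter inE => /andP[h3 h4]; apply/eqP.
exact: (adds_common hl hn hne').
Qed.

Lemma cnt_adds k la : is_part la -> \sum_(mu <- adds la) cnt k mu <= k * cnt k.-1 la.
Proof.
elim: k la => [|k IH] la hl.
  rewrite big1_seq // => mu /andP[_ /(addsP _ hl) [i [_ ->]]] /=.
  by apply/eqP; rewrite eqb0; apply/eqP => /(congr1 sumn); rewrite sumn_incr.
rewrite /= (eq_bigr (fun mu => \sum_(nu <- adds mu) cnt k nu + \sum_(nu <- rems mu) cnt k nu)); last first.
  by move=> mu _; rewrite big_cat.
rewrite big_split /=; apply: (@leq_trans (\sum_(mu <- adds la) (k * cnt k.-1 mu) +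
    (cnt k la + \sum_(ka <- rems la) (k * cnt k.-1 ka)))).
  apply: leq_add.
    rewrite big_seq [X in _ <= X]big_seq; apply: leq_sum => mu /(addsP _ hl) [i [hm _]]; exact: IH.
  apply: leq_trans (down_up_le _ hl) _; rewrite leq_add2l.
  rewrite big_seq [X in _ <= X]big_seq; apply: leq_sum => ka; rewrite remsP // => /andP[hk _]; exact: IH.
rewrite addnCA mulSn leq_add2l -!big_distrr /= -mulnDr.
case: k {IH} => [|k]; first by rewrite !mul0n.
by rewrite /= big_cat.
Qed.

(** This bounds the number of closed walks of length [2m] by [(2m-1)!!], the number of
    Brauer diagrams. *)
Lemma cnt_closed m : cnt m.+1.*2 [::] <= m.*2.+1 * cnt m.*2 [::].
Proof.
rewrite doubleS; change (\sum_(mu <- adds [::] ++ rems [::]) cnt m.*2.+1 mu <= m.*2.+1 * cnt m.*2 [::]).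
rewrite big_cat -[X in X <= _]/(\sum_(mu <- adds [::]) cnt m.*2.+1 mu + \sum_(mu <- rems [::]) cnt m.*2.+1 mu) [X in _ + X](_ : _ = 0) ?addn0; first exact: (@cnt_adds m.*2.+1 [::]).
rewrite big1_seq // => mu /andP[_]; rewrite remsP // => /andP[hm /(addsP _ hm) [i [_ /(congr1 sumn)]]].
Qed.

Lemma cnt_zero k la : is_part la -> k < sumn la -> cnt k la = 0.
Proof.
elim: k la => [|k IH] la hl hk /=; first by case: la hl hk.
rewrite big1_seq // => mu /andP[_]; rewrite mem_cat => /orP[/(addsP _ hl) [i [hm e]]|].
  by apply: IH => //; rewrite e sumn_incr; lia.
rewrite remsP // => /andP[hm /(addsP _ hm) [i [_ e]]].
by apply: IH => //; move: hk; rewrite e sumn_incr; lia.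
Qed.

Definition parts_upto M := flatten [seq parts k | k <- iota 0 M.+1].

Lemma parts_uptoP M la : (la \in parts_upto M) = is_part la && (sumn la <= M).
Proof.
apply/flattenP/andP => [[s /mapP[k]]|[hl hs]].
  by rewrite mem_iota add0n ltnS => hk -> ; rewrite partsP => /andP[-> /eqP ->].
exists (parts (sumn la)); last by rewrite partsP hl eqxx.
by apply: map_f; rewrite mem_iota; lia.
Qed.

Lemma parts_upto_uniq M : uniq (parts_upto M).
Proof.
rewrite /parts_upto; elim: (M.+1) 0 => //= k IH i; rewrite cat_uniq parts_uniq IH andbT /=.
apply/hasPn => la /flattenP[s /mapP[j]]; rewrite mem_iota => hj ->; rewrite !partsP.
by move=> /andP[-> /eqP ->]; rewrite /=; lia.
Qed.

Definition adj la mu := (mu \in adds la) || (la \in adds mu).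

Lemma nbrs_mem la mu : is_part la -> is_part mu -> (mu \in adds la ++ rems la) = adj la mu.
Proof. by move=> hl hm; rewrite mem_cat remsP // hm. Qed.

Lemma nbrs_part la mu : is_part la -> mu \in adds la ++ rems la -> is_part mu.
Proof.
move=> hl; rewrite mem_cat => /orP[/(addsP _ hl) [i []] //|]; by rewrite remsP // => /andP[].
Qed.

Lemma nbrs_uniq la : is_part la -> uniq (adds la ++ rems la).
Proof.
move=> hl; rewrite cat_uniq adds_uniq rems_uniq andbT /=; apply/hasPn => mu.
rewrite remsP // => /andP[hm /(addsP _ hm) [i [_ e]]]; apply/negP => /(addsP _ hl) [j [_ e']].
by have := congr1 sumn e; rewrite e' !sumn_incr; lia.
Qed.

Lemma cntS M k la : k <= M -> la \in parts_upto M ->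
  cnt k.+1 la = \sum_(mu <- parts_upto M) adj la mu * cnt k mu.
Proof.
move=> hk; move: (parts_uptoP M) (parts_upto_uniq M); move: (parts_upto M) => U hU uU.
rewrite hU => /andP[hl hs]; rewrite -[LHS]/(\sum_(mu <- adds la ++ rems la) cnt k mu) -sum_filter.
rewrite (bigID (fun mu => sumn mu <= M)) /= [X in _ + X](_ : _ = 0) ?addn0; last first.
  rewrite big_seq_cond big1 // => mu /andP[hmu hM]; apply: cnt_zero; first exact: nbrs_part hmu.
  by lia.
rewrite -big_filter; apply: perm_big; apply: uniq_perm.
- by rewrite filter_uniq ?nbrs_uniq.
- by rewrite filter_uniq.
move=> mu; rewrite !mem_filter hU; case hm: (is_part mu).
  by rewrite nbrs_mem //= andbC.
rewrite andbF; apply/negbTE; apply/negP => /andP[_ /(nbrs_part hl)]; by rewrite hm.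
Qed.

Lemma adj_sym la mu : adj la mu = adj mu la.
Proof. by rewrite /adj orbC. Qed.

Lemma cnt_glue M a b : a + b <= M ->
  \sum_(la <- parts_upto M) cnt a la * cnt b la = cnt (a + b) [::].
Proof.
elim: a b => [|a IH] b hM.
  rewrite add0n (eq_bigr (fun la => (la == [::]) * cnt b la)) // -sum_filter.
  have h0 : [::] \in parts_upto M by rewrite parts_uptoP.
  by rewrite (eq_filter (a2 := pred1 [::])) // filter_pred1_uniq ?parts_upto_uniq ?h0 ?big_seq1.
rewrite addSnnS -IH; last by lia.
transitivity (\sum_(la <- parts_upto M) \sum_(mu <- parts_upto M) adj la mu * cnt a mu * cnt b la).
  by apply: eq_big_seq => la hla; rewrite (@cntS M) ?big_distrl //; lia.
rewrite exchange_big; apply: eq_big_seq => mu hmu.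
rewrite (@cntS M b) //; last by lia.
rewrite big_distrr /=; apply: eq_bigr => la _; rewrite adj_sym; lia.
Qed.

Lemma cnt_square M m : m.*2 <= M ->
  \sum_(la <- parts_upto M) cnt m la * cnt m la = cnt m.*2 [::].
Proof. by move=> h; rewrite cnt_glue addnn. Qed.

(** ** Enumeration of up-down tableaux *)

Fixpoint walks m la : seq (seq (seq nat)) :=
  if m is m'.+1 then flatten [seq [seq rcons t la | t <- walks m' mu] | mu <- adds la ++ rems la]
  else if la == [::] then [:: [:: [::]]] else [::].

Lemma size_walks m la : size (walks m la) = cnt m la.
Proof.
elim: m la => [|m IH] la /=; first by case: eqP.
rewrite size_flatten /shape -map_comp sumnE big_map; apply: eq_bigr => mu _ /=.
by rewrite size_map IH.
Qed.

Lemma add_adj mu la : (exists k, add_node mu la k \/ add_node la mu k) <->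
  [/\ is_part la, is_part mu & adj la mu].
Proof.
split=> [[k [[h1 h2 h3 e]|[h1 h2 h3 e]]]|[hl hm /orP[/(addsP _ hl) [k [_ e]]|/(addsP _ hm) [k [_ e]]]]].
- by split=> //; rewrite /adj; apply/orP; right; apply/(addsP _ h2); exists k.-1; rewrite -e.
- by split=> //; rewrite /adj; apply/orP; left; apply/(addsP _ h2); exists k.-1; rewrite -e.
- by exists k.+1; right.
- by exists k.+1; left.
Qed.

Lemma walksP m la t : is_part la -> (t \in walks m la) <-> updown m la t.
Proof.
elim: m la t => [|m IH] la t hl /=.
  case: eqP => [->|hne]; split.
  - by rewrite inE => /eqP ->; split.
  - move=> [hs h0 _ _]; rewrite inE; apply/eqP; case: t hs h0 => [|a [|b t]] //= _ ->; by [].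
  - by [].
  - by move=> [_ h0 h1 _]; case: hne; rewrite -h0 -h1.
split=> [/flattenP[s /mapP[mu hmu ->] /mapP[u hu ->]]|[hs h0 hend hstep]].
  have hm := nbrs_part hl hmu; have [us u0 uend ustep] := (IH _ _ hm).1 hu.
  split; first by rewrite size_rcons us.
  - by rewrite nth_rcons us /=.
  - by rewrite nth_rcons us ltnn eqxx.
  move=> i hi; rewrite !nth_rcons us; have -> : i < m.+1 by [].
  have [him|him] := ltnP i.+1 m.+1; first exact: ustep.
  have -> : i = m by lia.
  rewrite eqxx uend; apply/add_adj; split=> //.
  by rewrite -nbrs_mem.
case/lastP: t hs h0 hend hstep => // u x; rewrite size_rcons => -[hs] h0.
rewrite nth_rcons hs ltnn eqxx => ex hstep; subst x.
have [_ hm had] := (add_adj _ _).1 (hstep m (ltnSn m)).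
move: hm had; rewrite !nth_rcons hs ltnSn ltnn eqxx => hm had.
apply/flattenP; exists [seq rcons t la | t <- walks m (nth [::] u m)].
  by apply: map_f; rewrite nbrs_mem.
apply: map_f; apply/(IH _ _ hm); split=> //.
- by move: h0; rewrite nth_rcons hs.
- move=> i hi; have := hstep i; have e1 : i < m.+1 by lia.
  have e2 : i.+1 < m.+1 by lia.
  by rewrite !nth_rcons hs e1 e2; apply; lia.
Qed.

Lemma walks_uniq m la : is_part la -> uniq (walks m la).
Proof.
elim: m la => [|m IH] la hl /=; first by case: eqP.
have := nbrs_uniq hl; have : {subset adds la ++ rems la <= is_part} by move=> mu; exact: nbrs_part.
elim: (_ ++ _) => //= mu s IHs hsub /andP[hmu hs].
have hm : is_part mu by apply: hsub; rewrite inE eqxx.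
rewrite cat_uniq map_inj_uniq ?IH //; last by move=> t t' /rcons_inj [].
rewrite IHs // ?andbT; last by move=> x hx; apply: hsub; rewrite inE hx orbT.
apply/hasPn => _ /flattenP[s' /mapP[nu hnu ->] /mapP[u hu ->]]; apply/negP => /mapP[u' hu' /rcons_inj [e]].
have hn : is_part nu by apply: hsub; rewrite inE hnu orbT.
have [_ _ e1 _] := (walksP m u hn).1 hu; have [_ _ e2 _] := (walksP m u' hm).1 hu'.
by move: hmu; rewrite -e2 -e e1 hnu.
Qed.

Lemma updown_sumn m la t : updown m la t -> is_part la -> sumn la <= m.
Proof.
move=> h hl; have : t \in walks m la by apply/walksP.
case: leqP => // hm; have := cnt_zero hl hm; rewrite -size_walks => /size0nil ->.
by rewrite in_nil.
Qed.

(** Indices of a Murphy basis of [B_m]. *)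
Definition tripairs m : seq (seq nat * seq (seq nat) * seq (seq nat)) :=
  flatten [seq [seq (la, s, t) | s <- walks m la, t <- walks m la] | la <- parts_upto m.*2].

Lemma tripairsP m x : x \in tripairs m <->
  [/\ is_part x.1.1, updown m x.1.1 x.1.2 & updown m x.1.1 x.2].
Proof.
split=> [/flattenP[s /mapP[la]]|].
  rewrite parts_uptoP => /andP[hl _] -> /allpairsP[[u v] [hu hv ->]] /=.
  by split=> //; apply/walksP.
case: x => [[la s] t] /= [hl hs ht]; apply/flattenP.
exists [seq (la, s, t) | s <- walks m la, t <- walks m la].
  by apply/mapP; exists la => //; rewrite parts_uptoP hl /=; have := updown_sumn hs hl; lia.
by apply/allpairsP; exists (s, t); split=> //; apply/walksP.
Qed.

Lemma tripairs_uniq m : uniq (tripairs m).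
Proof.
rewrite /tripairs; have := parts_upto_uniq m.*2.
have : {subset parts_upto m.*2 <= is_part} by move=> la; rewrite parts_uptoP => /andP[].
elim: (parts_upto _) => //= la s IH hsub /andP[hla hs].
have hl : is_part la by apply: hsub; rewrite inE eqxx.
rewrite cat_uniq allpairs_uniq ?walks_uniq // ?IH // ?andbT; last first.
- by move=> [u v] [u' v'] _ _ /= [-> ->].
- by move=> x hx; apply: hsub; rewrite inE hx orbT.
apply/hasPn => _ /flattenP[s' /mapP[mu hmu ->] /allpairsP[[u v] [_ _ ->]]] /=.
by apply/negP => /allpairsP[[u' v'] [_ _ [e _ _]]]; rewrite -e hmu in hla.
Qed.

Lemma size_tripairs m : size (tripairs m) = cnt m.*2 [::].
Proof.
rewrite -(@cnt_square m.*2) // size_flatten /shape -map_comp sumnE big_map.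
by apply: eq_bigr => la _ /=; rewrite size_allpairs size_walks.
Qed.

End Walks.

(** * The special elements in terms of strings *)

Section Links.
Variable n : nat.
Local Notation B := (qBrauer n).
Local Notation T := (bT n).
Local Notation E := (bE n).
Local Notation U := (Uof T).
Local Notation q := kq.
Implicit Types (u v w : 'S_n) (la mu pi tau rho : seq nat) (m f s i j k a b x y : nat).

Lemma brauer_qbs : (1 < n)%N -> qbs n T E.
Proof.
move=> hn; have rl (s t : bterm) : brel n s t -> bpi n s = bpi n t by move=> h; exact/bpi_eq/beq_rel.
have TV i : bpi n (termTV i) = U i by rewrite bpiTV UofE.
have sc c (x : B) : bpi n (TermC c) * x = c *: x by rewrite bpi_scale.
have E2 : bpi n termE2 = e2 T E by rewrite e2E !bpi_mul -!/(bT n _) -!TV.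
split.
- exact: bT_braids.
- exact: bT_quadratic.
- exact: bsigmaT.
- exact: bsigmaE.
- by rewrite -[LHS]bpi_mul (rl _ _ (rel_EE hn)) bpi_mul sc.
- by rewrite -[LHS]bpi_mul (rl _ _ (rel_TE hn)) bpi_mul sc.
- by move=> h; have := rl _ _ (rel_ETE h); rewrite !bpi_mul sc.
- move=> i hi; have [hin|hin] := ltnP i n; last first.
    by rewrite /GRing.comm bT_out ?mul0r ?mulr0 //; lia.
  have h : (2 < i < n)%N by rewrite hi.
  by have := rl _ _ (rel_TEcomm h); rewrite !bpi_mul.
- by move=> h; have := rl _ _ (rel_E2l h); rewrite 4!bpi_mul E2 -!TV.
- by move=> h; have := rl _ _ (rel_E2r h); rewrite 4!bpi_mul E2 -!TV.
Qed.

Lemma inv_eq (x y : B) : x * y = 1 -> y * x = 1 -> x^-1 = y.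
Proof.
move=> h1 h2; have ux : x \is a GRing.unit by apply/unitrP; exists y.
by rewrite -[LHS]mulr1 -h1 mulKr.
Qed.

Lemma inv_Sdn a b : (0 < a)%N -> (b <= n)%N -> (Sdn T b a)^-1 = Sup U a b.
Proof.
move=> h1 h2; apply: inv_eq; first exact: (SdnT_SupU (@bT_quadratic n)).
exact: (SupU_SdnT (@bT_quadratic n)).
Qed.

Lemma inv_Tij b a : (0 < a <= b)%N -> (b <= n)%N -> (Tij n b a)^-1 = Sup U a b.
Proof. by move=> h1 h2; rewrite Tij_dn // inv_Sdn //; lia. Qed.

Lemma Sup_unit a b : (0 < a)%N -> (b <= n)%N -> Sup T a b \is a GRing.unit.
Proof.
move=> ha hb; rewrite /Sup; have: all (fun i => 0 < i < n)%N (iota a (b - a)).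
  by apply/allP => i; rewrite mem_iota; lia.
elim: (iota a (b - a)) => [|i l IH] /=; first by rewrite pr_nil unitr1.
move=> /andP[hi hl]; rewrite pr_cons unitrMl ?IH //; apply/unitrP; exists (U i); split.
  exact: (UT (@bT_quadratic n)).
exact: (TU (@bT_quadratic n)).
Qed.

Lemma Epow_Ep k : (k.*2 <= n)%N -> Epow n k = Ep T E k.
Proof.
elim: k => [|k IH] hk; first by rewrite Ep0.
rewrite EpS /= IH; last by lia.
rewrite Tij_up ?inv_Tij; try lia.
by rewrite !mulrA.
Qed.

(** ** The symmetrizer of a row stabilizer *)

Definition rows_stable s la w := forall pi c tau x, la = pi ++ c :: tau ->
  (s + sumn pi < x <= s + sumn pi + c)%N -> (s + sumn pi < pact w x <= s + sumn pi + c)%N.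

Lemma perm_eq_stable w a c : (0 < a)%N -> (a + c <= n.+1)%N ->
  reflect (forall x, (a <= x < a + c)%N -> (a <= pact w x < a + c)%N)
    (perm_eq (map (pact w) (iota a c)) (iota a c)).
Proof.
move=> ha hc; apply: (iffP idP) => [h x hx|h].
  have : pact w x \in map (pact w) (iota a c) by apply: map_f; rewrite mem_iota.
  by rewrite (perm_mem h) mem_iota.
have hu : uniq (map (pact w) (iota a c)).
  rewrite map_inj_in_uniq ?iota_uniq // => x y; rewrite !mem_iota => hx hy; apply: pact_inj; lia.
apply: uniq_perm => //; first exact: iota_uniq.
have hs : {subset map (pact w) (iota a c) <= iota a c}.
  by move=> z /mapP[x]; rewrite !mem_iota => hx ->; exact: h.
by have [] := uniq_min_size hu hs; rewrite ?size_map.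
Qed.

Lemma row_tab_cons a c la : reshape (c :: la) (iota a (sumn (c :: la))) =
  iota a c :: reshape la (iota (a + c) (sumn la)).
Proof.
rewrite /= iotaD take_size_cat ?size_iota // drop_size_cat ?size_iota //.
Qed.

Lemma rows_stableP s la w : (s + sumn la <= n)%N ->
  all (fun r => perm_eq (map (pact w) r) r) (reshape la (iota s.+1 (sumn la))) <-> rows_stable s la w.
Proof.
elim: la s => [|c la IH] s hs; first by split=> // _ [].
rewrite row_tab_cons [all _ _]/(_ && _) addSn; move: hs => /= hs; split.
  move=> /andP[/perm_eq_stable h1 /IH h2] [|d pi] c' tau x /= [<- e] hx.
    by have := h1 _ _ x; lia.
  have := h2 _ pi c' tau x e; rewrite !addnA in hx *; apply; lia.
move=> h; apply/andP; split.
  by apply/perm_eq_stable => [||x hx]; [lia | lia | have := h [::] c la x erefl; rewrite /=; lia].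
apply/IH; first by lia.
by move=> pi c' tau x e hx; have := h (c :: pi) c' tau x; rewrite e /= !addnA; apply.
Qed.

Lemma fixes_offP w s k : (s + k <= n)%N ->
  fixes_off w (iota s.+1 k) <-> (forall x, (0 < x <= n)%N -> ~~ (s < x <= s + k)%N -> pact w x = x).
Proof.
move=> hk; split=> [/forallP h x hx hx'|h].
  have [i e] := pact_ord hx; have := h i; rewrite e pactE mem_iota => /implyP H.
  by rewrite (eqP (H _)) //; move: hx'; rewrite e; lia.
apply/forallP => i; apply/implyP; rewrite mem_iota => hi; apply/eqP/val_inj/succn_inj.
by rewrite -pactE h //; have := ltn_ord i; lia.
Qed.

Lemma row_stabP f la w : (f.*2 + sumn la <= n)%N -> (w \in row_stab n f la) <->
  (forall x, (0 < x <= n)%N -> ~~ (f.*2 < x <= f.*2 + sumn la)%N -> pact w x = x) /\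
  rows_stable f.*2 la w.
Proof.
move=> h; rewrite inE /tab_entries /row_tab /tab_entries; split.
  by move=> /andP[/(fixes_offP _ h) h1 /(rows_stableP _ h) h2].
by move=> [h1 h2]; apply/andP; split; [apply/(fixes_offP _ h) | apply/(rows_stableP _ h)].
Qed.

Lemma row_stab_rcons f rho c j w : (f.*2 + sumn rho + c.+1 <= n)%N ->
  let M := (f.*2 + sumn rho + c.+1)%N in (f.*2 + sumn rho < j <= M)%N ->
  ((w * wdn n M j)%g \in row_stab n f (rcons rho c.+1)) && (pact (w * wdn n M j)%g M == j) =
  (w \in row_stab n f (rcons rho c)).
Proof.
move=> hn M hj; have eM : M = (f.*2 + sumn rho + c.+1)%N by [].
clearbody M.
have s1 : sumn (rcons rho c.+1) = (sumn rho + c.+1)%N by rewrite sumn_rcons.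
have s0 : sumn (rcons rho c) = (sumn rho + c)%N by rewrite sumn_rcons.
have pw x : (0 < x <= n)%N -> pact (w * wdn n M j)%g x =
    if pact w x == M then j else if (j <= pact w x < M)%N then (pact w x).+1 else pact w x.
  by move=> hx; rewrite pactM // pact_wdn; [|lia|lia|exact: pact_range].
have inj x y : (0 < x <= n)%N -> (0 < y <= n)%N -> pact w x = pact w y -> x = y by move=> h1 h2; exact: pact_inj.
have rg x : (0 < x <= n)%N -> (0 < pact w x <= n)%N by exact: pact_range.
apply/andP/idP.
  have hle : (f.*2 + sumn (rcons rho c.+1) <= n)%N by rewrite s1; lia.
  move=> [/(row_stabP _ hle) [h1 h2] hM]; rewrite s1 in h1.
  have hwM : pact w M = M.
    have := hM; rewrite pw; last by lia.
    have hM0 : (0 < M <= n)%N by lia.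
    by case: (pact w M =P M) => // h; case: ifP => h3 /eqP h4; have := rg M hM0; lia.
  apply/row_stabP; first by rewrite s0; lia.
  rewrite s0; split.
    move=> x hx hx'; have [->|hxM] := eqVneq x M; first by [].
    have := h1 x hx; rewrite pw // => H; have := inj x M hx.
    move: H; case: eqP => h3 H H'; first by exfalso; have := H' _ (etrans h3 (esym hwM)); lia.
    by case: ifP H => h4 H; lia.
  move=> pi d tau x e hx.
  case/lastP: tau e => [|tau z]; rewrite ?cats1 -?rcons_cons -?rcons_cat => /rcons_inj [e1 e2].
    subst pi d; have := h2 rho c.+1 [::] x; rewrite cats1 => /(_ erefl) H.
    have hx0 : (0 < x <= n)%N by lia.
    have := inj x M hx0; rewrite hwM => H'; have : pact w x <> M by move=> h; have := H' _ h; lia.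
    by have := H _; rewrite pw //; case: eqP => // _; case: ifP => h4; lia.
  have hsz : (sumn pi + d <= sumn rho)%N by rewrite e1 sumn_cat /=; lia.
  have hx0 : (0 < x <= n)%N by lia.
  have := h2 pi d (rcons tau c.+1) x; rewrite -rcons_cons -rcons_cat -e1 => /(_ erefl hx).
  rewrite pw //; case: eqP => h3; first by lia.
  by case: ifP => h4; lia.
have hle : (f.*2 + sumn (rcons rho c) <= n)%N by rewrite s0; lia.
move=> /(row_stabP _ hle) [h1 h2]; rewrite s0 in h1.
have hwM : pact w M = M by apply: h1; lia.
rewrite pw ?hwM ?eqxx; last by lia.
split=> //; apply/row_stabP; first by rewrite s1; lia.
rewrite s1; split.
  move=> x hx hx'; rewrite pw // h1 //; last by lia.
  by case: eqP => h3; [lia | case: ifP => h4; lia].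
move=> pi d tau x e hx.
case/lastP: tau e => [|tau z]; rewrite ?cats1 -?rcons_cons -?rcons_cat => /rcons_inj [e1 e2].
  subst pi d; have hx0 : (0 < x <= n)%N by lia.
  rewrite pw //; have [->|hxM] := eqVneq x M; first by rewrite hwM eqxx; lia.
  have := h2 rho c [::] x; rewrite cats1 => /(_ erefl) H.
  by case: eqP => h3; [lia | case: ifP => h4; lia].
have hsz : (sumn pi + d <= sumn rho)%N by rewrite e1 sumn_cat /=; lia.
have hx0 : (0 < x <= n)%N by lia.
have := h2 pi d (rcons tau c) x; rewrite -rcons_cons -rcons_cat -e1 => /(_ erefl hx) H.
by rewrite pw //; case: eqP => h3; [lia | case: ifP => h4; lia].
Qed.

Lemma row_stab_fixes f la w : (f.*2 + sumn la <= n)%N -> w \in row_stab n f la ->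
  fixes_above (f.*2 + sumn la) w.
Proof. by move=> h /(row_stabP _ h) [h1 _] x hx; apply: h1; lia. Qed.

Lemma row_stab_eq f la la' : (f.*2 + sumn la <= n)%N -> (f.*2 + sumn la' <= n)%N ->
  sumn la = sumn la' -> (forall w, rows_stable f.*2 la w <-> rows_stable f.*2 la' w) ->
  row_stab n f la = row_stab n f la'.
Proof.
move=> h h' e hw; apply/setP => w; apply/idP/idP.
  by move=> /(row_stabP _ h) [h1 h2]; apply/row_stabP => //; split; [rewrite -e | exact/hw].
by move=> /(row_stabP _ h') [h1 h2]; apply/row_stabP => //; split; [rewrite e | exact/hw].
Qed.

(** Sorting the row stabilizer by the image of the last entry of the last row matches
    the recursion for the symmetrizers. *)
Lemma xla_xP f la : (f.*2 + sumn la <= n)%N -> xla n f la = xP T f.*2 la.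
Proof.
have [N hN] : exists N, (size la + sumn la <= N)%N by exists (size la + sumn la)%N.
elim: N la hN => [|N IH] la.
  case: la => // _ hn; rewrite xP_nil /xla (big_pred1 1%g).
    by rewrite (Tw1 n).2 (Tw1 n).1 expr0 scale1r.
  move=> w; apply/idP/eqP => [/(row_stabP _ hn) [h1 _] |->].
    by apply: perm_pact => x hx; rewrite pact1 // h1 //=; lia.
  by apply/row_stabP => //; split=> [x hx _|[]//]; rewrite pact1.
case/lastP: la => [|rho [|c]] hN hn; first by apply: IH.
- rewrite size_rcons sumn_rcons in hN hn.
  have -> : xP T f.*2 (rcons rho 0) = xP T f.*2 rho.
    by rewrite -cats1 xP_cat xP_cons Xs0 xP_nil !mulr1.
  rewrite -IH; [|lia|lia]; rewrite /xla; apply: eq_bigl => w.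
  rewrite (@row_stab_eq f (rcons rho 0) rho) ?sumn_rcons ?addn0 //; try lia.
  move=> w'; split=> h pi d tau x.
    by move=> e; apply: (h pi d (rcons tau 0)); rewrite e rcons_cat.
  case/lastP: tau => [|tau z]; rewrite ?cats1 -?rcons_cons -?rcons_cat => /rcons_inj [e1 e2].
    by rewrite -e2 => hx; exfalso; lia.
  exact: h e1.
- rewrite size_rcons sumn_rcons in hN hn.
  set M := (f.*2 + sumn rho + c.+1)%N.
  have -> : xP T f.*2 (rcons rho c.+1) = xP T f.*2 (rcons rho c) *
      \sum_((f.*2 + sumn rho).+1 <= j < M.+1) q ^+ (M - j) *: Sdn T M j.
    rewrite -[rcons rho c.+1]cats1 -[rcons rho c]cats1 !xP_cat !xP_cons !xP_nil !mulr1 (XsS T (f.*2 + sumn rho) c) mulrA.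
    by rewrite (Rx_sum n (f.*2 + sumn rho) c.+1).
  rewrite -IH; [|rewrite ?size_rcons sumn_rcons; lia|rewrite sumn_rcons; lia].
  rewrite mulr_sumr; pose F w := q ^+ slen w *: Tw w.
  transitivity (\sum_((f.*2 + sumn rho).+1 <= j < M.+1)
      \sum_(w | (w \in row_stab n f (rcons rho c.+1)) && (pact w M == j)) F w).
    rewrite (eq_bigr (fun j => \sum_(w in row_stab n f (rcons rho c.+1)) (if pact w M == j then F w else 0))); last first.
      by move=> j _; rewrite big_mkcondr.
    rewrite exchange_big /= /xla; apply: eq_bigr => w hw.
    have hle : (f.*2 + sumn (rcons rho c.+1) <= n)%N by rewrite sumn_rcons; lia.
    have [_ h2] := (row_stabP w hle).1 hw.
    have hM : ((f.*2 + sumn rho).+1 <= pact w M < M.+1)%N.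
      by have := h2 rho c.+1 [::] M; rewrite cats1 => /(_ erefl); rewrite /M; lia.
    rewrite (bigD1_seq (pact w M)) ?iota_uniq ?mem_index_iota //= eqxx big1 ?addr0 // => j.
    by rewrite eq_sym => /negbTE ->.
  apply: eq_big_nat => j hj.
  rewrite (reindex_inj (mulIg (wdn n M j))) /=.
  rewrite (eq_bigl (mem (row_stab n f (rcons rho c)))); last first.
    by move=> w; apply: row_stab_rcons; lia.
  rewrite /xla mulr_suml; apply: eq_bigr => w hw; rewrite /F.
  have hwf : fixes_above M.-1 w.
    have hle : (f.*2 + sumn (rcons rho c) <= n)%N by rewrite sumn_rcons; lia.
    have H := row_stab_fixes hle hw; rewrite sumn_rcons in H.
    by move=> x hx; apply: H; rewrite /M in hx; lia.
  have [-> ->] := @Tw_dn n w M j ltac:(lia) ltac:(lia) hwf.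
  by rewrite exprD -scalerAl -scalerAr scalerA.
Qed.

(** ** One step of an up-down tableau *)

(** Removing the last node of a row may leave a row of length zero. *)
Definition padd la l := exists z, l = la ++ nseq z 0%N.

Lemma paddxx la : padd la la. Proof. by exists 0%N; rewrite cats0. Qed.

Lemma padd_nth la l i : padd la l -> nth 0%N l i = nth 0%N la i.
Proof.
by case=> z ->; rewrite nth_cat; case: ltnP => // h; rewrite nth_nseq if_same nth_default.
Qed.

Lemma sumn_nseq0 z : sumn (nseq z 0%N) = 0%N. Proof. by elim: z. Qed.

Lemma padd_sumn la l : padd la l -> sumn l = sumn la.
Proof. by case=> z ->; rewrite sumn_cat sumn_nseq0 addn0. Qed.

Lemma padd_xP s la l : padd la l -> xP T s l = xP T s la.
Proof.
case=> z ->; rewrite xP_cat; suff -> : xP T (s + sumn la) (nseq z 0%N) = 1 by rewrite mulr1.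
by elim: z (s + sumn la)%N => [|z IH] k; rewrite /= ?xP_nil // xP_cons Xs0 mul1r IH.
Qed.

Lemma padd_psum la l k : padd la l -> psum l k = psum la k.
Proof.
case=> z ->; rewrite psum_cat; case: ltnP => // h.
have h0 i : psum (nseq z 0%N) i = 0%N by elim: z i => [|z IH] [|i] //=; exact: IH.
by rewrite h0 addn0 /psum take_oversize.
Qed.

Lemma rowsplit_psum la pi a tau : padd la (pi ++ a :: tau) ->
  psum la (size pi) = sumn pi /\ psum la (size pi).+1 = (sumn pi + a)%N.
Proof.
move=> h; rewrite -!(padd_psum _ h) /psum.
by rewrite take_size_cat // -cat_rcons take_size_cat ?size_rcons // sumn_rcons.
Qed.

Lemma padd_Garn s la l (g : B) : padd la l -> Garn s la g <-> Garn s l g.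
Proof.
move=> h; split=> [[pi1 [c [d [tau1 [v [e hv ->]]]]]]|].
  rewrite -(padd_xP _ h); case: h => z ->.
  by exists pi1, c, d, (tau1 ++ nseq z 0%N), v; rewrite e -catA.
case: h => z ->; elim: z => [|z IH]; first by rewrite cats0.
move=> [pi1 [c [d [tau1 [v [e hv eg]]]]]]; apply: IH; rewrite {}eg.
have er : la ++ nseq z.+1 0%N = rcons (la ++ nseq z 0%N) 0 by rewrite -addn1 nseqD catA cats1.
have ex : xP T s (la ++ nseq z.+1 0%N) = xP T s (la ++ nseq z 0%N).
  by rewrite er -cats1 xP_cat xP_cons Xs0 xP_nil !mulr1.
move: e; rewrite ex er; case/lastP: tau1 => [|tau1 y] e.
  by move: e; rewrite -[c :: _]/([:: c] ++ [:: d]) catA cats1 => /rcons_inj [_ ed]; move: hv; lia.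
move: e; rewrite -!rcons_cons -rcons_cat => /rcons_inj [e _].
by exists pi1, c, d, tau1, v.
Qed.

Lemma incr_nth_cat pi a tau : incr_nth (pi ++ a :: tau) (size pi) = pi ++ a.+1 :: tau.
Proof. by elim: pi => //= c pi ->. Qed.

Lemma padd_incr la pi a tau : padd la (pi ++ a :: tau) -> (size pi <= size la)%N ->
  padd (incr_nth la (size pi)) (pi ++ a.+1 :: tau).
Proof.
case=> z e; rewrite leq_eqVlt => /orP[/eqP hs|hs].
  have := e; move/eqP; rewrite eqseq_cat // => /andP[/eqP e1 /eqP e2]; case: z e e2 => //= z e [-> ->].
  by exists z; rewrite -e1; elim: (pi) => //= x l ->.
have := congr1 (take (size la)) e; rewrite [in RHS]take_size_cat // take_cat ltnNge (ltnW hs) /=.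
case: (size la - size pi)%N (subn_gt0 (size pi) (size la)) => [|k]; first by rewrite hs.
move=> _ /= e1; rewrite -e1 incr_nth_cat; exists z; move: e; rewrite -e1 -!catA /= => /eqP.
by rewrite eqseq_cat // => /andP[_ /eqP [et]]; rewrite -et.
Qed.

Lemma padd_exists la k : is_part la -> (k <= size la)%N -> exists pi a tau,
  [/\ size pi = k, padd la (pi ++ a :: tau) & (head 0 tau <= a)%N].
Proof.
move=> hla; rewrite leq_eqVlt => /orP[/eqP ->|hk].
  by exists la, 0%N, [::]; split=> //; exists 1%N.
exists (take k la), (nth 0%N la k), (drop k.+1 la); split.
- by rewrite size_take hk.
- by exists 0%N; rewrite cats0 -drop_nth // cat_take_drop.
- by rewrite -nth0 nth_drop addn0; exact: part_nth.
Qed.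

Lemma padd_of_nth la l : is_part la -> (forall i, nth 0%N la i = nth 0%N l i) -> padd la l.
Proof.
move=> hla h; have hs : (size la <= size l)%N.
  rewrite leqNgt -part_nth_gt0 // h nth_default //.
exists (size l - size la)%N; apply: (@eq_from_nth _ 0%N) => [|i hi].
  by rewrite size_cat size_nseq; lia.
rewrite nth_cat -h; case: ltnP => // hi'.
by rewrite nth_nseq if_same nth_default.
Qed.

Lemma decr_padd la pi a tau : is_part la -> la = pi ++ a.+1 :: tau -> (head 0 tau <= a)%N ->
  exists mu, [/\ is_part mu, la = incr_nth mu (size pi), padd mu (pi ++ a :: tau) & (size pi <= size mu)%N].
Proof.
move=> hla e hh; have [|mu [hmu emu]] := @decr_part la (size pi) hla.
  have -> : nth 0%N la (size pi).+1 = head 0%N tau.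
    by rewrite e nth_cat ltnNge leqnSn /= subSnn /= nth0.
  by rewrite e nth_cat ltnn subnn.
exists mu; split=> //; last by apply: incr_le => //; rewrite -emu.
apply: padd_of_nth => // i; apply/eqP; rewrite -(eqn_add2l (size pi == i)) -nth_incr_nth -emu e.
by rewrite -incr_nth_cat nth_incr_nth.
Qed.

Lemma added_row_incr mu k : (k <= size mu)%N -> added_row mu (incr_nth mu k) = k.+1.
Proof.
move=> hk; rewrite /added_row; congr _.+1.
have hs : (k < size (incr_nth mu k))%N by rewrite size_incr_nth; case: ifP => // _; exact: ltnSn.
rewrite (eq_find (a2 := pred1 k)); last first.
  by move=> j /=; apply/eqP/eqP => [/incr_inj ->|->].
have := index_uniq 0 (s := iota 0 (size (incr_nth mu k))) (i := k).
by rewrite size_iota nth_iota // add0n; apply => //; exact: iota_uniq.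
Qed.

Definition bfac m la mu : B := let f := ((m - sumn la)./2)%N in
  if (sumn mu < sumn la)%N then Tij n (f.*2 + psum la (added_row mu la))%N m
  else let k := added_row la mu in
    let bk := (f.*2.-1 + psum la k)%N in let bk1 := (f.*2.-1 + psum la k.-1)%N in
    (Tij n m f.*2)^-1 * (\sum_(bk1 <= j < bk.+1) q ^+ (bk - j) *: (Tij n j f.*2.-1)^-1).

Lemma budS m t : bud n m.+1 t = bfac m.+1 (nth [::] t m.+1) (nth [::] t m) * bud n m t.
Proof. by rewrite /bfac /=; case: ifP. Qed.

Lemma bud_take m t : bud n m (take m.+1 t) = bud n m t.
Proof.
suff H k : (m <= k)%N -> bud n m (take k.+1 t) = bud n m t by exact: H.
by elim: m => // m IH hk; rewrite !budS !nth_take ?IH //; lia.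
Qed.

Lemma half_level m f k : (f.*2 + k = m)%N -> ((m - k)./2 = f)%N.
Proof. by lia. Qed.

Lemma bfac_low m f la mu pi a tau : (0 < m <= n)%N -> (f.*2 + sumn la = m)%N ->
  padd mu (pi ++ a :: tau) -> la = incr_nth mu (size pi) -> (size pi <= size mu)%N ->
  bfac m la mu = Sup T (f.*2 + sumn pi + a.+1) m.
Proof.
move=> hm hf hr e hs; rewrite /bfac (half_level hf) e added_row_incr // sumn_incr ltnSn.
have hr' := padd_incr hr hs; rewrite -e in hr' *.
rewrite (rowsplit_psum hr').2.
move: hf; rewrite -(padd_sumn hr') sumn_cat /= => hf.
by rewrite Tij_up; [rewrite addnA | lia | lia].
Qed.

Lemma bfac_up m f la mu pi a tau : (m <= n)%N -> (f.+1.*2 + sumn la = m)%N ->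
  padd la (pi ++ a :: tau) -> mu = incr_nth la (size pi) -> (size pi <= size la)%N ->
  bfac m la mu = Sup U f.*2.+2 m * Theta f.*2 pi a.
Proof.
move=> hm hf hr e hs; rewrite /bfac (half_level hf) e added_row_incr // sumn_incr ltnNge leqnSn /=.
have [-> ->] := rowsplit_psum hr; have := padd_sumn hr; rewrite sumn_cat /= => hsum.
rewrite inv_Tij; [|lia|lia]; congr (_ * _).
have -> : (f.*2.+1 + (sumn pi + a) = (f.*2 + sumn pi + a).+1)%N by lia.
have -> : (f.*2.+1 + sumn pi = (f.*2 + sumn pi).+1)%N by lia.
rewrite /Theta; apply: eq_big_nat => j hj.
by rewrite inv_Tij //; lia.
Qed.

Definition yv m f la mu : B := Ep T E f * xP T f.*2 la * bfac m la mu.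

Hypothesis hn : (1 < n)%N.
Let hq := brauer_qbs hn.

Lemma Ep_HT f m (x : B) : HT T f.*2 m x -> GRing.comm (Ep T E f) x.
Proof.
by move=> h; apply: HT_comm h => i hi; apply: commr_sym; apply: (Ep_C hq); lia.
Qed.

Lemma yv_low m f la mu pi a tau : (0 < m <= n)%N -> (f.*2 + sumn la = m)%N ->
  padd mu (pi ++ a :: tau) -> la = incr_nth mu (size pi) -> (size pi <= size mu)%N ->
  yv m f la mu = Ep T E f * Yr f.*2 pi a.+1 tau.
Proof.
move=> hm hf hr e hs; rewrite /yv (bfac_low hm hf hr e hs) /Yr -mulrA.
have hr' := padd_incr hr hs; rewrite -e in hr'.
rewrite (padd_xP _ hr'); move: hf; rewrite -(padd_sumn hr') sumn_cat /= => hf.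
by have -> : (f.*2 + sumn pi + a.+1 + sumn tau = m)%N by lia.
Qed.

Lemma SupU_xP_shift f m la : (m <= n)%N -> (f.+1.*2 + sumn la = m)%N ->
  Sup U f.*2.+2 m * xP T f.*2.+1 la = xP T f.+1.*2 la * Sup U f.*2.+2 m.
Proof.
move=> hm hf; apply: (@xP_shift _ T (Sup U f.*2.+2 m) f.*2.+1 la) => i hi.
by apply: (SupU_shift (@bT_braids n) (@bT_quadratic n)); lia.
Qed.

Lemma yv_up m f la mu pi a tau : (m <= n)%N -> (f.+1.*2 + sumn la = m)%N ->
  padd la (pi ++ a :: tau) -> mu = incr_nth la (size pi) -> (size pi <= size la)%N ->
  yv m f.+1 la mu = Ep T E f.+1 * (Sup U f.*2.+2 m * Ya f.*2 pi a tau).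
Proof.
move=> hm hf hr e hs; have hsum := padd_sumn hr.
rewrite /yv (bfac_up hm hf hr e hs) Ya_Theta; last by lia.
rewrite (padd_xP _ hr) -[in LHS]mulrA; congr (_ * _).
by rewrite !mulrA (SupU_xP_shift hm hf).
Qed.

(** The strings that conjugate [E_1] into [E_{2f+1}] are absorbed, by [Ep_string]. *)
Lemma El_Ep f : (f.+1.*2 <= n)%N -> El n f.*2.+1 * Ep T E f = Ep T E f.+1.
Proof.
move=> hf; rewrite /El Tij_dn ?Tij_up; try lia.
rewrite inv_Sdn; [|lia|lia].
have hs := Ep_string hq hf.
have -> : Sdn T f.*2.+1 1 * (Sup T 2 f.*2.+2)^-1 * E * Sup T 2 f.*2.+2 * Sup U 1 f.*2.+1 * Ep T E f =
  Sdn T f.*2.+1 1 * ((Sup T 2 f.*2.+2)^-1 * Ep T E f.+1) by rewrite EpS !mulrA.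
rewrite -{1}hs mulKr; last by apply: Sup_unit => //; lia.
by rewrite mulrA (SdnT_SupU (@bT_quadratic n)) ?mul1r //; lia.
Qed.

Lemma Ep_SupU_comm f a b : (f.*2 < a)%N -> (b <= n)%N -> GRing.comm (Ep T E f) (Sup U a b).
Proof. by move=> ha hb; apply: (@Ep_HT f n); apply: HT_SupU. Qed.

(** Both kinds of branching elements are [E^f x_la] times the first factor of [b_t];
    for an added node this is [Ya_Theta]. *)
Lemma yla_yv f la mu : (f.*2 + sumn la = n)%N -> [/\ is_part la, is_part mu & adj la mu] ->
  (sumn mu < sumn la)%N || (0 < f)%N -> yla n f la mu = yv n f la mu.
Proof.
move=> hf [hla hmu hadj] hlt; rewrite /yla /yv Epow_Ep; last by lia.
rewrite xla_xP; last by lia.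
rewrite /bfac (half_level hf); case: ifP => hs //.
have hmla : mu \in adds la.
  case/orP: hadj => // /(addsP _ hmu) [k [_ e]]; move: hs; rewrite e sumn_incr; lia.
have [k [_ e]] := addsP _ hla hmla.
have hk : (k <= size la)%N by apply: incr_le => //; rewrite -e.
have [pi [a [tau [e1 hr _]]]] := padd_exists hla hk; subst k.
case: f hf hlt => [|f] hf hlt; first by rewrite hs in hlt.
rewrite -[RHS]/(Ep T E f.+1 * xP T f.+1.*2 la * _).
have := @yv_up n f la mu pi a tau (leqnn n) hf hr e hk.
rewrite /yv /bfac (half_level hf) hs => ->.
rewrite -(El_Ep (f := f)); last by lia.
have hsum := padd_sumn hr; move: hsum; rewrite sumn_cat /= => hsum.
rewrite e added_row_incr // (rowsplit_psum hr).2 Epow_Ep; last by lia.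
rewrite xla_xP; last by rewrite sumn_incr; lia.
rewrite !inv_Tij; [|lia|lia|lia|lia].
have c1 : Ep T E f * Sup U f.*2.+2 n = Sup U f.*2.+2 n * Ep T E f.
  by apply: Ep_SupU_comm; lia.
have c2 : Ep T E f * Sup U f.*2.+1 (f.*2.+1 + (sumn pi + a)) =
    Sup U f.*2.+1 (f.*2.+1 + (sumn pi + a)) * Ep T E f.
  by apply: Ep_SupU_comm; lia.
rewrite /Ya -(padd_xP _ (padd_incr hr hk)).
have -> : (f.*2 + sumn pi + a).+1 = (f.*2.+1 + (sumn pi + a))%N by lia.
rewrite -[in RHS](mulrA (El n f.*2.+1)) -[in LHS](mulrA (El n f.*2.+1)) (mulrA (Ep T E f)) c1.
by rewrite -!mulrA [in RHS](mulrA (Ep T E f) (Sup U _ _)) c2 -!mulrA.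
Qed.

End Links.

(** * Chains of branching elements *)

Section Chains.
Variable n : nat.
Local Notation B := (qBrauer n).
Local Notation T := (bT n).
Local Notation U := (Uof T).
Local Notation q := kq.
Local Notation H := (HT T).
Implicit Types (pi tau la mu rho l : seq nat) (s a b c e k m : nat) (x y g h : B).

Lemma cosT a m x : (m <= n)%N -> (a < m)%N -> H a m x ->
  x \in kspan [set y | exists h j, [/\ H a m.-1 h, (a < j <= m)%N & y = Sup T j m * h]]%classic.
Proof.
move=> hmn ham hx; rewrite -[x]mulr1.
have hb := @bT_braids n.
have mem h' j' : H a m.-1 h' -> (a < j' <= m)%N ->
  Sup T j' m * h' \in kspan [set y | exists h j,
    [/\ H a m.-1 h, (a < j <= m)%N & y = Sup T j m * h]]%classic.
  by move=> h1 h2; apply: kspan_in; exists h', j'.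
apply: (@kspan_genl _ _ _ _ _ _ _ hx); last first.
  by rewrite -(@Sup_geq _ T m m) // -[Sup _ _ _]mulr1; apply: mem; [exact: gen_subalg_1 | lia].
move=> _ _ [h [j [hh hj ->]]] [i hi ->].
case: (ltngtP i j) => hij.
- have [e|hne] := eqVneq i.+1 j.
    by rewrite mulrA -e -Sup_recl ?mem //; lia.
  rewrite mulrA (Sup_comm (a := j) (b := m) (x := T i)).
    by rewrite -mulrA mem //; apply: gen_subalg_M => //; apply: HT_gen; lia.
  by move=> k hk; apply: (T_comm hb); lia.
- have -> : i = i.-1.+1 by lia.
  rewrite mulrA -(Sup_shift hb); try lia.
  by rewrite -mulrA mem //; apply: gen_subalg_M => //; apply: HT_gen; lia.
- rewrite hij [Sup _ _ _]Sup_recl; last by lia.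
  rewrite !mulrA (@bT_quadratic n); last by lia.
  rewrite !mulrDl mul1r -!scalerAl rpredD ?rpredZ ?mem //; first by lia.
  by rewrite -Sup_recl ?mem //; lia.
Qed.

Lemma SupT_HT a m y : (m <= n)%N -> (0 < a)%N -> H a.-1 m.-1 y ->
  exists2 y', H a m y' & Sup T a m * y = y' * Sup T a m.
Proof.
move=> hm ha; elim=> {y} [x [i hi ->]||x y _ [x' hx ex] _ [y' hy ey]|x y _ [x' hx ex] _ [y' hy ey]|c x _ [x' hx ex]].
- exists (T i.+1); first by apply: HT_gen; lia.
  by apply: (Sup_shift (@bT_braids n)); lia.
- by exists 1; rewrite ?mulr1 ?mul1r //; exact: gen_subalg_1.
- by exists (x' + y'); rewrite ?mulrDl ?mulrDr ?ex ?ey //; exact: gen_subalg_D.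
- by exists (x' * y'); rewrite ?mulrA ?ex -?mulrA ?ey //; exact: gen_subalg_M.
- by exists (c *: x'); rewrite -?scalerAl -?scalerAr ?ex //; exact: gen_subalg_Z.
Qed.

(** What the removals of nodes from the rows below the first [k] rows generate. *)
Definition LowS s la k : set B := [set x | RG s la s (s + sumn la) x \/
  exists pi a tau h, [/\ la = pi ++ a.+1 :: tau, (head 0 tau <= a)%N, (k <= size pi)%N,
    H s (s + sumn la).-1 h & x = Yr s pi a.+1 tau * h]]%classic.

Lemma LowS_mulr s la k y h : y \in kspan (LowS s la k) -> H s (s + sumn la).-1 h ->
  y * h \in kspan (LowS s la k).
Proof.
move=> hy hh; apply: kspan_mulr hy => _ [[g [h0 [hg hh0 ->]]]|[pi [a [tau [h0 [e1 e2 e3 h1 ->]]]]]];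
  apply: kspan_in; [left|right].
  exists g, (h0 * h); rewrite mulrA; split=> //; apply: gen_subalg_M => //.
  by apply: HT_sub hh; lia.
by exists pi, a, tau, (h0 * h); rewrite mulrA; split=> //; apply: gen_subalg_M.
Qed.

Lemma LowS_le s la k k' y : (k <= k')%N -> y \in kspan (LowS s la k') -> y \in kspan (LowS s la k).
Proof.
move=> hk; apply: kspan_sub => z [h|[pi [a [tau [h [e1 e2 e3 h1 ->]]]]]]; [by left|right].
by exists pi, a, tau, h; split=> //; exact: leq_trans e3.
Qed.

Lemma sorted_adj pi c a tau : sorted geq (pi ++ c :: a :: tau) -> (a <= c)%N.
Proof. by case: pi => [|p pi] /=; rewrite ?cat_path /=; lia. Qed.

(** A removal that does not give a partition is pushed down the rows of the same length. *)
Lemma low_chain s la pi a tau : la = pi ++ a.+1 :: tau -> sorted geq la -> (s + sumn la <= n)%N ->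
  Yr s pi a.+1 tau \in kspan (LowS s la (size pi)).
Proof.
elim: tau pi a => [|b tau IH] pi a e hs hle.
  apply: kspan_in; right; exists pi, a, [::], 1; rewrite mulr1; split=> //; exact: gen_subalg_1.
have hba : (b <= a.+1)%N by rewrite e in hs; exact: sorted_adj hs.
have [hb|hb] := leqP b a.
  apply: kspan_in; right; exists pi, a, (b :: tau), 1; rewrite mulr1; split=> //; exact: gen_subalg_1.
have eb : b = a.+1 by lia.
subst b; have := @Yr_stuck n s pi a tau; rewrite -e => /(_ hle).
apply: kspan_min => y; rewrite /RLow /= -e => -[h|[b [tau' [h [[<- <-] hb0 hh ->]]]]].
  by apply: kspan_in; left.
apply: LowS_mulr hh; have := IH (pi ++ [:: a.+1]) a; rewrite -catA => /(_ e hs hle).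
by apply: LowS_le; rewrite size_cat; lia.
Qed.

Lemma RLow_LowS s la pi a tau y : la = pi ++ a.+1 :: tau -> sorted geq la -> (s + sumn la <= n)%N ->
  y \in kspan (RLow s pi a.+1 tau) -> y \in kspan (LowS s la (size pi).+1).
Proof.
move=> e hs hle; apply: kspan_min => z; rewrite /RLow /= -e => -[h|[b [tau' [h [et hb0 hh ->]]]]].
  by apply: kspan_in; left.
case: b et hb0 => // b et _.
apply: LowS_mulr hh; have := @low_chain s la (pi ++ [:: a.+1]) b tau'.
by rewrite -catA size_cat addn1; apply=> //; rewrite e et.
Qed.

Lemma row_of la (x : nat) : (0 < x <= sumn la)%N -> exists pi a tau,
  la = pi ++ a.+1 :: tau /\ (sumn pi < x <= sumn pi + a.+1)%N.
Proof.
elim: la x => [|c la IH] x /= hx; first by lia.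
have [h|h] := leqP x c.
  by case: c hx h => [|c] hx h; [lia | exists [::], c, la; split=> //=; lia].
have [|pi [a [tau [-> h2]]]] := IH (x - c)%N; first by lia.
by exists (c :: pi), a, tau; split=> //=; lia.
Qed.

(** The string of a Hecke coset starts in some row, which absorbs it up to its end. *)
Lemma xP_HT_low s la h : sorted geq la -> (0 < sumn la)%N -> (s + sumn la <= n)%N ->
  H s (s + sumn la) h -> xP T s la * h \in kspan (LowS s la 0).
Proof.
move=> hs h0 hle hh; have := @cosT s (s + sumn la) h hle ltac:(lia) hh.
apply: kspan_mull => _ [h' [j [hh' hj ->]]]; rewrite mulrA; apply: LowS_mulr hh'.
have [|pi [a [tau [e hx]]]] := @row_of la (j - s); first by lia.
have es : (s + sumn la = s + sumn pi + a.+1 + sumn tau)%N by rewrite e sumn_cat /=; lia.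
rewrite -(Sup_cat T (a := j) (b := s + sumn pi + a.+1)%N); last by lia.
have hx' : (s + sumn (pi ++ a.+1 :: tau) <= n)%N by rewrite -e.
rewrite mulrA {1}e (xP_Sup (s := s) (pi := pi) (b := a.+1) (tau := tau)) //; [|lia|lia].
rewrite -scalerAl rpredZ // es -/(Yr s pi a.+1 tau).
by apply: (@LowS_le _ _ 0 (size pi)) => //; exact: low_chain.
Qed.

(** What the additions of nodes to the first [k] rows generate. *)
Definition UpS s l k : set B := [set x | RG s.+1 l s (s + sumn l).+1 x \/
  exists pi a tau h, [/\ l = pi ++ a :: tau, pi = [::] \/ (a < last 0 pi)%N, (size pi < k)%N,
    H s (s + sumn l).+1 h & x = Ya s pi a tau * h]]%classic.

Lemma UpS_mulr s l k y h : y \in kspan (UpS s l k) -> H s (s + sumn l).+1 h ->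
  y * h \in kspan (UpS s l k).
Proof.
move=> hy hh; apply: kspan_mulr hy => _ [[g [h0 [hg hh0 ->]]]|[pi [a [tau [h0 [e1 e2 e3 h1 ->]]]]]];
  apply: kspan_in; [left|right].
  by exists g, (h0 * h); rewrite mulrA; split=> //; apply: gen_subalg_M.
by exists pi, a, tau, (h0 * h); rewrite mulrA; split=> //; apply: gen_subalg_M.
Qed.

(** An addition that does not give a partition is pushed up the rows of the same length. *)
Lemma up_chain s l pi a tau k : l = pi ++ a :: tau -> sorted geq l -> (s + sumn l < n)%N ->
  (size pi < k)%N -> Ya s pi a tau \in kspan (UpS s l k).
Proof.
elim/last_ind: pi a tau => [|pi c IH] a tau e hs hle hk.
  apply: kspan_in; right; exists [::], a, tau, 1; rewrite mulr1; split=> //; [by left|exact: gen_subalg_1].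
rewrite cat_rcons in e; have hac : (a <= c)%N by rewrite e in hs; exact: sorted_adj hs.
rewrite size_rcons in hk; have [hb|hb] := ltnP a c.
  apply: kspan_in; right; exists (rcons pi c), a, tau, 1; rewrite mulr1 size_rcons cat_rcons.
  split=> //; [by right; rewrite last_rcons | exact: gen_subalg_1].
have ea : a = c by lia.
subst a; have := @Ya_stuck n s pi c tau; rewrite -e cats1 => /(_ hle).
apply: kspan_min => y; rewrite /RUp /= cat_rcons -e => -[h|[pi1 [c1 [h [e1 hh ->]]]]].
  by apply: kspan_in; left.
move: e1; rewrite cats1 => /rcons_inj [<- <-].
by apply: UpS_mulr hh; apply: IH => //; lia.
Qed.

Lemma RUp_UpS s l pi a tau y : l = pi ++ a :: tau -> sorted geq l -> (s + sumn l < n)%N ->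
  y \in kspan (RUp s pi a tau) -> y \in kspan (UpS s l (size pi)).
Proof.
move=> e hs hle; apply: kspan_min => z; rewrite /RUp /= -e => -[h|[pi1 [c1 [h [e1 hh ->]]]]].
  by apply: kspan_in; left.
apply: UpS_mulr hh; apply: up_chain => //; first by rewrite e e1 -catA.
by rewrite e1 size_cat addn1.
Qed.

End Chains.
Arguments LowS {n} s la k.
Arguments UpS {n} s l k.

(** * The cellular basis indexed by standard tableaux and coset representatives *)

Section Tableaux.
Variable n : nat.
Local Notation B := (qBrauer n).
Local Notation T := (bT n).
Local Notation E := (bE n).
Local Notation U := (Uof T).
Local Notation q := kq.
Local Notation H := (HT T).
Implicit Types (u v w : 'S_n) (pi tau la mu rho l : seq nat) (s a b c e k m f i j x y : nat).

Lemma psumS la i : psum la i.+1 = (psum la i + nth 0%N la i)%N.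
Proof. by elim: la i => [|c la IH] [|i] //=; rewrite /psum /= ?take0 ?addn0 // -/(psum la i.+1) IH addnA. Qed.

Lemma psum_le la i j : (i <= j)%N -> (psum la i <= psum la j)%N.
Proof. by move/subnK <-; elim: (j - i)%N => // k IH; rewrite addSn psumS; lia. Qed.

Lemma psum_sumn la i : (psum la i <= sumn la)%N.
Proof. by rewrite -{2}(cat_take_drop i la) sumn_cat leq_addr. Qed.

Lemma psum_incr mu k i : psum (incr_nth mu k) i = (psum mu i + (k < i))%N.
Proof. by elim: i => [|i IH]; rewrite ?psumS ?IH ?nth_incr_nth; [rewrite /psum !take0|lia]. Qed.

(** The entry of the row reading tableau in the cell [(i, j)]. *)
Definition ent s la i j := (s + psum la i + j).+1.

Definition good s la w :=
  [/\ forall x, (0 < x <= n)%N -> ~~ (s < x <= s + sumn la)%N -> pact w x = x,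
      forall i j, (j.+1 < nth 0%N la i)%N -> (pact w (ent s la i j) < pact w (ent s la i j.+1))%N
    & forall i j, (j < nth 0%N la i.+1)%N -> (pact w (ent s la i j) < pact w (ent s la i.+1 j))%N].

Lemma ent_range s la i j : (j < nth 0%N la i)%N -> (s < ent s la i j <= s + sumn la)%N.
Proof. by move=> h; have := psum_sumn la i.+1; rewrite psumS /ent; lia. Qed.

Lemma good_range s la w x : (s + sumn la <= n)%N -> good s la w ->
  (s < x <= s + sumn la)%N -> (s < pact w x <= s + sumn la)%N.
Proof.
move=> hle [h _ _] hx; have hx0 : (0 < x <= n)%N by lia.
have hr := pact_range w hx0; case: (boolP (s < pact w x <= s + sumn la)%N) => // h1.
by have := pact_inj hr hx0 (h _ hr h1) => e; rewrite e in h1; rewrite hx in h1.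
Qed.

Lemma good_fixes s la w : (s + sumn la <= n)%N -> good s la w ->
  fixes_above (s + sumn la) w /\ fixes_upto s w.
Proof. by move=> hle [h _ _]; split=> x hx; apply: h; lia. Qed.

Lemma good_std f la w : (f.*2 + sumn la <= n)%N -> is_part la -> good f.*2 la w ->
  exists t, std_tab f la t /\ dperm n f t = w.
Proof.
move=> hle hla hg; have [g1 g2 g3] := hg.
have szR : size (tab_entries f la) = sumn la by rewrite size_iota.
have shR : shape (row_tab f la) = la by rewrite /row_tab reshapeKl ?szR.
have flR : flatten (row_tab f la) = tab_entries f la by rewrite /row_tab reshapeKr ?szR.
pose t := map (map (pact w)) (row_tab f la).
have sht : shape t = la.
  by rewrite -[RHS]shR /shape /t -map_comp; apply: eq_map => r /=; rewrite size_map.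
have flt : flatten t = map (pact w) (tab_entries f la) by rewrite -flR map_flatten.
have nthR i j : (j < nth 0%N la i)%N -> nth 0%N (nth [::] (row_tab f la) i) j = ent f.*2 la i j.
  move=> hj; rewrite /row_tab nth_reshape nth_take // nth_drop nth_iota.
    by rewrite /ent /psum; lia.
  by have := ent_range f.*2 hj; rewrite /ent /psum; lia.
have szr i : size (nth [::] (row_tab f la) i) = nth 0%N la i.
  have [hi|hi] := ltnP i (size la).
    by rewrite -[in RHS]shR /shape (nth_map [::]) //; rewrite -(size_map size) -/(shape _) shR.
  by rewrite !nth_default //; rewrite -(size_map size) -/(shape _) shR.
have szT : size (row_tab f la) = size la by rewrite -(size_map size) -/(shape _) shR.
have nthT i : (i < size la)%N -> nth [::] t i = map (pact w) (nth [::] (row_tab f la) i).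
  by move=> hi; rewrite (nth_map [::]) // szT.
have nthTT i j : (j < nth 0%N la i)%N -> nth 0%N (nth [::] t i) j = pact w (ent f.*2 la i j).
  move=> hj; have hi : (i < size la)%N by rewrite ltnNge; apply/negP => h; rewrite nth_default in hj.
  by rewrite nthT // (nth_map 0%N) ?szr // nthR.
exists t; split.
  split=> //.
  - rewrite flt; apply/perm_eq_stable => [||x hx]; [lia|lia|].
    by have := @good_range _ _ _ x hle hg; lia.
  - apply/(all_nthP [::]) => i; rewrite size_map szT => hi.
    apply/(sortedP 0%N) => j; rewrite nthT // size_map szr => hj.
    by rewrite -nthT // !nthTT //; [exact: g2 | exact: ltnW].
  - move=> i j hj; rewrite !nthTT ?g3 //; exact: leq_trans hj (part_nth i hla).
rewrite /dperm sht; case: pickP => [w' /andP[/(fixes_offP _ hle) h1 /eqP h2]|/(_ w)] /=; last first.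
  by rewrite eqxx andbT => /negP; case; apply/(fixes_offP _ hle).
apply: perm_pact => x hx; case: (boolP (f.*2 < x <= f.*2 + sumn la)%N) => hx'; last by rewrite h1 // g1.
have := congr1 flatten h2; rewrite flt -map_flatten flR => /eq_in_map h3.
by rewrite h3 // mem_iota; lia.
Qed.

(** Adding the largest entry to a standard tableau. *)
Lemma good_step s la mu k w : is_part la -> is_part mu -> la = incr_nth mu k ->
  (s + sumn la <= n)%N -> good s mu w ->
  good s la (wup n (s + psum mu k + nth 0%N mu k).+1 (s + sumn la) * w)%g.
Proof.
move=> hla hmu e hle hg; set m := (s + sumn la)%N; set a := (s + _ + _).+1.
have hs : sumn la = (sumn mu).+1 by rewrite e sumn_incr.
have ham : (0 < a <= m)%N.
  by have := psum_sumn mu k.+1; rewrite psumS /a /m; lia.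
have hg' := hg; case: hg' => g1 g2 g3.
have pw x : (0 < x <= n)%N -> pact (wup n a m * w)%g x =
    pact w (if x == a then m else if (a < x <= m)%N then x.-1 else x).
  by move=> hx; rewrite pactM // pact_wup.
have nla i : nth 0%N la i = ((k == i) + nth 0%N mu i)%N by rewrite e nth_incr_nth.
have hm : pact w m = m by apply: g1; rewrite /m; lia.
have val i j : (j < nth 0%N la i)%N -> pact (wup n a m * w)%g (ent s la i j) =
    (if (k == i) && (j == nth 0%N mu k) then m else pact w (ent s mu i j)) /\
    ((k == i) && (j == nth 0%N mu k) = false -> (j < nth 0%N mu i)%N).
  move=> hj; have hr := ent_range s hj; rewrite pw; last by lia.
  have := hj; rewrite nla => hj'.
  have pe : psum la i = (psum mu i + (k < i))%N by rewrite e psum_incr.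
  have [ek|hne] := eqVneq k i.
    subst i; rewrite /ent pe ltnn addn0 /=; have [ej|hj2] := eqVneq j (nth 0%N mu k).
      by rewrite ej -/a eqxx hm.
    have hj3 : (j < nth 0%N mu k)%N by lia.
    split=> // ; rewrite ifF; last by apply/negbTE; rewrite /a; lia.
    by rewrite ifF //; apply/negbTE; rewrite /a; lia.
  have hj3 : (j < nth 0%N mu i)%N by lia.
  split=> //=; case: (ltngtP k i) => hki; last by rewrite hki eqxx in hne.
    have h1 := psum_le mu hki; rewrite psumS in h1.
    rewrite /ent pe hki in hr *; rewrite ifF; last by apply/negbTE; rewrite /a; lia.
    by rewrite ifT; [congr (pact w _); lia | rewrite /a /m; lia].
  have h1 := psum_le mu hki; rewrite psumS in h1.
  rewrite /ent pe [(k < i)%N]ltnNge (ltnW hki) addn0 ifF; last by apply/negbTE; rewrite /a; lia.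
  by rewrite ifF //; apply/negbTE; rewrite /a; lia.
have lt i j : (j < nth 0%N mu i)%N -> (pact w (ent s mu i j) < m)%N.
  by move=> hj; have := @good_range s mu w _ ltac:(lia) hg (ent_range s hj); rewrite /m; lia.
split.
- move=> x hx hx'; rewrite pw // ifF; last by apply/negbTE; rewrite /a /m in hx' ham *; lia.
  rewrite ifF; last by apply/negbTE; rewrite /a /m in hx' ham *; lia.
  by apply: g1 => //; lia.
- move=> i j hj; have [-> h1] := val i j (ltnW hj); have [-> h2] := val i j.+1 hj.
  case: ifP h1 => [/andP[/eqP ei /eqP ej] _|_ /(_ erefl) h1].
    by exfalso; move: hj; rewrite nla ei eqxx ej -ei; lia.
  by case: ifP h2 => [_ _|_ /(_ erefl) h2]; [exact: lt | exact: g2].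
- move=> i j hj; have hj' : (j < nth 0%N la i)%N by apply: leq_trans hj (part_nth i hla).
  have [-> h1] := val i j hj'; have [-> h2] := val i.+1 j hj.
  case: ifP h1 => [/andP[/eqP ei /eqP ej] _|_ /(_ erefl) h1].
    by exfalso; have := part_nth k hmu; move: hj; rewrite nla ei -ei ej; lia.
  by case: ifP h2 => [_ _|_ /(_ erefl) h2]; [exact: lt | exact: g3].
Qed.

Definition HS s la : set B := [set x | RG s la s (s + sumn la) x \/
  exists2 w, good s la w & x = xP T s la * Tw w]%classic.

(** Induction by removing the largest entry, along the rows from the bottom. *)
Lemma xP_HT_std s la (h : B) : is_part la -> (s + sumn la <= n)%N -> H s (s + sumn la) h ->
  xP T s la * h \in kspan (HS s la).
Proof.
have [N hN] : exists N, (sumn la <= N)%N by exists (sumn la).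
elim: N la h hN => [|N IH] la h hN hla hle hh.
  have e : la = [::].
    case: la hla {hle hh} hN => // c la /andP[_]; rewrite inE negb_or /=; lia.
  subst la; rewrite xP_nil mul1r; have [|c ->] := HT_triv _ hh; first by lia.
  rewrite rpredZ //; apply: kspan_in; right; exists 1%g; last by rewrite xP_nil (Tw1 n).1 mul1r.
  by split=> [x hx _|[|i] j|[|i] j] //; rewrite pact1.
have [h0|h0] := posnP (sumn la); first by apply: IH => //; lia.
have hsla : sorted geq la by case/andP: hla.
suff LH d k (x : B) : (size la <= k + d)%N -> x \in kspan (LowS s la k) -> x \in kspan (HS s la).
  by apply: (LH (size la) 0); [lia | exact: xP_HT_low].
elim: d k x => [|d IHd] k x hk; apply: kspan_min => y [hx|[pi [a [tau [h' [e hh' hks hh'' {y}->]]]]]];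
    try by [apply: kspan_in; left].
  by exfalso; move: hk; rewrite e size_cat /=; lia.
have [mu [hmu e1 hp hsz]] := decr_padd hla e hh'.
have hs : sumn la = (sumn mu).+1 by rewrite e1 sumn_incr.
have es : (s + sumn la).-1 = (s + sumn mu)%N by lia.
have em : sumn mu = sumn (pi ++ a :: tau) by rewrite (padd_sumn hp).
have [hL hhL [eY hhL']] := Yr_left n s pi a tau.
rewrite es in hh''; rewrite eY (padd_xP _ _ hp) -mulrA.
apply: kspan_mull (IH mu h' _ hmu _ hh''); [|lia|lia].
move=> _ [[g [h2 [hg hh2 ->]]]|[w hw ->]].
  apply: (IHd (size pi).+1); first by lia.
  have [pi1 [c [d' [tau1 [v [e3 hv eg]]]]]] := (padd_Garn s g hp).1 hg.
  have e4 : pi ++ a :: tau = pi1 ++ c :: d' :: tau1 by [].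
  apply: (@RLow_LowS _ _ _ _ a tau) => //; rewrite eg mulrA mulrA -eY.
  apply: RLow_mulr; first by apply: (Yr_garnir (c := c) (d := d') (tau1 := tau1)) => //; rewrite -?e.
  by rewrite -e es.
have hm : (0 < s + sumn la <= n)%N by lia.
rewrite -(padd_xP _ _ hp) mulrA -eY /Yr; apply: kspan_in; right.
exists (wup n (s + psum mu (size pi) + nth 0%N mu (size pi)).+1 (s + sumn la) * w)%g.
  exact: good_step hw.
have [-> en] : psum mu (size pi) = sumn pi /\ nth 0%N mu (size pi) = a.
  by rewrite (rowsplit_psum hp).1 -(padd_nth _ hp) nth_cat ltnn subnn.
have eM : (s + sumn pi + a.+1 + sumn tau = s + sumn la)%N by rewrite e sumn_cat /=; lia.
have hfx : fixes_above (s + sumn la).-1 w by rewrite es; apply: (good_fixes _ hw).1; lia.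
have [e5 _] := @Tw_up n w (s + sumn la) (s + sumn pi + a.+1) ltac:(lia) ltac:(lia) hfx.
by rewrite en eM -e -addnS e5 mulrA.
Qed.

(** ** Coset representatives *)

Lemma D_wordS f (i j : nat -> nat) : word_perm n (D_word f.+1 i j) =
  (word_perm n (s_word f.*2.+2 (i f.+1)) *
    (word_perm n (s_word f.*2.+1 (j f.+1)) * word_perm n (D_word f i j)))%g.
Proof.
have -> : D_word f.+1 i j = (s_word f.*2.+2 (i f.+1) ++ s_word f.*2.+1 (j f.+1)) ++ D_word f i j.
  rewrite /D_word (_ : iota 1 f.+1 = rcons (iota 1 f) f.+1); last by have := iotaD 1 f 1; rewrite addn1 => ->; rewrite /= cats1 add1n.
  by rewrite rev_rcons.
by rewrite !word_perm_cat mulgA.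
Qed.

Lemma wup_word a b : (a <= b)%N -> word_perm n (s_word a b) = wup n a b.
Proof. by rewrite /s_word /wup => ->. Qed.

Lemma Dset0 m : Dset n 0 m 1%g.
Proof.
exists (fun _ => 0%N), (fun _ => 0%N); split=> [k l h1 h2 h3|k hk|]; [lia|lia|].
by rewrite /D_word /word_perm big_nil.
Qed.

Lemma Dset_le f m m' v : (m <= m')%N -> Dset n f m v -> Dset n f m' v.
Proof.
move=> hm [i [j [h1 h2 ->]]]; exists i, j; split=> // k hk.
by have [h3 /andP[h4 h5]] := h2 k hk; split=> //; rewrite h4 (leq_trans h5).
Qed.

Lemma Dset_step f m j v : (f.*2 < j < m)%N -> Dset n f m.-1 v ->
  Dset n f.+1 m (wup n f.*2.+2 m * (wup n f.*2.+1 j * v))%g.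
Proof.
move=> hj [i0 [j0 [h1 h2 ->]]].
exists (fun k => if k == f.+1 then m else i0 k), (fun k => if k == f.+1 then j else j0 k).
have hb k : (0 < k <= f)%N -> (j0 k < i0 k <= m.-1)%N by move=> /h2 [].
split.
- move=> k l hk hkl hl; rewrite (_ : (k == f.+1) = false); last by lia.
  case: eqP => el; last by apply: h1; lia.
  by have := hb k ltac:(lia); lia.
- move=> k hk; case: eqP => ek; first by rewrite ek; split; lia.
  by have [h3 h4] := h2 k ltac:(lia); split; lia.
rewrite D_wordS eqxx !wup_word; [|lia|lia]; congr (_ * (_ * word_perm _ _))%g.
rewrite /D_word; congr flatten; apply/eq_in_map => k.
by rewrite mem_rev mem_iota => hk; rewrite (_ : (k == f.+1) = false) //; lia.
Qed.

Lemma Dset_inv f m v : Dset n f.+1 m v -> exists m' j v', [/\ (f.*2 < j < m')%N, (m' <= m)%N,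
  Dset n f m'.-1 v' & v = (wup n f.*2.+2 m' * (wup n f.*2.+1 j * v'))%g].
Proof.
move=> [i [j [h1 h2 ->]]]; have [h3 /andP[h4 h5]] := h2 f.+1 ltac:(lia).
exists (i f.+1), (j f.+1), (word_perm n (D_word f i j)); split=> //.
- by apply/andP; split=> //; lia.
- exists i, j; split=> // k hk; last first.
    by have [h6 h7] := h2 k ltac:(lia); split=> //; have := h1 k f.+1 ltac:(lia) ltac:(lia) (leqnn _); lia.
  by move=> h6 h7 h8; apply: h1 => //; lia.
by rewrite D_wordS !wup_word //; lia.
Qed.

Lemma Dset_incr f m v : (m <= n)%N -> Dset n f m v ->
  (forall x y, (f.*2 < x)%N -> (x < y <= n)%N -> (pact v x < pact v y)%N) /\ fixes_above m v.
Proof.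
elim: f m v => [|f IH] m v hm.
  move=> [i [j [_ _ ->]]]; rewrite /D_word /word_perm big_nil; split=> [x y hx hy|x hx]; rewrite !pact1 //; lia.
move=> /Dset_inv [m' [j [v' [hj hm' hv ->]]]]; have [|h1 h2] := IH _ _ _ hv; first by lia.
have pw x : (0 < x <= n)%N -> pact (wup n f.*2.+2 m' * (wup n f.*2.+1 j * v'))%g x =
    let y := if x == f.*2.+2 then m' else if (f.*2.+2 < x <= m')%N then x.-1 else x in
    pact v' (if y == f.*2.+1 then j else if (f.*2.+1 < y <= j)%N then y.-1 else y).
  move=> hx; rewrite pactM // pactM; last by apply: pact_range.
  by rewrite [pact (wup n f.*2.+2 m') x]pact_wup //= ?pact_wup //; do ?case: ifP; lia.
split=> [x y hx hy|x hx]; last first.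
  have e1 : (x == f.*2.+2) = false by lia.
  have e2 : (f.*2.+2 < x <= m')%N = false by lia.
  have e3 : (x == f.*2.+1) = false by lia.
  have e4 : (f.*2.+1 < x <= j)%N = false by lia.
  by rewrite pw /= ?e1 ?e2 ?e3 ?e4; [apply: h2; lia | lia].
rewrite !pw /=; [|lia|lia]; have e1 : (x == f.*2.+2) = false by lia.
have e2 : (y == f.*2.+2) = false by lia.
rewrite e1 e2; apply: h1; do ?case: ifP; lia.
Qed.

Lemma Tw_upl a b v : (0 < a <= b)%N -> (b <= n)%N ->
  (forall x y, (a <= x)%N -> (x < y <= b)%N -> (pact v x < pact v y)%N) ->
  Tw (wup n a b * v)%g = Sup T a b * Tw v.
Proof.
have [k hk] : exists k, (b <= a + k)%N by exists b; rewrite leq_addl.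
elim: k a hk => [|k IH] a hk ha hb hv.
  have -> : a = b by lia.
  by rewrite Sup_geq // /wup subnn /word_perm big_nil mul1g mul1r.
have [e|hab] := eqVneq a b; first by subst a; rewrite Sup_geq // /wup subnn /word_perm big_nil mul1g mul1r.
have -> : wup n a b = (sref n a * wup n a.+1 b)%g.
  by rewrite /wup (_ : (b - a = (b - a.+1).+1)%N) /= ?word_perm_cat -?word_perm1 -?word_perm_cat //; lia.
have p1 : pact (wup n a.+1 b * v)%g a = pact v a.
  rewrite pactM; last by lia.
  rewrite pact_wup; [|lia|lia|lia].
  have -> : (a == a.+1) = false by lia.
  by have -> : (a.+1 < a <= b)%N = false by lia.
have p2 : pact (wup n a.+1 b * v)%g a.+1 = pact v b.
  by rewrite pactM; [rewrite pact_wup ?eqxx //; lia | lia].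
have [|e1 _] := @Tw_stepl n (wup n a.+1 b * v)%g a ltac:(lia) _; first by rewrite p1 p2; apply: hv; lia.
rewrite -mulgA e1 IH; [|lia|lia|lia|by move=> x y hx hy; apply: hv; lia].
by rewrite mulrA -Sup_recl //; lia.
Qed.

Lemma Dset_HT f m v : (m <= n)%N -> Dset n f m v -> HT T 0 m (Tw v).
Proof. by move=> hm hv; apply: Tw_HT => //; [exact: (Dset_incr hm hv).2 | move=> x; lia]. Qed.

End Tableaux.
Arguments HS {n} s la.

Section CosetSpan.
Variable n : nat.
Hypothesis hn : (1 < n)%N.
Local Notation B := (qBrauer n).
Local Notation T := (bT n).
Local Notation E := (bE n).
Local Notation U := (Uof T).
Local Notation del := kdelta.
Local Notation H := (HT T).
Local Notation S := (SQ T E).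
Local Notation Ep := (Ep T E).
Let hq := brauer_qbs hn.
Implicit Types (m f k i j a b : nat) (x y h s : B).

(** Trading the inverse string for the direct one. *)
Lemma SupU_T a k : (0 < a <= k)%N -> (k <= n)%N -> Sup U a k \in kspan [set x | x = Sup T a k \/
  exists h s, [/\ (a < k)%N, H a k h, H a.-1 k.-1 s & x = h * s]]%classic.
Proof.
elim: k => [|k IH] hk hkn; first by lia.
have [e|hne] := eqVneq a k.+1.
  by rewrite (@Sup_geq _ U) ?e //; apply: kspan_in; left; rewrite Sup_geq.
rewrite Sup_recr; last by lia.
apply: kspan_mulr (IH _ _); [|lia|lia].
move=> _ [->|[h [s [h1 h2 h3 ->]]]].
  rewrite UofE mulrBr -Sup_recr; last by lia.
  rewrite rpredB //; first by apply: kspan_in; left.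
  rewrite mulr_algr rpredZ //; apply: kspan_in; right; exists 1, (Sup T a k); rewrite mul1r.
  by split=> //; [lia | exact: gen_subalg_1 | apply: HT_Sup; lia].
apply: kspan_in; right; exists (h * U k), s.
split; [lia | | by apply: HT_sub h3; lia |].
  by apply: gen_subalg_M; [apply: HT_sub h2; lia | apply: HT_U; lia].
rewrite -!mulrA; congr (_ * _); apply/esym; apply: HT_comm h3 => i hi.
by apply: commr_sym; apply: comm_U; apply: (T_comm (@bT_braids n)); lia.
Qed.

Definition DS f m : set B := [set x | (exists h v, [/\ H f.*2 m h, Dset n f m v &
  x = Ep f * (h * Tw v)]) \/ IdG T E f.+1 m x]%classic.

Lemma DS_mull f m h x : H f.*2 m h -> x \in kspan (DS f m) -> h * x \in kspan (DS f m).
Proof.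
move=> hh; apply: kspan_mull => y [[h' [v [hh' hv ->]]]|hy].
  apply: kspan_in; left; exists (h * h'), v; split=> //; first exact: gen_subalg_M.
  by rewrite !mulrA -(Ep_HT hn hh).
apply: (kspan_sub (S := IdG T E f.+1 m)) => [z hz|]; first by right.
by apply: IdG_mull; [exact: SQ_HT hh | exact: kspan_in].
Qed.

(** By [Ep_SQ_restrict] either the last strand is free or it carries the last arc, and
    then the two strings of [Dset_step] split off. *)
Lemma Ep_SQ_D m f s : (m <= n)%N -> (f.*2 <= m)%N -> S m s -> Ep f * s \in kspan (DS f m).
Proof.
elim: m f s => [|m IH] f s hm hf hs.
  have -> : f = 0%N by lia.
  have [//|c ->] := SQ_triv _ hs; rewrite -scalerAr rpredZ //.
  apply: kspan_in; left; exists 1, 1%g; rewrite (Tw1 n).1 mul1r; split=> //; [exact: gen_subalg_1|exact: Dset0].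
have IdDS x : x \in kspan (IdG T E f.+1 m.+1) -> x \in kspan (DS f m.+1).
  by apply: kspan_sub => z hz; right.
have stepA h (a : B) : (f.*2 <= m)%N -> H f.*2 m.+1 h -> S m a -> Ep f * (h * a) \in kspan (DS f m.+1).
  move=> hfm hh ha; rewrite mulrA (Ep_HT hn hh) -mulrA; apply: DS_mull => //.
  apply: kspan_sub (IH f a _ hfm ha) => [y [[h' [v [hh' hv ->]]]|hy]|]; last by lia.
    left; exists h', v; split=> //; [by apply: HT_sub hh'; lia | exact: Dset_le hv].
  right; case: hy => a0 [b0 [h1 h2 h3 ->]]; exists a0, b0; split=> //; last by lia.
    exact: SQ_le h1.
  exact: SQ_le h2.
have stepB f' (a : B) : f = f'.+1 -> S m a -> Ep f * (Sup T f.*2 m.+1 * a) \in kspan (DS f m.+1).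
  move=> ef ha; have hSE : Ep f' * Sup T f.*2 m.+1 = Sup T f.*2 m.+1 * Ep f'.
    by apply: (@Ep_HT n hn f' m.+1); apply: HT_Sup; lia.
  have hEE : Ep f * Ep f' = del ^+ f' *: Ep f by apply: (Ep_Ep hq); lia.
  have eS (x : B) : Ep f * Sup T f.*2 m.+1 * (Ep f' * x) = del ^+ f' *: (Ep f * (Sup T f.*2 m.+1 * x)).
    by rewrite -mulrA (mulrA (Sup T _ _)) -hSE -(mulrA (Ep f')) (mulrA (Ep f)) hEE -scalerAl.
  have -> : Ep f * (Sup T f.*2 m.+1 * a) = del ^- f' *: ((Ep f * Sup T f.*2 m.+1) * (Ep f' * a)).
    by rewrite eS scalerA mulVr ?scale1r //; apply: unitrX; exact: del_unit.
  rewrite rpredZ //; apply: kspan_mull (IH f' a _ _ ha); [|lia|lia].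
  move=> _ [[h' [v [hh' hv ->]]]|[a0 [b0 [h1 h2 h3 ->]]]].
    have -> : Ep f * Sup T f.*2 m.+1 * (Ep f' * (h' * Tw v)) =
        del ^+ f' *: (Ep f * Sup T f.*2 m.+1 * (h' * Tw v)).
      by rewrite eS -mulrA.
    rewrite rpredZ //; have hc := @cosL _ T f'.*2 m h' (@bT_braids n) _ hh'.
    have hc' := hc ltac:(by move=> i hi; apply: (@bT_quadratic n); lia).
    apply: kspan_bi hc' _ => _ [y [j [hy hj ->]]].
    have hf2 : (0 < f.*2)%N by rewrite ef.
    have hy2 : H f.*2.-1 m.+1.-1 y by rewrite ef.
    have hfm' : (0 < f.*2 <= m.+1)%N by rewrite hf2.
    have hmn' : (m <= n)%N by apply: ltnW.
    have [y' hy' ey] := @SupT_HT n f.*2 m.+1 y hm hf2 hy2.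
    apply: kspan_in; left; exists y', (wup n f.*2 m.+1 * (wup n f'.*2.+1 j * v))%g.
    have hjm : (f'.*2 < j <= m)%N by lia.
    have [hi hfix] := Dset_incr hmn' hv.
    split=> //; first by rewrite ef; apply: Dset_step => //; lia.
    have e1 : Tw (wup n f'.*2.+1 j * v)%g = Sup T f'.*2.+1 j * Tw v.
      by apply: Tw_upl => [||x z hx hz]; [lia|lia|apply: hi; lia].
    have hfx : fixes_above m.+1.-1 (wup n f'.*2.+1 j * v)%g.
      move=> x hx; rewrite pactM; last by lia.
      rewrite pact_wup; [|lia|lia|lia].
      have -> : (x == f'.*2.+1) = false by lia.
      have -> : (f'.*2.+1 < x <= j)%N = false by lia.
      by apply: hfix; lia.
    have [e2 _] := @Tw_up n (wup n f'.*2.+1 j * v)%g m.+1 f.*2 hfm' hm hfx.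
    by rewrite e2 e1 -!mulrA (mulrA (Sup T f.*2 _) y) ey -!mulrA.
  rewrite -ef in h3 *.
  have -> : Ep f * Sup T f.*2 m.+1 * (a0 * Ep f * b0) = Ep f * ((Sup T f.*2 m.+1 * a0) * Ep f) * b0.
    by rewrite !mulrA.
  have ha0 : S m.+1 (Sup T f.*2 m.+1 * a0).
    by apply: gen_subalg_M; [apply: SQ_Sup; lia | apply: SQ_le h1].
  have hq' : qbs m.+1 T E by apply: qbs_le hq.
  apply: kspan_mulr (Ep_SQ_Ep hq' hf ha0) => y [[h hh ->]|hy].
    by rewrite -mulrA; apply: stepA => //; lia.
  apply: IdDS; apply: IdG_mulr; [exact: SQ_le h2 | exact: kspan_in].
apply: kspan_min (Ep_SQ_restrict hq hm hf hs) => y.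
case=> [[h [a [hh ha ->]]]|[[h [a [hf0 hh ha ->]]]|hy]].
- have [hfm|hfm] := leqP f.*2 m; first by apply: stepA.
  rewrite mulrA (Ep_HT hn hh) -mulrA; apply: DS_mull => //.
  have -> : a = Sup T f.*2 m.+1 * a by rewrite Sup_geq ?mul1r.
  by apply: (stepB f.-1) => //; lia.
- rewrite (mulrA (Ep f) h) (Ep_HT hn hh) -(mulrA h); apply: DS_mull => //.
  have hU : Sup U f.*2 m.+1 \in kspan _ := @SupU_T f.*2 m.+1 ltac:(lia) hm.
  apply: kspan_bi hU _ => _ [->|[h' [s' [h1 h2 h3 ->]]]].
    by apply: (stepB f.-1) => //; lia.
  rewrite -mulrA; apply: stepA => //.
  by apply: gen_subalg_M => //; apply: SQ_HT h3.
- by apply: IdDS; exact: kspan_in.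
Qed.

End CosetSpan.
Arguments DS {n} f m.

(** * Straightening *)

Section Order.
Implicit Types (la mu nu : seq nat) (k M : nat).

Lemma ple_refl la : ple la la.
Proof. by right; split=> // k. Qed.

Lemma ple_trans mu la nu : ple la mu -> ple mu nu -> ple la nu.
Proof.
case=> [h1|[e1 h1]] [h2|[e2 h2]]; [by left; lia|by left; lia|by left; lia|right].
by split; [rewrite e1 | exact: dominates_trans h2 h1].
Qed.

Lemma ple_anti la mu : is_part la -> is_part mu -> ple la mu -> ple mu la -> la = mu.
Proof.
move=> hla hmu [h1|[e1 h1]] [h2|[e2 h2]]; try by lia.
apply: part_ext => // i; have := psumS la i; have := psumS mu i.
have e k : psum la k = psum mu k by apply/eqP; rewrite eqn_leq h1 h2.
by rewrite !e => ->; move/addnI.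
Qed.

Lemma plt_trans mu la nu : is_part la -> is_part mu -> is_part nu ->
  plt la mu -> plt mu nu -> plt la nu.
Proof.
move=> h1 h2 h3 [h4 h5] [h6 h7]; split; first exact: ple_trans h6.
by move=> e; apply: h5; apply: ple_anti => //; rewrite e.
Qed.

Definition above_count M la := count (fun nu => `[< plt la nu >]) (parts_upto M).

Lemma above_lt M la nu : is_part la -> is_part nu -> plt la nu -> (sumn nu <= M)%N ->
  (above_count M nu < above_count M la)%N.
Proof.
move=> hla hnu h hM; rewrite /above_count -!size_filter.
rewrite -[X in (X < _)%N]/(size (filter _ _)) -[X in (X <= _)%N]/(size (nu :: filter _ _)).
apply: uniq_leq_size => [|x].
  rewrite cons_uniq (filter_uniq _ (parts_upto_uniq M)) andbT mem_filter.
  by apply/negP => /andP[/asboolP [_ ne] _].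
rewrite inE !mem_filter => /orP[/eqP ->|/andP[/asboolP hx hp]].
  by rewrite parts_uptoP hnu hM /= andbT; apply/asboolP.
rewrite hp andbT; apply/asboolP; apply: plt_trans hx => //.
by move: hp; rewrite parts_uptoP => /andP[].
Qed.

Lemma LambdaE (m f : nat) la : Lambda m (f, la) <-> is_part la /\ (f.*2 + sumn la = m)%N.
Proof. by split=> [[/= h1 h2 h3]|[h1 h2]]; [split=> //; lia | split=> //=; lia]. Qed.

Lemma shape_ind M (P : seq nat -> Prop) :
  (forall la, is_part la -> (sumn la <= M)%N ->
    (forall nu, is_part nu -> (sumn nu <= M)%N -> plt la nu -> P nu) -> P la) ->
  forall la, is_part la -> (sumn la <= M)%N -> P la.
Proof.
move=> hP la; have [N hN] : exists N, (above_count M la < N)%N by exists (above_count M la).+1.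
elim: N la hN => // N IH la hN hla hM; apply: hP => // nu hnu hs h.
by apply: IH => //; have := above_lt hla hnu h hs; lia.
Qed.

End Order.

Section Straighten.
Variable n : nat.
Hypothesis hn : (1 < n)%N.
Local Notation B := (qBrauer n).
Local Notation T := (bT n).
Local Notation E := (bE n).
Local Notation U := (Uof T).
Local Notation del := kdelta.
Local Notation H := (HT T).
Local Notation S := (SQ T E).
Local Notation Ep := (Ep T E).
Let hq := brauer_qbs hn.
Implicit Types (m f k i j : nat) (x y h : B) (pi tau la mu nu l : seq nat) (t : seq (seq nat)).

Lemma bsigma_xP s la : bsigma (xP T s la) = xP T s la.
Proof.
elim: la s => [|c la IH] s; first by rewrite xP_nil bsigma1.
rewrite xP_cons bsigmaM IH bsigma_Xs; apply/esym.
exact: (HT_HT_comm (leqnn _) (Xs_HT T s c) (xP_HT T (s + c) la)).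
Qed.

Definition el f la : B := Ep f * xP T f.*2 la.

Lemma el_C f la : Ep f * xP T f.*2 la = xP T f.*2 la * Ep f.
Proof. exact: (Ep_HT hn (xP_HT T f.*2 la)). Qed.

Lemma el_sigma f la : (f.*2 <= n)%N -> bsigma (el f la) = el f la.
Proof. by move=> hf; rewrite bsigmaM bsigma_xP (Ep_sigma hq hf) -el_C. Qed.

Lemma el_Ep f la : (f.*2 <= n)%N -> el f la * Ep f = del ^+ f *: el f la.
Proof. by move=> hf; rewrite /el -mulrA -el_C mulrA (Ep_Ep hq hf (leqnn f)) scalerAl. Qed.

Lemma el_EpM f la x : (f.*2 <= n)%N -> el f la * (Ep f * x) = del ^+ f *: (el f la * x).
Proof. by move=> hf; transitivity (el f la * Ep f * x); [exact: mulrA | rewrite el_Ep // -scalerAl]. Qed.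

(** Since [E^f] is idempotent up to a unit, what is known about [E^f a] is known
    about the multiples of [E^f x_la] by [a]. *)
Lemma el_via (X Y : set B) f la a b : (f.*2 <= n)%N -> Ep f * a \in kspan X ->
  (forall u, X u -> el f la * u * b \in kspan Y) -> el f la * a * b \in kspan Y.
Proof.
move=> hf ha h; have -> : el f la * a * b = del ^- f *: (el f la * ((Ep f * a) * b)).
  rewrite !mulrA el_Ep // -!scalerAl scalerA mulVr ?scale1r //.
  by apply: unitrX; exact: del_unit.
by rewrite rpredZ //; apply: kspan_bi ha _ => u /h; rewrite mulrA.
Qed.

(** The part of the ideal of strictly larger shapes that straightening produces:
    Garnir elements of the shape, and elements with more arcs. *)
Definition Rem m f la : set B := [set x |
  (exists g s, [/\ Garn f.*2 la g, S m s & x = Ep f * (g * s)]) \/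
  exists2 y, IdG T E f.+1 m y & x = el f la * y]%classic.

Lemma Rem_mulr m f la x s : S m s -> x \in kspan (Rem m f la) -> x * s \in kspan (Rem m f la).
Proof.
move=> hs; apply: kspan_mulr => _ [[g [s0 [hg hs0 ->]]]|[y hy ->]].
  by apply: kspan_in; left; exists g, (s0 * s); rewrite -!mulrA; split=> //; apply: gen_subalg_M.
rewrite -mulrA; apply: (kspan_mull (S := IdG T E f.+1 m)) => [u hu|].
  by apply: kspan_in; right; exists u.
by apply: IdG_mulr => //; exact: kspan_in.
Qed.

Lemma el_IdG m f la z : z \in kspan (IdG T E f.+1 m) -> el f la * z \in kspan (Rem m f la).
Proof. by apply: kspan_mull => u hu; apply: kspan_in; right; exists u. Qed.

Definition nbr f la mu := [/\ is_part mu, adj la mu & (sumn mu < sumn la)%N || (0 < f)%N].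

Definition YS m f la (P : seq nat -> Prop) : set B := [set x | Rem m f la x \/
  exists mu c, [/\ nbr f la mu, P mu, S m.-1 c & x = yv n m f la mu * c]]%classic.

Lemma Rem_YS m f la P x : x \in kspan (Rem m f la) -> x \in kspan (YS m f la P).
Proof. by apply: kspan_sub => y hy; left. Qed.

Lemma YS_sub m f la (P Q : seq nat -> Prop) x : (forall nu, nbr f la nu -> P nu -> Q nu) ->
  x \in kspan (YS m f la P) -> x \in kspan (YS m f la Q).
Proof.
move=> hPQ; apply: kspan_sub => y [hy|[mu [c [h1 h2 h3 e]]]]; [by left|right].
by exists mu, c; split=> //; exact: hPQ.
Qed.

Lemma Ep_LowS m f la k x c : (0 < m <= n)%N -> is_part la -> (f.*2 + sumn la = m)%N ->
  x \in kspan (LowS f.*2 la k) -> S m.-1 c ->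
  Ep f * (x * c) \in kspan (YS m f la (fun mu => exists2 k', (k <= k')%N & la = incr_nth mu k')).
Proof.
move=> hm hla hf hx hc; apply: kspan_bi hx _ => _ [[g [h [hg hh ->]]]|[pi [a [tau [h [e hh hk hh' ->]]]]]].
  apply: kspan_in; left; left; exists g, (h * c); rewrite -mulrA; split=> //.
  by apply: gen_subalg_M; [apply: SQ_HT; rewrite -hf; exact: hh | apply: SQ_le hc; lia].
have [mu [hmu e1 hp hsz]] := decr_padd hla e hh.
apply: kspan_in; right; exists mu, (h * c); split.
- split=> //; last by rewrite e1 sumn_incr ltnSn.
  by apply/orP; right; apply/(addsP _ hmu); exists (size pi); rewrite -e1.
- by exists (size pi).
- by apply: gen_subalg_M => //; apply: SQ_HT; rewrite -hf; exact: hh'.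
- by rewrite (yv_low hn hm hf hp e1 hsz) -!mulrA.
Qed.

Lemma Garn_shift m f la g : (m <= n)%N -> (f.+1.*2 + sumn la = m)%N -> Garn f.*2.+1 la g ->
  exists2 g', Garn f.+1.*2 la g' & Sup U f.*2.+2 m * g = g' * Sup U f.*2.+2 m.
Proof.
move=> hm hf [pi [a [b [tau [v [e hv ->]]]]]].
exists (xP T f.+1.*2 la * gam T (f.+1.*2 + sumn pi) a v).
  by exists pi, a, b, tau, v.
rewrite mulrA (SupU_xP_shift hn hm hf) -!mulrA; congr (_ * _).
apply: (@gam_shift _ T (Sup U f.*2.+2 m) (f.*2.+1 + sumn pi) a v) => i hi.
move: hf; rewrite e sumn_cat /= => hf.
by apply: (SupU_shift (@bT_braids n) (@bT_quadratic n)); lia.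
Qed.

Lemma Ep_UpS m f la l k x c : (m <= n)%N -> is_part la -> (f.+1.*2 + sumn la = m)%N ->
  padd la l -> (k <= size la)%N -> x \in kspan (UpS f.*2 l k) -> S m.-1 c ->
  Ep f.+1 * (Sup U f.*2.+2 m * (x * c)) \in
    kspan (YS m f.+1 la (fun mu => exists2 k', (k' < k)%N & mu = incr_nth la k')).
Proof.
move=> hm hla hf hp hk hx hc; rewrite mulrA.
have hs := padd_sumn hp; have em : (f.*2 + sumn l).+1 = m.-1 by lia.
have hSU : S m (Sup U f.*2.+2 m) by apply: SQ_SupU; lia.
apply: kspan_bi hx _ => _ [[g [h [hg hh ->]]]|[pi [a [tau [h [e hh hk' hh' ->]]]]]].
  have hg' := (padd_Garn _ g hp).2 hg.
  have [g' hg'' eg] := Garn_shift hm hf hg'.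
  apply: kspan_in; left; left; exists g', (Sup U f.*2.+2 m * (h * c)); split=> //.
    apply: gen_subalg_M => //; apply: gen_subalg_M; last by apply: SQ_le hc; lia.
    by rewrite em in hh; apply: SQ_le (SQ_HT E hh); lia.
  by rewrite -!mulrA; congr (_ * _); rewrite mulrA eg -mulrA.
rewrite e in hp; have hsz : (size pi <= size la)%N by lia.
have hpart : is_part (incr_nth la (size pi)).
  apply: incr_part => //; case: hh => [->|hl]; [by left|right].
  rewrite -!(padd_nth _ hp) !nth_cat ltnn subnn /=.
  case/lastP: (pi) hl => [//|p z]; rewrite last_rcons size_rcons /= leqnn => hl.
  by rewrite nth_rcons ltnn eqxx.
apply: kspan_in; right; exists (incr_nth la (size pi)), (h * c); split.
- split=> //; last by rewrite orbT.
  by apply/orP; left; apply/(addsP _ hla); exists (size pi).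
- by exists (size pi).
- by apply: gen_subalg_M => //; apply: SQ_HT; rewrite -em; exact: hh'.
- by rewrite (yv_up hn hm hf hp erefl hsz) -!mulrA.
Qed.

Lemma part_sumn0 la : is_part la -> sumn la = 0%N -> la = [::].
Proof. by case: la => // c la /andP[_]; rewrite inE negb_or /= => /andP[h _]; lia. Qed.

Lemma el_low m f la h c : (0 < m <= n)%N -> is_part la -> (f.*2 + sumn la = m)%N ->
  (0 < sumn la)%N -> H f.*2 m h -> S m.-1 c ->
  el f la * (h * c) \in kspan (YS m f la (fun mu => exists k', la = incr_nth mu k')).
Proof.
move=> hm hla hf h0 hh hc; rewrite /el -mulrA (mulrA (xP T _ _)).
apply: (@YS_sub _ _ _ (fun mu => exists2 k', (0 <= k')%N & la = incr_nth mu k')).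
  by move=> nu _ [k' _ e]; exists k'.
apply: Ep_LowS => //; apply: xP_HT_low => //; [by case/andP: hla | lia | by rewrite hf].
Qed.

Lemma el_newrow m f la c : (m <= n)%N -> is_part la -> (f.+1.*2 + sumn la = m)%N -> S m.-1 c ->
  el f.+1 la * (Sup U f.+1.*2 m * c) \in kspan (YS m f.+1 la (fun mu => mu = incr_nth la (size la))).
Proof.
move=> hm hla hf hc; have hp : padd la (la ++ 0%N :: [::]) by exists 1%N.
have hb := bfac_up hm hf hp erefl (leqnn _).
have hpart : is_part (incr_nth la (size la)).
  apply: incr_part => //; case: (posnP (size la)) => h0; [by left|right].
  by rewrite [nth _ _ (size la)]nth_default // part_nth_gt0 //; lia.
have ht : Theta f.*2 la 0 = Sup U f.*2.+1 m.-1.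
  rewrite /Theta addn0 big_nat1 subnn expr0 scale1r; congr (Sup U _ _); lia.
apply: kspan_in; right; exists (incr_nth la (size la)), (Sdn T m.-1 f.*2.+1 * c); split=> //.
- split=> //; last by rewrite orbT.
  by apply/orP; left; apply/(addsP _ hla); exists (size la).
- by apply: gen_subalg_M => //; apply: (@SQ_HT _ T E 0 m.-1); apply: HT_Sdn; lia.
- rewrite /yv hb ht -!mulrA (mulrA (Sup U f.*2.+1 _)) (SupU_SdnT (@bT_quadratic n)) ?mul1r ?mulrA //; lia.
Qed.

(** Hecke cosets produce the removals; the strand joined to the last arc produces the
    addition of a new row, from which the other additions arise by straightening. *)
Lemma el_span m f la c : (0 < m <= n)%N -> is_part la -> (f.*2 + sumn la = m)%N -> S m c ->
  el f la * c \in kspan (YS m f la (fun _ => True)).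
Proof.
move=> hm hla hf hc; have hfn : (f.*2 <= n)%N by lia.
have newrow h s : (0 < f)%N -> H f.*2 m h -> S m.-1 s ->
    el f la * (h * (Sup U f.*2 m * s)) \in kspan (YS m f la (fun _ => True)).
  case: f hf {hfn} => // f hf _ hh hs.
  have hqm : quadratic T m by move=> i hi; apply: (@bT_quadratic n); lia.
  have [y hy ey] := HT_mul_SupU (@bT_braids n) hqm (isT : (0 < f.+1.*2)%N) hh.
  have hmn : (m <= n)%N by lia.
  have hys : S m.-1 (y * s) by apply: gen_subalg_M => //; exact: SQ_HT hy.
  rewrite (mulrA h) ey -[Sup U _ _ * y * s]mulrA.
  by apply: YS_sub (el_newrow hmn hla hf hys).
rewrite -[el f la * c]mulr1; apply: el_via (hfn) (Ep_SQ_restrict hq _ _ hc) _; [lia|lia|].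
move=> u [[h [s [hh hs {u}->]]]|[[h [s [h0 hh hs {u}->]]]|hy]]; rewrite mulr1.
- rewrite el_EpM // rpredZ //.
  have [e0|h0] := posnP (sumn la); last by apply: YS_sub (el_low hm hla hf h0 hh hs).
  have -> : s = Sup U f.*2 m * s by rewrite Sup_geq ?mul1r //; lia.
  by apply: newrow => //; lia.
- by rewrite el_EpM // rpredZ //; exact: newrow.
- by apply/Rem_YS/el_IdG; exact: kspan_in.
Qed.

Lemma low_data la mu k : is_part la -> is_part mu -> la = incr_nth mu k -> exists pi a tau,
  [/\ size pi = k, la = pi ++ a.+1 :: tau, padd mu (pi ++ a :: tau) & (k <= size mu)%N].
Proof.
move=> hla hmu e; have nk : nth 0%N la k = (nth 0%N mu k).+1 by rewrite e nth_incr_nth eqxx.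
have hk : (k < size la)%N by rewrite ltnNge; apply/negP => h; rewrite nth_default in nk.
have el : la = take k la ++ (nth 0%N mu k).+1 :: drop k.+1 la by rewrite -nk -drop_nth // cat_take_drop.
have sz : size (take k la) = k by rewrite size_take hk.
exists (take k la), (nth 0%N mu k), (drop k.+1 la); split=> //; last by apply: incr_le => //; rewrite -e.
apply: padd_of_nth => // i; apply/eqP; rewrite -(eqn_add2l (k == i)) -nth_incr_nth -e {1}el.
by rewrite -incr_nth_cat nth_incr_nth sz.
Qed.

Lemma padd_sorted la l : is_part la -> padd la l -> sorted geq l.
Proof. by move=> hla hp; apply/(sortedP 0%N) => i _; rewrite !(padd_nth _ hp); exact: part_nth. Qed.

Definition flev f la mu := if (sumn mu < sumn la)%N then f else f.-1.

Lemma bfac_S m f la mu : (0 < m <= n)%N -> is_part la -> (f.*2 + sumn la = m)%N -> nbr f la mu ->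
  S m (bfac n m la mu).
Proof.
move=> hm hla hf [hmu /orP[ha|ha] hlt].
  have [k [_ e]] := addsP _ hla ha; have hk : (k <= size la)%N by apply: incr_le => //; rewrite -e.
  have [pi [a [tau [e1 hp _]]]] := padd_exists hla hk; subst k.
  case: f hf hlt => [|f] hf; first by rewrite e sumn_incr ltnNge leqnSn.
  move=> _; rewrite (bfac_up _ hf hp e hk); last by lia.
  have := padd_sumn hp; rewrite sumn_cat /= => hs.
  apply: gen_subalg_M; first by apply: SQ_SupU; lia.
  by apply: (SQ_HT E (a := f.*2)); apply: Theta_HT; lia.
have [k [_ e]] := addsP _ hmu ha; have [pi [a [tau [e1 e2 hp hk]]]] := low_data hla hmu e.
rewrite -e1 in e hk; rewrite (bfac_low hm hf hp e hk).
by apply: SQ_Sup => //; lia.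
Qed.

(** The branching element of a neighbour is a left multiple of the generator of
    its cell module, and the same left factor sends the straightening terms of the
    neighbour to the branching elements of larger neighbours. *)
Lemma yv_step m f la mu : (0 < m <= n)%N -> is_part la -> (f.*2 + sumn la = m)%N -> nbr f la mu ->
  exists h, yv n m f la mu = h * el (flev f la mu) mu /\
    forall r, r \in kspan (Rem m.-1 (flev f la mu) mu) -> h * r \in kspan (YS m f la (plt mu)).
Proof.
move=> hm hla hf hnb; have := hnb; case=> hmu hadj hlt.
have hbS := bfac_S hm hla hf hnb.
have hyv : yv n m f la mu = el f la * bfac n m la mu by [].
case/orP: hadj => ha.
  have [k [_ e]] := addsP _ hla ha; have hk : (k <= size la)%N by apply: incr_le => //; rewrite -e.
  have [pi [a [tau [e1 hp _]]]] := padd_exists hla hk; subst k.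
  have hfl : flev f la mu = f.-1 by rewrite /flev e sumn_incr ltnNge leqnSn.
  rewrite hfl; case: f hf hlt hnb hyv {hfl} => [|f] hf; first by rewrite e sumn_incr ltnNge leqnSn.
  move=> _ hnb hyv /=; have hmn : (m <= n)%N by lia.
  have hp' := padd_incr hp hk; rewrite -e in hp'.
  have hsum := padd_sumn hp; have hsum' := hsum; rewrite sumn_cat /= in hsum'.
  pose X := E * (Sup T 2 f.*2.+2 * Sup U 1 f.*2.+1); pose V := Sup U f.*2.+1 (f.*2 + sumn pi + a).+1.
  have eX : Ep f.+1 = X * Ep f by rewrite EpS /X -!mulrA.
  have c1 : Ep f * Sup U f.*2.+2 m = Sup U f.*2.+2 m * Ep f by apply: (Ep_SupU_comm hn); lia.
  have c2 : Ep f * V = V * Ep f by apply: (Ep_SupU_comm hn); lia.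
  have key z : X * (Sup U f.*2.+2 m * V) * (Ep f * z) = Ep f.+1 * (Sup U f.*2.+2 m * (V * z)).
    by rewrite eX -!mulrA; congr (_ * _); rewrite [in RHS](mulrA (Ep f)) c1 -!mulrA [in RHS](mulrA (Ep f)) c2 -!mulrA.
  have ey : yv n m f.+1 la mu = X * (Sup U f.*2.+2 m * V) * el f mu.
    by rewrite /el key (yv_up hn hmn hf hp e hk) /Ya -(padd_xP _ _ hp').
  have eYa : V * xP T f.*2 (pi ++ a.+1 :: tau) = Ya f.*2 pi a tau by [].
  clearbody X V; exists (X * (Sup U f.*2.+2 m * V)); split=> // r.
  apply: kspan_mull => _ [[g [s [hg hs ->]]]|[y [a0 [b0 [ha0 hb0 h0 ->]]] ->]].
    rewrite key (mulrA V).
    have [pi1 [c [d [tau1 [v [e3 hv eg]]]]]] := (padd_Garn _ g hp').1 hg.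
    have hV : V * g \in kspan (RUp f.*2 pi a tau).
      by rewrite eg mulrA eYa; apply: Ya_garnir e3 hv; lia.
    have hU := RUp_UpS erefl (padd_sorted hla hp) _ hV.
    apply: YS_sub (Ep_UpS hmn hla hf hp hk (hU _) hs); last by lia.
    move=> nu _ [k' hk' ->]; rewrite e; split; last by move/incr_inj; lia.
    right; rewrite !sumn_incr; split=> // i; rewrite !psum_incr; lia.
  rewrite [X * _ * (el f mu * _)]mulrA -ey hyv; have -> : el f.+1 la * bfac n m la mu * (a0 * Ep f.+1 * b0) =
      el f.+1 la * (bfac n m la mu * a0 * Ep f.+1) * b0 by rewrite !mulrA.
  have hS : S m (bfac n m la mu * a0) by apply: gen_subalg_M => //; apply: SQ_le ha0; lia.
  have hqm : qbs m T E by apply: qbs_le hq; lia.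
  have hfm : (f.+1.*2 <= m)%N by lia.
  have hfn : (f.+1.*2 <= n)%N by lia.
  apply: el_via (hfn) (Ep_SQ_Ep hqm hfm hS) _ => u [[h hh ->]|hu].
    rewrite el_EpM // -scalerAl rpredZ // -(mulrA (el f.+1 la)).
    apply: YS_sub (el_low hm hla hf _ hh hb0); last by lia.
    move=> nu _ [k' e4]; have s1 : sumn mu = (sumn la).+1 by rewrite e sumn_incr.
    have s2 : sumn la = (sumn nu).+1 by rewrite e4 sumn_incr.
    by split; [left; lia | move=> e5; rewrite e5 in s1; lia].
  apply/Rem_YS/Rem_mulr; first by apply: SQ_le hb0; lia.
  by apply: el_IdG; exact: kspan_in.
have [k [_ e]] := addsP _ hmu ha; have [pi [a [tau [e1 e2 hp hk]]]] := low_data hla hmu e.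
rewrite -e1 in e hk; have hfl : flev f la mu = f by rewrite /flev e sumn_incr ltnSn.
rewrite hfl {hfl}; have [hL hhL [eY _]] := Yr_left n f.*2 pi a tau.
have cL : Ep f * hL = hL * Ep f by apply: (Ep_HT hn hhL).
have ey : yv n m f la mu = hL * el f mu.
  by rewrite (yv_low hn hm hf hp e hk) eY /el !mulrA cL (padd_xP _ _ hp).
have hsum : (f.*2 + sumn (pi ++ a.+1 :: tau) <= n)%N by rewrite -e2; lia.
exists hL; split=> // r; apply: kspan_mull => _ [[g [s [hg hs ->]]]|[y hy ->]].
  rewrite (mulrA hL (Ep f)) -cL -(mulrA (Ep f)) (mulrA hL).
  have [pi1 [c [d [tau1 [v [e3 hv eg]]]]]] := (padd_Garn _ g hp).1 hg.
  have hYg : hL * g \in kspan (RLow f.*2 pi a.+1 tau).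
    by rewrite eg mulrA -eY; exact: Yr_garnir e3 hv.
  have hLow := RLow_LowS e2 _ _ hYg.
  apply: YS_sub (Ep_LowS hm hla hf (hLow _ _) hs); [|by case/andP: hla|by lia].
  move=> nu _ [k' hk' e4]; have hne : mu <> nu.
    by move=> en; move: e4; rewrite -en {1}e => /incr_inj; lia.
  split=> //; right; have es := congr1 sumn e4; rewrite e !sumn_incr in es.
  split=> [|i]; first by lia.
  by have := psum_incr mu (size pi) i; rewrite -e e4 psum_incr; lia.
rewrite [hL * (el f mu * y)]mulrA -ey hyv -[el f la * _ * y]mulrA; apply/Rem_YS/el_IdG/IdG_mull => //.
by apply: (IdG_le (m := m.-1)); [lia | exact: kspan_in].
Qed.

(** ** The up-down tableaux basis spans *)

Definition TS m f la (P : seq nat -> Prop) : set B := [set x | Rem m f la x \/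
  exists t, [/\ updown m la t, P (nth [::] t m.-1) & x = el f la * bud n m t]]%classic.

Lemma TS_sub m f la (P Q : seq nat -> Prop) x : (forall nu, P nu -> Q nu) ->
  x \in kspan (TS m f la P) -> x \in kspan (TS m f la Q).
Proof.
move=> hPQ; apply: kspan_sub => y [hy|[t [h1 h2 e]]]; [by left|right].
by exists t; split=> //; exact: hPQ.
Qed.

Lemma nbr_level m f la mu : (f.*2 + sumn la = m)%N -> is_part la -> nbr f la mu ->
  Lambda m.-1 (flev f la mu, mu).
Proof.
move=> hf hla [hmu /orP[ha|ha] hlt]; apply/LambdaE; split=> //; rewrite /flev.
  have [k [_ e]] := addsP _ hla ha; move: hlt; rewrite e sumn_incr ltnNge leqnSn /=; lia.
have [k [_ e]] := addsP _ hmu ha; have es := sumn_incr mu k; rewrite -e in es.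
by rewrite es ltnSn; lia.
Qed.

Lemma updown_rcons m la mu t : is_part la -> is_part mu -> adj la mu -> updown m mu t ->
  updown m.+1 la (rcons t la).
Proof.
move=> hla hmu hadj [h1 h2 h3 h4]; split.
- by rewrite size_rcons h1.
- by rewrite nth_rcons h1.
- by rewrite nth_rcons h1 ltnn eqxx.
move=> i hi; rewrite !nth_rcons h1 hi; case: (ltnP i m) => him.
  by rewrite ltnS him; exact: h4.
have -> : i = m by lia.
rewrite ltnn eqxx h3; apply/add_adj; split=> //; by rewrite adj_sym.
Qed.

Lemma yv_bud m f la mu t : updown m mu t ->
  el f la * bud n m.+1 (rcons t la) = yv n m.+1 f la mu * bud n m t.
Proof.
move=> [h1 h2 h3 h4]; rewrite budS !nth_rcons h1 ltnn eqxx ltnSn h3 mulrA; congr (_ * _).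
by rewrite -(bud_take n m (rcons t la)) -cats1 take_cat h1 ltnn subnn take0 cats0.
Qed.

(** Induction on [m] and, for fixed [m], from the larger to the smaller neighbours of
    the shape: [yv_step] turns straightening for a neighbour on one strand less into
    straightening on [m] strands. *)
Lemma straighten m f la c : (m <= n)%N -> Lambda m (f, la) -> S m c ->
  el f la * c \in kspan (TS m f la (fun _ => True)) /\
  forall mu c', (0 < m)%N -> nbr f la mu -> S m.-1 c' ->
    yv n m f la mu * c' \in kspan (TS m f la (ple mu)).
Proof.
elim: m f la c => [|m IH] f la c hm /LambdaE [hla hf] hc.
  have [//|a ->] := SQ_triv _ hc; split=> //.
  rewrite -scalerAr rpredZ //; apply: kspan_in; right; exists [:: [::]]; rewrite /= mulr1.
  by split=> //; split=> //; rewrite (part_sumn0 hla) //; lia.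
have Y mu c' : nbr f la mu -> S m c' -> yv n m.+1 f la mu * c' \in kspan (TS m.+1 f la (ple mu)).
  move=> hnb; have /LambdaE [hmu hs2] := nbr_level hf hla hnb.
  have hM : (sumn mu <= m)%N by lia.
  move: mu hmu hM {hs2} c' hnb; apply: shape_ind => mu hmu hM IHmu c' hnb hc'.
  have [h [ey hR]] := @yv_step m.+1 f la mu ltac:(lia) hla hf hnb.
  have [hs _] := IH _ _ _ (ltnW hm) (nbr_level hf hla hnb) hc'.
  rewrite ey -mulrA; apply: kspan_mull hs => z [hr|[t [h1 _ {z}->]]].
    apply: kspan_min (hR _ (kspan_in hr)) => z2 [hz|[nu [c2 [hnb2 hlt2 hc2 ->]]]].
      by apply: kspan_in; left.
    have /LambdaE [hnu hs2] := nbr_level hf hla hnb2.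
    apply: (TS_sub (P := ple nu)) => [ka|]; first exact: ple_trans hlt2.1.
    by apply: IHmu => //; lia.
  rewrite mulrA -ey -(yv_bud _ _ h1) //; apply: kspan_in; right; exists (rcons t la).
  have [_ hadj _] := hnb; split=> //; first exact: updown_rcons h1.
  by case: (h1) => s1 _ s3 _; rewrite /= nth_rcons s1 ltnSn s3; exact: ple_refl.
split=> [|mu c' _]; last exact: Y.
apply: kspan_min (el_span _ hla hf hc) => [z [hz|[mu [c2 [h1 _ h3 ->]]]]|]; last by lia.
  by apply: kspan_in; left.
by apply: TS_sub (Y _ _ h1 h3).
Qed.

(** ** The ideal of larger shapes *)

Definition Above m (P : seq nat -> Prop) : set B := [set x | exists (l : nat) nu a b,
  [/\ Lambda m (l, nu), P nu, S m a, S m b & x = a * (el l nu * b)]]%classic.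

Lemma xP_ones s r : xP T s (nseq r 1%N) = 1.
Proof. by elim: r s => [|r IH] s; rewrite /= ?xP_nil // xP_cons XsS Xs0 Rx1 !mul1r IH. Qed.

Lemma part_ones r : is_part (nseq r 1%N) /\ sumn (nseq r 1%N) = r.
Proof.
split; last by elim: r => //= r ->.
rewrite /is_part; apply/andP; split; last by apply/negP => /nseqP [].
by case: r => //; elim=> //= r ->.
Qed.

(** A Garnir element is a multiple of the symmetrizer of a more dominant composition,
    and [E^{f+1}] is the generator attached to the partition with rows of length one. *)
Lemma Rem_Above m f la x : (m <= n)%N -> Lambda m (f, la) -> Rem m f la x ->
  x \in kspan (Above m (plt la)).
Proof.
move=> hm /LambdaE [hla hf] [[g [s [[pi [a [b [tau [v [e hv ->]]]]]] hs ->]]]|[y [a [b [h1 h2 h3 ->]]] ->]].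
  rewrite {1}e xP_gam; last by lia.
  set rho := pi ++ _ :: _ :: tau; have erho : sumn rho = sumn la.
    by rewrite /rho e !sumn_cat /=; lia.
  set Z := Lc _ _ _; have hZ : H f.*2 m Z.
    by apply: HT_sub (Lc_HT n (f.*2 + sumn pi + a) v (b - v)); [lia|move: hf; rewrite e sumn_cat /=; lia].
  rewrite -!mulrA (mulrA (Ep f)) (Ep_HT hn hZ) -mulrA (mulrA (Ep f)).
  have hst := @xP_straighten n f.*2 rho ltac:(lia).
  rewrite -[Z * _]mulr1 -mulrA.
  have -> : Z * (Ep f * xP T f.*2 rho * s * 1) = (Z * Ep f) * (xP T f.*2 rho * s) by rewrite mulr1 !mulrA.
  apply: kspan_bi hst _ => _ [nu [h [h' [n1 n2 n3 [n4 n5] ->]]]].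
  rewrite erho hf in n2 n4 n5; apply: kspan_in; exists f, nu, (Z * h), (h' * s); split.
  - by apply/LambdaE; split=> //; lia.
  - split; first by right; split=> // i; apply: leq_trans (n3 i); rewrite e; apply: dominates_join; lia.
    move=> en; have := n3 (size pi).+1; rewrite -en e.
    have [_ ->] := rowsplit_psum (paddxx (pi ++ a :: b :: tau)).
    by have [_ ->] := rowsplit_psum (paddxx rho); lia.
  - by apply: (SQ_HT E (a := f.*2)); apply: gen_subalg_M.
  - by apply: gen_subalg_M => //; exact: SQ_HT n5.
  - by rewrite /el -!mulrA; congr (_ * _); rewrite !mulrA (Ep_HT hn n4).
have [o1 o2] := part_ones (m - f.+1.*2).
apply: kspan_in; exists f.+1, (nseq (m - f.+1.*2) 1%N), (el f la * a), b; split=> //.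
- by apply/LambdaE; split=> //; lia.
- by split; [left; lia | move=> en; move: hf; rewrite en o2; lia].
- apply: gen_subalg_M => //; apply: gen_subalg_M; first by apply: SQ_Ep; lia.
  by apply: (SQ_HT E (a := f.*2)); rewrite -hf; exact: xP_HT.
- by rewrite /el xP_ones mulr1 !mulrA.
Qed.

Lemma Above_mul m P a b x : S m a -> S m b -> x \in kspan (Above m P) -> a * (x * b) \in kspan (Above m P).
Proof.
move=> ha hb hx; apply: kspan_bi hx _ => _ [l [nu [a' [b' [h1 h2 h3 h4 ->]]]]].
apply: kspan_in; exists l, nu, (a * a'), (b' * b); split=> //; try exact: gen_subalg_M.
by rewrite !mulrA.
Qed.

(** If the multiples of the generators of the cell modules are spanned modulo larger
    shapes by a family, then two-sided multiples are spanned by the products of two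
    members of the family. *)
Lemma cell_span m (Bs : seq nat -> set B) (P : seq nat -> Prop) : (m <= n)%N ->
  (forall f la s, Lambda m (f, la) -> S m s -> el f la * s \in
    kspan [set x | (exists2 b, Bs la b & x = el f la * b) \/ Above m (plt la) x]%classic) ->
  (forall nu nu', is_part nu -> is_part nu' -> P nu -> plt nu nu' -> P nu') ->
  (forall la b, is_part la -> Bs la b -> S m b) ->
  forall x, x \in kspan (Above m P) -> x \in kspan [set y | exists (l : nat) nu b b',
    [/\ Lambda m (l, nu), P nu, Bs nu b, Bs nu b' & y = bsigma b * (el l nu * b')]]%classic.
Proof.
move=> hm hspan hP hBs; set X := [set y | _]%classic => x; apply: kspan_min => {x} _ [l [nu [a [b [hL hPn ha hb ->]]]]].
have /LambdaE [hnu hl] := hL; have hM : (sumn nu <= m)%N by lia.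
move: nu hnu hM {hl} l hL hPn a b ha hb; apply: shape_ind => nu hnu hM IH l hL hPn a b ha hb.
have /LambdaE [_ hl] := hL; have hln : (l.*2 <= n)%N by lia.
have hlt u a' b' : Above m (plt nu) u -> S m a' -> S m b' -> a' * (u * b') \in kspan X.
  move=> [l' [nu' [a1 [b1 [h1 h2 h3 h4 ->]]]]] ha' hb'; have /LambdaE [hnu' hl'] := h1.
  have -> : a' * (a1 * (el l' nu' * b1) * b') = (a' * a1) * (el l' nu' * (b1 * b')) by rewrite !mulrA.
  by apply: (IH nu') => //; [lia|exact: (hP nu)|exact: gen_subalg_M|exact: gen_subalg_M].
apply: kspan_mull (hspan l nu b hL hb) => u [[b0 hb0 ->]|hu]; last first.
  by rewrite -[u]mulr1; apply: hlt => //; exact: gen_subalg_1.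
have hsa : S m (bsigma a) by apply: SQ_sigma hq ha.
have -> : a * (el l nu * b0) = bsigma (el l nu * bsigma a) * b0 by rewrite bsigmaM bsigmaK el_sigma ?mulrA.
pose Q (w : B) := bsigma w * b0 \in kspan X.
apply: (@kspan_ind _ _ _ Q _ _ _ _ (hspan l nu _ hL hsa)); rewrite /Q;
  first 2 last.
- move=> z [[b1 hb1 {z}->]|[l' [nu' [a1 [b2 [h1 h2 h3 h4 {z}->]]]]]].
    by rewrite bsigmaM el_sigma // -mulrA; apply: kspan_in; exists l, nu, b1, b0.
  have /LambdaE [_ hl'] := h1; have hln' : (l'.*2 <= n)%N by lia.
  rewrite (bsigmaM a1) (bsigmaM (el l' nu')) el_sigma // -[_ * b0]mul1r; apply: hlt; [|exact: gen_subalg_1|exact: hBs hb0].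
  by exists l', nu', (bsigma b2), (bsigma a1); rewrite mulrA; split=> //; apply: SQ_sigma hq _.
- by rewrite bsigma0 mul0r rpred0.
- by move=> c u1 v1 hu1 hv1; rewrite bsigmaD bsigmaZ mulrDl -scalerAl rpredD ?rpredZ.
Qed.

End Straighten.

(** * An action on tensor space *)

Ltac ifword :=
  repeat match goal with
  | |- context [if ?b then _ else _] =>
      lazymatch b with
      | context [if _ then _ else _] => fail
      | _ => case: (boolP b) => ?
      end
  end; first [reflexivity | exfalso; lia | (f_equal; lia) | idtac].

Section Tensor.
Variables (R : comNzRingType) (q qi : R) (h : nat).
Hypothesis qK : q * qi = 1.
Let N := h.*2.+1.
Local Notation I := 'I_N.
Local Notation W := (nat -> I).
Local Notation V := (W -> R).
Local Notation d := (q - qi).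
Implicit Types (f g : V) (w : W) (a b s t u x y : I).

Definition Xop (al be ga : R) (k : nat) f : V := fun w =>
  if w k == w k.+1 then al * f w
  else f (w \o sw k) + (if (w k < w k.+1)%N then be else ga) * f w.

Local Notation Top := (Xop q 0 d).
Local Notation Uop := (Xop qi (- d) 0).

Definition cw a : R := q ^+ a * qi ^+ h.

Definition upd a w : W := fun i => if (i == 1%N) || (i == 2%N) then a else w i.

Definition Eop f : V := fun w =>
  if w 1%N == w 2%N then cw (w 1%N) * \sum_a cw a * f (upd a w) else 0.

Let ordE (i j : I) : (i == j) = (i == j :> nat). Proof. by []. Qed.

(** ** Reduction to few letters *)

Definition put3 k s t u w : W := fun i =>
  if i == k then s else if i == k.+1 then t else if i == k.+2 then u else w i.

Lemma put3_id k w : w = put3 k (w k) (w k.+1) (w k.+2) w.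
Proof. by apply: funext => i; rewrite /put3; do 3?[case: eqP => [->|_] //]. Qed.

Lemma put3_sw k s t u w : put3 k s t u w \o sw k = put3 k t s u w.
Proof. by apply: funext => i; rewrite /put3 /sw /=; ifword. Qed.

Lemma put3_swS k s t u w : put3 k s t u w \o sw k.+1 = put3 k s u t w.
Proof. by apply: funext => i; rewrite /put3 /sw /=; ifword. Qed.

Lemma put3_k k s t u w : (put3 k s t u w k = s) * (put3 k s t u w k.+1 = t) *
  (put3 k s t u w k.+2 = u).
Proof. by rewrite /put3; do ![split]; ifword. Qed.

Lemma Xop3 al be ga k f s t u w : Xop al be ga k f (put3 k s t u w) =
  if s == t then al * f (put3 k s t u w)
  else f (put3 k t s u w) + (if (s < t)%N then be else ga) * f (put3 k s t u w).
Proof. by rewrite /Xop !put3_k put3_sw. Qed.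

Lemma Xop3S al be ga k f s t u w : Xop al be ga k.+1 f (put3 k s t u w) =
  if t == u then al * f (put3 k s t u w)
  else f (put3 k s u t w) + (if (t < u)%N then be else ga) * f (put3 k s t u w).
Proof. by rewrite /Xop !put3_k put3_swS. Qed.

Definition put4 s t u x w : W := fun i =>
  if i == 1%N then s else if i == 2 then t else if i == 3 then u else if i == 4 then x else w i.

Lemma put4_id w : w = put4 (w 1%N) (w 2%N) (w 3%N) (w 4%N) w.
Proof. by apply: funext => i; rewrite /put4; do 4?[case: eqP => [->|_] //]. Qed.

Lemma Xop41 al be ga f s t u x w : Xop al be ga 1 f (put4 s t u x w) =
  if s == t then al * f (put4 s t u x w)
  else f (put4 t s u x w) + (if (s < t)%N then be else ga) * f (put4 s t u x w).
Proof.
rewrite /Xop /=; congr (if _ then _ else f _ + _).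
by apply: funext => i; rewrite /put4 /sw /=; ifword.
Qed.

Lemma Xop42 al be ga f s t u x w : Xop al be ga 2 f (put4 s t u x w) =
  if t == u then al * f (put4 s t u x w)
  else f (put4 s u t x w) + (if (t < u)%N then be else ga) * f (put4 s t u x w).
Proof.
rewrite /Xop /=; congr (if _ then _ else f _ + _).
by apply: funext => i; rewrite /put4 /sw /=; ifword.
Qed.

Lemma Xop43 al be ga f s t u x w : Xop al be ga 3 f (put4 s t u x w) =
  if u == x then al * f (put4 s t u x w)
  else f (put4 s t x u w) + (if (u < x)%N then be else ga) * f (put4 s t u x w).
Proof.
rewrite /Xop /=; congr (if _ then _ else f _ + _).
by apply: funext => i; rewrite /put4 /sw /=; ifword.
Qed.

Lemma Eop4 f s t u x w : Eop f (put4 s t u x w) =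
  if s == t then cw s * \sum_a cw a * f (put4 a a u x w) else 0.
Proof.
rewrite /Eop /=; case: ifP => // _; congr (_ * _); apply: eq_bigr => a _; congr (_ * f _).
by apply: funext => i; rewrite /put4 /upd; ifword.
Qed.

(** ** The Hecke relations *)

Lemma Top_Uop k f : Uop k f = (fun w => Top k f w - d * f w).
Proof.
apply: funext => w; rewrite /Xop; case: eqP => _; first by ring.
by case: ifP => _; ring.
Qed.

Lemma Top_sqr k f : Top k (Top k f) = (fun w => f w + d * Top k f w).
Proof.
apply: funext => w; rewrite (put3_id k w); move: (w k) (w k.+1) (w k.+2) => s t u.
rewrite !Xop3; have [->|hst] := eqVneq s t; first by ring: qK.
have hst' : (s != t :> nat) := hst.
have [h1|h1] := boolP (s < t)%N; first by rewrite (_ : (t < s)%N = false); [ring | lia].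
by rewrite (_ : (t < s)%N); [ring | lia].
Qed.

Lemma Top_braid k f : Top k (Top k.+1 (Top k f)) = Top k.+1 (Top k (Top k.+1 f)).
Proof.
apply: funext => w; rewrite (put3_id k w); move: (w k) (w k.+1) (w k.+2) => s t u.
do ![rewrite ?Xop3 ?Xop3S].
rewrite !ordE.
case: (ltngtP s t) => h1; case: (ltngtP t u) => h2; case: (ltngtP s u) => h3; try lia;
  rewrite ?(val_inj h1) ?(val_inj h2) ?(val_inj h3) ?ltnn ?eqxx;
  try ring; try ring: qK.
Qed.

Lemma Top_UopK k f : Top k (Uop k f) = f /\ Uop k (Top k f) = f.
Proof.
split; apply: funext => w; rewrite (put3_id k w); move: (w k) (w k.+1) (w k.+2) => s t u;
  rewrite !Xop3; have [->|hst] := eqVneq s t; try (by ring: qK);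
  have hst' : (s != t :> nat) := hst;
  (have [h1|h1] := boolP (s < t)%N; [rewrite (_ : (t < s)%N = false) | rewrite (_ : (t < s)%N)]);
  by [ring | lia].
Qed.

Lemma sw_id k i : i != k -> i != k.+1 -> sw k i = i.
Proof. by rewrite /sw; do 2?case: eqP. Qed.

Lemma Xop_comm al be ga al' be' ga' i j f : (i.+1 < j)%N ->
  Xop al be ga i (Xop al' be' ga' j f) = Xop al' be' ga' j (Xop al be ga i f).
Proof.
move=> hij; apply: funext => w; rewrite /Xop /= !(sw_id (k := i)) ?(sw_id (k := j)); try lia.
have -> : (w \o sw i) \o sw j = (w \o sw j) \o sw i.
  by apply: funext => x /=; congr w; rewrite /sw; ifword.
by case: (w i == _); case: (w j == _) => //; ring.
Qed.

Lemma Xop_Eop al be ga i f : (2 < i)%N -> Xop al be ga i (Eop f) = Eop (Xop al be ga i f).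
Proof.
move=> hi; apply: funext => w; rewrite /Xop /Eop /= !(sw_id (k := i)); try lia.
have e a : upd a (w \o sw i) = upd a w \o sw i.
  by apply: funext => x /=; rewrite /upd /comp /sw; ifword.
have e' a k : (2 < k)%N -> upd a w k = w k by move=> hk; rewrite /upd; ifword.
case: (w 1%N == w 2%N); last by rewrite !mulr0 addr0 if_same.
under [in RHS]eq_bigr => a _ do rewrite (e' a i hi) (e' a i.+1 (ltnW hi)); case: (w i == w i.+1).
  by rewrite mulrCA; congr (_ * _); rewrite mulr_sumr; apply: eq_bigr => a _; ring.
rewrite mulrCA -mulrDr; congr (_ * _); rewrite mulr_sumr -big_split /=.
by apply: eq_bigr => a _; rewrite e; ring.
Qed.

Lemma Top_Eop f : Top 1 (Eop f) = (fun w => q * Eop f w).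
Proof.
apply: funext => w; rewrite (put4_id w) Xop41 !Eop4; move: (w 1%N) (w 2%N) => s t.
by rewrite (eq_sym t s); case: (s == t); rewrite // !mulr0 addr0.
Qed.

Lemma Eop_Top f : Eop (Top 1 f) = (fun w => q * Eop f w).
Proof.
apply: funext => w; rewrite (put4_id w) !Eop4; case: eqP => _; last by rewrite mulr0.
rewrite mulrCA; congr (_ * _); rewrite mulr_sumr; apply: eq_bigr => a _.
by rewrite Xop41 eqxx mulrCA.
Qed.

(** ** The relations of E *)

Let p (a : nat) : R := q ^+ a * qi ^+ h * (q ^+ a * qi ^+ h).
Let r (k : nat) : R := qi * (q ^+ k * q ^+ k * (qi ^+ h * qi ^+ h)).

Let r_lo (a : nat) : r a = qi * p a. Proof. by rewrite /r /p; ring. Qed.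
Let r_hi (a : nat) : r a.+1 = q * p a.
Proof. by rewrite /r /p !exprS; ring: qK. Qed.

Lemma telesc (l k M : nat) : (l <= k)%N ->
  \sum_(a < M) (if (l <= a < k)%N then d * p a else 0) = r (minn k M) - r (minn l M).
Proof.
move=> hlk; elim: M => [|M IH]; first by rewrite big_ord0 !minn0 subrr.
rewrite big_ord_recr /= IH; case: ifP => hM.
  have -> : minn k M = M by lia. have -> : minn k M.+1 = M.+1 by lia.
  have -> : minn l M = l by lia. have -> : minn l M.+1 = l by lia.
  by rewrite r_hi r_lo; ring.
have [hkM|hMl] : (k <= M)%N \/ (M < l)%N by lia.
  have -> : minn k M = k by lia. have -> : minn k M.+1 = k by lia.
  have -> : minn l M = l by lia. have -> : minn l M.+1 = l by lia.
  by rewrite addr0.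
have -> : minn k M = M by lia. have -> : minn k M.+1 = M.+1 by lia.
have -> : minn l M = M by lia. have -> : minn l M.+1 = M.+1 by lia.
by rewrite !subrr addr0.
Qed.

Let qexp k : q ^+ k * qi ^+ k = 1. Proof. by rewrite -exprMn qK expr1n. Qed.

Let rN : r N = q ^+ N.
Proof.
rewrite /r /N exprS -addnn exprD; have e := qexp h.
transitivity (q ^+ h * qi ^+ h * (q ^+ h * qi ^+ h) * (q * qi) * (q * (q ^+ h * q ^+ h))); first by ring.
by rewrite e qK; ring.
Qed.

Let r0 : r 0 = qi ^+ N.
Proof. by rewrite /r /N expr0 exprS -addnn exprD; ring. Qed.

Lemma sum_cw : d * (\sum_a cw a * cw a) = q ^+ N - qi ^+ N.
Proof.
rewrite -r0 -rN; have := @telesc 0 N N (leq0n N); rewrite minnn min0n => <-.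
rewrite mulr_sumr; apply: eq_bigr => a _; by rewrite ltn_ord.
Qed.

Lemma Eop_Eop f : Eop (Eop f) = (fun w => (\sum_a cw a * cw a) * Eop f w).
Proof.
apply: funext => w; rewrite (put4_id w) !Eop4; case: eqP => _; last by rewrite mulr0.
rewrite mulrCA; congr (_ * _); rewrite mulr_suml; apply: eq_bigr => a _.
by rewrite Eop4 eqxx mulrA.
Qed.

Lemma Eop_Top_Eop f : Eop (Top 2 (Eop f)) = (fun w => q ^+ N * Eop f w).
Proof.
apply: funext => w; rewrite (put4_id w) !Eop4; case: eqP => _; last by rewrite mulr0.
rewrite mulrCA; congr (_ * _); move: (w 3%N) (w 4%N) => u x.
set K := \sum_a _.
have -> : q ^+ N = \sum_(a < N) ((if a == u then q * p u else 0) +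
    (if (u.+1 <= a < N)%N then d * p a else 0)).
  rewrite big_split /= telesc ?ltn_ord // minnn (minn_idPl _) ?ltn_ord //.
  rewrite -big_mkcond /= big_pred1_eq r_hi rN; ring.
rewrite mulr_suml; apply: eq_bigr => a _; rewrite Xop42 !Eop4 eqxx -/K ltn_ord andbT.
case: eqVneq => [->|hau]; first by rewrite ltnn -/K /p /cw; ring.
have hau' : (a != u :> nat) := hau.
by case: ltnP => h1; [rewrite (_ : (u < a)%N = false) | rewrite (_ : (u < a)%N)]; try lia; rewrite /p /cw; ring.
Qed.
(** ** The relations of E_(2) *)

Definition twocaps (K : W -> R) : V := fun w =>
  if (w 1%N == w 2%N) && (w 3%N == w 4%N) then cw (w 1%N) * (cw (w 3%N) * K w) else 0.

Definition twosum f : W -> R := fun w => \sum_b cw b * (\sum_a cw a * f (put4 a a b b w)).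

Lemma twosum_put4 f s t u x w : twosum f (put4 s t u x w) = twosum f w.
Proof.
rewrite /twosum; apply: eq_bigr => b _; congr (_ * _); apply: eq_bigr => a _; congr (_ * f _).
by apply: funext => i; rewrite /put4; ifword.
Qed.

Lemma twocaps4 f s t u x w : twocaps (twosum f) (put4 s t u x w) =
  if s == t then cw s * (if u == x then cw u * twosum f w else 0) else 0.
Proof.
by rewrite /twocaps twosum_put4 /=; case: (s == t) => //=; case: (u == x); rewrite ?mulr0.
Qed.

Section Sandwich.
Variables (f : V) (w : W).
Let H u x := \sum_b cw b * f (put4 b b u x w).
Let P f := Uop 2 (Eop f).
Let Q f := Uop 1 (P f).

Let PE s t u x : P f (put4 s t u x w) =
  if t == u then (if s == t then qi * (cw s * H u x) else 0)
  else (if s == u then cw s * H t x else 0) +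
       (if (t < u)%N && (s == t) then - d * (cw s * H u x) else 0).
Proof.
rewrite /P Xop42 !Eop4 -/(H u x) -/(H t x).
case: (t == u); first by case: (s == t); rewrite ?mulr0.
by case: (t < u)%N; case: (s == t); rewrite /= ?mul0r ?mulr0.
Qed.

Let QE1 a u x : Q f (put4 a a u x w) =
  if a == u then qi * (qi * (cw a * H u x)) else
  if (a < u)%N then qi * (- d * (cw a * H u x)) else 0.
Proof.
rewrite /Q Xop41 eqxx PE eqxx andbT; case: (a == u) => //.
by case: (a < u)%N; rewrite ?add0r ?addr0 ?mulr0.
Qed.

Let QE2 a x u y : a != x -> Q f (put4 a x u y w) =
  (if x == u then cw x * H a y else 0) +
  (if (a < x)%N && (a == u) then - d * (cw a * H x y) else 0).
Proof.
move=> hax; rewrite /Q Xop41 (negbTE hax) !PE (negbTE hax) (eq_sym x a) (negbTE hax) !andbF !addr0.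
congr (_ + _).
  by case: (eqVneq a u) => [e|//]; rewrite -e (eq_sym x a) (negbTE hax).
case: (eqVneq x u) => [<-|_]; first by rewrite (negbTE hax) andbF mulr0.
by case: (a < x)%N; case: (a == u); rewrite /= ?mul0r ?mulr0.
Qed.

Let term x y a := cw a * Top 2 (Top 3 (Q f)) (put4 a a x y w).

Let term_eq x a : term x x a = cw x * (cw a * H a a).
Proof.
rewrite /term Xop42; have [->|hax] := eqVneq a x.
  by rewrite Xop43 eqxx QE1 eqxx; ring: qK.
rewrite !Xop43 eqxx (negbTE hax) QE1 !(QE2 _ _ hax) eqxx (negbTE hax) !andbF.
have hax' : (a != x :> nat) := hax.
case: ltnP => h1.
  by rewrite (eq_sym x a) (negbTE hax) /=; ring.
by rewrite (eq_sym x a) (negbTE hax) /=; ring.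
Qed.

Let term_lt x y a : (x < y)%N -> term x y a = qi * d * H y x *
  ((if a == y then qi * p y else 0) - (if a == x then q * p x else 0) -
   (if (x.+1 <= a < y)%N then d * p a else 0)).
Proof.
move=> hxy; have hxy' : x != y by rewrite ordE; lia.
have yx : y != x by rewrite eq_sym.
rewrite /term Xop42; have [->|hax] := eqVneq a x.
  rewrite Xop43 (negbTE hxy') QE1 (negbTE hxy') hxy ltnn /= QE1 eqxx.
  by rewrite /p /cw; ring: qK.
rewrite !Xop43 (negbTE hxy') hxy; have [eay|hay] := eqVneq a y.
  rewrite eay (QE2 _ _ yx) (negbTE hxy') QE1 eqxx /= (_ : (y < x)%N = false); last by lia.
  by rewrite ltnn andbF /p /cw /=; ring.
rewrite !(QE2 _ _ hax) (negbTE hxy') (eq_sym x a) (negbTE hax) (negbTE hay) !andbF eqxx andbT QE1 (negbTE hay) QE1 (negbTE hax).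
have hax' : (a != x :> nat) := hax; have hay' : (a != y :> nat) := hay.
have [h1|h1] := boolP (a < x)%N.
  have e1 : (a < y)%N by lia.
  have e2 : (x < a)%N = false by lia.
  by rewrite e1 e2 /=; ring.
have -> : (x < a)%N by lia.
case: (a < y)%N => /=; rewrite /p /cw; ring.
Qed.

Let term_gt x y a : (y < x)%N -> term x y a = d * H x y *
  ((if a == x then qi * p x else 0) - (if a == y then q * p y else 0) -
   (if (y.+1 <= a < x)%N then d * p a else 0)).
Proof.
move=> hyx; have hxy' : x != y by rewrite ordE; lia.
have yx : y != x by rewrite eq_sym.
rewrite /term Xop42; have [->|hax] := eqVneq a x.
  rewrite Xop43 (negbTE hxy') !QE1 (negbTE hxy') eqxx (_ : (x < y)%N = false); last by lia.
  by rewrite ltnn andbF /p /cw; ring: qK.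
have hax' : (a != x :> nat) := hax.
rewrite !Xop43 (negbTE hxy') (_ : (x < y)%N = false); last by lia.
have [eay|hay] := eqVneq a y.
  rewrite eay (QE2 _ _ yx) hyx eqxx (eq_sym x y) (negbTE yx) /= ltnn /=.
  by rewrite /p /cw; ring.
have hay' : (a != y :> nat) := hay.
rewrite !(QE2 _ _ hax) (negbTE hxy') (eq_sym x a) (negbTE hax) (negbTE hay) !andbF eqxx andbT !QE1 (negbTE hay) (negbTE hax).
have [h1|h1] := boolP (a < x)%N.
  case: (ltnP a y) => h2.
    by rewrite (_ : (y < a)%N = false) /=; [ring | lia].
  by rewrite (_ : (y < a)%N) /=; [rewrite /p /cw; ring | lia].
have e1 : (a < y)%N = false by lia.
have e2 : (y < a)%N by lia.
by rewrite e1 e2 /=; ring.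
Qed.

Let sum_pick (x : I) (c : R) : \sum_(a < N) (if a == x then c else 0) = c.
Proof. by rewrite -big_mkcond /= big_pred1_eq. Qed.

Lemma sandwich_sum x y : \sum_a cw a * Top 2 (Top 3 (Uop 1 (Uop 2 (Eop f)))) (put4 a a x y w) =
  if x == y then cw x * twosum f w else 0.
Proof.
have -> : \sum_a cw a * Top 2 (Top 3 (Uop 1 (Uop 2 (Eop f)))) (put4 a a x y w) =
  \sum_a term x y a by [].
have [<-|hxy] := eqVneq x y.
  rewrite (eq_bigr _ (fun a _ => term_eq x a)) -mulr_sumr; congr (_ * _).
have hxy' : (x != y :> nat) := hxy.
have [h1|h1] : (x < y)%N \/ (y < x)%N by lia.
  rewrite (eq_bigr _ (fun a _ => term_lt a h1)) -mulr_sumr !sumrB !sum_pick telesc //.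
  rewrite !(minn_idPl _) ?(ltn_ord x) ?(ltnW (ltn_ord y)) // r_lo r_hi; ring.
rewrite (eq_bigr _ (fun a _ => term_gt a h1)) -mulr_sumr !sumrB !sum_pick telesc //.
rewrite !(minn_idPl _) ?(ltn_ord y) ?(ltnW (ltn_ord x)) // r_lo r_hi; ring.
Qed.
End Sandwich.

Lemma sandwich f : Eop (Top 2 (Top 3 (Uop 1 (Uop 2 (Eop f))))) = twocaps (twosum f).
Proof.
by apply: funext => w; rewrite (put4_id w) Eop4 sandwich_sum twocaps4.
Qed.

Lemma Xop_twocaps al be ga f : Xop al be ga 1 (Xop al be ga 2 (twocaps (twosum f))) =
  Xop al be ga 3 (Xop al be ga 2 (twocaps (twosum f))).
Proof.
apply: funext => w; rewrite (put4_id w); move: (w 1%N) (w 2%N) (w 3%N) (w 4%N) => s t u x.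
rewrite Xop41 Xop43 !Xop42 !twocaps4; move: (twosum f w) => K.
case: (eqVneq s t) => [e1|/eqP h1]; case: (eqVneq u x) => [e2|/eqP h2];
case: (eqVneq s u) => [e3|/eqP h3]; case: (eqVneq t x) => [e4|/eqP h4];
case: (eqVneq s x) => [e5|/eqP h5]; case: (eqVneq t u) => [e6|/eqP h6];
  first [by exfalso; congruence | by subst; rewrite ?eqxx; ring].
Qed.

(** The braiding of two adjacent pairs of caps is trivial. *)
Lemma twocaps_fix f : Top 2 (Top 3 (Uop 1 (Uop 2 (twocaps (twosum f))))) = twocaps (twosum f).
Proof. by rewrite Xop_twocaps (proj1 (Top_UopK 3 _)) (proj1 (Top_UopK 2 _)). Qed.

Lemma twosum_Xop al be ga f :
  twosum (Xop al be ga 2 (Xop al be ga 3 f)) = twosum (Xop al be ga 2 (Xop al be ga 1 f)).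
Proof.
apply: funext => w; rewrite /twosum.
have e (g : I -> I -> R) : \sum_b cw b * (\sum_a cw a * g a b) = \sum_b \sum_a cw b * cw a * g a b :> R.
  by apply: eq_bigr => b _; rewrite mulr_sumr; apply: eq_bigr => a _; rewrite mulrA.
pose B a b := if (a < b)%N then be else ga.
pose G a b := if a == b then al * (al * f (put4 a a b b w)) else
  B a b * f (put4 a b a b w) + B a b * (al * f (put4 a a b b w)).
have e1 a b : Xop al be ga 2 (Xop al be ga 3 f) (put4 a a b b w) =
    G a b + (if a == b then 0 else f (put4 a b b a w)).
  rewrite Xop42 !Xop43 eqxx /G /B; case: (eqVneq a b) => [->|hab]; first by rewrite ?eqxx addr0.
  by ring.
have e2 a b : Xop al be ga 2 (Xop al be ga 1 f) (put4 a a b b w) =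
    G a b + (if a == b then 0 else f (put4 b a a b w)).
  rewrite Xop42 !Xop41 eqxx /G /B; case: (eqVneq a b) => [->|hab]; first by rewrite ?eqxx addr0.
  by ring.
transitivity (\sum_b \sum_a cw b * cw a * (G a b + (if a == b then 0 else f (put4 a b b a w)))).
  by rewrite -e; apply: eq_bigr => b _; congr (_ * _); apply: eq_bigr => a _; rewrite e1.
transitivity (\sum_b \sum_a cw b * cw a * (G a b + (if a == b then 0 else f (put4 b a a b w)))); last first.
  by rewrite -e; apply: eq_bigr => b _; congr (_ * _); apply: eq_bigr => a _; rewrite e2.
have sp (g g' : I -> I -> R) : \sum_b \sum_a cw b * cw a * (g a b + g' a b) =
    \sum_b \sum_a cw b * cw a * g a b + \sum_b \sum_a cw b * cw a * g' a b :> R.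
  rewrite -big_split; apply: eq_bigr => b _; rewrite -big_split; apply: eq_bigr => a _.
  by rewrite mulrDr.
rewrite !sp; congr (_ + _); rewrite exchange_big; apply: eq_bigr => a _; apply: eq_bigr => b _.
by rewrite (eq_sym a b) (mulrC (cw b)).
Qed.

Lemma twosum_fix f : twosum (Top 2 (Top 3 (Uop 1 (Uop 2 f)))) = twosum f.
Proof. by rewrite twosum_Xop (proj1 (Top_UopK 1 _)) (proj1 (Top_UopK 2 _)). Qed.

End Tensor.

(** * Brauer diagrams *)

(** A diagram on m top and m bottom points is coded by the partner of the last
    top point, one of 2m - 1 possibilities, and a diagram on m - 1 + m - 1 points. *)
Fixpoint codes (m : nat) : seq (seq nat) :=
  if m is m'.+1 then [seq k :: c | k <- iota 0 (m'.*2.+1), c <- codes m'] else [:: [::]].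

(** The letter [0] stands for E and [i > 0] for [T_i]. *)
Fixpoint dword (c : seq nat) : seq nat :=
  if c is k :: c' then
    let m := size c in
    if (k < m)%N then dword c' ++ rev (iota k.+1 (m - k.+1))
    else let i := (k - m).+1 in
      rev (iota 1 (m - 1)) ++ (rev (iota 2 (i.+1 - 2)) ++ 0%N :: iota 2 (m - 2) ++ iota 1 (m.-1 - 1) ++ dword c')
  else [::].

(** Colourings of the top and the bottom points, with one colour for each arc. *)
Fixpoint dtop (c : seq nat) (x : nat) : nat :=
  if c is k :: c' then
    let m := size c in
    if (k < m)%N then if x == m then m.-1 else dtop c' x
    else let i := (k - m).+1 in
      if (x == m) || (x == i) then m.-1 else if (x < i)%N then dtop c' x else dtop c' x.-1
  else 0%N.

Fixpoint dbot (c : seq nat) (x : nat) : nat :=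
  if c is k :: c' then
    let m := size c in
    if (k < m)%N then
      if (x < k.+1)%N then dbot c' x else if x == k.+1 then m.-1 else dbot c' x.-1
    else if x == m then dtop c' m.-1 else dbot c' x
  else 0%N.

Lemma codesP m c : c \in codes m -> size c = m /\ forall k c', c = k :: c' ->
  (k < m.-1.*2.+1)%N /\ c' \in codes m.-1.
Proof.
elim: m c => [|m IH] c; first by rewrite inE => /eqP ->.
move=> /allpairsP[[k c'] [hk hc ->]]; rewrite mem_iota in hk; rewrite /= in hk hc *.
by split=> [|_ _ [<- <-]]; rewrite ?(IH _ hc).1.
Qed.

Lemma codes_uniq m : uniq (codes m).
Proof.
elim: m => // m IH; rewrite allpairs_uniq ?iota_uniq //.
by move=> [k c] [k' c'] _ _ /= [-> ->].
Qed.

Lemma size_codesS m : size (codes m.+1) = (m.*2.+1 * size (codes m))%N.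
Proof. by rewrite size_allpairs size_iota. Qed.

Lemma dcol_lt m c : c \in codes m -> (forall x, (0 < x <= m)%N -> (dtop c x < m)%N) /\
  (forall x, (0 < x <= m)%N -> (dbot c x < m)%N).
Proof.
elim: m c => [|m IH] c hc; first by split=> x; lia.
have [hs hkc] := codesP hc; case: c hc hs hkc => // k c hc [hs] /(_ _ _ erefl) /= [hk hc'].
have [h1 h2] := IH _ hc'; rewrite hs.
split=> x hx; case: ifP => hkm.
- by case: eqP => hxm; [lia | have := h1 x; lia].
- by case: ifP => hxm; [lia |]; case: ifP => hxi; [have := h1 x | have := h1 x.-1]; lia.
- case: ifP => hxk; first by have := h2 x; lia.
  by case: eqP => hxk'; [lia | have := h2 x.-1; lia].
- by case: eqP => hxm; [have := h1 m | have := h2 x]; lia.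
Qed.

(** At q = 1 the operators permute positions and contract pairs, so that the
    colouring of one diagram is compatible with another one only if they agree. *)
Section Classical.
Variable h : nat.
Let N := h.*2.+1.
Local Notation W := (nat -> 'I_N).
Local Notation V := (W -> int).
Implicit Types (f g : V) (w : W).

Definition op1 (i : nat) : V -> V := if i is 0 then Eop 1 1 (h := h) else Xop 1 0 0 i.
Definition ops (s : seq nat) f : V := foldr op1 f s.

Lemma ops_cat s t f : ops (s ++ t) f = ops s (ops t f).
Proof. exact: foldr_cat. Qed.

Lemma ops_cons i s f : ops (i :: s) f = op1 i (ops s f).
Proof. by []. Qed.

Lemma op1_T i f w : (0 < i)%N -> op1 i f w = f (w \o sw i).
Proof.
case: i => // i _; rewrite /op1 /Xop; case: eqP => e.
  rewrite mul1r; congr f; apply: funext => x /=; rewrite /sw.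
  by case: eqP => [->|_]; [rewrite e | case: eqP => [->|//]; rewrite e].
by case: ifP; rewrite mul0r addr0.
Qed.

Lemma op1_E f w : op1 0 f w = if w 1%N == w 2%N then \sum_a f (upd a w) else 0.
Proof.
rewrite /op1 /Eop; case: eqP => // _; rewrite /cw !expr1n mulr1 mul1r.
by apply: eq_bigr => a _; rewrite !expr1n mulr1 mul1r.
Qed.

Lemma ops_T s f w : all (fun i => 0 < i)%N s -> ops s f w = f (w \o wact (rev s)).
Proof.
elim: s w => [|i s IH] w //= /andP[hi hs]; rewrite op1_T // IH //.
congr f; apply: funext => x /=; congr w.
by rewrite rev_cons -cats1 wact_cat /wact /=.
Qed.

Lemma all_iota_pos a k : (0 < a)%N -> all (fun i => 0 < i)%N (iota a k).
Proof. by move=> ha; apply/allP => i; rewrite mem_iota; lia. Qed.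

Lemma ops_dn j m f w : (0 < j)%N -> ops (rev (iota j (m - j))) f w = f (w \o wact (iota j (m - j))).
Proof. by move=> hj; rewrite ops_T ?revK // all_rev all_iota_pos. Qed.

Lemma ops_up j m f w : (0 < j)%N -> ops (iota j (m - j)) f w = f (w \o wact (rev (iota j (m - j)))).
Proof. by move=> hj; rewrite ops_T // all_iota_pos. Qed.

Definition wordin (m : nat) (s : seq nat) := all (fun i => (i < m)%N && ((0 < i) || (1 < m))%N) s.

Lemma dword_in m c : c \in codes m -> wordin m (dword c).
Proof.
elim: m c => [|m IH] c; first by rewrite inE => /eqP ->.
move=> hc; have [hs hkc] := codesP hc; case: c hc hs hkc => // k c hc [hs] /(_ _ _ erefl) /= [hk hc'].
have h1 : wordin m.+1 (dword c).
  by apply: sub_all (IH _ hc') => i; lia.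
rewrite hs; case: ifP => hkm; rewrite /wordin !(all_cat, all_rev) /= ?all_cat; last first.
  by rewrite -/(wordin m.+1 (dword c)) h1 andbT; do 5?[apply/andP; split];
    try (apply/allP => i; rewrite mem_iota); lia.
by rewrite -/(wordin m.+1 (dword c)) h1 /=; apply/allP => i; rewrite mem_iota; lia.
Qed.

Lemma ops_local m s f w : wordin m s ->
  (forall w', (forall x, (m < x)%N -> w' x = w x) -> f w' = 0) -> ops s f w = 0.
Proof.
elim: s w => [|i s IH] w /= hs hf; first exact: hf.
case/andP: hs => hi hs; case: i hi => [|i] hi.
  rewrite op1_E; case: ifP => // _; apply: big1 => a _; apply: IH => // w' hw'.
  by apply: hf => x hx; rewrite hw' // /upd; ifword.
rewrite op1_T //; apply: IH => // w' hw'; apply: hf => x hx.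
by rewrite hw' //= sw_id //; lia.
Qed.

Definition agree m (u : nat -> nat) w : bool := all (fun x => w x == u x :> nat) (iota 1 m).

Lemma agreeP m u w : reflect (forall x, (0 < x <= m)%N -> w x = u x :> nat) (agree m u w).
Proof.
apply: (iffP allP) => H x hx; first by apply/eqP/H; rewrite mem_iota; lia.
by apply/eqP/H; move: hx; rewrite mem_iota; lia.
Qed.

Lemma diagram_test m c c' K w : (m <= N)%N -> c \in codes m -> c' \in codes m ->
  (forall w1 w2, (forall x, (m < x)%N -> w1 x = w2 x) -> K w1 = K w2) ->
  agree m (dtop c') w ->
  ops (dword c) (fun w => if agree m (dbot c') w then K w else 0) w = if c == c' then K w else 0.
Proof.
elim: m c c' K w => [|m IH] c c' K w hmN.
  by rewrite !inE => /eqP -> /eqP -> _ _; rewrite eqxx.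
move=> hc hc' hK /agreeP hw.
have [hs hkc] := codesP hc; case: c hc hs hkc => // k c hc [hs] /(_ _ _ erefl) [hk hc0].
have [hs' hkc'] := codesP hc'; case: c' hc' hs' hkc' hw => // k' c' hc' [hs'] /(_ _ _ erefl) [hk' hc0']; rewrite -[m.+1.-1]/m in hk hc0 hk' hc0'.
have dtE x : dtop (k' :: c') x = if (k' < m.+1)%N then if x == m.+1 then m else dtop c' x
    else if (x == m.+1) || (x == (k' - m.+1).+1) then m
    else if (x < (k' - m.+1).+1)%N then dtop c' x else dtop c' x.-1 by rewrite /= hs'.
have dbE x : dbot (k' :: c') x = if (k' < m.+1)%N then
      if (x < k'.+1)%N then dbot c' x else if x == k'.+1 then m else dbot c' x.-1
    else if x == m.+1 then dtop c' m else dbot c' x by rewrite /= hs'.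
have -> : dword (k :: c) = if (k < m.+1)%N then dword c ++ rev (iota k.+1 (m.+1 - k.+1))
    else rev (iota 1 (m.+1 - 1)) ++ (rev (iota 2 ((k - m.+1).+2 - 2)) ++
      0%N :: iota 2 (m.+1 - 2) ++ iota 1 (m - 1) ++ dword c) by rewrite /= hs.
move=> hw.
have [ht hb] := dcol_lt hc0'.
have wm : w m.+1 = m :> nat.
  by rewrite hw ?leqnn // dtE eqxx /= if_same.
have w_lt x : (0 < x <= m)%N -> (k' < m.+1)%N || (x != (k' - m.+1).+1) -> (w x < m)%N.
  move=> hx hx'; rewrite hw ?dtE; last by lia.
  have xm : (x == m.+1) = false by lia.
  case: ifP hx' => h1 hx'; first by rewrite xm; apply: ht.
  by rewrite xm /= (negbTE hx'); case: ifP => h2; [have := ht x | have := ht x.-1]; lia.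
case: ifP => hkm.
- (* the last top point of c is joined to a bottom point *)
  rewrite ops_cat.
  have eg : ops (rev (iota k.+1 (m.+1 - k.+1)))
      (fun w0 => if agree m.+1 (dbot (k' :: c')) w0 then K w0 else 0) =
    fun w0 => if agree m.+1 (dbot (k' :: c')) (w0 \o wact (iota k.+1 (m.+1 - k.+1)))
      then K (w0 \o wact (iota k.+1 (m.+1 - k.+1))) else 0.
    by apply: funext => w0; rewrite ops_dn.
  rewrite eg {eg}.
  have ins (w0 : W) x : (w0 \o wact (iota k.+1 (m.+1 - k.+1))) x =
    w0 (if x == k.+1 then m.+1 else if (k.+1 < x <= m.+1)%N then x.-1 else x).
    by rewrite /= wact_up //; lia.
  have [e|hne] := eqVneq k k'.
    move: dtE dbE hw w_lt; rewrite -e hkm => dtE dbE hw w_lt.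
    pose K' (w0 : W) := if w0 m.+1 == m :> nat then K (w0 \o wact (iota k.+1 (m.+1 - k.+1))) else 0.
    have -> : (fun w0 : W => if agree m.+1 (dbot (k :: c')) (w0 \o wact (iota k.+1 (m.+1 - k.+1)))
        then K (w0 \o wact (iota k.+1 (m.+1 - k.+1))) else 0) =
        (fun w0 => if agree m (dbot c') w0 then K' w0 else 0).
      apply: funext => w0; rewrite /K'.
      have -> : agree m.+1 (dbot (k :: c')) (w0 \o wact (iota k.+1 (m.+1 - k.+1))) =
          agree m (dbot c') w0 && (w0 m.+1 == m :> nat).
        apply/idP/andP => [/agreeP H|[/agreeP H /eqP Hm]].
          split; last by have := H k.+1; rewrite ins dbE ltnn !eqxx => ->; lia.
          apply/agreeP => x hx; have [hxk|hxk] := leqP x k.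
            have := H x; rewrite ins dbE (_ : (x < k.+1)%N); last by lia.
            have e1 : (x == k.+1) = false by lia.
            have e2 : (k.+1 < x <= m.+1)%N = false by lia.
            by rewrite e1 e2; apply; lia.
          have := H x.+1; rewrite ins dbE (_ : (x.+1 < k.+1)%N = false); last by lia.
          have e1 : (x.+1 == k.+1) = false by lia.
          have e2 : (k.+1 < x.+1 <= m.+1)%N by lia.
          by rewrite e1 e2; apply; lia.
        apply/agreeP => x hx; rewrite ins dbE.
        case: eqP => [->|hxk]; first by rewrite ltnn.
        have e1 : (k.+1 < x <= m.+1)%N = (k.+1 < x)%N by lia.
        rewrite e1; case: (ltngtP x k.+1) => h1; [| |lia]; by apply: H; lia.
      by case: (agree _ _ _) => //=; case: ifP.
    rewrite (IH _ _ K') //; try lia.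
    + rewrite eqseq_cons eqxx /= /K' wm eqxx; congr (if _ then _ else _).
      apply: hK => x hx; rewrite ins.
      have e1 : (x == k.+1) = false by lia.
      have e2 : (k.+1 < x <= m.+1)%N = false by lia.
      by rewrite e1 e2.
    + move=> w1 w2 H; rewrite /K' H //; case: ifP => // _.
      apply: hK => x hx; rewrite !ins.
      have e1 : (x == k.+1) = false by lia.
      have e2 : (k.+1 < x <= m.+1)%N = false by lia.
      by rewrite e1 e2; apply: H; lia.
    + apply/agreeP => x hx; rewrite hw ?dtE; last by lia.
      by rewrite (_ : (x == m.+1) = false) //; lia.
  rewrite eqseq_cons (negbTE hne) andFb.
  apply: (ops_local (dword_in hc0)) => w' hw'.
  case: ifP => // /agreeP H; exfalso.
  have hk1 : (0 < k.+1 <= m.+1)%N by lia.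
  have := H _ hk1; rewrite ins eqxx hw' // wm dbE; case: ifP => h1.
    case: ifP => h2; first by have := hb k.+1; lia.
    case: eqP => h3; first by move: h3 hne; lia.
    by have := hb k; rewrite -[k.+1.-1]/k; lia.
  by case: eqP => h2; [have := ht m | have := hb k.+1]; lia.
(* the last top point of c is joined to another top point *)
set i := (k - m.+1).+1.
have hi : (0 < i <= m)%N by rewrite /i; lia.
rewrite -[(k - m.+1).+2]/i.+1 ops_cat ops_dn // ops_cat ops_dn //.
set w2 : W := _ \o _.
have w2E x : w2 x = w (if x == 1%N then m.+1 else if x == 2 then i else
    if (2 < x <= i.+1)%N then x.-2 else if (x <= m.+1)%N then x.-1 else x).
  rewrite /w2 /= !wact_up; [congr w; iflia | lia | lia].
rewrite ops_cons op1_E.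
have -> : w2 1%N = w m.+1 by rewrite w2E.
have -> : w2 2 = w i by rewrite w2E.
have [e|hne] := eqVneq k k'; last first.
  rewrite eqseq_cons (negbTE hne) andFb; case: eqP => // /(congr1 val) /= e.
  by have := w_lt i hi; rewrite -e wm ltnn => H; exfalso; move: H; rewrite /i; lia.
have hkm' : (k' < m.+1)%N = false by rewrite -e.
have hii : i = (k' - m.+1).+1 by rewrite /i e.
move: dtE dbE; rewrite hkm' -hii => dtE dbE.
have -> : (w m.+1 == w i) by apply/eqP/val_inj; rewrite /= wm hw ?dtE ?eqxx ?orbT //; lia.
have ha0 : (dtop c' m < N)%N by have := ht m; lia.
pose a0 : 'I_N := Ordinal ha0.
have w5E a x : (0 < x)%N ->
    ((upd a w2 \o wact (rev (iota 2 (m.+1 - 2)))) \o wact (rev (iota 1 (m - 1)))) x =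
    if (x == m) || (x == m.+1) then a else
    w (if (x < i)%N then x else if (x < m)%N then x.+1 else x).
  move=> hx; rewrite /=.
  have -> : wact (rev (iota 2 (m.+1 - 2))) (wact (rev (iota 1 (m - 1))) x) =
      if x == m then 1%N else if x == m.+1 then 2 else if (x < m)%N then x.+2 else x.
    by rewrite !wact_dn; [iflia | lia | lia].
  have [->|h1] := eqVneq x m; first by [].
  have [->|h2] := eqVneq x m.+1; first by [].
  rewrite /= /upd; have [h3|h3] := ltnP x m.
    have -> : (x.+2 == 1%N) || (x.+2 == 2) = false by lia.
    by rewrite w2E; congr w; iflia.
  have -> : (x == 1%N) || (x == 2) = false by lia.
  by rewrite w2E; congr w; iflia.
pose K' (w0 : W) := if w0 m.+1 == dtop c' m :> nat then K w0 else 0.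
have fE : (fun w0 : W => if agree m.+1 (dbot (k' :: c')) w0 then K w0 else 0) =
    (fun w0 => if agree m (dbot c') w0 then K' w0 else 0).
  apply: funext => w0; rewrite /K'.
  have -> : agree m.+1 (dbot (k' :: c')) w0 = agree m (dbot c') w0 && (w0 m.+1 == dtop c' m :> nat).
    apply/idP/andP => [/agreeP H|[/agreeP H /eqP Hm]].
      split; last by rewrite H ?dbE ?eqxx //; lia.
      by apply/agreeP => x hx; rewrite H ?dbE; [have -> : (x == m.+1) = false by lia | lia].
    apply/agreeP => x hx; rewrite dbE; case: eqP => [->//|hxm]; apply: H; lia.
  by case: (agree _ _ _) => //=; case: ifP.
rewrite fE (bigD1 a0) //= [X in _ + X]big1 ?addr0.
  rewrite !ops_cat (@ops_up 2 m.+1) // (@ops_up 1 m) //.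
  rewrite (IH _ _ K') //; try lia.
  + rewrite eqseq_cons e eqxx /= /K' w5E // eqxx orbT eqxx; congr (if _ then _ else _).
    apply: hK => x hx; rewrite w5E; last by lia.
    have -> : (x == m) || (x == m.+1) = false by lia.
    by congr w; iflia.
  + by move=> w1 w2' H; rewrite /K' H //; case: ifP => // _; apply: hK => x hx; apply: H; lia.
  + apply/agreeP => x hx; rewrite w5E; last by lia.
    have -> : (x == m.+1) = false by lia.
    rewrite orbF; case: eqP => [->//|hxm].
    rewrite hw ?dtE; last by iflia.
    have [h1|h1] := ltnP x i.
      have -> : (x == m.+1) || (x == i) = false by lia.
      by rewrite h1.
    have -> : (x < m)%N by lia.
    have -> : (x.+1 == m.+1) || (x.+1 == i) = false by lia.
    by have -> : (x.+1 < i)%N = false by lia.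
move=> a ha; rewrite !ops_cat (@ops_up 2 m.+1) // (@ops_up 1 m) //.
apply: (ops_local (dword_in hc0)) => w' hw'; case: ifP => // _; rewrite /K'.
rewrite hw' // w5E // eqxx orbT; case: eqP => // e1.
by case/eqP: ha; apply: val_inj.
Qed.
End Classical.

(** * The tensor representation *)

Section Representation.
Variables (n h : nat) (L : fieldType) (x : L) (phi : kk -> L).
Hypotheses (x0 : x != 0) (dx0 : x - x^-1 != 0).
Hypotheses (phiD : forall a b, phi (a + b) = phi a + phi b).
Hypotheses (phiM : forall a b, phi (a * b) = phi a * phi b) (phi1 : phi 1 = 1).
Hypotheses (phiq : phi kq = x) (phiz : phi kz = x ^+ h.*2.+1).
Local Notation N := h.*2.+1.
Local Notation W := (nat -> 'I_N).
Local Notation V := (W -> L).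
Local Notation Top := (Xop x 0 (x - x^-1)).
Local Notation Uop := (Xop x^-1 (- (x - x^-1)) 0).
Local Notation EE := (Eop x x^-1 (h := h)).
Implicit Types (f g : V) (w : W) (t : bterm).

Let xK : x * x^-1 = 1. Proof. by rewrite mulfV. Qed.

Let phi0 : phi 0 = 0.
Proof. by apply: (addrI (phi 0)); rewrite -phiD !addr0. Qed.
Let phiN a : phi (- a) = - phi a.
Proof. by apply: (addrI (phi a)); rewrite -phiD !subrr phi0. Qed.
Let phi_inv a : a \is a GRing.unit -> phi a != 0 -> phi a^-1 = (phi a)^-1.
Proof. by move=> ua ha; apply: (mulfI ha); rewrite -phiM mulrV // phi1 mulfV. Qed.
Let phiqV : phi kq^-1 = x^-1.
Proof. by rewrite phi_inv ?kq_unit ?phiq. Qed.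
Let phid : phi (kq - kq^-1) = x - x^-1.
Proof. by rewrite phiD phiN phiq phiqV. Qed.
Let phidel : phi kdelta = \sum_(a < N) cw x x^-1 a * cw x x^-1 a.
Proof.
apply: (mulfI dx0); rewrite sum_cw // -phid -phiM mulrC divrK ?kdq_unit //.
by rewrite phiD phiN phi_inv ?kz_unit ?phiz ?expf_neq0 // exprVn.
Qed.

Fixpoint teval t f : V :=
  match t with
  | TermT i => if (0 < i < n)%N then Top i f else fun=> 0
  | TermE => if (1 < n)%N then EE f else fun=> 0
  | TermC c => fun w => phi c * f w
  | TermAdd s t => fun w => teval s f w + teval t f w
  | TermMul s t => teval s (teval t f)
  end.

Lemma Xop_lin (al be ga : L) i (a : L) f g : Xop al be ga i (fun w => a * f w + g w) =
  fun w => a * Xop al be ga i f w + Xop al be ga i g w.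
Proof. by apply: funext => w; rewrite /Xop; case: eqP => _; [ring | case: ifP => _; ring]. Qed.

Lemma Eop_lin (a : L) f g : EE (fun w => a * f w + g w) = fun w => a * EE f w + EE g w.
Proof.
apply: funext => w; rewrite /Eop; case: eqP => _; last by rewrite mulr0 addr0.
rewrite mulrCA -mulrDr; congr (_ * _); rewrite mulr_sumr -big_split /=.
by apply: eq_bigr => b _; ring.
Qed.

Lemma teval_lin t (a : L) f g : teval t (fun w => a * f w + g w) =
  fun w => a * teval t f w + teval t g w.
Proof.
elim: t f g => [i||c|s IHs t IHt|s IHs t IHt] f g /=.
- by case: ifP => _; [exact: Xop_lin | apply: funext => w; ring].
- by case: ifP => _; [exact: Eop_lin | apply: funext => w; ring].
- by apply: funext => w; ring.
- by rewrite IHs IHt; apply: funext => w; ring.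
- by rewrite IHt IHs.
Qed.

Lemma tevalD t f g : teval t (fun w => f w + g w) = fun w => teval t f w + teval t g w.
Proof.
have := teval_lin t 1 f g; rewrite (_ : (fun w => 1 * f w + g w) = fun w => f w + g w).
  by move=> ->; apply: funext => w; rewrite mul1r.
by apply: funext => w; rewrite mul1r.
Qed.

Lemma teval0 t : teval t (fun=> 0) = fun=> 0.
Proof.
have := teval_lin t (-1) (fun=> 0) (fun=> 0); rewrite (_ : (fun w => _ + _) = (fun=> 0 : L)).
  by move=> ->; apply: funext => w; rewrite mulN1r addNr.
by apply: funext => w; rewrite mulr0 addr0.
Qed.

Lemma tevalZ t a f : teval t (fun w => a * f w) = fun w => a * teval t f w.
Proof.
have := teval_lin t a f (fun=> 0); rewrite (_ : (fun w => _ + 0) = fun w => a * f w).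
  by move=> ->; apply: funext => w; rewrite teval0 addr0.
by apply: funext => w; rewrite addr0.
Qed.

Lemma teval_TV i f : (0 < i < n)%N -> teval (termTV i) f = Uop i f.
Proof.
move=> hi; rewrite /= hi Top_Uop; apply: funext => w.
by rewrite phiN phid mulNr.
Qed.

Lemma teval_E2 f : (3 < n)%N -> teval termE2 f = twocaps x x^-1 (twosum x x^-1 f).
Proof.
move=> hn; have h1 : (0 < 1 < n)%N by lia.
have h2 : (0 < 2 < n)%N by lia. have h3 : (0 < 3 < n)%N by lia.
have e1 : (1 < n)%N by lia. have e2 : (2 < n)%N by lia.
rewrite -[teval termE2 f]/(teval TermE (teval (TermT 2) (teval (TermT 3)
  (teval (termTV 1) (teval (termTV 2) (teval TermE f)))))) !teval_TV //= e2 hn e1.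
exact: sandwich.
Qed.

Lemma teval_brel s t : brel n s t -> forall f, teval s f = teval t f.
Proof.
case=> {s t}.
- by move=> i /negbTE hi f /=; rewrite hi phi0; apply: funext => w; rewrite mul0r.
- by move=> hn f /=; rewrite ltnNge -ltnS hn phi0 /=; apply: funext => w; rewrite mul0r.
- move=> i hi f /=; rewrite hi phiN phiq phiqV phi0.
  have := teval_lin (TermT i) x^-1 f (teval (TermT i) f); rewrite /= hi => e.
  apply: funext => w; rewrite (_ : (fun w => Top i f w + x^-1 * f w) = fun w => x^-1 * f w + Top i f w).
    by rewrite e Top_sqr // mul0r; ring: xK.
  by apply: funext => u; rewrite addrC.
- by move=> i j hi hj hij f /=; rewrite hi hj; case/orP: hij => h1; [|apply: esym]; exact: Xop_comm.
- move=> k hk hk1 f /=; have -> : (0 < k < n)%N by lia.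
  by rewrite hk1; exact: Top_braid.
- by move=> hn f /=; rewrite hn phidel Eop_Eop.
- by move=> hn f /=; rewrite hn phiq; exact: Top_Eop.
- by move=> hn f /=; rewrite hn phiq; exact: Eop_Top.
- move=> hn f /=; rewrite hn phiz; have -> : (1 < n)%N by lia.
  exact: Eop_Top_Eop.
- move=> i /andP[hi hin] f /=; have -> : (0 < i < n)%N by lia.
  have -> : (1 < n)%N by lia.
  exact: Xop_Eop.
- move=> hn f; have h1 : (0 < 1 < n)%N by lia.
  have h2 : (0 < 2 < n)%N by lia. have h3 : (0 < 3 < n)%N by lia.
have e1 : (1 < n)%N by lia. have e2 : (2 < n)%N by lia.
  rewrite -[LHS]/(teval (TermT 2) (teval (TermT 3) (teval (termTV 1) (teval (termTV 2) (teval termE2 f))))).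
  rewrite teval_E2 // !teval_TV //= e2 hn.
  by rewrite twocaps_fix.
- move=> hn f; have h1 : (0 < 1 < n)%N by lia.
  have h2 : (0 < 2 < n)%N by lia. have h3 : (0 < 3 < n)%N by lia.
have e1 : (1 < n)%N by lia. have e2 : (2 < n)%N by lia.
  rewrite -[LHS]/(teval termE2 (teval (TermT 2) (teval (TermT 3) (teval (termTV 1) (teval (termTV 2) f))))).
  rewrite !teval_E2 // !teval_TV //= e2 hn.
  by rewrite twosum_fix.
Qed.

Lemma teval_beq s t : beq n s t -> forall f, teval s f = teval t f.
Proof.
elim=> {s t} //=.
- by move=> s t hst f; exact: teval_brel.
- by move=> s t u _ h1 _ h2 f; rewrite h1 h2.
- by move=> s s' t t' _ h1 _ h2 f; rewrite h1 h2.
- by move=> s s' t t' _ h1 _ h2 f; rewrite h1 h2.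
- by move=> s t u f; apply: funext => w; ring.
- by move=> s t f; apply: funext => w; ring.
- by move=> s f; apply: funext => w; rewrite phi0; ring.
- by move=> s f; apply: funext => w; rewrite phi0 phiN phi1; ring.
- by move=> s f; apply: funext => w; rewrite phi1 mul1r.
- by move=> s t u f; rewrite tevalD.
- by move=> a b f; apply: funext => w; rewrite phiD; ring.
- by move=> a b f; apply: funext => w; rewrite phiM; ring.
- by move=> a s f; rewrite tevalZ.
Qed.

Definition rho (b : qBrauer n) f : V := teval (generic_quotient.repr b) f.

Lemma rho_bpi t f : rho (bpi n t) f = teval t f.
Proof. by apply: teval_beq; exact: bpi_repr. Qed.

Lemma rhoD (b c : qBrauer n) f w : rho (b + c) f w = rho b f w + rho c f w.
Proof. by rewrite -{1}(bpiK b) -{1}(bpiK c) -bpi_add rho_bpi. Qed.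

Lemma rhoM (b c : qBrauer n) f : rho (b * c) f = rho b (rho c f).
Proof. by rewrite -{1}(bpiK b) -{1}(bpiK c) -bpi_mul rho_bpi. Qed.

Lemma rhoZ a (b : qBrauer n) f w : rho (a *: b) f w = phi a * rho b f w.
Proof. by rewrite bpi_scale rhoM rho_bpi. Qed.

Lemma rho1 f : rho 1 f = f.
Proof. by rewrite -[1]/(bpi n (TermC 1)) rho_bpi; apply: funext => w /=; rewrite phi1 mul1r. Qed.

Lemma rho0 f w : rho 0 f w = 0.
Proof. by rewrite -(scale0r (0 : qBrauer n)) rhoZ phi0 mul0r. Qed.

Lemma rho_sum (I : Type) (r : seq I) (a : I -> kk) (F : I -> qBrauer n) f w :
  rho (\sum_(i <- r) a i *: F i) f w = \sum_(i <- r) phi (a i) * rho (F i) f w.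
Proof.
elim: r => [|i r IH]; first by rewrite !big_nil rho0.
by rewrite !big_cons rhoD rhoZ IH.
Qed.

Lemma rho_T i f : (0 < i < n)%N -> rho (bT n i) f = Top i f.
Proof. by move=> hi; rewrite rho_bpi /= hi. Qed.

Lemma rho_E f : (1 < n)%N -> rho (bE n) f = EE f.
Proof. by move=> hn; rewrite rho_bpi /= hn. Qed.
End Representation.

(** * Independence of as many elements as there are Brauer diagrams *)

Local Notation Lq := {fraction {poly int}}.
Local Notation xq := (FracField.tofrac 'X : Lq).
Local Notation tofrac := FracField.tofrac.

Lemma xq_neq0 : xq != 0. Proof. by rewrite tofrac_eq0 polyX_eq0. Qed.

Lemma xq_inj i j : xq ^+ i = xq ^+ j -> i = j.
Proof.
rewrite -!tofracXn => /eqP; rewrite tofrac_eq => /eqP /(congr1 (fun p : {poly int} => size p)).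
by rewrite !size_polyXn => -[].
Qed.

Lemma xq_pow k : (0 < k)%N -> xq ^+ k != 1.
Proof. by move=> hk; apply/eqP; rewrite -(expr0 xq) => /xq_inj; lia. Qed.

Lemma subVq (y : Lq) : y != 0 -> y ^+ 2 != 1 -> y - y^-1 != 0.
Proof.
move=> y0; apply: contraNneq => e; have : y * (y - y^-1) = 0 by rewrite e mulr0.
by rewrite mulrBr mulfV // => /eqP; rewrite subr_eq0 expr2.
Qed.

(** ** Specialisation at q = 1 *)

Definition rel (a : Lq) (b : int) : Prop :=
  exists k (P : {poly int}), xq ^+ k * a = tofrac P /\ P.[1] = b.

Lemma rel_of (P : {poly int}) b : P.[1] = b -> rel (tofrac P) b.
Proof. by exists 0%N, P; rewrite expr0 mul1r. Qed.

Lemma rel0 : rel 0 0. Proof. by rewrite -tofrac0; apply: rel_of; rewrite horner0. Qed.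
Lemma rel1 : rel 1 1. Proof. by rewrite -tofrac1; apply: rel_of; rewrite hornerC. Qed.
Lemma relx : rel xq 1. Proof. by apply: rel_of; rewrite hornerX. Qed.
Lemma relV : rel xq^-1 1.
Proof. by exists 1%N, 1; rewrite expr1 mulfV ?xq_neq0 // tofrac1 hornerC. Qed.

Lemma relD a b a' b' : rel a b -> rel a' b' -> rel (a + a') (b + b').
Proof.
move=> [k [P [eP <-]]] [k' [P' [eP' <-]]]; exists (k + k')%N, ('X^k' * P + 'X^k * P').
rewrite !hornerE !expr1n !mul1r; split=> //.
by rewrite tofracD !tofracM !tofracXn -eP -eP' exprD; ring.
Qed.

Lemma relM a b a' b' : rel a b -> rel a' b' -> rel (a * a') (b * b').
Proof.
move=> [k [P [eP <-]]] [k' [P' [eP' <-]]]; exists (k + k')%N, (P * P').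
by rewrite hornerM; split=> //; rewrite tofracM -eP -eP' exprD; ring.
Qed.

Lemma relN a b : rel a b -> rel (- a) (- b).
Proof.
move=> [k [P [eP <-]]]; exists k, (- P).
by rewrite hornerN; split=> //; rewrite tofracN -eP mulrN.
Qed.

Lemma relX a b k : rel a b -> rel (a ^+ k) (b ^+ k).
Proof. by move=> h; elim: k => [|k IH]; rewrite ?expr0 ?exprS; [exact: rel1 | exact: relM]. Qed.

Lemma rel_sum (I : Type) (r : seq I) (F : I -> Lq) (G : I -> int) :
  (forall i, rel (F i) (G i)) -> rel (\sum_(i <- r) F i) (\sum_(i <- r) G i).
Proof. by move=> h; elim/big_rec2: _ => [|i a b _ hab]; [exact: rel0 | exact: relD]. Qed.

Lemma rel_prod (I : Type) (r : seq I) (F : I -> Lq) (G : I -> int) :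
  (forall i, rel (F i) (G i)) -> rel (\prod_(i <- r) F i) (\prod_(i <- r) G i).
Proof. by move=> h; elim/big_rec2: _ => [|i a b _ hab]; [exact: rel1 | exact: relM]. Qed.

Lemma rel_neq0 a b : rel a b -> b != 0 -> a != 0.
Proof.
move=> [k [P [eP <-]]]; apply: contraNneq => a0; move: eP; rewrite a0 mulr0.
by move/esym/eqP; rewrite tofrac_eq0 => /eqP ->; rewrite horner0.
Qed.

Lemma rel_det K (A : 'M[Lq]_K) (B : 'M[int]_K) : (forall i j, rel (A i j) (B i j)) ->
  rel (\det A) (\det B).
Proof.
move=> h; apply: rel_sum => s; apply: relM; last by apply: rel_prod => i; exact: h.
apply: relX; apply: relN; exact: rel1.
Qed.

Section RelOps.
Variable h : nat.
Local Notation N := h.*2.+1.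
Local Notation W := (nat -> 'I_N).

Definition opq (i : nat) : (W -> Lq) -> W -> Lq :=
  if i is 0 then Eop xq xq^-1 (h := h) else Xop xq 0 (xq - xq^-1) i.

Lemma rel_opq i f f1 : (forall w, rel (f w) (f1 w)) -> forall w, rel (opq i f w) (op1 i f1 w).
Proof.
move=> hf w; case: i => [|i] /=.
  rewrite /Eop; case: eqP => _; last exact: rel0.
  have hc (a : 'I_N) : rel (cw xq xq^-1 a) (cw 1 1 a).
    by apply: relM; apply: relX; [exact: relx | exact: relV].
  by apply: relM => //; apply: rel_sum => a; apply: relM.
rewrite /Xop; case: eqP => _; first by apply: relM => //; exact: relx.
apply: relD => //; apply: relM => //; case: ifP => _; first exact: rel0.
by rewrite -[0 : int](subrr 1); apply: relD; [exact: relx | apply: relN; exact: relV].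
Qed.

Lemma rel_ops s f f1 : (forall w, rel (f w) (f1 w)) ->
  forall w, rel (foldr opq f s w) (ops s f1 w).
Proof. by elim: s => // i s IH hf w /=; apply: rel_opq => w'; exact: IH. Qed.
End RelOps.

(** ** Evaluation of the ground ring *)

Definition bivar (P : {poly {poly int}}) : {poly Lq} :=
  (map_poly (map_poly (intr : int -> Lq)) P).[xq%:P].
HB.lock Definition evy (y : Lq) (P : {poly {poly int}}) : Lq := (bivar P).[y].

Lemma evyE y P : evy y P = (bivar P).[y]. Proof. by rewrite evy.unlock. Qed.

Lemma evyD y P Q : evy y (P + Q) = evy y P + evy y Q.
Proof. by rewrite !evyE /bivar rmorphD !hornerD. Qed.
Lemma evyB y P Q : evy y (P - Q) = evy y P - evy y Q.
Proof. by rewrite !evyE /bivar rmorphB /= !(hornerD, hornerN). Qed.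
Lemma evyM y P Q : evy y (P * Q) = evy y P * evy y Q.
Proof. by rewrite !evyE /bivar rmorphM !hornerM. Qed.
Lemma evy1 y : evy y 1 = 1.
Proof. by rewrite !evyE /bivar rmorph1 !hornerC. Qed.
Lemma evyX y : evy y 'X = xq.
Proof. by rewrite !evyE /bivar map_polyX hornerX hornerC. Qed.
Lemma evyC y : evy y ('X%:P) = y.
Proof. by rewrite !evyE /bivar map_polyC hornerC /= map_polyX hornerX. Qed.

Lemma bivar_coef P j : (bivar P)`_j = tofrac (\poly_(i < size P) P`_i`_j).
Proof.
rewrite /bivar (@horner_coef_wide _ (size P)) ?size_poly // poly_def rmorph_sum coef_sum.
apply: eq_bigr => i _; rewrite coef_map /= -rmorphXn /= coefMC coef_map /=.
rewrite -mul_polyC tofracM tofracXn; congr (_ * _).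
by rewrite -[X in tofrac X%:P]intz !rmorph_int.
Qed.

Lemma bivar_neq0 P : P != 0 -> bivar P != 0.
Proof.
apply: contraNneq => e; apply/eqP/polyP => i; rewrite coef0; apply/polyP => j; rewrite coef0.
have := bivar_coef P j; rewrite e coef0 => /esym/eqP; rewrite tofrac_eq0 => /eqP e'.
have [hi|hi] := ltnP i (size P); last by rewrite (nth_default 0 hi) coef0.
by have := congr1 (fun p : {poly int} => p`_i) e'; rewrite coef_poly hi coef0.
Qed.

Lemma evy_q_nz (N : nat) : (0 < N)%N -> evy (xq ^+ N) ('X ^+ 2 - 1) != 0 /\
  evy (xq ^+ N) ('X%:P ^+ 2 - 1) != 0.
Proof.
move=> hN; have e P : evy (xq ^+ N) (P ^+ 2 - 1) = evy (xq ^+ N) P ^+ 2 - 1.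
  by rewrite evyB evy1 [P ^+ 2]expr2 evyM [RHS]addrC expr2 addrC.
by rewrite !e evyX evyC !subr_eq0 -exprM; split; apply: xq_pow; lia.
Qed.

Lemma kk_frac (a : kk) : exists P Q : {poly {poly int}},
  (forall N, (0 < N)%N -> evy (xq ^+ N) Q != 0) /\ val a * tofrac Q = tofrac P.
Proof.
case: a => a /= /asboolP; elim=> {a}.
- by exists 1, 1; split=> [N _|]; rewrite ?evy1 ?oner_eq0 // !tofrac1 mulr1.
- move=> a b _ [P [Q [hQ e]]] _ [P' [Q' [hQ' e']]]; exists (P * Q' - P' * Q), (Q * Q').
  split=> [N hN|]; first by rewrite evyM mulf_neq0 ?hQ ?hQ'.
  by rewrite tofracB !tofracM -e -e'; ring.
- move=> a b _ [P [Q [hQ e]]] _ [P' [Q' [hQ' e']]]; exists (P * P'), (Q * Q').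
  split=> [N hN|]; first by rewrite evyM mulf_neq0 ?hQ ?hQ'.
  by rewrite !tofracM -e -e'; ring.
- by exists 'X, 1; split=> [N _|]; rewrite ?evy1 ?oner_eq0 // tofrac1 mulr1.
- exists 1, 'X; split=> [N _|]; first by rewrite evyX xq_neq0.
  by rewrite tofrac1 mulVf // fq_neq0.
- by exists 'X%:P, 1; split=> [N _|]; rewrite ?evy1 ?oner_eq0 // tofrac1 mulr1.
- exists 1, 'X%:P; split=> [N _|]; first by rewrite evyC expf_neq0 // xq_neq0.
  by rewrite tofrac1 mulVf // fz_neq0.
- exists 'X, ('X ^+ 2 - 1); split=> [N hN|]; first by case: (evy_q_nz hN).
  rewrite tofracB tofracXn tofrac1 -/fq; apply: (mulfI fdq_neq0).
  by rewrite mulrA mulfV ?fdq_neq0 // mul1r mulrBl expr2 mulVf ?fq_neq0.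
- exists 'X%:P, ('X%:P ^+ 2 - 1); split=> [N hN|]; first by case: (evy_q_nz hN).
  rewrite tofracB tofracXn tofrac1 -/fz; apply: (mulfI fdz_neq0).
  by rewrite mulrA mulfV ?fdz_neq0 // mul1r mulrBl expr2 mulVf ?fz_neq0.
Qed.

Definition phi (N : nat) (a : kk) : Lq :=
  let: exist P hP := cid (kk_frac a) in
  let: exist Q _ := cid hP in evy (xq ^+ N) P / evy (xq ^+ N) Q.

Lemma phiE N (a : kk) (P Q : {poly {poly int}}) : (0 < N)%N -> evy (xq ^+ N) Q != 0 ->
  val a * tofrac Q = tofrac P -> phi N a = evy (xq ^+ N) P / evy (xq ^+ N) Q.
Proof.
move=> hN hQ e; rewrite /phi; case: (cid _) => P' hP; case: (cid hP) => Q' [hQ' e'].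
apply/eqP; rewrite eqr_div ?hQ' // -!evyM; apply/eqP; congr (evy _ _).
apply/eqP; rewrite -tofrac_eq !tofracM -e -e'; apply/eqP; ring.
Qed.

Section PhiMorphism.
Variable N : nat.
Hypothesis hN : (0 < N)%N.

Lemma phi_ring (a b : kk) : phi N (a + b) = phi N a + phi N b /\ phi N (a * b) = phi N a * phi N b.
Proof.
have [P [Q [/(_ N hN) hQ e]]] := kk_frac a; have [P' [Q' [/(_ N hN) hQ' e']]] := kk_frac b.
rewrite (phiE hN hQ e) (phiE hN hQ' e').
have hQQ : evy (xq ^+ N) (Q * Q') != 0 by rewrite evyM; exact: mulf_neq0 hQ hQ'.
rewrite (@phiE N (a + b) (P * Q' + P' * Q) _ hN hQQ); last first.
  have -> : val (a + b) = val a + val b by [].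
  by rewrite tofracD !tofracM -e -e'; ring.
rewrite (@phiE N (a * b) (P * P') _ hN hQQ); last first.
  have -> : val (a * b) = val a * val b by [].
  by rewrite !tofracM -e -e'; ring.
by rewrite !(evyD, evyM) (addf_div _ _ hQ hQ') mulf_div.
Qed.

Lemma phi_1 : phi N 1 = 1.
Proof.
have h1 : evy (xq ^+ N) 1 != 0 by rewrite evy1 oner_eq0.
have e1 : val (1 : kk) * tofrac 1 = tofrac 1 by rewrite tofrac1 mulr1.
by rewrite (phiE hN h1 e1) evy1 divr1.
Qed.

Lemma phi_kq : phi N kq = xq.
Proof.
have h1 : evy (xq ^+ N) 1 != 0 by rewrite evy1 oner_eq0.
have e1 : val kq * tofrac 1 = tofrac 'X by rewrite tofrac1 mulr1.
by rewrite (phiE hN h1 e1) evy1 divr1 evyX.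
Qed.

Lemma phi_kz : phi N kz = xq ^+ N.
Proof.
have h1 : evy (xq ^+ N) 1 != 0 by rewrite evy1 oner_eq0.
have e1 : val kz * tofrac 1 = tofrac 'X%:P by rewrite tofrac1 mulr1.
by rewrite (phiE hN h1 e1) evy1 divr1 evyC.
Qed.
End PhiMorphism.

(** A nonzero scalar vanishes under few specialisations only, since a polynomial
    in z over Q(q) has finitely many roots. *)
Lemma phi_neq0 (a : kk) m : a != 0 -> exists h, (m <= h.*2.+1)%N /\ phi h.*2.+1 a != 0.
Proof.
move=> a0; have [P [Q [hQ e]]] := kk_frac a.
have P0 : P != 0.
  have vq : tofrac Q != 0 :> Kfrac.
    rewrite tofrac_eq0; apply/eqP => Q0; have := hQ 1%N isT.
    by rewrite Q0 evyE /bivar rmorph0 !horner0 eqxx.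
  have va : val a != 0 by apply: contraNneq a0 => e0; apply/eqP/val_inj.
  by apply: contraNneq (mulf_neq0 va vq) => P0; rewrite e P0 tofrac0.
pose rs := [seq xq ^+ h.*2.+1 | h <- iota m (size (bivar P))].
have [hall|] := boolP (all (root (bivar P)) rs).
  have hu : uniq rs by rewrite map_inj_uniq ?iota_uniq // => i j /xq_inj [] /double_inj.
  by have := max_poly_roots (bivar_neq0 P0) hall hu; rewrite size_map size_iota ltnn.
rewrite -has_predC => /hasP[y /mapP[h hh ->] /= hr]; exists h; split.
  by move: hh; rewrite mem_iota; lia.
rewrite (@phiE h.*2.+1 a P Q (ltn0Sn _) (hQ _ (ltn0Sn _)) e); apply: mulf_neq0; [by rewrite evyE; exact: hr | by rewrite invr_eq0; exact: (hQ _ (ltn0Sn _))].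
Qed.

(** ** The independence criterion *)

Lemma kspan_coef (A : lmodType kk) (J : eqType) (r : seq J) (F : J -> A) x : uniq r ->
  x \in kspan [set y | exists2 j, j \in r & y = F j]%classic ->
  exists c : J -> kk, x = \sum_(j <- r) c j *: F j.
Proof.
move=> hr; apply: (@kspan_ind _ _ _ (fun x => exists c : J -> kk, x = \sum_(j <- r) c j *: F j)).
- by exists (fun=> 0); rewrite big1 // => j _; rewrite scale0r.
- move=> a y z [c ->] [c' ->]; exists (fun j => a * c j + c' j).
  rewrite scaler_sumr -big_split; apply: eq_bigr => j _.
  by rewrite scalerDl scalerA.
- move=> _ [j hj ->]; exists (fun i => (i == j)%:R).
  rewrite (bigD1_seq j) //= eqxx scale1r big1 ?addr0 // => i /negbTE ->.
  by rewrite scale0r.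
Qed.

Definition diagB (n : nat) (c : seq nat) : qBrauer n :=
  \prod_(i <- dword c) (if i == 0%N then bE n else bT n i).

Lemma rho_word n h m (ph : kk -> Lq) (s : seq nat) f : (m <= n)%N -> xq - xq^-1 != 0 ->
  (forall a b, ph (a + b) = ph a + ph b) -> (forall a b, ph (a * b) = ph a * ph b) ->
  ph 1 = 1 -> ph kq = xq -> ph kz = xq ^+ h.*2.+1 -> wordin m s ->
  @rho n h _ xq ph (\prod_(i <- s) (if i == 0%N then bE n else bT n i)) f =
    foldr (@opq h) f s.
Proof.
move=> hmn dx pD pM p1 pq pz; have x0 := xq_neq0.
elim: s => [|l s IH] hs; first by rewrite big_nil (rho1 n x0 dx pD pM p1 pq pz).
move: hs; rewrite /wordin /= => /andP[hl hs]; rewrite big_cons (rhoM x0 dx pD pM p1 pq pz) IH //.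
case: eqP hl => [-> hl|/eqP l0 hl]; first by rewrite (rho_E x0 dx pD pM p1 pq pz) //; lia.
by rewrite (rho_T x0 dx pD pM p1 pq pz) //; [case: l l0 hl | lia].
Qed.

(** A nonzero relation survives some specialisation of [z] to a power of [q].  There the
    matrix of the diagrams tested against colourings becomes the identity at [q = 1], so
    that the diagrams act independently, and so does a family of at most as many elements
    that spans them. *)
Theorem diag_indep n m (J : eqType) (r : seq J) (F : J -> qBrauer n) (a : J -> kk) :
  (m <= n)%N -> uniq r -> (size r <= size (codes m))%N ->
  (forall c, c \in codes m -> diagB n c \in kspan [set y | exists2 j, j \in r & y = F j]%classic) ->
  \sum_(j <- r) a j *: F j = 0 -> forall j, j \in r -> a j = 0.
Proof.
move=> hmn hr hsz hspan hsum j0 hj0; apply/eqP/negPn/negP => /(@phi_neq0 _ m) [h [hmh ha]].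
have hN : (0 < h.*2.+1)%N by [].
have dx : xq - xq^-1 != 0 by apply: subVq (xq_neq0) (xq_pow _).
pose rh := @rho n h _ xq (phi h.*2.+1).
have [pD pM] : (forall a b, phi h.*2.+1 (a + b) = phi h.*2.+1 a + phi h.*2.+1 b) /\
    (forall a b, phi h.*2.+1 (a * b) = phi h.*2.+1 a * phi h.*2.+1 b).
  by split=> u v; have [] := phi_ring hN u v.
have pq := phi_kq hN; have pz := phi_kz hN; have p1 := phi_1 hN.
have x0 := xq_neq0.
pose K := size (codes m); pose cd (i : 'I_K) := nth [::] (codes m) i.
have cdP i : cd i \in codes m by rewrite mem_nth.
pose fL (k : 'I_K) : (nat -> 'I_h.*2.+1) -> Lq := fun w => if agree m (dbot (cd k)) w then 1 else 0.
pose wd (k : 'I_K) : nat -> 'I_h.*2.+1 := fun x => inord (dtop (cd k) x).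
pose M : 'M[Lq]_K := \matrix_(i, k) rh (diagB n (cd i)) (fL k) (wd k).
have detM : \det M != 0.
  apply: (@rel_neq0 _ (\det (1%:M : 'M[int]_K))); last by rewrite det1 oner_eq0.
  apply: rel_det => i k; rewrite !mxE.
  have -> : (i == k)%:R = ops (dword (cd i)) (fun w => if agree m (dbot (cd k)) w then 1 else 0 : int) (wd k).
    rewrite (@diagram_test h m _ _ (fun=> 1)) //; last first.
      apply/agreeP => x hx; rewrite /wd inordK //.
      by have [/(_ x hx) H _] := dcol_lt (cdP k); apply: leq_trans H hmh.
    have -> : (cd i == cd k) = (i == k) by rewrite /cd nth_uniq ?codes_uniq.
    by case: eqP.
  have -> : rh (diagB n (cd i)) (fL k) = foldr (@opq h) (fL k) (dword (cd i)).
    by rewrite /rh /diagB; apply: (rho_word (fL k) hmn dx pD pM p1 pq pz (dword_in h (cdP i))).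
  apply: rel_ops => w; rewrite /fL; case: ifP => _; [exact: rel1 | exact: rel0].
have [A eA] : exists A : 'I_K -> J -> kk, forall i, diagB n (cd i) = \sum_(j <- r) A i j *: F j.
  exists (fun i => projT1 (cid (kspan_coef hr (hspan _ (cdP i))))) => i.
  by case: (cid _).
pose S := size r.
pose AM : 'M[Lq]_(K, S) := \matrix_(i, j) phi h.*2.+1 (A i (nth j0 r j)).
pose RM : 'M[Lq]_(S, K) := \matrix_(j, k) rh (F (nth j0 r j)) (fL k) (wd k).
have eM : M = AM *m RM.
  apply/matrixP => i k; rewrite !mxE eA /rh (rho_sum x0 dx pD pM p1 pq pz) (big_nth j0) big_mkord.
  by apply: eq_bigr => j _; rewrite !mxE.
have rM : \rank M = K by apply/mxrank_unit; rewrite unitmxE unitfE.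
have rR : (K <= \rank RM)%N by apply: (leq_trans _ (mxrankM_maxr AM RM)); rewrite -eM rM.
have free : row_free RM by rewrite /row_free eqn_leq rank_leq_row; apply: leq_trans rR; exact: hsz.
pose al : 'rV[Lq]_S := \row_j phi h.*2.+1 (a (nth j0 r j)).
have : al *m RM = 0.
  apply/matrixP => i k; rewrite !mxE.
  have := rho_sum x0 dx pD pM p1 pq pz r a F (fL k) (wd k).
  rewrite hsum (rho0 n x0 dx pD pM p1 pq pz) (big_nth j0) big_mkord => e; rewrite [RHS]e.
  by apply: eq_bigr => j _; rewrite !mxE.
move/eqP; rewrite mulmx_free_eq0 // => /eqP /matrixP al0.
have hi : (index j0 r < S)%N by rewrite index_mem.
by have := al0 0 (Ordinal hi); rewrite !mxE /= nth_index // => e; rewrite e eqxx in ha.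
Qed.

(** * The bases *)

Section Linear.
Variables (V : lmodType kk).
Implicit Types (S X : set V).

Lemma kprojZE S a (x : V) : kproj S (a *: x) = a *: kproj S x.
Proof. by rewrite -kprojZ. Qed.

Lemma kproj0 S : kproj S (0 : V) = 0.
Proof. by rewrite -(scale0r (0 : V)) kprojZE scale0r. Qed.

Lemma kproj_sum S (I : eqType) (s : seq I) (c : I -> kk) (F : I -> V) :
  kproj S (\sum_(i <- s) c i *: F i) = \sum_(i <- s) c i *: kproj S (F i).
Proof.
elim: s => [|i s IH]; first by rewrite !big_nil kproj0.
by rewrite !big_cons kprojD kprojZE IH.
Qed.

Lemma kproj_eq0 S (x : V) : (kproj S x = 0) <-> (x \in kspan S).
Proof. by rewrite -(kproj0 S) kproj_eq subr0. Qed.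

Lemma kspan_indE (W : lmodType kk) (S : set W) (P : W -> Prop) (x : W) : x \in kspan S -> P 0 ->
  (forall a u v, P u -> P v -> P (a *: u + v)) -> (forall u, S u -> P u) -> P x.
Proof. by move=> hx h0 h1 h2; exact: (@kspan_ind _ _ S P h0 h1 h2 x hx). Qed.

Lemma kspan_lift S (X : set V) (Y : set (kquot S)) z : (forall u, Y u -> exists2 x, X x & u = kproj S x) ->
  z \in kspan Y -> exists2 x, x \in kspan X & z = kproj S x.
Proof.
move=> h hz; apply: (kspan_indE (P := fun z => exists2 x, x \in kspan X & z = kproj S x) hz).
- by exists 0; rewrite ?kproj0 // rpred0.
- move=> a u v [x hx ->] [y hy ->]; exists (a *: x + y); first by rewrite rpredD ?rpredZ.
  by rewrite kprojD kprojZE.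
- by move=> u /h [x hx ->]; exists x => //; exact: kspan_in.
Qed.

Lemma kspan_split (X Y : set V) x : x \in kspan [set y | X y \/ Y y]%classic ->
  exists u v, [/\ u \in kspan X, v \in kspan Y & x = u + v].
Proof.
move=> hx; apply: (kspan_indE (P := fun x => exists u v, [/\ u \in kspan X, v \in kspan Y & x = u + v]) hx).
- by exists 0, 0; rewrite !rpred0 addr0.
- move=> a y z [u [v [h1 h2 ->]]] [u' [v' [h3 h4 ->]]].
  exists (a *: u + u'), (a *: v + v'); split; try by rewrite rpredD ?rpredZ.
  by rewrite scalerDr addrACA.
- by move=> y [hy|hy]; [exists y, 0 | exists 0, y]; rewrite ?addr0 ?add0r rpred0 kspan_in.
Qed.

End Linear.

Section Bases.
Variable n : nat.
Hypothesis hn : (1 < n)%N.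
Local Notation B := (qBrauer n).
Local Notation T := (bT n).
Local Notation E := (bE n).
Local Notation H := (HT T).
Local Notation S := (SQ T E).
Local Notation Ep := (Ep T E).
Local Notation bud := (bud n).
Let hq := brauer_qbs hn.
Implicit Types (m f k : nat) (x y h b c : B) (la mu nu : seq nat) (t s : seq (seq nat)).

Lemma mtE m f la t : (m <= n)%N -> Lambda m (f, la) -> mt n m f la t = el n f la * bud m t.
Proof.
by move=> hm /LambdaE [_ hf]; rewrite /mt Epow_Ep //; [rewrite xla_xP //; lia | lia].
Qed.

Lemma mstE m f la s t : (m <= n)%N -> Lambda m (f, la) ->
  mst n m f la s t = bsigma (bud m s) * (el n f la * bud m t).
Proof.
move=> hm /LambdaE [_ hf]; rewrite /mst Epow_Ep //; last by lia.
by rewrite xla_xP //; [rewrite /el !mulrA | lia].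
Qed.

Lemma updownS m la t : is_part la -> updown m.+1 la t ->
  let mu := nth [::] t m in [/\ updown m mu (take m.+1 t), is_part mu, adj la mu & t = rcons (take m.+1 t) la].
Proof.
move=> hla [h1 h2 h3 h4] mu.
have [_ hmu hadj] : [/\ is_part la, is_part mu & adj la mu].
  have [k hk] := h4 m (ltnSn m); have := (add_adj mu la).1.
  by rewrite /mu -h3; case=> [|a1 a2 a3]; [exists k | split; rewrite // -h3].
split=> //; last first.
  rewrite -[LHS](cat_take_drop m.+1) -cats1; congr (_ ++ _).
  by rewrite (drop_nth [::]) ?h1 // h3 drop_oversize // h1.
split; first by rewrite size_takel // h1.
- by rewrite nth_take.
- by rewrite nth_take.
- by move=> i hi; rewrite !nth_take //; [apply: h4; exact: ltnW | exact: ltnW].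
Qed.

Lemma updown_level m la t : is_part la -> updown m la t -> exists f, Lambda m (f, la).
Proof.
elim: m la t => [|m IH] la t hla ht.
  have [_ h2 h3 _] := ht; exists 0%N; apply/LambdaE; by rewrite -h3 h2.
have [h1 hmu hadj _] := updownS hla ht; have [f /LambdaE [_ hf]] := IH _ _ hmu h1.
case/orP: hadj => [/(addsP _ hla)|/(addsP _ hmu)] [k [_ e]].
  by exists f.+1; apply/LambdaE; split=> //; move: hf; rewrite e sumn_incr; lia.
by exists f; apply/LambdaE; split=> //; rewrite e sumn_incr; lia.
Qed.

Lemma updown_nbr m f la t : updown m.+1 la t -> Lambda m.+1 (f, la) -> nbr f la (nth [::] t m).
Proof.
move=> ht /LambdaE [hla hf]; have [h1 hmu hadj _] := updownS hla ht; split=> //.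
have := updown_sumn h1 hmu.
case/orP: hadj => [/(addsP _ hla)|/(addsP _ hmu)] [k [_ e]].
  by rewrite e sumn_incr; lia.
by rewrite [in sumn la]e sumn_incr ltnSn.
Qed.

Lemma bud_S m la t : (m <= n)%N -> is_part la -> updown m la t -> S m (bud m t).
Proof.
elim: m la t => [|m IH] la t hm hla ht; first exact: gen_subalg_1.
have [f hL] := updown_level hla ht; have hnb := updown_nbr ht hL.
have [h1 hmu hadj et] := updownS hla ht; have [_ _ h3 _] := ht; rewrite budS h3.
have /LambdaE [_ hf] := hL.
apply: gen_subalg_M; first by apply: (bfac_S hn _ hla hf hnb); lia.
by rewrite -bud_take; apply: SQ_le (IH _ _ _ hmu h1); lia.
Qed.

Definition Bud m la : set B := [set b | exists2 t, updown m la t & b = bud m t]%classic.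

Lemma Bud_span m f la c : (m <= n)%N -> Lambda m (f, la) -> S m c -> el n f la * c \in
  kspan [set x | (exists2 b, Bud m la b & x = el n f la * b) \/ Above m (plt la) x]%classic.
Proof.
move=> hm hL hc; have [h _] := straighten hn hm hL hc.
apply: kspan_min h => x [hx|[t [h1 _ ->]]].
  by apply: kspan_sub (Rem_Above hn hm hL hx) => y hy; right.
by apply: kspan_in; left; exists (bud m t) => //; exists t.
Qed.

Lemma plt_up la : is_part la -> forall nu nu', is_part nu -> is_part nu' ->
  plt la nu -> plt nu nu' -> plt la nu'.
Proof. by move=> hla nu nu' h1 h2; exact: plt_trans. Qed.

Definition Fm m (j : seq nat * seq (seq nat) * seq (seq nat)) : B :=
  mst n m ((m - sumn j.1.1)./2) j.1.1 j.1.2 j.2.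

Lemma FmE m f la s t : (m <= n)%N -> Lambda m (f, la) ->
  Fm m (la, s, t) = bsigma (bud m s) * (el n f la * bud m t).
Proof.
move=> hm hL; have /LambdaE [_ hf] := hL.
by rewrite /Fm /= (half_level hf) mstE.
Qed.

Lemma Above_Fm m (P : seq nat -> Prop) x : (m <= n)%N ->
  (forall nu nu', is_part nu -> is_part nu' -> P nu -> plt nu nu' -> P nu') ->
  x \in kspan (Above m P) ->
  x \in kspan [set y | exists2 j, j \in [seq j <- tripairs m | `[< P j.1.1 >]] & y = Fm m j]%classic.
Proof.
move=> hm hP hx; have := @cell_span n hn m (Bud m) P hm _ hP _ x hx.
have h1 : forall f la (s : B), Lambda m (f, la) -> S m s -> el n f la * s \in
    kspan [set x | (exists2 b, Bud m la b & x = el n f la * b) \/ Above m (plt la) x]%classic.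
  by move=> f la s hL hs; exact: Bud_span.
have h2 : forall la b, is_part la -> Bud m la b -> S m b by move=> la b hla [t ht ->]; exact: bud_S ht.
move=> /(_ h1 h2); apply: kspan_sub => _ [l [nu [_ [_ [hL hPn [s hs ->] [t ht ->] ->]]]]].
exists (nu, s, t); last by rewrite (FmE _ _ hm hL).
by rewrite mem_filter; apply/andP; split; [apply/asboolP | apply/tripairsP; split=> //; case/LambdaE: hL].
Qed.

Lemma S_Above m x : S m x -> x \in kspan (Above m (fun _ => True)).
Proof.
move=> hx; have [o1 o2] := part_ones m; apply: kspan_in; exists 0%N, (nseq m 1%N), x, 1.
split=> //; first by apply/LambdaE.
  exact: gen_subalg_1.
by rewrite /el xP_ones Ep0 !mulr1.
Qed.

(** The [m_st] span the elements attached to the diagrams and are at most as many. *)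
Lemma mst_indep m (r : seq (seq nat * seq (seq nat) * seq (seq nat))) (a : _ -> kk) : (m <= n)%N -> uniq r -> {subset r <= tripairs m} ->
  \sum_(j <- r) a j *: Fm m j = 0 -> forall j, j \in r -> a j = 0.
Proof.
move=> hm hu hr hs j hj.
have hsz : (size (tripairs m) <= size (codes m))%N.
  rewrite size_tripairs; elim: (m) => [//|k IH].
  by apply: leq_trans (cnt_closed k) _; rewrite size_codesS leq_mul2l IH orbT.
pose a' j := if j \in r then a j else 0.
have := @diag_indep n m _ (tripairs m) (Fm m) a' hm (tripairs_uniq m) hsz _ _ j (hr j hj).
rewrite /a' hj; apply.
  move=> c hc; have hS : S m (diagB n c).
    have hw : wordin m (dword c) := dword_in 0 hc.
    rewrite /diagB; elim: (dword c) hw => [|i s IH] /=; first by rewrite big_nil => _; exact: gen_subalg_1.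
    move=> /andP[/andP[h1 h2] h3]; rewrite big_cons; apply: gen_subalg_M; last exact: IH.
    by case: eqP h2 => [e|e] h2; [apply: SQ_E; lia | apply: SQ_T; lia].
  by apply: kspan_sub (Above_Fm hm _ (S_Above hS)) => // y [i]; rewrite mem_filter => /andP[_ hi] ->; exists i.
transitivity (\sum_(j <- r) a j *: Fm m j); last exact: hs.
rewrite (eq_bigr (fun i => if i \in r then a i *: Fm m i else 0)); last first.
  by move=> i _; case: ifP; rewrite ?scale0r.
rewrite -big_mkcond -big_filter; apply: perm_big; apply: uniq_perm => //.
  by rewrite filter_uniq ?tripairs_uniq.
by move=> i; rewrite mem_filter; case: (boolP (i \in r)) => //= hi; rewrite hr.
Qed.

(** Independence modulo the larger shapes, by multiplying with [sigma (b_t)]. *)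
Lemma indep_mod m f la (s : seq (seq (seq nat))) (c : seq (seq nat) -> kk) :
  (m <= n)%N -> Lambda m (f, la) -> uniq s -> (forall t, t \in s -> updown m la t) ->
  \sum_(t <- s) c t *: (el n f la * bud m t) \in kspan (Above m (plt la)) ->
  forall t, t \in s -> c t = 0.
Proof.
move=> hm hL hu hs hA i hi; have /LambdaE [hla hf] := hL.
have hbi := bud_S hm hla (hs i hi).
have hA' : bsigma (bud m i) * (\sum_(t <- s) c t *: (el n f la * bud m t)) \in kspan (Above m (plt la)).
  rewrite -[\sum_(_ <- _) _]mulr1; apply: Above_mul => //; [by apply: SQ_sigma hq _ | exact: gen_subalg_1].
have := Above_Fm hm (plt_up hla) hA'.
set r2 := [seq j <- _ | _] => h2.
have hu2 : uniq r2 by rewrite filter_uniq ?tripairs_uniq.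
have [d ed] := kspan_coef hu2 h2.
pose r1 := [seq (la, i, t) | t <- s].
have hu1 : uniq r1 by rewrite map_inj_uniq // => t t' [].
have hn1 j : j \in r2 -> j \notin r1.
  by rewrite mem_filter => /andP[/asboolP [_ hne] _]; apply/negP => /mapP[t _ e]; apply: hne; rewrite e.
have := @mst_indep m (r1 ++ r2) (fun j => if j \in r1 then c j.2 else - d j) hm _ _ _ (la, i, i).
rewrite map_f // mem_cat map_f //=; apply=> //.
- by rewrite cat_uniq hu1 hu2 andbT; apply/hasPn.
- move=> j; rewrite mem_cat mem_filter => /orP[/mapP[t ht ->]|/andP[]//].
  by apply/tripairsP; split=> //=; exact: hs.
- rewrite big_cat /= big_map /= (eq_big_seq (fun t => c t *: Fm m (la, i, t))); last first.
    by move=> t ht; rewrite map_f.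
  rewrite [X in _ + X](eq_big_seq (fun j => - (d j *: Fm m j))); last first.
    by move=> j /hn1 /negbTE ->; rewrite scaleNr.
  rewrite sumrN -ed mulr_sumr; apply/eqP; rewrite subr_eq0; apply/eqP; apply: eq_bigr => t _.
  by rewrite (FmE _ _ hm hL) scalerAr.
Qed.

(** ** The cell modules *)

Lemma dperm_HT f t la : (f.*2 + sumn la <= n)%N -> shape t = la ->
  HT T f.*2 (f.*2 + sumn la) (Tw (dperm n f t)).
Proof.
move=> hle hsh; rewrite /dperm hsh; case: pickP => [w /andP[/(fixes_offP _ hle) h _]|_] /=.
  by apply: Tw_HT => // x hx; apply: h; lia.
by rewrite (Tw1 n).1; exact: gen_subalg_1.
Qed.

Definition StdB m la : set B := [set b | exists f t v, [/\ Lambda m (f, la), std_tab f la t,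
  Dset n f m v & b = Tw (dperm n f t) * Tw v]]%classic.

Lemma StdB_S m la b : (m <= n)%N -> StdB m la b -> S m b.
Proof.
move=> hm [f [t [v [/LambdaE [hla hf] [h1 _ _ _] h2 ->]]]]; apply: gen_subalg_M.
  by apply: (SQ_HT E (a := f.*2)); rewrite -hf; apply: dperm_HT => //; lia.
exact: (SQ_HT E (Dset_HT hm h2)).
Qed.

Lemma StdB_span m f la c : (m <= n)%N -> Lambda m (f, la) -> S m c -> el n f la * c \in
  kspan [set x | (exists2 b, StdB m la b & x = el n f la * b) \/ Above m (plt la) x]%classic.
Proof.
move=> hm hL hc; have /LambdaE [hla hf] := hL; have hfm : (f.*2 <= m)%N by lia.
have hfn : (f.*2 <= n)%N by lia.
have hR x : x \in kspan (Rem m f la) -> x \in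
    kspan [set x | (exists2 b, StdB m la b & x = el n f la * b) \/ Above m (plt la) x]%classic.
  apply: kspan_min => y hy; apply: kspan_sub (Rem_Above hn hm hL hy) => z hz; by right.
rewrite -[el n f la * c]mulr1; apply: el_via (hfn) (Ep_SQ_D hn hm hfm hc) _ => // u.
move=> [[h [v [hh hv {u}->]]]|hu]; rewrite mulr1; last by apply/hR/el_IdG; exact: kspan_in.
rewrite el_EpM // rpredZ //.
have hle : (f.*2 + sumn la <= n)%N by lia.
rewrite -hf in hh; have hx := xP_HT_std hla hle hh.
rewrite /el -mulrA (mulrA (xP _ _ _)); apply: kspan_bi hx _ => _ [[g [h' [hg hh' ->]]]|[w hw ->]].
  apply: hR; apply: kspan_in; left; exists g, (h' * Tw v); rewrite -mulrA; split=> //.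
  apply: gen_subalg_M; first by apply: (SQ_HT E (a := f.*2)); rewrite -hf.
  exact: (SQ_HT E (Dset_HT hm hv)).
have [t [ht ed]] := good_std hle hla hw.
apply: kspan_in; left; exists (Tw w * Tw v); last by rewrite !mulrA.
by exists f, t, v; split=> //; rewrite ed.
Qed.

(** Both bases satisfy the hypothesis of [cell_span], which then describes the same ideal
    by either. *)
Lemma cells_AboveP m la x : (m <= n)%N -> is_part la ->
  (x \in kspan (cells_above n m la)) <-> (x \in kspan (Above m (plt la))).
Proof.
move=> hm hla.
have cE l mu w s v t : Lambda m (l, mu) -> std_tab l mu s ->
    cellC l mu w s v t = bsigma (Tw (dperm n l s) * Tw w) * (el n l mu * (Tw (dperm n l t) * Tw v)).
  move=> /LambdaE [hmu hl] [hs _ _ _]; have hle : (l.*2 + sumn mu <= n)%N by lia.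
  rewrite /cellC /xst Epow_Ep; last by lia.
  rewrite xla_xP // bsigmaM /el -!mulrA; congr (_ * _); rewrite !mulrA.
  by rewrite (Ep_HT hn (HT_bsigma (dperm_HT hle hs))).
split.
  apply: kspan_sub => _ [l [mu [w [s [v [t [h1 h2 [h3 h4] [h5 h6] ->]]]]]]].
  exists l, mu, (bsigma (Tw (dperm n l s) * Tw w)), (Tw (dperm n l t) * Tw v); split=> //; last exact: cE.
    by apply: SQ_sigma hq _; apply: (StdB_S (la := mu)) => //; exists l, s, w.
  by apply: (StdB_S (la := mu)) => //; exists l, t, v.
move=> hx.
have h1 : forall f la (s : B), Lambda m (f, la) -> S m s -> el n f la * s \in
    kspan [set x | (exists2 b, StdB m la b & x = el n f la * b) \/ Above m (plt la) x]%classic.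
  by move=> f la' s hL hs; exact: StdB_span.
have h2 : forall la b, is_part la -> StdB m la b -> S m b by move=> la' b _; exact: StdB_S.
have := @cell_span n hn m (StdB m) (plt la) hm h1 (plt_up hla) h2 x hx.
apply: kspan_sub => _ [l [nu [_ [_ [hL hP [f1 [s [w [hL1 hs hw ->]]]] [f2 [t [v [hL2 ht hv ->]]]] ->]]]]].
have e1 : f1 = l by move: hL hL1 => /LambdaE [_ a1] /LambdaE [_ a2]; lia.
have e2 : f2 = l by move: hL hL2 => /LambdaE [_ a1] /LambdaE [_ a2]; lia.
subst f1 f2; exists l, nu, w, s, v, t; split=> //; by rewrite cE.
Qed.

Lemma cell_proj0 m f la x : (m <= n)%N -> Lambda m (f, la) ->
  (cell_proj n m la x = 0) <-> (x \in kspan (Above m (plt la))).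
Proof. by move=> hm /LambdaE [hla _]; rewrite /cell_proj kproj_eq0; exact: cells_AboveP. Qed.

Lemma cell_projD m la x y : cell_proj n m la (x + y) = cell_proj n m la x + cell_proj n m la y.
Proof. exact: kprojD. Qed.

Lemma cell_projZ m la a x : cell_proj n m la (a *: x) = a *: cell_proj n m la x.
Proof. exact: kprojZE. Qed.

Lemma cell_moduleP m f la X : (m <= n)%N -> Lambda m (f, la) ->
  (X \in cell_module n m f la) <-> (exists2 c, S m c & X = cell_proj n m la (el n f la * c)).
Proof.
move=> hm hL; have /LambdaE [hla hf] := hL; have hle : (f.*2 + sumn la <= n)%N by lia.
split.
  move=> hX; apply: (kspan_indE (P := fun X => exists2 c, S m c & X = cell_proj n m la (el n f la * c)) hX).
  - by exists 0; [exact: gen_0 | rewrite mulr0 /cell_proj kproj0].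
  - move=> a u v [c hc ->] [c' hc' ->]; exists (a *: c + c').
      by apply: gen_subalg_D => //; exact: gen_subalg_Z.
    by rewrite mulrDr -scalerAr cell_projD cell_projZ.
  - move=> _ [v [t [hv ht ->]]]; exists (Tw (dperm n f t) * Tw v).
      by apply: (StdB_S (la := la)) => //; exists f, t, v.
    rewrite Epow_Ep; last by lia.
    by rewrite xla_xP // !mulrA.
move=> [c hc ->].
apply: (kspan_indE (P := fun x => cell_proj n m la x \in cell_module n m f la) (StdB_span hm hL hc)).
- by rewrite /cell_proj kproj0 rpred0.
- by move=> a u v hu hv; rewrite cell_projD cell_projZ rpredD ?rpredZ.
- move=> x [[_ [f' [t [v [hL' ht hv ->]]]] ->]|hx]; last first.
    by rewrite (cell_proj0 x hm hL).2 ?rpred0 //; exact: kspan_in.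
  have e : f' = f by move: hL' => /LambdaE [_ a1]; lia.
  subst f'; apply: kspan_in; exists v, t; split=> //.
  rewrite Epow_Ep; last by lia.
  by rewrite xla_xP // !mulrA.
Qed.

Lemma straighten_coef m f la c : (m <= n)%N -> Lambda m (f, la) -> S m c ->
  exists (a : seq (seq nat) -> kk) r, r \in kspan (Rem m f la) /\
    el n f la * c = \sum_(t <- walks m la) a t *: (el n f la * bud m t) + r.
Proof.
move=> hm hL hc; have /LambdaE [hla hf] := hL; have [h _] := straighten hn hm hL hc.
have [r [u [hr hu e]]] := kspan_split h.
have hu' : u \in kspan [set y | exists2 t, t \in walks m la & y = el n f la * bud m t]%classic.
  by apply: kspan_sub hu => y [t [h1 _ ->]]; exists t => //; apply/walksP.
have [a ea] := kspan_coef (walks_uniq m hla) hu'.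
by exists a, r; split=> //; rewrite e addrC -ea.
Qed.

Lemma mt_basis m f la : (m <= n)%N -> Lambda m (f, la) ->
  is_basis (updown m la) (fun t => cell_proj n m la (mt n m f la t)) (cell_module n m f la).
Proof.
move=> hm hL; have /LambdaE [hla hf] := hL; split.
  move=> s c hu hs; rewrite (eq_bigr (fun t => c t *: cell_proj n m la (el n f la * bud m t))); last first.
    by move=> t _; rewrite mtE.
  by rewrite /cell_proj -kproj_sum => /(cell_proj0 _ hm hL); exact: indep_mod.
move=> X; apply/idP/idP.
  move=> /(cell_moduleP _ hm hL) [c hc ->].
  have [a [r [hr ->]]] := straighten_coef hm hL hc.
  rewrite cell_projD (cell_proj0 r hm hL).2 ?addr0; last first.
    by apply: kspan_min hr => x; exact: Rem_Above.
  rewrite /cell_proj kproj_sum; rewrite big_seq; apply: rpred_sum => t ht.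
  rewrite rpredZ //; apply: kspan_in; exists t; last by rewrite mtE.
  exact/(walksP _ _ hla).
move=> hX; apply: (kspan_indE (P := fun X => X \in cell_module n m f la) hX); first exact: rpred0.
  by move=> a u v hu hv; rewrite rpredD ?rpredZ.
move=> _ [t ht <-]; apply/(cell_moduleP _ hm hL); exists (bud m t); last by rewrite mtE.
exact: bud_S ht.
Qed.

(** ** The cellular structure *)

Lemma all_S x : S n x.
Proof.
rewrite -(bpiK x); elim: (generic_quotient.repr x) => [i||a|u hu v hv|u hu v hv].
- case: (boolP (0 < i < n)%N) => hi; first exact: (@SQ_T n T E n i hi).
  by rewrite -/(bT n i) bT_out //; exact: gen_0.
- exact: SQ_E.
- by rewrite bpiC; exact: gen_C.
- by rewrite bpi_add; exact: gen_subalg_D.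
- by rewrite bpi_mul; exact: gen_subalg_M.
Qed.

Lemma mst_cellular : cellular_basis (Lambda n) (fun p p' => ple p'.2 p.2)
  (fun p => updown n p.2) (fun p s t => mst n n p.1 p.2 s t) (@bsigma n).
Proof.
have wE la : is_part la -> updown n la = [set` walks n la]%classic.
  by move=> hla; apply/seteqP; split=> t /(walksP _ _ hla).
split.
- by move=> x _; exact: ple_refl.
- move=> [f la] [f' la'] /LambdaE [h1 h2] /LambdaE [h3 h4] /= h5 h6.
  have e := ple_anti h1 h3 h6 h5; subst la'; congr (_, _); lia.
- by move=> x y z _ _ _ h1 h2; exact: ple_trans h2 h1.
- by move=> [f la] /LambdaE [hla _] /=; rewrite wE //; exact: finite_seq.
- split.
    move=> s c hu hs hsum i hi.
    pose g (u : nat * seq nat * seq (seq nat) * seq (seq nat)) := (u.1.1.2, u.1.2, u.2).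
    have ginj : {in s &, injective g}.
      move=> [[[f la] s1] t1] [[[f' la'] s2] t2] /hs [/LambdaE [_ h1] _ _] /hs [/LambdaE [_ h2] _ _] [e1 -> ->].
      by move: h1 h2; rewrite e1 => h1 h2; congr (_, _, _, _); lia.
    have hg u : u \in s -> Fm n (g u) = mst n n u.1.1.1 u.1.1.2 u.1.2 u.2.
      move: u => [[[f la] s1] t1] /hs [/= /LambdaE [_ h1] _ _].
      by rewrite /Fm /g /= (half_level h1).
    pose inv j := nth i s (index j (map g s)).
    have invg u : u \in s -> inv (g u) = u.
      move=> hu'; rewrite /inv; have hx : (index (g u) (map g s) < size s)%N by rewrite -(size_map g) index_mem map_f.
      have e := nth_index (g i) (map_f g hu'); rewrite (nth_map i) // in e.
      by apply: ginj => //; exact: mem_nth.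
    have := @mst_indep n (map g s) (c \o inv) (leqnn n) _ _ _ (g i) (map_f g hi).
    rewrite /= invg //; apply.
    - by rewrite map_inj_in_uniq.
    - move=> _ /mapP[u hu' ->]; apply/tripairsP; have [h1 h2 h3] := hs u hu'.
      by split=> //; move: h1; case: (u) => [[[f la] s1] t1] /= /LambdaE [].
    - rewrite big_map -[RHS]hsum; apply: eq_big_seq => u hu' /=; by rewrite invg // hg.
  move=> x; apply/esym/idP; have := Above_Fm (leqnn n) _ (S_Above (all_S x)).
  move=> /(_ (fun _ _ _ _ _ _ => I)); apply: kspan_sub => y [[[la s] t]].
  rewrite mem_filter => /andP[_ /tripairsP [/= h1 h2 h3]] ->.
  have [f hL] := updown_level h1 h2; exists (f, la, s, t) => //=.
  by have /LambdaE [_ hf] := hL; rewrite /Fm /= (half_level hf).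
- exact: bsigma_linear.
- by move=> a b; rewrite bsigmaM.
- exact: bsigmaK.
- move=> [f la] s t hL _ _ /=; have /LambdaE [_ hf] := hL.
  rewrite !mstE // (bsigmaM (bsigma _)) (bsigmaM (el n f la)) bsigmaK (el_sigma hn); last by lia.
  by rewrite -[LHS]mulrA.
- move=> a [f la] s hL hs /=; have /LambdaE [hla hf] := hL; rewrite /= in hs.
  have [r [z [hz e]]] := straighten_coef (leqnn n) hL (all_S (bud n s * bsigma a)).
  exists r => t ht; rewrite wE // -fsbig_seq ?walks_uniq // mstE //.
  have hf2 : (f.*2 <= n)%N by lia.
  have e1 : a * (bsigma (bud n s) * (el n f la * bud n t)) =
      bsigma (el n f la * (bud n s * bsigma a)) * bud n t.
    by rewrite (bsigmaM (el n f la)) (bsigmaM (bud n s)) bsigmaK (el_sigma hn) // !mulrA.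
  have e2 : bsigma (el n f la * (bud n s * bsigma a)) * bud n t -
      \sum_(s' <- walks n la) r s' *: mst n n f la s' t = bsigma z * bud n t.
    rewrite e bsigmaD mulrDl; have -> : bsigma (\sum_(t0 <- walks n la) r t0 *: (el n f la * bud n t0)) * bud n t =
        \sum_(s' <- walks n la) r s' *: mst n n f la s' t; last by rewrite addrAC subrr add0r.
    elim: (walks n la) => [|u w IH]; first by rewrite !big_nil bsigma0 mul0r.
    rewrite !big_cons bsigmaD bsigmaZ mulrDl IH -scalerAl; congr (_ *: _ + _).
    by rewrite mstE // bsigmaM (el_sigma hn) // [RHS]mulrA.
  rewrite e1 e2; have hA : z \in kspan (Above n (plt la)).
    by apply: kspan_min hz => x; exact: Rem_Above.
  have hA2 : bsigma z * bud n t \in kspan (Above n (plt la)).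
    apply: (kspan_indE (P := fun z => bsigma z * bud n t \in kspan (Above n (plt la))) hA).
    - by rewrite bsigma0 mul0r rpred0.
    - by move=> c u v hu hv; rewrite bsigmaD bsigmaZ mulrDl -scalerAl rpredD ?rpredZ.
    - move=> _ [l [nu [a1 [b1 [h1 h2 h3 h4 ->]]]]]; apply: kspan_in.
      exists l, nu, (bsigma b1), (bsigma a1 * bud n t); split=> //; try exact: all_S.
      have /LambdaE [_ hl] := h1.
      by rewrite (bsigmaM a1) (bsigmaM (el n l nu)) (el_sigma hn); [rewrite !mulrA | lia].
  apply: kspan_sub (Above_Fm (leqnn n) (plt_up hla) hA2) => y [[[nu s1] t1]].
  rewrite mem_filter => /andP[/asboolP /= [h1 h2] /tripairsP [/= h3 h4 h5]] ->.
  have [l hL1] := updown_level h3 h4; exists (l, nu), s1, t1; split=> //=.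
    by split=> // -[_ e3]; exact: h2.
  by have /LambdaE [_ hf1] := hL1; rewrite /Fm /= (half_level hf1).
Qed.

End Bases.

(** * The branching filtration *)

Section Branch.
Variables (n f : nat) (la : seq nat).
Hypotheses (hn : (1 < n)%N) (hL : Lambda n (f, la)).
Local Notation B := (qBrauer n).
Local Notation T := (bT n).
Local Notation E := (bE n).
Local Notation S := (SQ T E).
Local Notation bud := (bud n).
Local Notation p := (cell_proj n n la).
Local Notation yf := (yv n n f la).
Implicit Types (i j k : nat) (x y h b c : B) (mu nu : seq nat) (t s : seq (seq nat)).

Let hla : is_part la. Proof. by case/LambdaE: hL. Qed.
Let hf : (f.*2 + sumn la = n)%N. Proof. by case/LambdaE: hL. Qed.
Let hpred : (n.-1 < n)%N. Proof. by lia. Qed.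
Let hn0 : (0 < n <= n)%N. Proof. by lia. Qed.

Lemma cell_projB m nu x y : cell_proj n m nu (x - y) = cell_proj n m nu x - cell_proj n m nu y.
Proof. by rewrite -scaleN1r cell_projD cell_projZ scaleN1r. Qed.

Lemma updown_pred m g ka t : (0 < m)%N -> updown m ka t -> Lambda m (g, ka) ->
  [/\ nbr g ka (nth [::] t m.-1), updown m.-1 (nth [::] t m.-1) (take m t) &
    el n g ka * bud m t = yv n m g ka (nth [::] t m.-1) * bud m.-1 t].
Proof.
case: m => // m _ ht hK; have /LambdaE [hka _] := hK.
have [h1 hmu hadj et] := updownS hka ht; split=> //; first exact: updown_nbr ht hK.
by rewrite {1}et (yv_bud n g ka h1) bud_take.
Qed.

Variables (mus : seq (seq nat)) (a : nat).
Hypothesis hmus : RA_enum n f la mus a.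
Local Notation M := (Mset n f la mus).
Local Notation nus := (nth [::] mus).

Lemma RA_nbr i : (i < size mus)%N -> nbr f la (nus i) /\ flev f la (nus i) = (if (i < a)%N then f else f.-1).
Proof.
move=> hi; have [_ _ _ h4 h5] := hmus; case: (ltnP i a) => hia.
  have [[k hk] /LambdaE [h6 h7]] := h4 i hia.
  have [|_ _ h8] := (add_adj (nus i) la).1; first by exists k; left.
  have hlt : (sumn (nus i) < sumn la)%N by lia.
  by split; [split=> //; rewrite hlt | rewrite /flev hlt].
have [|[k hk] [h0 /LambdaE [h6 h7]]] := h5 i; first by rewrite hia hi.
have [|_ _ h8] := (add_adj (nus i) la).1; first by exists k; right.
have hlt : (sumn (nus i) < sumn la)%N = false by lia.
by split; [split=> //; rewrite h0 orbT | rewrite /flev hlt].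
Qed.

Lemma nbr_RA nu : nbr f la nu -> exists2 i, (i < size mus)%N & nu = nus i.
Proof.
move=> hnb; have [h1 _ _ _ _] := hmus; have [hnu hadj _] := hnb.
have hin : nu \in mus.
  apply/h1; split; first by apply/add_adj.
  by exists (flev f la nu); exact: nbr_level hf hla hnb.
by exists (index nu mus); rewrite ?index_mem ?nth_index.
Qed.

Lemma nus_le i j : (i <= j)%N -> (j < size mus)%N -> ple (nus j) (nus i).
Proof.
move=> hij hj; have [_ h2 _ _ _] := hmus; move: hij; rewrite leq_eqVlt => /orP[/eqP ->|hij].
  exact: ple_refl.
by have [] := h2 i j; rewrite ?hij.
Qed.

Lemma nus_ge i j : (i < size mus)%N -> (j < size mus)%N -> ple (nus j) (nus i) -> (i <= j)%N.
Proof.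
move=> hi hj h; rewrite leqNgt; apply/negP => hji; have [_ h2 _ _ _] := hmus.
have [|h3 h4] := h2 j i; first by rewrite hji.
have [[h5 _ _] _] := RA_nbr hi; have [[h6 _ _] _] := RA_nbr hj.
by apply: h4; exact: ple_anti.
Qed.

Lemma p0 x : x \in kspan (Rem n f la) -> p x = 0.
Proof.
move=> hx; apply/(cell_proj0 hn _ (leqnn n) hL).
by apply: kspan_min hx => y; exact: Rem_Above.
Qed.

Lemma yv_M i j c : (i < j <= size mus)%N -> S n.-1 c -> p (yf (nus i) * c) \in kspan (M j).
Proof.
move=> hij hc; have hi : (i < size mus)%N by lia.
have [hnb _] := RA_nbr hi; have [_ h] := straighten hn (leqnn n) hL (gen_subalg_1 _).
have hT := h _ _ (ltnW hn) hnb hc.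
apply: (kspan_indE (P := fun x => p x \in kspan (M j)) hT).
- by rewrite /cell_proj kproj0 rpred0.
- by move=> e u v hu hv; rewrite cell_projD cell_projZ rpredD ?rpredZ.
- move=> x [hx|[t [h1 h2 ->]]]; first by rewrite p0 ?rpred0 //; exact: kspan_in.
  apply: kspan_in; exists t; split=> //; [by lia | | by rewrite mtE].
  by apply: ple_trans h2; apply: nus_le; lia.
Qed.

Lemma M_rep j X : (j <= size mus)%N -> X \in kspan (M j) -> exists2 x,
  x \in kspan [set y | exists i c, [/\ (i < j)%N, S n.-1 c & y = yf (nus i) * c]]%classic & X = p x.
Proof.
move=> hj; apply: kspan_lift => _ [t [h0 ht hp ->]].
have [hnb h1 e] := updown_pred (ltnW hn) ht hL.
have [i hi ei] := nbr_RA hnb.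
exists (el n f la * bud n t); last by rewrite mtE.
rewrite e; exists i, (bud n.-1 t); split; last by rewrite ei.
  by rewrite ei in hp; have := nus_ge hi _ hp; lia.
have [hnu _ _] := hnb; rewrite -bud_take prednK ?(ltnW hn) //.
by apply: (bud_S hn _ hnu h1); lia.
Qed.

Lemma M_N j : (j <= size mus)%N -> kspan (M j) =i kspan (Nset n f la mus j).
Proof.
move=> hj X; have hy i : (i < j)%N -> yla n f la (nus i) = yf (nus i).
  move=> hi; have [[h1 h2 h3] _] := @RA_nbr i ltac:(lia); exact: yla_yv.
apply/idP/idP.
  move=> /(M_rep hj) [x hx ->]; apply: (kspan_indE (P := fun x => p x \in kspan _) hx).
  - by rewrite /cell_proj kproj0 rpred0.
  - by move=> e u v hu hv; rewrite cell_projD cell_projZ rpredD ?rpredZ.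
  - by move=> y [i [c [hi hc ->]]]; apply: kspan_in; exists i, c; rewrite hy.
by apply: kspan_min => _ [i [c [hi hc ->]]]; rewrite hy //; apply: yv_M => //; lia.
Qed.

Lemma p_mulr x y b : S n b -> p x = p y -> p (x * b) = p (y * b).
Proof.
move=> hb e; apply/eqP; rewrite -subr_eq0 -cell_projB -mulrBl; apply/eqP.
apply/(cell_proj0 hn _ (leqnn n) hL); rewrite -[_ * b]mul1r; apply: Above_mul => //; first exact: gen_subalg_1.
by apply/(cell_proj0 hn _ (leqnn n) hL); rewrite cell_projB e subrr.
Qed.

Lemma S_pred b : S n.-1 b -> S n b.
Proof. by apply: SQ_le; exact: leq_pred. Qed.

Lemma M_submodule j : (j <= size mus)%N ->
  {subset kspan (M j) <= cell_module n n f la} /\ right_submodule (subB n n.-1) p (kspan (M j)).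
Proof.
move=> hj; split.
  move=> X hX; apply: kspan_min hX => _ [t [_ ht _ ->]].
  apply/(cell_moduleP hn _ (leqnn n) hL); exists (bud n t); last by rewrite mtE.
  exact: (bud_S hn (leqnn n) hla ht).
move=> x b hb /(M_rep hj) [y hy e]; rewrite (p_mulr (S_pred hb) e).
apply: (kspan_indE (P := fun y => p (y * b) \in kspan (M j)) hy).
- by rewrite mul0r /cell_proj kproj0 rpred0.
- by move=> d u v hu hv; rewrite mulrDl -scalerAl cell_projD cell_projZ rpredD ?rpredZ.
- by move=> _ [i [c [hi hc ->]]]; rewrite -mulrA; apply: yv_M; [lia | exact: gen_subalg_M].
Qed.

Section Layer.
Variable j : nat.
Hypothesis hj : (1 <= j <= size mus)%N.
Local Notation mu := (nus j.-1).
Local Notation l := (flev f la mu).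
Local Notation p' := (cell_proj n n.-1 mu).
Let hj1 : (j.-1 < size mus)%N. Proof. by lia. Qed.
Let hnb : nbr f la mu. Proof. by case: (RA_nbr hj1). Qed.
Let hmu : is_part mu. Proof. by case: hnb. Qed.
Let hL' : Lambda n.-1 (l, mu). Proof. exact: nbr_level hf hla hnb. Qed.
Let hn1 : (n.-1 <= n)%N. Proof. exact: leq_pred. Qed.

(** The annihilators of the generators of the layer and of the cell module agree,
    by independence of the two bases. *)
Lemma layer_kernel c : S n.-1 c ->
  (p' (el n l mu * c) = 0) <-> (p (yf mu * c) \in kspan (M j.-1)).
Proof.
move=> hc; have [e [r [hr eq]]] := straighten_coef hn hn1 hL' hc.
have [h [ey hR]] := yv_step hn hn0 hla hf hnb.
have hud t : t \in walks n.-1 mu -> updown n.-1 mu t by move/(walksP _ _ hmu).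
have en : n.-1.+1 = n by lia.
have eq2 : yf mu * c = \sum_(t <- walks n.-1 mu) e t *: (el n f la * bud n (rcons t la)) + h * r.
  rewrite ey -mulrA eq mulrDr mulr_sumr; congr (_ + _); apply: eq_big_seq => t ht.
  have := yv_bud n f la (hud t ht); rewrite en => ->.
  by rewrite -scalerAr mulrA -ey.
have hhr : p (h * r) \in kspan (M j.-1).
  apply: (kspan_indE (P := fun x => p x \in kspan (M j.-1)) (hR r hr)).
  - by rewrite /cell_proj kproj0 rpred0.
  - by move=> d u v hu hv; rewrite cell_projD cell_projZ rpredD ?rpredZ.
  - move=> x [hx|[nu [c' [hnb' [hp hne] hc' ->]]]]; first by rewrite p0 ?rpred0 //; exact: kspan_in.
    have [i hi ei] := nbr_RA hnb'; rewrite ei in hp hne *; apply: yv_M => //.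
    have := nus_ge hi hj1 hp; rewrite leq_eqVlt => /orP[/eqP e1|]; last by lia.
    by rewrite e1 in hne.
have hrA : r \in kspan (Above n.-1 (plt mu)) by apply: kspan_min hr => x; exact: Rem_Above.
split=> [/(cell_proj0 hn _ hn1 hL')|hM].
  rewrite eq => hA; have hA2 : \sum_(t <- walks n.-1 mu) e t *: (el n l mu * bud n.-1 t) \in kspan (Above n.-1 (plt mu)).
    by rewrite -[\sum_(_ <- _) _](addrK r) rpredB.
  have he := indep_mod hn hn1 hL' (walks_uniq _ hmu) hud hA2.
  by rewrite eq2 big_seq big1 ?add0r // => t ht; rewrite he ?scale0r.
pose r2 := [seq t <- walks n la | `[< plt mu (nth [::] t n.-1) >]].
have hu2 : uniq r2 by rewrite filter_uniq // walks_uniq.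
set Z := \sum_(_ <- _) _ in eq2.
have hZ : p Z \in kspan (M j.-1).
  have -> : p Z = p (yf mu * c) - p (h * r) by rewrite eq2 cell_projD addrK.
  exact: rpredB.
have [x hx ex] : exists2 x, x \in kspan [set y | exists2 t, t \in r2 & y = el n f la * bud n t]%classic & p Z = p x.
  apply: kspan_lift hZ => _ [t [h0 ht hp ->]]; exists (el n f la * bud n t); last by rewrite mtE.
  exists t => //; rewrite mem_filter; apply/andP; split; last exact/(walksP _ _ hla).
  have hle : ple mu (nus j.-1.-1) by apply: nus_le; lia.
  apply/asboolP; split; first exact: ple_trans hp.
  move=> em; rewrite -em in hp; have := @nus_ge j.-1 j.-1.-1 ltac:(lia) ltac:(lia) hp; lia.
have [d ed] := kspan_coef hu2 hx.
pose r1 := [seq rcons t la | t <- walks n.-1 mu].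
have szt t : t \in walks n.-1 mu -> size t = n /\ nth [::] t n.-1 = mu.
  by move/hud => [h1 _ h3 _]; rewrite h1.
have n1 t : t \in walks n.-1 mu -> nth [::] (rcons t la) n.-1 = mu /\ take n (rcons t la) = t.
  move=> ht; have [s1 s2] := szt t ht; rewrite nth_rcons s1 hpred.
  by split; [exact: s2 | rewrite -cats1 take_cat s1 ltnn subnn take0 cats0].
have n2 t : t \in r2 -> nth [::] t n.-1 <> mu.
  by rewrite mem_filter => /andP[/asboolP [_ h1] _] h2; apply: h1.
pose g t := if nth [::] t n.-1 == mu then e (take n t) else - d t.
have hu1 : uniq (r1 ++ r2).
  rewrite cat_uniq hu2 andbT map_inj_uniq ?walks_uniq //; last by move=> t1 t2 /rcons_inj [].
  by apply/hasPn => t ht; apply/negP => /mapP[t0 h0 e0]; apply: (n2 t ht); rewrite e0; exact: (n1 t0 h0).1.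
have hs12 t : t \in r1 ++ r2 -> updown n la t.
  rewrite mem_cat mem_filter => /orP[/mapP[t0 h0 ->]|/andP[_ /(walksP _ _ hla)]] //.
  by have [_ hadj _] := hnb; rewrite -{1}en; exact: updown_rcons (hud _ h0).
have hsum : \sum_(t <- r1 ++ r2) g t *: (el n f la * bud n t) = Z - x.
  rewrite big_cat big_map ed -sumrN; congr (_ + _); apply: eq_big_seq => t ht; rewrite /g.
    by have [-> ->] := n1 t ht; rewrite eqxx.
  by case: eqP => [/(n2 t ht)//|_]; rewrite scaleNr.
have hA : \sum_(t <- r1 ++ r2) g t *: (el n f la * bud n t) \in kspan (Above n (plt la)).
  by rewrite hsum; apply/(cell_proj0 hn _ (leqnn n) hL); rewrite cell_projB ex subrr.
have hg := indep_mod hn (leqnn n) hL hu1 hs12 hA.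
apply/(cell_proj0 hn _ hn1 hL'); rewrite eq big_seq big1 ?add0r // => t ht.
have [e1 e2] := n1 t ht; have := hg (rcons t la); rewrite /g e1 eqxx e2 => -> //.
  by rewrite scale0r.
by rewrite mem_cat; apply/orP; left; apply/mapP; exists t.
Qed.

Local Notation quo := (kproj (M j.-1)).

Definition layer_map (Y : kquot (M j.-1)) : cell_quot n n.-1 mu :=
  p' (el n l mu * xget 0 [set c | S n.-1 c /\ Y = quo (p (yf mu * c))]%classic).

Lemma S_sub c c' : S n.-1 c -> S n.-1 c' -> S n.-1 (c - c').
Proof. by move=> h h'; apply: gen_subalg_D => //; rewrite -scaleN1r; exact: gen_subalg_Z. Qed.

Lemma layer_eq c c' : S n.-1 c -> S n.-1 c' ->
  (quo (p (yf mu * c)) = quo (p (yf mu * c'))) <-> (p' (el n l mu * c) = p' (el n l mu * c')).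
Proof.
move=> hc hc'; have hk := layer_kernel (S_sub hc hc').
rewrite kproj_eq -cell_projB -mulrBr -hk mulrBr cell_projB; split=> [/eqP|->]; last by rewrite subrr.
by rewrite subr_eq0 => /eqP.
Qed.

Lemma layer_mapE c : S n.-1 c -> layer_map (quo (p (yf mu * c))) = p' (el n l mu * c).
Proof.
move=> hc; rewrite /layer_map; set P := [set c0 | _]%classic.
have [h1 h2] : P (xget 0 P) by apply: (xgetPex 0 (P := P)); exists c.
by apply/esym/layer_eq.
Qed.

Lemma layer_rep Y : Y \in kimage (M j.-1) (kspan (M j)) ->
  exists2 c, S n.-1 c & Y = quo (p (yf mu * c)).
Proof.
move=> /asboolP [X hX ->]; have [x hx ->] := M_rep (proj2 (andP hj)) hX.
suff [c hc h] : exists2 c, S n.-1 c & p x - p (yf mu * c) \in kspan (M j.-1).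
  by exists c => //; apply/kproj_eq.
apply: (kspan_indE (P := fun x => exists2 c, S n.-1 c & p x - p (yf mu * c) \in kspan (M j.-1)) hx).
- by exists 0; [exact: gen_0 | rewrite mulr0 subrr rpred0].
- move=> d u v [c hc h] [c' hc' h']; exists (d *: c + c').
    by apply: gen_subalg_D => //; exact: gen_subalg_Z.
  rewrite mulrDr -scalerAr !cell_projD !cell_projZ opprD addrACA -scalerBr.
  by rewrite rpredD ?rpredZ.
- move=> _ [i [c [hi hc ->]]]; have [ei|hne] := eqVneq i j.-1.
    by exists c => //; rewrite ei subrr rpred0.
  exists 0; first exact: gen_0.
  by rewrite mulr0 [X in _ - X]kproj0 subr0; apply: yv_M => //; lia.
Qed.

Lemma layer_in c : S n.-1 c -> quo (p (yf mu * c)) \in kimage (M j.-1) (kspan (M j)).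
Proof. by move=> hc; apply/asboolP; exists (p (yf mu * c)) => //; apply: yv_M => //; lia. Qed.

(** [layer_kernel] says that sending the class of [y_mu c] to that of [E^l x_mu c] is well
    defined and injective. *)
Lemma layer_iso : right_isomorphism (subB n n.-1) (fun x => quo (p x))
  (kimage (M j.-1) (kspan (M j))) p' (cell_module n n.-1 l mu) layer_map.
Proof.
split.
- move=> d u v /layer_rep [c hc ->] /layer_rep [c' hc' ->].
  rewrite -kprojZE -kprojD -cell_projZ -cell_projD scalerAr -mulrDr !layer_mapE //.
    by rewrite mulrDr -scalerAr cell_projD cell_projZ.
  by apply: gen_subalg_D => //; exact: gen_subalg_Z.
- split.
  + move=> Y /layer_rep [c hc ->]; rewrite /= layer_mapE //.
    by apply/(cell_moduleP hn _ hn1 hL'); exists c.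
  + move=> Y Y'; rewrite !inE /= => /layer_rep [c hc ->] /layer_rep [c' hc' ->].
    by rewrite !layer_mapE // => /layer_eq; apply.
  + move=> X /(cell_moduleP hn _ hn1 hL') [c hc ->].
    by exists (quo (p (yf mu * c))); [exact: layer_in | exact: layer_mapE].
- move=> x x' b hb /layer_rep [c hc e]; rewrite e layer_mapE // => e'.
  have hcb : S n.-1 (c * b) by apply: gen_subalg_M.
  have hj2 : (j.-1 <= size mus)%N by lia.
  have [_ hsub] := M_submodule hj2.
  have e2 : quo (p (x * b)) = quo (p (yf mu * (c * b))).
    apply/kproj_eq; rewrite -cell_projB mulrA -mulrBl; apply: hsub => //.
    by rewrite cell_projB; apply/kproj_eq.
  rewrite e2 layer_mapE //; split; first exact: layer_in.
  have hd : x' * b - el n l mu * (c * b) = 1 * ((x' - el n l mu * c) * b).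
    by rewrite mul1r mulrBl mulrA.
  apply/esym/eqP; rewrite -subr_eq0 -cell_projB; apply/eqP.
  apply/(cell_proj0 hn _ hn1 hL'); rewrite hd; apply: Above_mul => //; first exact: gen_subalg_1.
  by apply/(cell_proj0 hn _ hn1 hL'); rewrite cell_projB e' subrr.
Qed.

Lemma layer_map_mt t : updown n la t -> nth [::] t n.-1 = mu ->
  updown n.-1 mu (take n t) /\
  layer_map (quo (p (mt n n f la t))) = p' (mt n n.-1 l mu (take n t)).
Proof.
move=> ht e; have [_ h1 e1] := updown_pred (ltnW hn) ht hL; rewrite e in h1 e1; split=> //.
have hb : S n.-1 (bud n.-1 t).
  rewrite -bud_take prednK ?(ltnW hn) //; exact: (bud_S hn hn1 hmu h1).
rewrite mtE // e1 layer_mapE // mtE //.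
by congr (p' (_ * _)); rewrite -(bud_take n n.-1 t) prednK ?(ltnW hn).
Qed.

End Layer.
End Branch.

Theorem theorem4p6 (n f : nat) (la : seq nat)
    (hn : (2 <= n)%N) (hla : Lambda n (f, la)) :
  [/\ is_basis (updown n la) (fun t => cell_proj n n la (mt n n f la t))
        (cell_module n n f la),
      forall (mus : seq (seq nat)) (a : nat), RA_enum n f la mus a ->
      forall j : nat, (1 <= j <= size mus)%N ->
      let mu := nth [::] mus j.-1 in
      let l := if (j <= a)%N then f else f.-1 in
      let M i := kspan (Mset n f la mus i) in
      let N i := kspan (Nset n f la mus i) in
      let quo := kproj (Mset n f la mus j.-1) in
      [/\ {subset M j <= cell_module n n f la} /\
          right_submodule (subB n n.-1) (cell_proj n n la) (M j),
          M j =i N j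
        & exists phi : kquot (Mset n f la mus j.-1) -> cell_quot n n.-1 mu,
            right_isomorphism (subB n n.-1)
              (fun x => quo (cell_proj n n la x)) (kimage (Mset n f la mus j.-1) (M j))
              (cell_proj n n.-1 mu) (cell_module n n.-1 l mu) phi /\
            forall t, updown n la t -> nth [::] t n.-1 = mu ->
              updown n.-1 mu (take n t) /\
              phi (quo (cell_proj n n la (mt n n f la t))) =
                cell_proj n n.-1 mu (mt n n.-1 l mu (take n t))]
    & cellular_basis (Lambda n) (fun p p' => ple p'.2 p.2)
        (fun p => updown n p.2) (fun p s t => mst n n p.1 p.2 s t) (@bsigma n)].
Proof.
split.
- exact: mt_basis.
- move=> mus a hmus j hj mu l M N quo; have hjs : (j <= size mus)%N by case/andP: hj.
  have hj1 : (j.-1 < size mus)%N by lia.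
  have el : l = flev f la mu.
    have [_ ->] := RA_nbr hn hla hmus hj1; rewrite /l.
    by have -> : (j <= a)%N = (j.-1 < a)%N by lia.
  split; [exact: (M_submodule hn hla hmus) | exact: (M_N hn hla hmus) |].
  exists (@layer_map n f la mus j); rewrite el; split; first exact: (layer_iso hn hla hmus hj).
  by move=> t; exact: (layer_map_mt hn hla hmus hj).
- exact: mst_cellular.
Qed.
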